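(* Let $n\ge3$ and let $f\in\mathcal O_n$ be a strictly quasi-homogeneous reduced holomorphic function germ at $0\in\mathbb C^n$. Assume that $X_f=\{f=0\}$ is irreducible and has only normal crossings singularities off a codimension $\ge 3$ subset. Then every holomorphic integrable one-form germ $\omega\in\Omega^1(\mathbb C^n,0)$ of the form $\omega=df+f\eta$, with $\eta\in\Omega^1(\mathbb C^n,0)$, admits a holomorphic first integral.
   Context: $f(x_1,\dots,x_n)$ is quasi-homogeneous if there exist $d,d_1,\dots,d_n\ge0$ with $f(t^{d_1}x_1,\dots,t^{d_n}x_n)=t^df(x_1,\dots,x_n)$; strictly quasi-homogeneous if moreover $d>0$ and $d_j>0$ for all $j$. $f$ is reduced if every germ vanishing on $X_f$ is divisible by $f$. ''$X_f$ has only normal crossings singularities off a codimension $\ge3$ subset'' means: there is an analytic subset germ $Y\subset X_f$ of dimension at most $n-3$ such that at every point of $X_f\setminus Y$, $X_f$ is smooth or locally given in suitable coordinates by $x_1\cdots x_k=0$. A one-form $\omega$ is integrable if $\omega\wedge d\omega=0$. A holomorphic first integral of $\omega$ is a non-constant holomorphic germ $F$ with $\omega\wedge dF=0$. *)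

(* Defs.v *)
(* The complex numbers are R[i] (mathcomp-real-closed)
   for an arbitrary R : realType (any realType is the field of real numbers). *)
From HB Require Import structures.
From mathcomp Require Import all_boot all_order all_algebra.
From mathcomp Require Import boolp classical_sets reals topology normedtype derive.
From mathcomp Require Import complex.
Import Order.TTheory GRing.Theory Num.Theory.
Import numFieldNormedType.Exports.

Set Implicit Arguments.
Unset Strict Implicit.
Unset Printing Implicit Defensive.

Local Open Scope ring_scope.
Local Open Scope classical_set_scope.

Definition Cn (R : realType) (n : nat) : normedModType R[i] := 'rV[R[i]]_n.

Definition coord (R : realType) (n : nat) (x : Cn R n) (j : 'I_n) : R[i] :=
  (x : 'rV[R[i]]_n) 0 j.

Definition pt (R : realType) (n : nat) (a : 'I_n -> R[i]) : Cn R n :=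
  \row_j a j.

Section Germs.
Variables (R : realType) (n : nat).

(* points of C^n are row vectors; values of functions live in C^o, the
   complex numbers seen as a normed C-vector space *)
Local Notation V := (Cn R n).
Local Notation C := (R[i])^o.

Definition holo_at (f : V -> C) (p : V) : Prop :=
  \forall x \near p, differentiable f x.

Definition holo_map_at (phi : V -> V) (p : V) : Prop :=
  \forall x \near p, differentiable phi x.

Definition pd (i : 'I_n) (f : V -> C) (x : V) : C := 'D_(delta_mx 0 i) f x.

Definition local_biholo (phi : V -> V) (p : V) : Prop :=
  holo_map_at phi p /\
  exists psi : V -> V, holo_map_at psi (phi p) /\
    (\forall x \near p, psi (phi x) = x) /\
    (\forall y \near phi p, phi (psi y) = y).

Definition germ_eq (A B : set V) : Prop := \forall x \near (0 : V), (A x <-> B x).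

Definition zero_set (f : V -> C) : set V := [set x | f x = 0].

Definition analytic_germ (Y : set V) : Prop :=
  exists (k : nat) (g : 'I_k -> V -> C),
    (forall j, holo_at (g j) 0) /\
    \forall x \near (0 : V), (Y x <-> forall j, g j x = 0).

Definition regular_point_dim (Y : set V) (p : V) (m : nat) : Prop :=
  Y p /\ (m <= n)%N /\
  exists phi : V -> V, local_biholo phi p /\ phi p = 0 /\
    \forall x \near p, (Y x <-> forall i : 'I_n, (m <= i)%N -> coord (phi x) i = 0).

Definition germ_dim_le (Y : set V) (k : nat) : Prop :=
  \forall p \near (0 : V), forall m, regular_point_dim Y p m -> (m <= k)%N.

Definition strictly_quasi_homogeneous (f : V -> C) : Prop :=
  exists (d : nat) (w : 'I_n -> nat),
    (0 < d)%N /\ (forall j, (0 < w j)%N) /\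
    \forall x \near (0 : V), forall t : R[i], `|t| <= 1 ->
      f (pt (fun j => t ^+ w j * coord x j)) = t ^+ d * f x.

Definition reduced_germ (f : V -> C) : Prop :=
  forall g : V -> C, holo_at g 0 ->
    (\forall x \near (0 : V), f x = 0 -> g x = 0) ->
    exists h : V -> C, holo_at h 0 /\ \forall x \near (0 : V), g x = f x * h x.

Definition irreducible_zero_germ (f : V -> C) : Prop :=
  forall A B : set V, analytic_germ A -> analytic_germ B ->
    (\forall x \near (0 : V), (f x = 0 <-> A x \/ B x)) ->
    germ_eq A (zero_set f) \/ germ_eq B (zero_set f).

Definition smooth_or_normal_crossing (f : V -> C) (p : V) : Prop :=
  (exists m, regular_point_dim (zero_set f) p m) \/
  exists (phi : V -> V) (k : nat), (k <= n)%N /\ local_biholo phi p /\ phi p = 0 /\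
    \forall x \near p, (f x = 0 <-> \prod_(i < n | (i < k)%N) coord (phi x) i = 0).

Definition nc_off_codim3 (f : V -> C) : Prop :=
  exists Y : set V, analytic_germ Y /\
    (\forall x \near (0 : V), Y x -> f x = 0) /\
    germ_dim_le Y (n - 3) /\
    \forall p \near (0 : V), f p = 0 -> ~ Y p -> smooth_or_normal_crossing f p.

(* one-forms are given by their coefficient functions: w = sum_i w_i dx_i *)
Definition one_form_dfeta (f : V -> C) (eta : 'I_n -> V -> C) : 'I_n -> V -> C :=
  fun i x => pd i f x + f x * eta i x.

(* w /\ dw = 0, written in coordinates (coefficient of dx_i/\dx_j/\dx_k) *)
Definition integrable_form (w : 'I_n -> V -> C) : Prop :=
  \forall x \near (0 : V), forall i j k : 'I_n,
    w i x * (pd j (w k) x - pd k (w j) x)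
  + w j x * (pd k (w i) x - pd i (w k) x)
  + w k x * (pd i (w j) x - pd j (w i) x) = 0.

(* F is a holomorphic first integral of w: non-constant germ with w /\ dF = 0 *)
Definition holo_first_integral (w : 'I_n -> V -> C) (F : V -> C) : Prop :=
  holo_at F 0 /\ ~ (\forall x \near (0 : V), F x = F 0) /\
  \forall x \near (0 : V), forall i j : 'I_n, w i x * pd j F x - w j x * pd i F x = 0.

End Germs.

(* Main.v *)
(* Replace [f] by its weighted homogeneous representative, of weight [d]. Weight by weight, integrability
  leaves a form [tau] with [df /\ d tau = 0], and one needs [theta] with [d (tau + theta df) = 0].
  Contraction with the Euler field turns this into dividing a form by [df] along [X_f]. The quotient is
  holomorphic where [X_f] is smooth or a normal crossing; a generic two-dimensional fibration misses the
  codimension 3 set, and interpolation over its fibres extends the quotient to all of [X_f].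
  This gives formal [H], [v] with [H omega = df + f dv], hence the formal first integral [f exp v].
  Off [X_f] its powers solve a linear transport equation with convergent coefficients, so geometric bounds
  spread along paths. At one point the bounds come from a curve through a smooth point of [X_f]: a series
  [e] inverting the formal integral there is transported around [X_f], and the average over the [d]-th roots
  of unity is a power series in the first integral that converges. *)
Require Import Defs.
From HB Require Import structures.
From mathcomp Require Import all_boot all_order all_algebra.
From mathcomp Require Import boolp classical_sets functions reals topology normedtype landau derive.
From mathcomp Require Import complex.
From mathcomp Require measure lebesgue_measure lebesgue_integral ftc.
From mathcomp Require interval_inference.
From mathcomp Require separable cyclic cyclotomic.
From mathcomp Require Import ring lra zify.
Import Order.TTheory GRing.Theory Num.Theory Num.Def.
Import numFieldNormedType.Exports.
Set Implicit Arguments.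
Unset Strict Implicit.
Unset Printing Implicit Defensive.
Local Open Scope complex_scope.
Local Open Scope ring_scope.
Local Notation coord := Defs.coord.
Local Notation "z *' v" := ((z : complex _) *: v) (at level 40).

(** A norm of [dd e1 f] along [e1] is a function [h] constant along [e1]. Off [h = 0] the roots of
    [f] along [e1] are simple and the quotient is a Lagrange interpolant, with a bound that survives
    collisions of roots. The locus [f = h = 0] has codimension 2, so a second direction [e2] is
    enough, and [Y] has one dimension too few to meet every fibre. Dimension enters only through
    regular points: a fibre section that stays in [Y] is shown to be holomorphic, and its graph is a
    regular piece of dimension [n - 2] or [n - 1]. The weight [D = d] escapes the local argument,
    whose gluing divides by [d - D]; there [rho / f] is closed, its residue along [X_f] is constant,
    and contraction with the Euler field kills it. A formal first integral is unique at best up to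
    composition with a series in one variable, so [f exp v] itself need not converge. Expansion
    along weighted orbits gives the transport equation [ddS u A = a * fth A], which every power of
    [A] and every series in [A] inherits; this is why one change of series repairs convergence at
    all points at once. *)

Definition nm (R : realType) (V : normedModType R[i]) (x : V) : R := complex.Re `|x|.
Notation nmc z := (nm (z : (complex _)^o)).

(** * Real-valued norms and Frechet differentials *)

Section Norm.
Variable R : realType.
Local Notation C := R[i].
Implicit Types V W : normedModType C.

Lemma le_of_eq (x y : R) : x = y -> x <= y. by move=> ->. Qed.

Lemma lt_minP (x y z : R) : reflect (x < y /\ x < z) (x < minr y z).
by rewrite lt_min; exact: andP. Qed.

Lemma ex_small (m k : R) : 0 < m -> 0 <= k -> exists2 s : R, 0 < s & s * k < m.
move=> m0 k0; have k1 : 0 < k + 1 by lra.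
exists (m / (k + 1)); first by rewrite divr_gt0.
by rewrite mulrAC ltr_pdivrMr // ltr_pM2l //; lra.
Qed.

Lemma lin_lt (a b k s m : R) : a <= k * b -> b < s -> 0 <= k -> s * k < m -> a < m.
by move=> ab /ltW bs k0; apply: le_lt_trans; apply: le_trans ab _; rewrite mulrC ler_wpM2r. Qed.

(** A norm over [R[i]] is an element of [R[i]]. Being real it equals its real part [nm], so all
    estimates can be carried out in [R], within reach of [lra] and [nra]. *)
Lemma nmE V (x : V) : `|x| = (nm x)%:C.
have : `|x| \is Num.real by apply: normr_real.
by rewrite /nm; case: (`|x|) => a b /complex_realP [k ->].
Qed.

Lemma nm_ge0 V (x : V) : 0 <= nm x.
by rewrite -lecR -nmE normr_ge0. Qed.
Lemma nm0 V : nm (0 : V) = 0.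
by rewrite /nm normr0. Qed.
Lemma nmN V (x : V) : nm (- x) = nm x.
by rewrite /nm normrN. Qed.
Lemma nmC V (x y : V) : nm (x - y) = nm (y - x).
by rewrite -nmN opprB. Qed.
Lemma nmD V (x y : V) : nm (x + y) <= nm x + nm y.
by rewrite -lecR rmorphD /= -!nmE ler_normD. Qed.
Lemma nmB V (x y : V) : nm (x - y) <= nm x + nm y.
by rewrite -(nmN y) nmD. Qed.
Lemma nm_dist V (y x z : V) : nm (x - z) <= nm (x - y) + nm (y - z).
by rewrite -[x - z](subrKA y) nmD. Qed.
Lemma nm_rev V (x y : V) : nm x - nm y <= nm (x - y).
by rewrite lerBlDr -{1}[x](subrK y) nmD. Qed.
Lemma nm_self V (x : V) (r : R) : 0 < r -> nm (x - x) < r. by rewrite subrr nm0. Qed.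
Lemma nm_eq0 V (x : V) : (nm x == 0) = (x == 0).
by rewrite -[LHS](inj_eq (@complexI R)) -nmE normr_eq0. Qed.
Lemma nm_le0 V (x : V) : nm x <= 0 -> x = 0.
by move=> h; apply/eqP; rewrite -nm_eq0 eq_le h nm_ge0. Qed.
Lemma nm_gt0 V (x : V) : (0 < nm x) = (x != 0).
by rewrite lt0r nm_eq0 nm_ge0 andbT. Qed.
Lemma nm_neq0 (x : C^o) : 0 < nm x -> x != 0.
by rewrite nm_gt0. Qed.
Lemma nmZ V (a : C^o) (x : V) : nm (a *' x) = nm a * nm x.
by apply: complexI; rewrite rmorphM /= -!nmE normrZ. Qed.

Lemma nmZ_lt V (z : C^o) (v : V) (q m : R) : nm z < q -> q * nm v < m -> nm (z *' v) < m.
by move=> zq; apply: le_lt_trans; rewrite nmZ ler_wpM2r ?nm_ge0 // ltW. Qed.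

Lemma ex_line V (r : R) (v : V) : 0 < r -> exists2 q : R, 0 < q & forall p x (z : C^o),
 nm (x - p) < r / 2 -> nm z < q -> nm (x + z *' v - p) < r.
move=> r0; have r2 : 0 < r / 2 by lra.
have [q q0 qv] := ex_small r2 (nm_ge0 v); exists q => // p x z xr /nmZ_lt /(_ qv) zr.
by rewrite addrAC; apply: le_lt_trans (nmD _ _) _; lra.
Qed.
Lemma nmM (a b : C^o) : nmc (a * b) = nm a * nm b.
exact: (@nmZ C^o). Qed.
Lemma nm1 : nm (1 : C^o) = 1.
by rewrite /nm normr1. Qed.
Lemma nmX (a : C^o) k : nmc (a ^+ k) = nm a ^+ k.
by elim: k => [|k IH]; rewrite ?expr0 ?nm1 // !exprS nmM IH. Qed.
Lemma nmV (a : C^o) : nmc (a^-1) = (nm a)^-1.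
by apply: complexI; rewrite fmorphV /= -!nmE normfV. Qed.
Lemma nm_real (r : R) : nmc (r%:C) = `|r|.
by rewrite /nm normc_def /= expr0n addr0 sqrtr_sqr. Qed.
Lemma nm_nat k : nm (k%:R : C^o) = k%:R.
by rewrite /nm normr_nat -[in LHS](rmorph_nat (real_complex R)). Qed.
Lemma nm_sum V (I : Type) (s : seq I) (P : pred I) (F : I -> V) :
 nm (\sum_(i <- s | P i) F i) <= \sum_(i <- s | P i) nm (F i).
elim/big_rec2: _ => [|i y1 y2 _ h]; first by rewrite nm0.
by apply: le_trans (nmD _ _) _; rewrite lerD2l.
Qed.
Lemma nm_prod (I : Type) (s : seq I) (P : pred I) (F : I -> C^o) :
 nmc (\prod_(i <- s | P i) F i) = \prod_(i <- s | P i) nm (F i).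
by elim/big_rec2: _ => [|i y1 y2 _ h]; rewrite ?nm1 // nmM h. Qed.
Lemma nm_Re (a : C^o) : `|complex.Re a| <= nm a.
by rewrite -lecR -nmE normc_ge_Re. Qed.
Lemma nm_Im (a : C^o) : `|complex.Im a| <= nm a.
have h : (complex.Re (- ('i%C * a) : C)) = complex.Im a by case: a => x y /=; rewrite mul0r mul1r sub0r opprK.
rewrite -h; apply: le_trans (nm_Re _) _; rewrite nmN nmM.
by rewrite [nmc ('i%C)](_ : _ = 1) ?mul1r // /nm normc_def /= expr0n expr1n add0r sqrtr1.
Qed.
Lemma nm_ReIm (a : C^o) : nm a <= `|complex.Re a| + `|complex.Im a|.
rewrite /nm normc_def /= -[leRHS]ger0_norm ?addr_ge0 // -sqrtr_sqr ler_wsqrtr //.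
have h : 0 <= `|complex.Re a| * `|complex.Im a| by apply: mulr_ge0.
by rewrite sqrrD !real_normK ?num_real //; lra.
Qed.

Lemma nearP V (p : V) (P : V -> Prop) :
 (\forall x \near p, P x) <-> exists2 e : R, 0 < e & forall x, nm (x - p) < e -> P x.
split.
 move/nbhs_normP => [e /= e0 h].
 have er : e = (complex.Re e)%:C by move: e0; rewrite ltcE /=; case: e {h} => a b /= /andP [/eqP -> _].
 exists (complex.Re e); first by rewrite -ltcR -er.
 by move=> x hx; apply: h; rewrite /= nmE nmC er ltcR.
move=> [e e0 h]; apply/nbhs_normP; exists e%:C; first by rewrite /= ltcR.
by move=> x /=; rewrite nmE ltcR nmC; exact: h.
Qed.

Definition lin V W (L : V -> W) := forall (a : C) x y, L (a *: x + y) = a *: L x + L y.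

(** The derivative is a bare function [L], with linearity and boundedness as side conditions, so
    that derivatives are computed and compared without packaging continuous linear maps. [difP]
    identifies the resulting notion with [differentiable]. *)
Definition hd V W (g : V -> W) (p : V) (L : V -> W) :=
 [/\ lin L, (exists2 K : R, 0 <= K & forall h, nm (L h) <= K * nm h) &
  forall e : R, 0 < e -> exists2 d : R, 0 < d & forall h, nm h < d ->
   nm (g (p + h) - g p - L h) <= e * nm h].

Definition dif V W (g : V -> W) (p : V) := exists L, hd g p L.

Lemma lin0 V W (L : V -> W) : lin L -> L 0 = 0.
by move=> h; have := h 1 0 0; rewrite !scale1r addr0 => /eqP; rewrite -subr_eq0 opprD addNKr oppr_eq0 => /eqP. Qed.
Lemma linZ V W (L : V -> W) a x : lin L -> L (a *: x) = a *: L x.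
by move=> h; have := h a x 0; rewrite !addr0 lin0 // addr0. Qed.
Lemma linD V W (L : V -> W) x y : lin L -> L (x + y) = L x + L y.
by move=> h; have := h 1 x y; rewrite !scale1r. Qed.
Lemma linN V W (L : V -> W) x : lin L -> L (- x) = - L x.
by move=> h; rewrite -scaleN1r linZ // scaleN1r. Qed.
Lemma linB V W (L : V -> W) x y : lin L -> L (x - y) = L x - L y.
by move=> h; rewrite linD // linN. Qed.

Lemma differentiable_hd V W (g : V -> W) p : differentiable g p -> hd g p ('d g p).
move=> d; have /diff_locallyP [dc E] := d; split.
- by move=> a x y; rewrite linearP.
- have /linear_boundedP [K [Kr hK]] := (linear_bounded_continuous _).2 dc.
 have K1 : (`|K| + 1)%R > K by apply: le_lt_trans (real_ler_norm Kr) _; rewrite ltrDl.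
 have := hK _ K1.
 have -> : `|K| + 1 = (nmc K + 1)%:C by rewrite rmorphD /= -(nmE (K : C^o)) rmorph1.
 move=> hh; exists (nmc K + 1); first by rewrite addr_ge0 ?nm_ge0.
 by move=> x; have := hh x; rewrite !nmE -rmorphM lecR.
- move=> e e0; have /eqaddoP hh := E.
 have /= := hh e%:C; rewrite ltcR => /(_ e0) /nearP [r r0 hr].
 exists r => // x hx; have := hr x; rewrite subr0 => /(_ hx) /=.
 by rewrite !nmE -rmorphM lecR -addrA -opprD [p + x]addrC.
Qed.

Lemma difP V W (g : V -> W) p : differentiable g p <-> dif g p.
split=> [/differentiable_hd h|]; first by exists ('d g p).
move=> [L [Ll [K K0 LK] LE]].
pose HL := GRing.isLinear.Build C V W *:%R L Ll.
pose L' : {linear V -> W} := HB.pack L HL.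
have cL : continuous L'.
 apply/linear_bounded_continuous/linear_boundedP.
 exists K%:C; split; first by rewrite realE lecR K0.
 move=> k hk x; apply: le_trans (_ : K%:C * `|x| <= _); last first.
  by rewrite ler_wpM2r // ltW.
 by rewrite !nmE -rmorphM lecR.
have E : g \o shift p = cst (g p) + L' +o_ (0 : V) id.
 apply/eqaddoP => e; rewrite ltcE; case: e => a b /= /andP [/eqP -> a0].
 have [d d0 h] := LE a a0; apply/nearP; exists d => // x; rewrite subr0 => /h.
 by rewrite !nmE -[(a +i* 0)%C]/(a%:C) -rmorphM lecR -addrA -opprD [p + x]addrC.
apply/diff_locallyP; rewrite (diff_unique cL E); split => //.
Qed.

Lemma hd_unique V W (g : V -> W) p L M : hd g p L -> hd g p M -> forall v, L v = M v.
move=> [l1 _ h1] [l2 _ h2] v; apply/eqP; rewrite -subr_eq0 -nm_eq0 eq_le nm_ge0 andbT.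
apply/ler_addgt0Pl => e e0; rewrite addr0.
have nv : 0 < nm v + 1 by rewrite ltr_wpDl // nm_ge0.
have e1 : 0 < e / 2 / (nm v + 1) by rewrite !divr_gt0.
have [d1 d10 H1] := h1 _ e1; have [d2 d20 H2] := h2 _ e1.
have m0 : 0 < minr d1 d2 by rewrite lt_min d10.
have [s s0 sv] := ex_small m0 (nm_ge0 v).
have ns : nm (s%:C *: v) < minr d1 d2 by rewrite nmZ nm_real gtr0_norm.
move: ns; rewrite lt_min => /andP [n1 n2].
have := H1 _ n1; have := H2 _ n2; rewrite (linZ _ _ l1) (linZ _ _ l2).
set A := g _ - g p => k2 k1.
have : nm (s%:C *: (L v - M v)) <= e / (nm v + 1) * nm (s%:C *: v).
 have -> : s%:C *: (L v - M v) = (A - s%:C *: M v) - (A - s%:C *: L v) by rewrite opprB [RHS]addrC addrA subrK scalerBr.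
 apply: le_trans (nmB _ _) _; apply: le_trans (lerD k2 k1) _.
 by rewrite -mulrDl; apply: le_of_eq; congr (_ * _); rewrite -mulrDl -splitr.
rewrite !nmZ nm_real gtr0_norm // mulrCA ler_pM2l //.
move/le_trans; apply; rewrite mulrAC ler_pdivrMr // ler_pM2l //; lra.
Qed.

Lemma hd_dir V W (g : V -> W) p L v : hd g p L -> 'D_v g p = L v.
move=> h; have d : differentiable g p by apply/difP; exists L.
by rewrite deriveE //; exact: (hd_unique (differentiable_hd d) h).
Qed.

End Norm.

Ltac pos := solve [ done | assumption | exact: nm_ge0 | exact: ltW | match goal with
 | |- is_true (0 < _ * _) => apply: mulr_gt0; pos
 | |- is_true (0 < _^-1) => rewrite invr_gt0; pos
 | |- is_true (0 < _ ^+ _) => apply: exprn_gt0; pos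
 | |- is_true (0 < _ + _) => first [apply: addr_gt0; pos | apply: ltr_wpDl; pos | apply: ltr_pwDl; pos]
 | |- is_true (0 < Order.min _ _) => rewrite lt_min; apply/andP; split; pos
 | |- is_true (0 < nm _) => rewrite nm_gt0; pos
 | |- is_true (0 < _ - _) => rewrite subr_gt0; pos
 | |- is_true (0 <= _ * _) => apply: mulr_ge0; pos
 | |- is_true (0 <= _^-1) => rewrite invr_ge0; pos
 | |- is_true (0 <= _ ^+ _) => apply: exprn_ge0; pos
 | |- is_true (0 <= _ + _) => apply: addr_ge0; pos
 | |- is_true (0 <= bigop.body _ _ _) => apply: sumr_ge0 => ? _; pos
 | |- is_true (_ \is Num.pos) => rewrite posrE; pos
 | |- is_true (_ \is Num.nneg) => rewrite nnegrE; pos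
 | |- is_true (0 <= _) => apply: ltW; pos end ].

(** * Rules of complex differentiation *)

Section HD.
Variable R : realType.
Local Notation C := R[i].
Implicit Types V W : normedModType C.

Lemma lin1 (L : C^o -> C^o) : lin L -> forall h, L h = h * L 1.
by move=> l h; have := linZ (h : C) (1 : C^o) l; rewrite /GRing.scale /= mulr1. Qed.

Lemma hdP V W (g : V -> W) p L : hd g p L <-> differentiable g p /\ forall v, 'd g p v = L v.
split=> [h|[dg /funext <-]]; last exact: differentiable_hd.
have dg : differentiable g p by apply/difP; exists L.
by split=> // v; exact: (hd_unique (differentiable_hd dg) h).
Qed.

Lemma hd_ext V W (f g : V -> W) p L : (exists2 e : R, 0 < e & forall x, nm (x - p) < e -> f x = g x) ->
 hd f p L -> hd g p L.
move=> [e e0 h] [l b H]; split=> // e1 e10; have [d d0 k] := H _ e10.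
exists (minr d e); first by rewrite lt_min d0.
move=> x /lt_minP [xd xe].
rewrite -h; last by rewrite addrC addKr.
by rewrite -h; [exact: k|rewrite subrr nm0].
Qed.

Lemma hd_lin V W (L : V -> W) p : lin L -> (exists2 K : R, 0 <= K & forall h, nm (L h) <= K * nm h) -> hd L p L.
move=> l b; split=> // e e0; exists 1 => // h _.
by rewrite (linD _ _ l) [L p + _]addrC addrK subrr nm0 mulr_ge0 ?nm_ge0 // ltW.
Qed.

Lemma hd_id V (p : V) : hd id p id.
by apply: hd_lin => //; exists 1 => // h; rewrite mul1r. Qed.

Lemma hdD V W (f g : V -> W) p L M : hd f p L -> hd g p M ->
 hd (fun x => f x + g x) p (fun h => L h + M h).
move=> /hdP [df E] /hdP [dg F]; apply/hdP; split=> [|v]; first exact: differentiableD.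
by have /(congr1 (fun h => h v)) /= -> := diffD df dg; rewrite -[L v]E -[M v]F.
Qed.

Lemma hd_cont V W (f : V -> W) p L : hd f p L ->
 forall e : R, 0 < e -> exists2 d : R, 0 < d & forall h, nm h < d -> nm (f (p + h) - f p) < e.
move=> /hdP [/differentiable_continuous cf _] e e0.
have /cf /nearP [d d0 h] : \forall y \near f p, nm (y - f p) < e by apply/nearP; exists e.
by exists d => // x xd; apply: h; rewrite addrC addKr.
Qed.

Lemma hd_comp (V W U : normedModType C) (f : V -> W) (g : W -> U) p L M :
 hd f p L -> hd g (f p) M -> hd (fun x => g (f x)) p (fun h => M (L h)).
move=> /hdP [df E] /hdP [dg F]; apply/hdP; split=> [|v]; first exact: differentiable_comp df dg.
by have /(congr1 (fun h => h v)) /= -> := diff_comp df dg; rewrite -[L v]E -F.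
Qed.

Lemma hdM V (f g : V -> C^o) p L M : hd f p L -> hd g p M ->
 hd (fun x => f x * g x : C^o) p (fun h => f p * M h + g p * L h : C^o).
move=> /hdP [df E] /hdP [dg F]; apply/hdP; split=> [|v]; first exact: (differentiableM df dg).
by have /(congr1 (fun h => h v)) /= -> := diffM df dg; rewrite -[L v]E -[M v]F.
Qed.

Lemma hdZ V W (c : C) (f : V -> W) p L : hd f p L -> hd (fun x => c *: f x) p (fun h => c *: L h).
move=> /hdP [df E]; apply/hdP; split=> [|v]; first exact: differentiableZ.
by have /(congr1 (fun h => h v)) /= -> := diffZ c df; rewrite -[L v]E.
Qed.

Lemma hd_inv (a : C^o) : a != 0 -> hd (fun z : C^o => z^-1 : C^o) a (fun h => - (a ^- 2 * h) : C^o).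
move=> a0; apply/hdP; split=> [|v]; first exact: differentiable_Rinv.
by have /(congr1 (fun h => h v)) /= -> := diff_Rinv a0; rewrite -mulNr.
Qed.

Lemma dif_cst V W (c : W) (p : V) : dif (fun=> c) p. exact/difP/differentiable_cst. Qed.
Lemma hd_cst V W (c : W) (p : V) : hd (fun=> c) p (fun=> 0).
by apply/hdP; split=> [|v]; [exact: differentiable_cst|rewrite diff_cst]. Qed.
Lemma difD V W (f g : V -> W) p : dif f p -> dif g p -> dif (fun x => f x + g x) p.
by move=> [L h] [M k]; eexists; apply: hdD h k. Qed.
Lemma difZ V W c (f : V -> W) p : dif f p -> dif (fun x => c *: f x) p.
by move=> [L h]; eexists; apply: hdZ h. Qed.
Lemma difN V W (f : V -> W) p : dif f p -> dif (fun x => - f x) p.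
by move=> /(difZ (-1)); under eq_fun do rewrite scaleN1r. Qed.
Lemma difB V W (f g : V -> W) p : dif f p -> dif g p -> dif (fun x => f x - g x) p.
by move=> h /difN; apply: difD. Qed.
Lemma difM V (f g : V -> C^o) p : dif f p -> dif g p -> dif (fun x => f x * g x : C^o) p.
by move=> [L h] [M k]; eexists; apply: hdM h k. Qed.
Lemma difX V (f : V -> C^o) k p : dif f p -> dif (fun x => f x ^+ k : C^o) p.
move=> h; elim: k => [|k IH]; first exact: dif_cst.
by under eq_fun do rewrite exprS; apply: difM.
Qed.
Lemma difV V (f : V -> C^o) p : f p != 0 -> dif f p -> dif (fun x => (f x)^-1 : C^o) p.
by move=> f0 [L h]; eexists; apply: hd_comp h (hd_inv f0). Qed.
Lemma dif_comp (V W U : normedModType C) (f : V -> W) (g : W -> U) p :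
 dif f p -> dif g (f p) -> dif (fun x => g (f x)) p.
by move=> [L h] [M k]; eexists; apply: hd_comp h k. Qed.
Lemma dif_eq V W (f g : V -> W) p : (forall x, f x = g x) -> dif f p -> dif g p.
by move=> /funext ->. Qed.
Lemma dif_sum V W I (s : seq I) (P : pred I) (F : I -> V -> W) p :
 (forall i, P i -> dif (F i) p) -> dif (fun x => \sum_(i <- s | P i) F i x) p.
move=> h; elim: s => [|i s IH]; first by apply: dif_eq (dif_cst _ _) => x; rewrite big_nil.
case Pi: (P i); last by apply: dif_eq IH => x; rewrite big_cons Pi.
by apply: dif_eq (difD (h _ Pi) IH) => x; rewrite big_cons Pi.
Qed.
Lemma dif_prod V I (s : seq I) (P : pred I) (F : I -> V -> C^o) p :
 (forall i, P i -> dif (F i) p) -> dif (fun x => \prod_(i <- s | P i) F i x : C^o) p.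
move=> h; elim: s => [|i s IH]; first by apply: dif_eq (dif_cst _ _) => x; rewrite big_nil.
case Pi: (P i); last by apply: dif_eq IH => x; rewrite big_cons Pi.
by apply: dif_eq (difM (h _ Pi) IH) => x; rewrite big_cons Pi.
Qed.
Lemma difZl V W (f : V -> C^o) (v : W) p : dif f p -> dif (fun x => f x *' v) p.
move=> df; apply: (dif_comp (g := fun z : C^o => z *' v)) df _; exists (fun z : C^o => z *' v); apply: hd_lin.
 by move=> a x y; rewrite scalerDl scalerA.
by exists (nm v); [exact: nm_ge0|move=> h; rewrite nmZ mulrC].
Qed.
Lemma dif_line V (p v : V) (z : C^o) : dif (fun z : C^o => p + z *' v) z.
by apply: difD; [exact: dif_cst|apply: difZl; eexists; exact: hd_id]. Qed.
Lemma dif_id V (p : V) : dif id p. by eexists; apply: hd_id. Qed.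
Lemma dif_shift V (p v : V) : dif (fun x => x + v) p.
by apply: difD; [exact: dif_id|exact: dif_cst]. Qed.
Lemma dif_ext V W (f g : V -> W) p (e : R) : 0 < e -> (forall x, nm (x - p) < e -> f x = g x) ->
 dif f p -> dif g p.
by move=> e0 h [L k]; exists L; apply: hd_ext k; exists e. Qed.
Lemma dif_cont V W (f : V -> W) p (e : R) : dif f p -> 0 < e ->
 exists2 d : R, 0 < d & forall x, nm (x - p) < d -> nm (f x - f p) < e.
move=> [L h] /(hd_cont h) [d d0 k]; exists d => // x /k.
by rewrite [p + _]addrC subrK.
Qed.
End HD.

Ltac dif_more := fail.
Ltac dfs := lazymatch goal with
 | |- dif (fun _ => ?c) _ => exact: dif_cst
 | |- dif (fun x => x) _ => exact: dif_id
 | |- dif (fun _ => (_ + _)%R) _ => apply: difD; dfs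
 | |- dif (fun _ => (- _)%R) _ => apply: difN; dfs
 | |- dif (fun _ => (_ * _)%R) _ => apply: difM; dfs
 | |- dif (fun _ => (_ ^+ _)%R) _ => apply: difX; dfs
 | |- dif (GRing.mul ?c) _ => apply: (difM (f := fun=> c) (g := id)); dfs
 | |- dif (+%R ?c) _ => apply: (difD (f := fun=> c) (g := id)); dfs
 | |- dif (fun _ => (_^-1)%R) _ => apply: difV; [assumption|dfs]
 | |- dif (fun _ => bigop.body _ _ _) _ => apply: dif_sum => ? _; dfs
 | |- _ => solve [ done | dif_more | exact: dif_line | apply: difZ; dfs | apply: difZl; dfs | match goal with H : _ |- dif _ _ => solve [apply: H; pos] end ] end.
Ltac side := lazymatch goal with |- dif _ _ => dfs | _ => pos end.

(** * Bisection arguments and derivatives along a real parameter *)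

Section Real.
Variable R : realType.
Local Notation C := R[i].

Lemma pow2_gt0 n : 0 < (2^-1 : R) ^+ n. by side. Qed.

Lemma pow2_half n : (2^-1 : R) ^+ n.+1 = 2^-1 ^+ n / 2. by rewrite exprS mulrC. Qed.

Lemma pow2_small (e : R) : 0 < e -> exists N, 2^-1 ^+ N < e.
move=> e0; exists (Num.truncn e^-1).+1; have := truncnS_gt e^-1.
set N := (Num.truncn e^-1).+1 => h.
rewrite exprVn -[e]invrK ltf_pV2 ?posrE ?invr_gt0 ?exprn_gt0 //.
apply: lt_le_trans h _; rewrite -natrX ler_nat.
by rewrite ltnW // ltn_expl.
Qed.

Lemma nested (a b : nat -> R) : (forall n, a n <= a n.+1) -> (forall n, b n.+1 <= b n) ->
 (forall n, a n <= b n) -> exists l, forall n, a n <= l <= b n.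
move=> ia ib ab.
have ha m n : (m <= n)%N -> a m <= a n by move=> /subnKC <-; elim: (n - m)%N => [|k IH]; rewrite ?addn0 // addnS (le_trans IH).
have hb m n : (m <= n)%N -> b n <= b m by move=> /subnKC <-; elim: (n - m)%N => [|k IH]; rewrite ?addn0 // addnS (le_trans _ IH).
have hab m n : a m <= b n.
 apply: le_trans (ha _ (maxn m n) (leq_maxl _ _)) _.
 exact: le_trans (ab _) (hb _ _ (leq_maxr _ _)).
pose S := [set a n | n in setT]%classic.
have hS : has_sup S by split; [exists (a 0), 0|exists (b 0) => _ [n _ <-]; apply: hab].
exists (sup S) => n; apply/andP; split; first by apply: ub_le_sup; [exact: hS.2|exists n].
by apply: ge_sup; [exact: hS.1|move=> _ [m _ <-]; apply: hab].
Qed.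

Lemma real_complete (u e : nat -> R) : (forall n m, (n <= m)%N -> `|u n - u m| <= e n) ->
 exists l, forall n, `|u n - l| <= e n.
move=> h.
have hab m n : u m - e m <= u n + e n.
 case: (leqP m n) => [/h|/ltnW /h]; rewrite ler_norml => /andP [h1 h2].
  have := h n n (leqnn _); rewrite subrr normr0; lra.
 have := h m m (leqnn _); rewrite subrr normr0; lra.
pose S := [set u n - e n | n in setT]%classic.
have hS : has_sup S by split; [exists (u 0 - e 0), 0|exists (u 0 + e 0) => _ [n _ <-]; apply: hab].
exists (sup S) => n.
have h1 : u n - e n <= sup S by apply: ub_le_sup; [exact: hS.2|exists n].
have h2 : sup S <= u n + e n by apply: ge_sup; [exact: hS.1|move=> _ [m _ <-]; apply: hab].
by rewrite ler_norml; lra.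
Qed.

Lemma complex_complete (u : nat -> C^o) (e : nat -> R) :
 (forall n m, (n <= m)%N -> nm (u n - u m) <= e n) ->
 exists l : C^o, forall n, nm (u n - l) <= 2 * e n.
move=> h.
have [a ha] : exists l, forall n, `|complex.Re (u n) - l| <= e n.
 apply: (@real_complete (fun n => complex.Re (u n))) => n m /h; apply: le_trans.
 by rewrite -raddfB nm_Re.
have [b hb] : exists l, forall n, `|complex.Im (u n) - l| <= e n.
 apply: (@real_complete (fun n => complex.Im (u n))) => n m /h; apply: le_trans.
 by rewrite -raddfB nm_Im.
exists (a +i* b)%C => n; apply: le_trans (nm_ReIm _) _.
by rewrite mulr_natl mulr2n; case: (u n) (ha n) (hb n) => x y /= h1 h2; exact: lerD.
Qed.

(** A square on which [G] fails has a failing quarter. The nested failing squares shrink to a point,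
    and near that point the local hypothesis contradicts the failure. *)
Lemma cousin2 (G : R -> R -> R -> Prop) :
 (forall x y s, 0 < s -> G x y (s / 2) -> G (x + s / 2) y (s / 2) -> G x (y + s / 2) (s / 2) ->
   G (x + s / 2) (y + s / 2) (s / 2) -> G x y s) ->
 (forall x0 y0, 0 <= x0 <= 1 -> 0 <= y0 <= 1 -> exists2 e, 0 < e & forall x y s, 0 < s < e ->
   x <= x0 <= x + s -> y <= y0 <= y + s -> 0 <= x -> x + s <= 1 -> 0 <= y -> y + s <= 1 -> G x y s) ->
 G 0 0 1.
move=> h1 h2; apply: contrapT => nG.
(* The corner of the first quarter on which [G] fails; once three quarters hold, the fourth must
   fail. *)
pose nx (p : R * R) s := if pselect (G p.1 p.2 (s / 2)) then
 if pselect (G (p.1 + s / 2) p.2 (s / 2)) then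
 if pselect (G p.1 (p.2 + s / 2) (s / 2)) then (p.1 + s / 2, p.2 + s / 2) else (p.1, p.2 + s / 2)
 else (p.1 + s / 2, p.2) else p.
pose q := fix q n := if n is n'.+1 then nx (q n') (2^-1 ^+ n') else (0, 0).
have nxP p s : 0 < s -> ~ G p.1 p.2 s -> [/\ ~ G (nx p s).1 (nx p s).2 (s / 2),
  p.1 <= (nx p s).1 <= p.1 + s / 2 & p.2 <= (nx p s).2 <= p.2 + s / 2].
 move=> s0 ng; rewrite /nx; case: pselect => g1; last by split=> //; lra.
 case: pselect => g2; last by split=> //=; lra.
 case: pselect => g3; last by split=> //=; lra.
 split=> /=; [|by lra..].
 by move=> g4; apply: ng; apply: h1.
have qP n : [/\ ~ G (q n).1 (q n).2 (2^-1 ^+ n), 0 <= (q n).1, (q n).1 + 2^-1 ^+ n <= 1,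
  0 <= (q n).2 & (q n).2 + 2^-1 ^+ n <= 1].
 elim: n => [|n [g a b c d]]; first by rewrite /= expr0 !add0r lexx.
 have s0 := pow2_gt0 n; have [g' /andP [a1 a2] /andP [a3 a4]] := nxP _ _ s0 g.
 rewrite pow2_half /=; split=> //; lra.
have qS n : (q n).1 <= (q n.+1).1 <= (q n).1 + 2^-1 ^+ n / 2 /\
 (q n).2 <= (q n.+1).2 <= (q n).2 + 2^-1 ^+ n / 2.
 by have [g _ _ _ _] := qP n; have [_ ? ?] := nxP _ _ (pow2_gt0 n) g.
have [x0 hx] : exists l, forall n, (q n).1 <= l <= (q n).1 + 2^-1 ^+ n.
 apply: nested => n; have [/andP [a1 a2] _] := qS n; have := pow2_gt0 n; rewrite ?pow2_half; lra.
have [y0 hy] : exists l, forall n, (q n).2 <= l <= (q n).2 + 2^-1 ^+ n.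
 apply: nested => n; have [_ /andP [a1 a2]] := qS n; have := pow2_gt0 n; rewrite ?pow2_half; lra.
have [e e0 he] : exists2 e, 0 < e & forall x y s, 0 < s < e ->
   x <= x0 <= x + s -> y <= y0 <= y + s -> 0 <= x -> x + s <= 1 -> 0 <= y -> y + s <= 1 -> G x y s.
 apply: h2; first by have := hx 0%N; rewrite /= expr0 add0r.
 by have := hy 0%N; rewrite /= expr0 add0r.
have [N hN] := pow2_small e0.
have [g a b c d] := qP N; apply: g; apply: he => //; by rewrite pow2_gt0.
Qed.

Lemma cousin1 (G : R -> R -> Prop) :
 (forall x s, 0 < s -> G x (s / 2) -> G (x + s / 2) (s / 2) -> G x s) ->
 (forall x0, 0 <= x0 <= 1 -> exists2 e, 0 < e & forall x s, 0 < s < e ->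
   x <= x0 <= x + s -> 0 <= x -> x + s <= 1 -> G x s) -> G 0 1.
move=> h1 h2; apply: (@cousin2 (fun x _ s => G x s)).
 by move=> x _ s s0 a b _ _; apply: h1.
by move=> x0 y0 hx hy; have [e e0 h] := h2 _ hx; exists e => // x y s ? ? _ ? ? _ _; apply: h.
Qed.

Definition rder (G : R -> C^o) (x : R) (l : C^o) := forall e : R, 0 < e -> exists2 d : R, 0 < d &
 forall h : R, `|h| < d -> nmc (G (x + h) - G x - h%:C * l) <= e * `|h|.

(** The straddle lemma. Bisection produces intervals that contain [x] but need not start at it, so
    the increment is compared with the derivative across [x]. *)
Lemma rder_straddle G x l (e : R) : rder G x l -> 0 < e -> exists2 d : R, 0 < d & forall a s, 0 < s < d ->
 a <= x <= a + s -> nmc (G (a + s) - G a - s%:C * l) <= e * s.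
move=> h e0; have [d d0 hd] := h e e0; exists d => // a s sd ax.
have n1 : `|a - x| = x - a by rewrite ler0_norm; lra.
have n2 : `|a + s - x| = a + s - x by rewrite ger0_norm; lra.
have := hd (a - x); have := hd (a + s - x); rewrite n1 n2 !subrKC => k2 k1.
have -> : G (a + s) - G a - s%:C * l = (G (a + s) - G x - (a + s - x)%:C * l) - (G a - G x - (a - x)%:C * l) by rewrite !(rmorphB, rmorphD) /=; ring.
have k3 : x - a < d by lra.
have k4 : a + s - x < d by lra.
by apply: le_trans (nmB _ _) _; apply: le_trans (lerD (k2 k4) (k1 k3)) _; lra.
Qed.

(** Complex values admit no mean value equality. The inequality is additive under cutting an
    interval and holds locally up to a slack [e1] per unit length, so bisection applies. *)
Lemma rder_le (G g : R -> C^o) (M a b : R) : a <= b ->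
 (forall x, a <= x <= b -> rder G x (g x)) -> (forall x, a <= x <= b -> nm (g x) <= M) ->
 nm (G b - G a) <= M * (b - a).
move=> ab hG hg; apply/ler_addgt0Pl => e e0; rewrite [e + _]addrC.
case: (leP b a) => ba.
 have -> : b = a by apply/eqP; rewrite eq_le ab ba.
 by rewrite !subrr nm0 mulr0 add0r ltW.
have l0 : 0 < b - a by lra.
pose e1 := e / (b - a); have e10 : 0 < e1 by rewrite divr_gt0.
pose c x := a + (b - a) * x.
suff : nm (G (c (0 + 1)) - G (c 0)) <= (M + e1) * (b - a) * 1.
 rewrite /c add0r mulr0 addr0 !mulr1 mulrDl /e1 divfK ?gt_eqF //.
 by rewrite [a + _]addrC subrK.
pose Good x s := nm (G (c (x + s)) - G (c x)) <= (M + e1) * (b - a) * s.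
apply: (@cousin1 Good) => [x s s0|x0 /andP [x0a x0b]]; rewrite /Good.
 rewrite -addrA -splitr => g1 g2.
 apply: le_trans (nm_dist (G (c (x + s / 2))) _ _) _.
 apply: le_trans (lerD g2 g1) _; rewrite -mulrDr -splitr //.
have cx0 : a <= c x0 <= b by rewrite /c; nra.
have [d d0 hd] := rder_straddle (hG _ cx0) e10.
have [t t0 td] := ex_small d0 (ltW l0).
exists t => // x s /andP [s0 st] /andP [xa xb] _ _.
have cE : c (x + s) = c x + (b - a) * s by rewrite /c; ring.
have s1 : 0 < (b - a) * s by side.
have s2 : (b - a) * s < d by rewrite mulrC; apply: le_lt_trans td; rewrite ler_pM2r // ltW.
have := hd (c x) ((b - a) * s); rewrite s1 s2 -cE /c !lerD2l !ler_pM2l // xa xb -/(c x) -/(c x0) -/(c (x + s)) => /(_ isT isT) h.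
rewrite -[G _ - _](subrK (((b - a) * s)%:C * g (c x0))); apply: le_trans (nmD _ _) _.
by rewrite nmM nm_real gtr0_norm //; have := ler_wpM2l (ltW s1) (hg _ cx0); lra.
Qed.

Lemma rderD G H x l m : rder G x l -> rder H x m -> rder (fun x => G x + H x) x (l + m).
move=> h k e e0; have e2 : 0 < e / 2 by lra.
have [d d0 hd] := h _ e2; have [d' d0' hd'] := k _ e2.
exists (minr d d'); first by side.
move=> t /lt_minP [t1 t2].
have -> : G (x + t) + H (x + t) - (G x + H x) - t%:C * (l + m) =
 (G (x + t) - G x - t%:C * l) + (H (x + t) - H x - t%:C * m) by ring.
apply: le_trans (nmD _ _) _; rewrite [e]splitr mulrDl lerD ?hd ?hd' //.
Qed.

Lemma rderZ c G x l : rder G x l -> rder (fun x => c * G x) x (c * l).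
move=> h e e0; have [s s0 sc] := ex_small e0 (nm_ge0 (c : C^o)).
have [d d0 hd] := h _ s0; exists d => // t /hd k.
have -> : c * G (x + t) - c * G x - t%:C * (c * l) = c * (G (x + t) - G x - t%:C * l) by ring.
rewrite nmM; apply: le_trans (ler_wpM2l (nm_ge0 _) k) _.
by rewrite mulrA ler_wpM2r // mulrC ltW.
Qed.

Lemma rder_lin (c b : C^o) x : rder (fun x => x%:C * c + b) x c.
move=> e e0; exists 1 => // h _.
have -> : (x + h)%:C * c + b - (x%:C * c + b) - h%:C * c = 0 by rewrite rmorphD /=; ring.
by rewrite nm0 mulr_ge0 // ltW.
Qed.

Lemma rder_le2 (G H g h : R -> C^o) (D : C^o) (M a s : R) : 0 <= s -> (forall x, a <= x <= a + s -> rder G x (g x)) ->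
 (forall x, a <= x <= a + s -> rder H x (h x)) -> (forall x, a <= x <= a + s -> nm (g x - h x - D) <= M) ->
 nmc (G (a + s) - H (a + s) - (G a - H a) - s%:C * D) <= M * s.
move=> s0 hG hH hM; have := @rder_le (fun x => G x + -1 * H x + (x%:C * - D + 0)) (fun x => g x + -1 * h x - D) M a (a + s).
rewrite [a + s - a]addrC addKr => le; apply: le_trans (le _ _ _); rewrite ?lerDl //.
- by apply: le_of_eq; congr nm; rewrite rmorphD /=; ring.
- by move=> x hx; apply: rderD (rderD (hG x hx) (rderZ _ (hH x hx))) (rder_lin _ _ _).
- by move=> x hx; rewrite mulN1r; exact: hM.
Qed.

Lemma rder_seg (W : normedModType C) (g : W -> C^o) (p v : W) (t : R) L : hd g (p + t%:C *: v) L ->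
 rder (fun s => g (p + s%:C *: v)) t (L v).
move=> [linL _ hL] e e0; set k := nm v + 1.
have k0 : 0 < k by rewrite ltr_wpDl // nm_ge0.
have [dl dl0 hdl] := hL _ (divr_gt0 e0 k0).
exists (dl / k) => [|u ud]; first by side.
have kx : nm v <= k by rewrite /k lerDl.
have hN : nm (u%:C *: v) = `|u| * nm v by rewrite nmZ nm_real.
have LE : L (u%:C *: v) = u%:C * L v by rewrite (linZ _ _ linL).
have E : p + (t + u)%:C *: v = p + t%:C *: v + u%:C *: v by rewrite rmorphD scalerDl addrA.
have lt : nm (u%:C *: v) < dl by rewrite hN; apply: le_lt_trans (ler_wpM2l (normr_ge0 u) kx) _; rewrite -ltr_pdivlMr.
have := hdl _ lt; rewrite hN LE E; clear -e0 k0 kx; move: (nm v) k k0 kx => c k k0 ck le; apply: le_trans le _.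
rewrite mulrAC -mulrA; apply: ler_wpM2l; first exact: ltW.
by rewrite -mulrA ler_piMr // ler_pdivrMr // mul1r.
Qed.

End Real.

(** * Primitives and integrals of continuous complex functions on [0, 1] *)

Section Primitive.
Import measure lebesgue_measure lebesgue_integral ftc.
Variable R : realType.
Local Notation C := R[i].
Local Open Scope classical_set_scope.

Definition rcont (g : R -> C^o) := forall x (e : R), 0 < e -> exists2 d : R, 0 < d &
 forall y, `|y - x| < d -> nm (g y - g x) <= e.

(** The Lebesgue integral serves only to produce a primitive. Integrating from -1, on a segment up
    to 2, keeps 0 and 1 interior, so that the derivative is two-sided there. *)
Lemma real_prim (f : R -> R) : continuous f -> exists F : R -> R, forall x, 0 <= x <= 1 ->
 forall e, 0 < e -> exists2 d, 0 < d & forall h, `|h| < d -> `|F (x + h) - F x - h * f x| <= e * `|h|.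
move=> cf; exists (fun x => \int[lebesgue_measure]_(t in `[-1, x]) f t)%R => x /andP [x0 x1] e e0.
have i : lebesgue_measure.-integrable `[-1, 2] (constructive_ereal.EFin \o f).
 apply: continuous_compact_integrable; first exact: segment_compact.
 exact: continuous_subspaceT.
have x2 : x < 2 by lra.
have x3 : -1 < x by lra.
have /= [D E] := continuous_FTC1_closed x2 i x3 (cf x).
move: D E; set F := (fun _ => _) => D E.
have D' : (h^-1 *: ((F \o shift x) (h *: 1) - F x) @[h --> 0^'] --> f x) by rewrite -E derive1E; exact: D.
have /cvgrPdist_le /(_ e e0) := D'; rewrite near_withinE => /nbhs_normP [d /= d0 hd].
exists d => // h hh; have [->|hn] := eqVneq h 0.
 by rewrite addr0 subrr mul0r subrr normr0 mulr0.
have := hd h; rewrite /ball_ /= sub0r normrN => /(_ hh hn).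
rewrite /= /GRing.scale /= mulr1 [h + x]addrC => k.
have -> : F (x + h) - F x - h * f x = - (h * (f x - h^-1 * (F (x + h) - F x))) by field.
by rewrite normrN normrM mulrC ler_wpM2r.
Qed.

Lemma rcont_real (g : R -> C^o) : rcont g ->
 continuous (fun x => complex.Re (g x)) /\ continuous (fun x => complex.Im (g x)).
move=> h; split=> x; apply/cvgrPdist_le => e e0; have [d d0 k] := h x _ e0;
 apply/nbhs_normP; exists d => // y /=; rewrite distrC => /k; rewrite nmC => /le_trans h'; apply: le_trans (h' _ (lexx _)).
 by rewrite -raddfB nm_Re.
by rewrite -raddfB nm_Im.
Qed.

Lemma rprim (g : R -> C^o) : rcont g -> exists G : R -> C^o, forall x, 0 <= x <= 1 -> rder G x (g x).
move=> /rcont_real [/real_prim [F hF] /real_prim [G hG]].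
exists (fun x => (F x +i* G x)%C) => x hx e e0.
have e2 : 0 < e / 2 by lra.
have [d d0 k] := hF _ hx _ e2; have [d' d0' k'] := hG _ hx _ e2.
exists (minr d d'); first by side.
move=> h /lt_minP [/k h1 /k' h2].
apply: le_trans (nm_ReIm _) _.
case: (g x) h1 h2 => u v /= h1 h2; rewrite !mul0r subr0 addr0 [e]splitr mulrDl; exact: lerD.
Qed.

Definition prim (g : R -> C^o) : R -> C^o := xget (fun=> 0) [set G | forall x, 0 <= x <= 1 -> rder G x (g x)].

Lemma primP g : rcont g -> forall x, 0 <= x <= 1 -> rder (prim g) x (g x).
by move=> /rprim [G hG]; rewrite /prim; case: xgetP => [_ -> //|/(_ G)]. Qed.

Definition int (g : R -> C^o) : C^o := prim g 1 - prim g 0.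

Lemma int_le g (M : R) : rcont g -> (forall x, 0 <= x <= 1 -> nm (g x) <= M) -> nm (int g) <= M.
by move=> /primP h k; have := rder_le ler01 h k; rewrite subr0 mulr1. Qed.

Lemma int_prim (g G : R -> C^o) : rcont g -> (forall x, 0 <= x <= 1 -> rder G x (g x)) -> int g = G 1 - G 0.
move=> /primP h k; apply: subr0_eq; apply: nm_le0.
pose H x := prim g x + (-1) * G x.
have hH x : 0 <= x <= 1 -> rder H x (g x + (-1) * g x) by move=> ?; apply: rderD (h _ _) (rderZ _ (k _ _)).
have := @rder_le _ H (fun x => g x + (-1) * g x) 0 0 1 ler01 hH.
rewrite mul0r /H => hh; have -> : int g - (G 1 - G 0) = prim g 1 + -1 * G 1 - (prim g 0 + -1 * G 0) by rewrite /int; ring.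
by apply: hh => x _; rewrite mulN1r subrr nm0.
Qed.

Lemma rcont_comb g h (c : C^o) : rcont g -> rcont h -> rcont (fun x => g x + c * h x).
move=> cg ch x e e0; have e2 : 0 < e / 2 by lra.
have [d1 d10 k1] := cg x _ e2; have [s s0 k2] := ex_small e2 (nm_ge0 c); have [d3 d30 k3] := ch x _ s0.
exists (minr d1 d3); first by pos.
move=> y /lt_minP [/k1 y1 /k3 y3]; rewrite opprD addrACA -mulrBr.
apply: le_trans (nmD _ _) _; rewrite nmM [e]splitr lerD //.
by apply: le_trans (ltW k2); rewrite mulrC ler_wpM2r ?nm_ge0.
Qed.

Lemma int_comb g h (c : C^o) : rcont g -> rcont h -> int (fun x => g x + c * h x) = int g + c * int h.
move=> cg ch; rewrite (@int_prim _ (fun x => prim g x + c * prim h x)); [|exact: rcont_comb|].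
 by rewrite /int; ring.
by move=> x hx; apply: rderD (primP cg hx) (rderZ _ (primP ch hx)).
Qed.

(** Clamping to [0, 1] turns an integrand controlled on the segment only into one continuous on the
    whole line, as [rcont] asks. *)
Definition cl (x : R) : R := if x < 0 then 0 else if 1 < x then 1 else x.

Lemma clP x : 0 <= cl x <= 1.
by rewrite /cl; case: ltP => ?; [|case: ltP => ?]; lra. Qed.

Lemma cl_id x : 0 <= x <= 1 -> cl x = x.
by move=> /andP [a b]; rewrite /cl !ltNge a b. Qed.

Lemma cl_lip x y : `|cl x - cl y| <= `|x - y|.
rewrite /cl; case: (ltP x 0) => ?; [|case: (ltP 1 x) => ?]; (case: (ltP y 0) => ?; [|case: (ltP 1 y) => ?]);
 rewrite ler_norml; case: (ler0P (x - y)) => ?; lra.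
Qed.

Lemma rcont_cl (F : C^o -> C^o) : (forall x : R, 0 <= x <= 1 -> dif F (x%:C : C^o)) ->
 rcont (fun x => F (cl x)%:C).
move=> h x e e0; have [d d0 k] := dif_cont (h _ (clP x)) e0.
exists d => // y hy; apply: ltW; apply: k; rewrite -rmorphB nm_real.
exact: le_lt_trans (cl_lip _ _) hy.
Qed.

End Primitive.

Lemma sub01 (R : realType) (x s u : R) : 0 <= x -> x + s <= 1 -> x <= u <= x + s -> 0 <= u <= 1.
by move=> h1 h2 /andP [h3 h4]; lra. Qed.

(** * Goursat's argument for a conical homotopy *)

Section Goursat.
Variable R : realType.
Local Notation C := R[i].
Variables (f : C^o -> C^o) (a p q : C^o) (m dl : R).
Let gam (t : C^o) : C^o := p + t * (q - p).
Let z (l t : C^o) : C^o := a + l * (gam t - a).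
Hypotheses (df : forall l t : R, 0 <= l <= 1 -> 0 <= t <= 1 -> dif f (z l%:C t%:C)) (m0 : 0 < m) (gm : forall t : R, 0 <= t <= 1 -> m <= nm (gam t%:C - a)) (dl01 : 0 < dl <= 1).

(** [gA] and [gB] are the two components of the pullback of [f z dz / (z - a)] under the homotopy
    [a + l (gam t - a)], where [dz / (z - a)] is the sum of [dl / l] and [dgam / (gam - a)]. The
    function [gl] runs over the scales from [dl] to 1. *)
Definition gA (l : C^o) (t : C^o) : C^o := f (a + l * (p + t * (q - p) - a)) * ((q - p) / (p + t * (q - p) - a)).
Definition gl (s : C^o) : C^o := dl%:C + (1 - dl)%:C * s.
Definition gB (u : C^o) (s : C^o) : C^o := f (a + gl s * (u - a)) / gl s * (1 - dl)%:C.

Let gl_real (s : R) : gl s%:C = (dl + (1 - dl) * s)%:C.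
by rewrite /gl [in RHS]rmorphD [in RHS]rmorphM. Qed.

Let gl01 (s : R) : 0 <= s <= 1 -> dl <= dl + (1 - dl) * s <= 1.
by case/andP: dl01 => h1 h2 /andP [h3 h4]; nra. Qed.

Let dA (l : R) : 0 <= l <= 1 -> forall t : R, 0 <= t <= 1 -> dif (gA l%:C) t%:C.
move=> hl t ht; have n0 : p + t%:C * (q - p) - a != 0 by rewrite -nm_gt0; apply: lt_le_trans m0 (gm ht).
apply: difM; last dfs.
by apply: (dif_comp (g := f)); [dfs|exact: df].
Qed.

Let dB (t : R) : 0 <= t <= 1 -> forall s : R, 0 <= s <= 1 -> dif (gB (gam t%:C)) s%:C.
move=> ht s hs; have /andP [h1 h2] := gl01 hs; case/andP: dl01 => h3 h4.
have n0 : gl s%:C != 0 by rewrite gl_real -nm_gt0 nm_real gtr0_norm; lra.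
have dg : dif gl (s%:C : C^o) by rewrite /gl; dfs.
apply: difM; last dfs; apply: difM; last dfs.
apply: (dif_comp (g := f)); first dfs.
by rewrite gl_real; apply: df => //; lra.
Qed.

Let A l := fun t : R => gA l (cl t)%:C.
Let B u := fun s : R => gB u (cl s)%:C.

(** The circulation [E] of the pullback around a parameter square is additive under subdivision, and
    it is [o(s^2)] near each point because [f] is affine there to first order. Bisection then gives
    zero, with no continuity of the derivative of [f]. *)
Lemma goursat_side : int (A 1) - int (A dl%:C) = int (B q) - int (B p).
case/andP: (dl01) => dl0 dl1.
have rA (l : R) : 0 <= l <= 1 -> forall t : R, 0 <= t <= 1 -> rder (prim (A l%:C)) t (gA l%:C t%:C).
 move=> hl t ht; have := primP (rcont_cl (dA hl)) ht; by rewrite /A cl_id.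
have rB (t : R) : 0 <= t <= 1 -> forall s : R, 0 <= s <= 1 -> rder (prim (B (gam t%:C))) s (gB (gam t%:C) s%:C).
 move=> hl s ht; have := primP (rcont_cl (dB hl)) ht; by rewrite /B cl_id.
pose lam s := dl + (1 - dl) * s.
pose PA s t := prim (A (lam s)%:C) t.
pose PB t s := prim (B (gam t%:C)) s.
pose E x y s : C^o := (PA (x + s) (y + s) - PA x (y + s)) - (PA (x + s) y - PA x y)
  - ((PB (y + s) (x + s) - PB y (x + s)) - (PB (y + s) x - PB y x)).
suff E0 : E 0 0 1 = 0.
 have l1 : lam 1 = 1 by rewrite /lam; ring.
 have l0 : lam 0 = dl by rewrite /lam; ring.
 have g1 : gam (1 : R)%:C = q by rewrite /gam rmorph1; ring.
 have g0 : gam (0 : R)%:C = p by rewrite /gam rmorph0; ring.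
 move: E0; rewrite /E /PA /PB !add0r l1 l0 g1 g0 rmorph1 => E0; rewrite /int.
 by apply/eqP; rewrite -subr_eq0 -E0; apply/eqP; ring.
apply: nm_le0; apply/ler_addgt0Pl => e e0; rewrite addr0.
suff : nm (E 0 0 1) <= e * 1 ^+ 2 by rewrite expr1n mulr1.
apply: (@cousin2 _ (fun x y s => nm (E x y s) <= e * s ^+ 2)).
 move=> x y s s0 g1 g2 g3 g4.
 have -> : E x y s = E x y (s / 2) + E (x + s / 2) y (s / 2) + E x (y + s / 2) (s / 2)
   + E (x + s / 2) (y + s / 2) (s / 2).
  rewrite /E -!addrA -!splitr; ring.
 apply: le_trans (nmD _ _) _; apply: le_trans (lerD (nmD _ _) g4) _.
 apply: le_trans (lerD (lerD (nmD _ _) g3) (lexx _)) _.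
 have -> : e * s ^+ 2 = e * (s / 2) ^+ 2 + e * (s / 2) ^+ 2 + e * (s / 2) ^+ 2 + e * (s / 2) ^+ 2 by field.
 by rewrite !lerD.
move=> x0 y0 hx0 hy0.
have hl0 := gl01 hx0.
have hl0' : 0 <= lam x0 <= 1 by rewrite /lam; case/andP: hl0 => h1 h2; lra.
pose z0 := z (lam x0)%:C y0%:C.
have [L [lL [KL KL0 bL] hL]] := df hl0' hy0.
pose c := L 1.
have Lc h : L h = h * c by exact: lin1.
pose Q := nm (q - p); pose Kg := nm (p - a) + Q; pose K := Kg + Q.
have Q0 : 0 <= Q by side.
have Kg0 : 0 <= Kg by rewrite addr_ge0 ?nm_ge0.
have K0 : 0 <= K by rewrite addr_ge0.
have gK (t : R) : 0 <= t <= 1 -> nm (gam t%:C - a) <= Kg.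
 move=> /andP [t0 t1]; rewrite /gam addrAC; apply: le_trans (nmD _ _) _.
 by rewrite lerD2l nmM nm_real ger0_norm // ler_piMl.
pose K' := 2 * K * (Q / m) + 2 * K / dl.
have K'0 : 0 <= K' by rewrite /K' addr_ge0 // ?divr_ge0 ?(ltW dl0) ?mulr_ge0 ?invr_ge0 ?(ltW m0).
have [e1 e10 e1K] := ex_small e0 K'0.
have [d d0 hd] := hL _ e10.
have [r r0 rK] := ex_small d0 K0.
exists r => // x y s /andP [s0 sr] /andP [xa xb] /andP [ya yb] x_0 x_1 y_0 y_1.
have lamE u v : lam u - lam v = (1 - dl) * (u - v) by rewrite /lam; ring.
have err (u v : R) : x <= u <= x + s -> y <= v <= y + s ->
  nmc (f (z (lam u)%:C v%:C) - f z0 - (z (lam u)%:C v%:C - z0) * c) <= e1 * (K * s).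
 move=> /andP [u1 u2] /andP [v1 v2].
 have hz : nm (z (lam u)%:C v%:C - z0) <= K * s.
  have -> : z (lam u)%:C v%:C - z0 = (lam u - lam x0)%:C * (gam v%:C - a) + (lam x0)%:C * ((v - y0)%:C * (q - p)) by rewrite /z0 /z /gam !rmorphB /=; ring.
  apply: le_trans (nmD _ _) _; rewrite !nmM !nm_real /K mulrDl lerD //.
   rewrite mulrC ler_pM ?nm_ge0 //; first by apply: gK; lra.
   rewrite lamE normrM ger0_norm; last by lra.
   have : `|u - x0| <= s by rewrite ler_norml; lra.
   have := normr_ge0 (u - x0); nra.
  have h1 : `|v - y0| <= s by rewrite ler_norml; lra.
  case/andP: hl0' => h2 h3; rewrite (ger0_norm h2) -/Q.
  have := normr_ge0 (v - y0); rewrite mulrA [Q * s]mulrC => h4; apply: ler_wpM2r => //; nra.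
 have lt : nm (z (lam u)%:C v%:C - z0) < d.
  apply: le_lt_trans hz _; apply: le_lt_trans rK; rewrite mulrC ler_wpM2r // ltW //.
 have := hd _ lt; rewrite Lc -/z0 [z0 + _]addrC subrK => /le_trans; apply.
 by rewrite ler_wpM2l // ltW.
(* For the affine approximation of [f] at [z0] both components have this same constant as their
   difference between opposite sides, so it cancels from the circulation and only the errors
   remain. *)
pose D := (lam (x + s) - lam x)%:C * (q - p) * c.
have F1 : nmc ((PA (x + s) (y + s) - PA x (y + s)) - (PA (x + s) y - PA x y) - s%:C * D)
  <= 2 * (e1 * (K * s)) * (Q / m) * s.
 have hl (u : R) : x <= u <= x + s -> 0 <= lam u <= 1 by move=> hu; have /gl01 := sub01 x_0 x_1 hu; rewrite /lam => /andP [? ?]; lra.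
 have hl1 : x <= x <= x + s by rewrite lexx lerDl ltW.
 have hl2 : x <= x + s <= x + s by rewrite lexx lerDl ltW.
 apply: (rder_le2 (ltW s0) (fun t ht => rA _ (hl _ hl2) t (sub01 y_0 y_1 ht)) (fun t ht => rA _ (hl _ hl1) t (sub01 y_0 y_1 ht))).
 move=> t ht; have t01 := sub01 y_0 y_1 ht.
 have e2 := err _ _ hl2 ht; have e3 := err _ _ hl1 ht.
 have ga : gam t%:C - a != 0 by rewrite -nm_gt0; apply: lt_le_trans m0 (gm t01).
 rewrite [X in nm X](_ : _ = ((f (z (lam (x + s))%:C t%:C) - f z0 - (z (lam (x + s))%:C t%:C - z0) * c)
   - (f (z (lam x)%:C t%:C) - f z0 - (z (lam x)%:C t%:C - z0) * c)) * ((q - p) / (gam t%:C - a))); last first.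
  rewrite /gA -/(gam _) -/(z _ _) -/(z _ _) /D rmorphB /=.
  set f1 := f (z (lam (x + s))%:C _); set f2 := f (z (lam x)%:C _).
  by rewrite /z; field.
 rewrite nmM; apply: ler_pM; rewrite ?nm_ge0 //.
  apply: le_trans (nmB _ _) _; apply: le_trans (lerD e2 e3) _; lra.
 by rewrite nmM nmV ler_wpM2l // lef_pV2 ?posrE ?gm // nm_gt0.
have F2 : nmc ((PB (y + s) (x + s) - PB y (x + s)) - (PB (y + s) x - PB y x) - s%:C * D)
  <= 2 * (e1 * (K * s)) / dl * s.
 have hl1 : y <= y <= y + s by rewrite lexx lerDl ltW.
 have hl2 : y <= y + s <= y + s by rewrite lexx lerDl ltW.
 apply: (rder_le2 (ltW s0) (fun t ht => rB _ (sub01 y_0 y_1 hl2) t (sub01 x_0 x_1 ht)) (fun t ht => rB _ (sub01 y_0 y_1 hl1) t (sub01 x_0 x_1 ht))).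
 move=> t ht; have t01 := sub01 x_0 x_1 ht.
 have e2 := err _ _ ht hl2; have e3 := err _ _ ht hl1.
 have /andP [l1 l2] := gl01 t01; rewrite -/(lam t) in l1 l2.
 have lt0 : (lam t)%:C != 0 :> C by rewrite fmorph_eq0; apply/eqP; lra.
 rewrite [X in nm X](_ : _ = ((f (z (lam t)%:C (y + s)%:C) - f z0 - (z (lam t)%:C (y + s)%:C - z0) * c)
   - (f (z (lam t)%:C y%:C) - f z0 - (z (lam t)%:C y%:C - z0) * c)) / (lam t)%:C * (1 - dl)%:C); last first.
  rewrite /gB gl_real -/(lam t) -/(z _ _) -/(z _ _) /D lamE [x + s - x](_ : _ = s); last by ring.
  set f1 := f (z _ (y + s)%:C); set f2 := f (z _ y%:C).
  have e4 : ((1 - dl) * s)%:C = (1 - dl)%:C * s%:C by rewrite rmorphM.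
  have e5 : (y + s)%:C = y%:C + s%:C by rewrite rmorphD.
  by rewrite e4 /z /gam e5; field.
 rewrite !nmM nmV !nm_real; apply: le_trans (_ : 2 * (e1 * (K * s)) / dl * 1 <= _); last by rewrite mulr1.
 apply: ler_pM; rewrite ?mulr_ge0 ?invr_ge0 ?nm_ge0 //; last by rewrite ger0_norm; lra.
 apply: ler_pM; rewrite ?nm_ge0 ?invr_ge0 //.
  apply: le_trans (nmB _ _) _; apply: le_trans (lerD e2 e3) _; lra.
 by rewrite lef_pV2 ?posrE ?normr_gt0 ?gtr0_norm //; lra.
rewrite /E; set U := _ - _ - _ in F1; set V := _ - _ - _ in F2.
rewrite [X in nm X](_ : _ = U - V); last by rewrite /U /V; ring.
apply: le_trans (nmB _ _) _; apply: le_trans (lerD F1 F2) _.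
apply: le_trans (_ : e1 * K' * s ^+ 2 <= _); last by rewrite ler_wpM2r ?sqr_ge0 // ltW.
apply: le_of_eq; rewrite /K'; field.
by rewrite !gt_eqF.
Qed.

End Goursat.

Lemma le_of_sqr (R : realType) (x y : R) : 0 <= y -> x ^+ 2 <= y ^+ 2 -> x <= y.
by move=> y0 h; rewrite leNgt; apply/negP => h'; nra. Qed.

(** * Cauchy's formula and Taylor expansion by integrals over a square *)

Section Contour.
Variable R : realType.
Local Notation C := R[i].
Variable r : R.
Hypothesis r0 : 0 < r.
Local Notation I := ('i%C : C).

(** Corners, in counterclockwise order, of the square of half side [r]. On its sides the modulus
    lies between [r] and [2 * r], and the estimates use nothing else. *)
Definition crn (j : nat) : C^o := r%:C * (I ^+ j * (1 - I)).
Definition sid (j : nat) (t : C^o) : C^o := crn j + t * (crn j.+1 - crn j).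

Lemma sqrI : I * I = -1. by apply/eqP; rewrite eq_complex /= !mul0r mulr1 mul1r sub0r addr0 oppr0 !eqxx. Qed.

Lemma crn_diff j : crn j.+1 - crn j = r%:C * (I ^+ j * (2 * I)).
rewrite /crn exprS; have -> : r%:C * (I * I ^+ j * (1 - I)) - r%:C * (I ^+ j * (1 - I)) =
 r%:C * (I ^+ j * (2 * I - 1 - I * I)) by ring.
by rewrite sqrI; congr (_ * (_ * _)); ring.
Qed.

Lemma nm_sq (x y : R) : nmc ((x +i* y)%C) ^+ 2 = x ^+ 2 + y ^+ 2.
by rewrite /nm normc_def /= sqr_sqrtr // addr_ge0 ?sqr_ge0. Qed.

Lemma nmI : nmc I = 1.
have := nm_sq 0 1; rewrite expr0n expr1n add0r => h.
by apply/eqP; rewrite -sqrp_eq1 ?nm_ge0 // h.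
Qed.

Lemma sidE j (t : R) : sid j t%:C = r%:C * (I ^+ j * (1 +i* (2 * t - 1))%C).
rewrite /sid crn_diff /crn.
have -> : (1 +i* (2 * t - 1))%C = 1 + I * (2 * t%:C - 1) by apply/eqP; rewrite eq_complex /=; apply/andP; split; apply/eqP; ring.
by ring.
Qed.

Lemma nm_sid j (t : R) : nm (sid j t%:C) = r * nmc ((1 +i* (2 * t - 1))%C).
by rewrite sidE !nmM nmX nmI expr1n mul1r nm_real gtr0_norm. Qed.

Lemma sid_bd j (t : R) : 0 <= t <= 1 -> r <= nm (sid j t%:C) <= 2 * r.
have rp := r0.
move=> /andP [t0 t1]; rewrite nm_sid; set x := nm _.
have hx : x ^+ 2 = 1 + (2 * t - 1) ^+ 2 by rewrite /x nm_sq expr1n.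
have x0 : 0 <= x by side.
have h1 : 1 <= x by rewrite -(@ler_pXn2r _ 2) ?nnegrE // expr1n hx lerDl sqr_ge0.
have h2 : x <= 2 by rewrite -(@ler_pXn2r _ 2) ?nnegrE // hx; nra.
by rewrite mulrC [2 * r]mulrC ![r * _]mulrC ler_pMl // h1 ler_pM2r.
Qed.

Lemma nm_crn_diff j : nm (crn j.+1 - crn j) = 2 * r.
by rewrite crn_diff !nmM nmX nmI expr1n mul1r mulr1 nm_real gtr0_norm // nm_nat mulrC. Qed.

Definition onb (F : C^o -> C^o) := forall j (t : R), 0 <= t <= 1 -> dif F (sid j t%:C).
Definition Jf (F : C^o -> C^o) j := fun t : R => F (sid j (cl t)%:C) * (crn j.+1 - crn j) : C^o.
Definition J (F : C^o -> C^o) : C^o := \sum_(j < 4) int (Jf F j).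

Lemma rcont_Jf F j : onb F -> rcont (Jf F j).
move=> h; apply: (@rcont_cl _ (fun t : C^o => F (sid j t) * (crn j.+1 - crn j) : C^o)) => t ht.
apply: difM; last dfs.
by apply: (dif_comp (g := F)); [rewrite /sid; dfs|exact: h].
Qed.

Lemma J_ext F G : (forall j (t : R), 0 <= t <= 1 -> F (sid j t%:C) = G (sid j t%:C)) -> J F = J G.
move=> h; apply: eq_bigr => j _; congr int; apply/funext => t.
by rewrite /Jf h // clP.
Qed.

Lemma J_le F (M : R) : onb F -> (forall j (t : R), 0 <= t <= 1 -> nm (F (sid j t%:C)) <= M) ->
 nm (J F) <= 8 * r * M.
have rp := r0.
move=> o h; apply: le_trans (nm_sum _ _ _) _.
apply: le_trans (_ : \sum_(j < 4) (2 * r * M) <= _).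
 apply: ler_sum => j _; apply: int_le; first exact: rcont_Jf.
 move=> t ht; rewrite nmM nm_crn_diff mulrC ler_pM2l ?mulr_gt0 //.
 by apply: h; exact: clP.
by rewrite sumr_const card_ord -mulr_natr; lra.
Qed.

Lemma J_comb F G (c : C^o) : onb F -> onb G -> J (fun z => F z + c * G z) = J F + c * J G.
move=> f g; rewrite /J mulr_sumr -big_split /=; apply: eq_bigr => j _.
have E : Jf (fun z => F z + c * G z) j = (fun t => Jf F j t + c * Jf G j t) by apply/funext => t; rewrite /Jf; ring.
by rewrite E; apply: int_comb; exact: rcont_Jf.
Qed.

Lemma crn4 : crn 4 = crn 0.
have I2 : I ^+ 2 = -1 by rewrite expr2 sqrI.
have I4 : I ^+ 4 = 1 by rewrite (exprM _ 2 2) I2 sqrrN expr1n.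
by rewrite /crn I4 expr0.
Qed.

Lemma J_prim F G : onb F -> (forall j (t : R), 0 <= t <= 1 -> hd G (sid j t%:C) (fun h : C^o => F (sid j t%:C) * h : C^o)) ->
 J F = 0.
move=> o h.
have E (j : 'I_4) : int (Jf F j) = G (crn j.+1) - G (crn j).
 rewrite (@int_prim _ _ (fun t : R => G (sid j t%:C))); first last.
 - move=> x hx; rewrite /Jf cl_id //.
  exact: (rder_seg (W := C^o) (h j x hx)).
 - exact: rcont_Jf.
 by rewrite /sid rmorph1 rmorph0 mul0r addr0 mul1r [_ + (_ - _)]addrC subrK.
rewrite /J (eq_bigr _ (fun j _ => E j)) !big_ord_recl big_ord0 /= /bump /= crn4; ring.
Qed.

(** The homotopy of [goursat_side] shrinks the contour towards [a]; its radial parts telescope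
    around the closed square, and on the small contour [f] is nearly [f a]. The integral of
    [1 / (z - a)] stands in place of [2 pi i]. *)
Lemma J_cauchy (f : C^o -> C^o) (a : C^o) : nm a <= r / 2 -> (forall z, nm z <= 2 * r -> dif f z) ->
 J (fun z => f z / (z - a)) = f a * J (fun z => 1 / (z - a)).
have rp := r0.
move=> ha df.
have na (j : nat) (t : R) : 0 <= t <= 1 -> r / 2 <= nm (sid j t%:C - a) by move=> /(sid_bd j) /andP [h1 h2]; have := nm_rev (sid j t%:C) a; lra.
have nz (j : nat) (t : R) : 0 <= t <= 1 -> sid j t%:C - a != 0 by move=> /(na j) h; apply: nm_neq0; lra.
have zb (j : nat) (l t : R) : 0 <= l <= 1 -> 0 <= t <= 1 -> nmc (a + l%:C * (sid j t%:C - a)) <= 2 * r.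
 move=> /andP [l0 l1] /(sid_bd j) /andP [h1 h2].
 have -> : a + l%:C * (sid j t%:C - a) = (1 - l)%:C * a + l%:C * sid j t%:C by rewrite rmorphB rmorph1; ring.
 apply: le_trans (nmD _ _) _; rewrite !nmM !nm_real !ger0_norm; [|lra..].
 have := nm_ge0 a; nra.
have dfa : dif f a by apply: df; lra.
have donb : onb (fun z => 1 / (z - a)) by move=> j t ht; apply: difM; [dfs|apply: difV; [exact: nz|dfs]].
apply: subr0_eq; apply: nm_le0.
apply/ler_addgt0Pl => e e0; rewrite addr0.
have e16 : 0 < e / 16 by lra.
have [d d0 hd] := dif_cont dfa e16.
have r30 : 0 <= 3 * r by lra.
have [s s0 sr] := ex_small d0 r30.
(* Points of the contour are within [3 * r] of [a], so at this scale [f] differs from [f a] by less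
   than [e / 16]. *)
pose dl := minr s 1.
have dl01 : 0 < dl <= 1 by rewrite /dl lt_min s0 ltr01 ge_min lexx orbT.
have m0 : 0 < r / 2 by lra.
have G (j : nat) := @goursat_side R f a (crn j) (crn j.+1) (r / 2) dl
  (fun l t hl ht => df _ (zb j l t hl ht)) m0 (na j) dl01.
pose Al (j : nat) := fun t : R => gA f a (crn j) (crn j.+1) dl%:C (cl t)%:C.
pose Bl (j : nat) := int (fun s0 => gB f a dl (crn j) (cl s0)%:C).
have S1 : J (fun z => f z / (z - a)) = \sum_(j < 4) int (Al j).
 have Z : \sum_(j < 4) (Bl j.+1 - Bl j) = 0 by rewrite !big_ord_recl big_ord0 /= /bump /= /Bl crn4; ring.
 apply/eqP; rewrite -subr_eq0 -[X in _ == X]Z /J -sumrB; apply/eqP; apply: eq_bigr => j _.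
 have := G j; rewrite -/(Bl j.+1) -/(Bl j) -/(Al j) => <-.
 congr (_ - _); congr int; apply/funext => t.
 have tz := nz j _ (clP t); rewrite /Jf /gA -/(sid _ _) mul1r [a + _]addrC subrK.
 by ring.
rewrite S1 /J mulr_sumr -sumrB; apply: le_trans (nm_sum _ _ _) _.
apply: le_trans (_ : \sum_(j < 4) (e / 4) <= _); last by rewrite sumr_const card_ord -mulr_natr; lra.
apply: ler_sum => j _.
have cA : rcont (Al j).
 apply: rcont_cl => t ht.
 have tz := nz j _ ht.
 apply: difM; last by side.
 apply: (dif_comp (g := f)); first dfs.
 by apply: df; apply: (zb j dl t) => //; case/andP: dl01 => ? ?; lra.
have cK := rcont_Jf j donb.
rewrite -[_ - _](_ : int (fun t => Al j t + (- f a) * Jf (fun z => 1 / (z - a)) j t) = _); last first.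
 by rewrite int_comb //; ring.
apply: int_le => [|t _]; [exact: rcont_comb|have ht := clP t].
have tz := nz j _ ht; have tn := na j _ ht.
rewrite /Al /Jf /gA -/(sid _ _); set zt := sid j _.
have -> : f (a + dl%:C * (zt - a)) * ((crn j.+1 - crn j) / (zt - a)) + - f a * (1 / (zt - a) * (crn j.+1 - crn j))
 = (f (a + dl%:C * (zt - a)) - f a) * ((crn j.+1 - crn j) / (zt - a)) by ring.
rewrite !nmM nm_crn_diff nmV.
apply: le_trans (_ : e / 16 * 4 <= _); last by lra.
apply: ler_pM; rewrite ?mulr_ge0 ?invr_ge0 ?nm_ge0 //; first by lra.
 apply: ltW; apply: hd; rewrite [a + _]addrC addrK nmM nm_real.
 apply: le_lt_trans sr; apply: ler_pM; rewrite ?nm_ge0 ?normr_ge0 //.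
  by case/andP: dl01 => h1 _; rewrite gtr0_norm // /dl ge_min lexx.
 have := nmB zt a; case/andP: (sid_bd j ht) => _ h2; rewrite -/zt in h2; lra.
rewrite ler_pdivrMr; last by side.
by rewrite -/zt in tn; lra.
Qed.

Lemma onb_pow (F : C^o -> C^o) k : (forall z, nm z <= 2 * r -> dif F z) -> onb (fun z => F z / z ^+ k).
have rp := r0.
move=> h j t ht; case/andP: (sid_bd j ht) => h1 h2; apply: difM; first exact: h.
by apply: difV; [rewrite expf_neq0 // nm_neq0 //; lra|dfs].
Qed.

Lemma onb_pow_res (F : C^o -> C^o) (a : C^o) k : nm a <= r / 2 -> (forall z, nm z <= 2 * r -> dif F z) ->
 onb (fun z => F z / (z ^+ k * (z - a))).
have rp := r0.
move=> ha h j t ht; case/andP: (sid_bd j ht) => h1 h2; apply: difM; first exact: h.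
have h3 := nm_rev (sid j t%:C) a.
by apply: difV; [rewrite mulf_neq0 ?expf_neq0 // nm_neq0 //; lra|dfs].
Qed.

Lemma J_geom (F : C^o -> C^o) (a : C^o) m : nm a <= r / 2 -> (forall z, nm z <= 2 * r -> dif F z) ->
 J (fun z => F z / (z - a)) = \sum_(k < m) a ^+ k * J (fun z => F z / z ^+ k.+1)
   + a ^+ m * J (fun z => F z / (z ^+ m * (z - a))).
have rp := r0.
move=> ha h; elim: m => [|m IH].
 rewrite big_ord0 add0r expr0 mul1r; apply: J_ext => j t _; by rewrite expr0 mul1r.
rewrite IH big_ord_recr /= -addrA; congr (_ + _).
have -> : J (fun z => F z / (z ^+ m * (z - a))) =
  J (fun z => F z / z ^+ m.+1 + a * (F z / (z ^+ m.+1 * (z - a)))).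
 apply: J_ext => j t ht; case/andP: (sid_bd j ht) => h1 h2.
 have h3 := nm_rev (sid j t%:C) a; set z := sid j _ in h1 h2 h3 *.
 have z0 : z != 0 by apply: nm_neq0; lra.
 have za : z - a != 0 by apply: nm_neq0; lra.
 by rewrite exprS; field; rewrite za z0 expf_neq0.
rewrite J_comb; [rewrite exprS; ring|exact: onb_pow|exact: onb_pow_res].
Qed.

Lemma J_res_le (F : C^o -> C^o) (a : C^o) m (M : R) : nm a <= r / 2 -> (forall z, nm z <= 2 * r -> dif F z) ->
 (forall z, nm z <= 2 * r -> nm (F z) <= M) ->
 nmc (a ^+ m * J (fun z => F z / (z ^+ m * (z - a)))) <= 16 * M * (nm a / r) ^+ m.
have rp := r0.
move=> ha h hM.
have M0 : 0 <= M by apply: le_trans (nm_ge0 _) (hM 0 _); rewrite (nm0 C^o) mulr_ge0 // ltW.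
rewrite nmM nmX; have := J_le (onb_pow_res m ha h) (M := M / (r ^+ m * (r / 2))) _.
have rm : 0 < r ^+ m by side.
move=> hJ; apply: le_trans (ler_wpM2l _ (hJ _)) _; first by side.
 move=> j t ht; case/andP: (sid_bd j ht) => h1 h2.
 have h3 := nm_rev (sid j t%:C) a; set z := sid j _ in h1 h2 h3 *.
 rewrite nmM nmV nmM nmX; apply: ler_pM; rewrite ?nm_ge0 ?invr_ge0 ?mulr_ge0 ?exprn_ge0 ?nm_ge0 ?hM //.
 rewrite lef_pV2 ?posrE; [|apply: mulr_gt0; [apply: exprn_gt0; lra|lra]|apply: mulr_gt0 => //; lra].
 apply: ler_pM; [exact: ltW| lra | | lra].
 by apply: lerXn2r; rewrite ?nnegrE ?nm_ge0 ?(ltW r0).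
rewrite expr_div_n; apply: le_of_eq; field.
by rewrite gt_eqF //= gt_eqF.
Qed.

Lemma hd_powV (z : C^o) k : z != 0 ->
 hd (fun z : C^o => - (k.+1%:R)^-1 * (z^-1) ^+ k.+1 : C^o) z (fun h => 1 / z ^+ k.+2 * h : C^o).
move=> z0.
have X m : hd (fun z : C^o => (z^-1) ^+ m : C^o) z (fun h => - m%:R * z^-1 ^+ m.+1 * h : C^o).
 elim: m => [|m IH].
  have := hd_cst (1 : C^o) z; congr hd; apply/funext => h; rewrite oppr0 !mul0r //.
 have := hdM (hd_inv z0) IH; congr hd; apply/funext => h; first by rewrite exprS.
 by rewrite !exprS -natr1; field.
have := hdZ (- (k.+1%:R)^-1) (X k.+1); congr hd; apply/funext => h.
rewrite /GRing.scale /=; have : (k.+1%:R : C) != 0 by rewrite pnatr_eq0.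
rewrite -exprVn; move: (k.+1%:R : C) (z^-1 ^+ k.+2 : C) => N y n0.
have -> : - N^-1 * (- N * y * h) = N^-1 * N * y * h by ring.
by rewrite mulVf.
Qed.

Lemma J_pow k : J (fun z => 1 / z ^+ k.+2) = 0.
have rp := r0.
apply: (@J_prim _ (fun z : C^o => - (k.+1%:R)^-1 * (z^-1) ^+ k.+1 : C^o)).
 by apply: onb_pow => z _; exact: dif_cst.
move=> j t ht; case/andP: (sid_bd j ht) => h1 h2; apply: hd_powV.
by apply: nm_neq0; lra.
Qed.

Definition J0 : C^o := J (fun z => 1 / z).

(** In the geometric expansion of [1 / (z - a)] every power [z^-(k + 2)] has a primitive and
    integrates to zero, which leaves the term [1 / z]. *)
Lemma J_const (a : C^o) : nm a <= r / 2 -> J (fun z => 1 / (z - a)) = J0.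
have rp := r0.
move=> ha; apply: subr0_eq; apply: nm_le0.
apply/ler_addgt0Pl => e e0; rewrite addr0.
have e16 : 0 < e / 16 by lra.
have [N hN] := pow2_small e16.
have d1 (z : C^o) : nm z <= 2 * r -> dif (fun=> 1 : C^o) z by move=> _; exact: dif_cst.
rewrite (J_geom N.+1 ha d1) big_ord_recl big1 => [|k _]; last by rewrite J_pow mulr0.
rewrite addr0 expr0 mul1r /J0 [X in _ - X](_ : _ = J (fun z => 1 / z ^+ 1)); last first.
 by side.
rewrite addrAC subrr add0r.
apply: le_trans (J_res_le N.+1 (M := 1) ha d1 _) _; first by move=> z _; rewrite nm1.
rewrite mulr1; apply: le_trans (_ : 16 * 2^-1 ^+ N <= _); last by lra.
rewrite ler_pM2l //; apply: le_trans (_ : 2^-1 ^+ N.+1 <= _).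
 apply: lerXn2r; rewrite ?nnegrE ?invr_ge0 ?divr_ge0 ?nm_ge0 ?(ltW r0) //.
 by rewrite ler_pdivrMr // mulrC.
by rewrite pow2_half; have := @pow2_gt0 R N; lra.
Qed.

(** The value [2 pi i] is never computed; a positive lower bound is enough. On each side the
    integral of [1 / z] is within [5 / 2] of [3 i], so the total is within 10 of [12 i]. *)
Lemma J0_ge : 2 <= nm J0.
have rp := r0.
have d1 (z : C^o) : nm z <= 2 * r -> dif (fun=> 1 : C^o) z by move=> _; exact: dif_cst.
have o1 : onb (fun z => 1 / z).
 move=> j t ht; case/andP: (sid_bd j ht) => h1 h2; apply: difM; first dfs.
 by apply: difV; [apply: nm_neq0; lra|dfs].
pose c := 3 * I.
have K (j : 'I_4) : nmc (int (Jf (fun z => 1 / z) j) - c) <= 5 / 2.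
 have cc : rcont (fun=> 1 : C^o) by move=> t e e0; exists 1 => // y _; rewrite subrr nm0 ltW.
 rewrite [X in nm X](_ : _ = int (fun t => Jf (fun z => 1 / z) j t + (- c) * 1)); last first.
  rewrite (int_comb _ (rcont_Jf j o1) cc); congr (_ + _).
  rewrite (@int_prim _ _ (fun t : R => t%:C * 1 + 0)) //; last by move=> x _; exact: rder_lin.
  by rewrite rmorph1 rmorph0; ring.
 apply: int_le => [|u _]; [by apply: rcont_comb => //; exact: rcont_Jf|have /andP [] := clP u]; rewrite /Jf; move: (cl u) => t t0 t1.
 rewrite sidE crn_diff.
 have Ij : I ^+ j != 0 by rewrite expf_neq0 // -(nm_gt0 (I : C^o)) nmI.
 have rr : r%:C != 0 :> C by rewrite fmorph_eq0 gt_eqF.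
 set w := (1 +i* (2 * t - 1))%C.
 have w2 : nmc w ^+ 2 = 1 + (2 * t - 1) ^+ 2 by rewrite nm_sq expr1n.
 have w0 : w != 0.
  rewrite -(nm_gt0 (w : C^o)) lt0r nm_ge0 andbT; apply/eqP => h.
  by move: w2; rewrite h expr0n /=; nra.
 have -> : 1 / (r%:C * (I ^+ j * w)) * (r%:C * (I ^+ j * (2 * I))) + - c * 1 = I * (2 - 3 * w) / w by rewrite /c; field; rewrite w0 Ij rr.
 rewrite !nmM nmI mul1r nmV ler_pdivrMr ?nm_gt0 //.
 have -> : 2 - 3 * w = (- 1 +i* (- (3 * (2 * t - 1))))%C by apply/eqP; rewrite eq_complex /w /=; apply/andP; split; apply/eqP; ring.
 set X := nm _; suff : X ^+ 2 <= (5 / 2 * nmc w) ^+ 2.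
  by apply: le_of_sqr; rewrite mulr_ge0 ?divr_ge0 ?nm_ge0.
 by rewrite exprMn w2 /X nm_sq; nra.
have h : nmc (J0 - 4 * c) <= 10.
 have -> : J0 - 4 * c = \sum_(j < 4) (int (Jf (fun z => 1 / z) j) - c) by rewrite /J0 /J !big_ord_recl !big_ord0; ring.
 apply: le_trans (nm_sum _ _ _) _.
 apply: le_trans (ler_sum _ (fun j _ => K j)) _.
 by rewrite sumr_const card_ord -mulr_natr; lra.
have n4 : nmc (4 * c) = 12 by rewrite /c !nmM nmI !nm_nat; ring.
by have := nm_rev (4 * c : C^o) J0; rewrite nmC n4; lra.
Qed.

Lemma taylor_disc (f : C^o -> C^o) (M : R) :
 (forall z, nm z <= 2 * r -> dif f z) -> (forall z, nm z <= 2 * r -> nm (f z) <= M) ->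
 exists t : nat -> C^o, (forall k, nm (t k) <= 4 * M / r ^+ k) /\
  forall m (z : C^o), nm z <= r / 2 -> nm (f z - \sum_(k < m) t k * z ^+ k) <= 8 * M * (nm z / r) ^+ m.
have rp := r0.
move=> df fM; have J2 := J0_ge.
have M0 : 0 <= M by apply: le_trans (nm_ge0 _) (fM 0 _); rewrite (nm0 C^o) mulr_ge0 // ltW.
have J00 : J0 != 0 by apply: nm_neq0; lra.
have iJ : nmc (J0^-1) <= 2^-1 by rewrite nmV lef_pV2 ?posrE //; lra.
exists (fun k => J (fun z => f z / z ^+ k.+1) / J0); split.
 move=> k; have rk : 0 < r ^+ k by side.
 have := J_le (onb_pow k.+1 df) (M := M / r ^+ k.+1).
 move=> hJ; rewrite nmM; apply: le_trans (ler_pM (nm_ge0 _) (nm_ge0 _) (hJ _) iJ) _.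
  move=> j t ht; case/andP: (sid_bd j ht) => h1 h2.
  rewrite nmM nmV nmX; apply: ler_pM; rewrite ?nm_ge0 ?invr_ge0 ?exprn_ge0 ?nm_ge0 ?fM //.
  rewrite lef_pV2 ?posrE ?exprn_gt0 //; last by lra.
  by apply: lerXn2r; rewrite ?nnegrE ?nm_ge0 ?(ltW r0).
 rewrite exprS; apply: le_of_eq; field.
 by rewrite !gt_eqF.
move=> m z hz.
have -> : f z - \sum_(k < m) J (fun z => f z / z ^+ k.+1) / J0 * z ^+ k =
  (z ^+ m * J (fun w => f w / (w ^+ m * (w - z)))) / J0.
 have := J_cauchy hz df; rewrite (J_const hz) (J_geom m hz df) => E.
 have -> : f z = f z * J0 / J0 by rewrite mulfK.
 rewrite -E mulrDl mulr_suml addrAC -sumrB big1 ?add0r // => k _; ring.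
rewrite nmM; apply: le_trans (ler_pM (nm_ge0 _) (nm_ge0 _) (J_res_le m hz df fM) iJ) _.
set q := (_ ^+ m); lra.
Qed.

End Contour.

(** * Taylor coefficients as asymptotic expansions; Cauchy estimates and uniform limits *)

Section Taylor.
Variable R : realType.
Local Notation C := R[i].
Implicit Types V : normedModType C.
Local Open Scope classical_set_scope.

Lemma pow2_le m n : (m <= n)%N -> (2^-1 : R) ^+ n <= 2^-1 ^+ m.
by move=> h; apply: ler_wiXn2l => //; lra. Qed.

Definition bigO (m : nat) (F : C^o -> C^o) := exists K d : R, [/\ 0 <= K, 0 < d &
 forall z, nm z < d -> nm (F z) <= K * nm z ^+ m].

Lemma bigO_le m n F : (m <= n)%N -> bigO n F -> bigO m F.
move=> mn [K [d [K0 d0 h]]]; exists K, (minr d 1); split=> //; first by side.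
move=> z /lt_minP [zd z1]; apply: le_trans (h _ zd) _.
by rewrite ler_wpM2l // ler_wiXn2l ?nm_ge0 // ltW.
Qed.

Lemma bigO_D m F G : bigO m F -> bigO m G -> bigO m (fun z => F z + G z).
move=> [K [d [K0 d0 h]]] [K' [d' [K0' d0' h']]].
exists (K + K'), (minr d d'); split; [exact: addr_ge0|by side|].
move=> z /lt_minP [zd zd']; apply: le_trans (nmD _ _) _.
by rewrite mulrDl lerD ?h ?h'.
Qed.

Lemma bigO_M m n F G : bigO m F -> bigO n G -> bigO (m + n) (fun z => F z * G z).
move=> [K [d [K0 d0 h]]] [K' [d' [K0' d0' h']]].
exists (K * K'), (minr d d'); split; [exact: mulr_ge0|by side|].
move=> z /lt_minP [zd zd']; rewrite nmM exprD mulrACA.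
by apply: ler_pM; rewrite ?nm_ge0 ?h ?h'.
Qed.

Lemma bigO_cst c : bigO 0 (fun=> c).
by exists (nm c), 1; split; rewrite ?nm_ge0 // => z _; rewrite expr0 mulr1. Qed.

Lemma bigO_X m : bigO m (fun z => z ^+ m).
by exists 1, 1; split=> // z _; rewrite nmX mul1r. Qed.

Lemma bigO_ext m F G : (forall z, F z = G z) -> bigO m F -> bigO m G.
by move=> /funext ->. Qed.

Lemma bigO_Z m c F : bigO m F -> bigO m (fun z => c * F z).
by move=> h; exact: (bigO_M (bigO_cst c) h). Qed.

Lemma bigO_sum m I (s : seq I) (P : pred I) (F : I -> C^o -> C^o) :
 (forall i, P i -> bigO m (F i)) -> bigO m (fun z => \sum_(i <- s | P i) F i z).
move=> h; elim: s => [|i s IH].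
 apply: (@bigO_ext _ (fun=> 0)) => [z|]; first by rewrite big_nil.
 by exists 0, 1; split=> // z _; rewrite nm0 mul0r.
case Pi: (P i); last by apply: bigO_ext IH => z; rewrite big_cons Pi.
by apply: bigO_ext (bigO_D (h _ Pi) IH) => z; rewrite big_cons Pi.
Qed.

(** No convergence is asked for. The coefficients are still unique, so identities between Taylor
    coefficients follow from identities between functions near 0. *)
Definition asy (g : C^o -> C^o) (a : nat -> C^o) := forall m, bigO m (fun z => g z - \sum_(k < m) a k * z ^+ k).

Lemma asy_small (c : C^o) m : bigO m.+1 (fun z => c * z ^+ m) -> c = 0.
move=> [K [d [K0 d0 h]]]; apply: nm_le0; apply/ler_addgt0Pl => e e0; rewrite addr0.
have [s s0 sK] := ex_small e0 K0.
pose t := minr s (d / 2).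
have t0 : 0 < t by rewrite lt_min s0 divr_gt0.
have td : t < d by rewrite /t gt_min; apply/orP; right; lra.
have := h t%:C; rewrite nm_real gtr0_norm // => /(_ td).
rewrite nmM nmX nm_real gtr0_norm // exprS mulrA ler_pM2r ?exprn_gt0 // => /le_trans; apply.
by apply: le_trans (ltW sK); rewrite mulrC ler_wpM2r // /t ge_min lexx.
Qed.

Lemma asy_uniq g a b : asy g a -> asy g b -> a = b.
move=> ha hb; apply/funext => m; elim/ltn_ind: m => m IH.
apply: subr0_eq; apply: (@asy_small _ m).
apply: bigO_ext (bigO_D (hb m.+1) (bigO_Z (-1) (ha m.+1))) => z.
rewrite !big_ord_recr /= [X in _ - (X + _) + _](_ : _ = \sum_(k < m) a k * z ^+ k); first ring.
by apply: eq_bigr => k _; rewrite IH.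
Qed.

Definition tc (g : C^o -> C^o) : nat -> C^o := xget (fun=> 0) [set a | asy g a].

Lemma asy_tc g a : asy g a -> tc g = a.
by move=> h; rewrite /tc; case: xgetP => [b -> /asy_uniq /(_ h)|/(_ a)]. Qed.

Lemma tcP g a : asy g a -> asy g (tc g).
by move=> h; rewrite (asy_tc h). Qed.

Lemma asy_ext (g h : C^o -> C^o) a (d : R) : 0 < d -> (forall z, nm z < d -> g z = h z) -> asy g a -> asy h a.
move=> d0 e H m; have [K [d' [K0 d0' k]]] := H m.
exists K, (minr d' d); split=> //; first by side.
by move=> z /lt_minP [z1 z2]; rewrite -e ?k.
Qed.

Lemma asyD g h a b : asy g a -> asy h b -> asy (fun z => g z + h z) (fun k => a k + b k).
move=> ha hb m; apply: bigO_ext (bigO_D (ha m) (hb m)) => z.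
rewrite addrACA -opprD -big_split /=; congr (_ - _); apply: eq_bigr => k _; by rewrite mulrDl.
Qed.

Lemma asyZ c g a : asy g a -> asy (fun z => c * g z) (fun k => c * a k).
move=> ha m; apply: bigO_ext (bigO_Z c (ha m)) => z.
rewrite mulrBr mulr_sumr; congr (_ - _); apply: eq_bigr => k _; by rewrite mulrA.
Qed.

Lemma asy_cst (c : C^o) : asy (fun=> c) (fun k => if k == 0%N then c else 0).
case=> [|m]; first by apply: bigO_ext (bigO_cst c) => z; rewrite big_ord0 subr0.
apply: (@bigO_ext _ (fun z => 0 * z ^+ m.+1)) => [z|]; last exact: bigO_Z (bigO_X _).
by rewrite big_ord_recl big1 ?expr0 ?mulr1 ?addr0 ?subrr ?mul0r // => i _; rewrite mul0r.
Qed.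

Lemma asy_poly (q : {poly C}) : asy (fun z => q.[z]) (fun k => q`_k).
move=> m; apply: (@bigO_ext _ (fun z => \sum_(k < size q | (m <= k)%N) q`_k * z ^+ k)) => [z|].
 rewrite (horner_coef_wide z (leq_maxr m (size q))).
 have -> : \sum_(k < m) q`_k * z ^+ k = \sum_(i < maxn m (size q) | (i < m)%N) q`_i * z ^+ i by rewrite (big_ord_widen _ (fun i => q`_i * z ^+ i) (leq_maxl m (size q))).
 rewrite [X in _ = X - _](bigID (fun i : 'I__ => (i < m)%N)) /= addrAC subrr add0r.
 under [in RHS]eq_bigl do rewrite -leqNgt.
 rewrite (big_ord_widen_cond _ (fun i => (m <= i)%N) (fun i => q`_i * z ^+ i) (leq_maxr m (size q))).
 rewrite [RHS](bigID (fun i : 'I__ => (i < size q)%N)) /= [X in _ = _ + X]big1 ?addr0 // => i /andP [_].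
 by rewrite -leqNgt => h; rewrite nth_default ?mul0r.
apply: bigO_sum => k mk; apply: bigO_Z; exact: bigO_le mk (bigO_X _).
Qed.

Lemma asyM g h a b : asy g a -> asy h b ->
 asy (fun z => g z * h z) (fun k => \sum_(i < k.+1) a i * b (k - i)%N).
move=> ha hb m; pose p : {poly C} := \poly_(i < m) a i; pose q : {poly C} := \poly_(i < m) b i.
have hp z : p.[z] = \sum_(k < m) a k * z ^+ k by rewrite horner_poly.
have hq z : q.[z] = \sum_(k < m) b k * z ^+ k by rewrite horner_poly.
have bp : bigO 0 (fun z => p.[z]) by have := asy_poly p 0; apply: bigO_ext => z; rewrite big_ord0 subr0.
have bh : bigO 0 h by have := hb 0%N; apply: bigO_ext => z; rewrite big_ord0 subr0.
have A1 := bigO_M (ha m) bh; have A2 := bigO_M bp (hb m); rewrite addn0 in A1; rewrite add0n in A2.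
apply: bigO_ext (bigO_D (bigO_D A1 A2) (asy_poly (p * q) m)) => z.
rewrite hornerM -!hp -!hq.
have -> : \sum_(k < m) (p * q)`_k * z ^+ k = \sum_(k < m) (\sum_(i < k.+1) a i * b (k - i)%N) * z ^+ k.
 apply: eq_bigr => k _; rewrite coefM; congr (_ * _); apply: eq_bigr => i _.
 have im : (i < m)%N by apply: leq_ltn_trans (ltn_ord k); rewrite -ltnS.
 have km : (k - i < m)%N by apply: leq_ltn_trans (leq_subr _ _) (ltn_ord k).
 by rewrite !coef_poly im km.
ring.
Qed.

(** The square of half side [r / 3] lies in the disc of radius [2 * (r / 3)], inside the given one;
    this is the origin of the radii [r / 3] and [r / 6] met everywhere below. *)
Lemma disc_tc (f : C^o -> C^o) (r M : R) : 0 < r ->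
 (forall z, nm z < r -> dif f z) -> (forall z, nm z < r -> nm (f z) <= M) ->
 [/\ asy f (tc f), (forall k, nm (tc f k) <= 4 * M / (r / 3) ^+ k) &
  forall m (z : C^o), nm z <= r / 6 -> nm (f z - \sum_(k < m) tc f k * z ^+ k) <= 8 * M * (nm z / (r / 3)) ^+ m].
move=> r0 df fM.
have r3 : 0 < r / 3 by lra.
have lt (z : C^o) : nm z <= 2 * (r / 3) -> nm z < r by move=> h; apply: le_lt_trans h _; lra.
have M0 : 0 <= M by apply: le_trans (nm_ge0 _) (fM 0 _); rewrite (nm0 C^o).
have [t [ht hz]] := taylor_disc r3 (fun z h => df z (lt z h)) (fun z h => fM z (lt z h)).
have at_ : asy f t.
 move=> m; exists (8 * M / (r / 3) ^+ m), (r / 6); split.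
 - by side.
 - by side.
 - move=> z hz6; have hz6' : nm z <= r / 3 / 2 by apply: ltW; apply: lt_le_trans hz6 _; lra.
  by apply: le_trans (hz m z hz6') _; rewrite expr_div_n mulrA mulrAC.
rewrite (asy_tc at_); split=> // m z hz6; apply: hz; apply: le_trans hz6 _; lra.
Qed.

Lemma tc0 (f : C^o -> C^o) a : asy f a -> tc f 0%N = f 0.
move=> h; have [K [d [K0 d0 k]]] := tcP h 1%N.
have := k 0; rewrite (nm0 C^o) => /(_ d0); rewrite expr1 mulr0 big_ord1 expr0 mulr1.
by move=> /nm_le0 /eqP; rewrite subr_eq0 => /eqP.
Qed.

Lemma tc1 (f : C^o -> C^o) a L : asy f a -> hd f 0 L -> tc f 1%N = L 1.
move=> h hf; have f0 := tc0 h; have [K [d [K0 d0 k]]] := tcP h 2%N.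
suff hf' : hd f 0 (fun z => tc f 1%N * z : C^o) by have := hd_unique hf' hf 1; rewrite mulr1.
split.
- by move=> b x y; rewrite /GRing.scale /=; ring.
- by exists (nm (tc f 1%N)); [exact: nm_ge0|move=> z; rewrite nmM].
- move=> e e0; have [s s0 sK] := ex_small e0 K0.
 exists (minr d s); first by side.
 move=> z /lt_minP [zd zs]; have := k _ zd.
 rewrite !big_ord_recl big_ord0 /= expr0 mulr1 expr1 addr0 f0 add0r opprD addrA => /le_trans; apply.
 rewrite expr2 mulrA ler_wpM2r ?nm_ge0 //; apply: le_trans (ltW sK).
 by rewrite mulrC ler_wpM2r // ltW.
Qed.

Lemma dif_on_line V (f : V -> C^o) (p h : V) (z : C^o) : dif f (p + z *' h) ->
 dif (fun z : C^o => f (p + z *' h)) z.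
by move=> d; apply: (dif_comp (g := f)) => //; exact: dif_line. Qed.

Lemma hd_on_line V (f : V -> C^o) (p h : V) L : hd f p L ->
 hd (fun z : C^o => f (p + z *' h)) 0 (fun z => (z : C) * L h : C^o).
move=> hf.
have h1 : hd (fun z : C^o => p + z *' h) 0 (fun z : C^o => 0 + z *' h).
 apply: hdD; first exact: hd_cst.
 apply: hd_lin; first by move=> a x y; rewrite scalerDl scalerA.
 by exists (nm h); [exact: nm_ge0|move=> z; rewrite nmZ mulrC].
have := @hd_comp R C^o V C^o (fun z : C^o => p + z *' h) f 0 (fun z : C^o => 0 + z *' h) L h1.
rewrite scale0r addr0 => /(_ hf); congr hd; apply/funext => z.
by have [l _ _] := hf; rewrite add0r (linZ _ _ l).
Qed.

(** On the complex line through [p] in the direction [h], where a disc of radius [r / nm h] is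
    available, [f p] and [L h] are the first two Taylor coefficients. *)
Lemma cauchy_est V (f : V -> C^o) p (r M : R) L : 0 < r ->
 (forall x, nm (x - p) < r -> dif f x) -> (forall x, nm (x - p) < r -> nm (f x) <= M) -> hd f p L ->
 (forall h, nm (L h) <= 12 * M / r * nm h) /\
 (forall h, nm h <= r / 6 -> nm (f (p + h) - f p - L h) <= 72 * M / r ^+ 2 * nm h ^+ 2).
move=> r0 df fM hf.
have M0 : 0 <= M by apply: le_trans (nm_ge0 _) (fM p _); rewrite subrr nm0.
have key h : h != 0 -> nm (L h) <= 12 * M / r * nm h /\
  (nm h <= r / 6 -> nm (f (p + h) - f p - L h) <= 72 * M / r ^+ 2 * nm h ^+ 2).
 move=> hn0; have h0 : 0 < nm h by side.
 pose g (z : C^o) := f (p + z *' h).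
 have lt (z : C^o) : nm z < r / nm h -> nm (p + z *' h - p) < r by rewrite addrC addKr nmZ ltr_pdivlMr.
 have rh : 0 < r / nm h by side.
 have [A B D] := disc_tc rh (fun z hz => dif_on_line (df _ (lt z hz))) (fun z hz => fM _ (lt z hz)).
 have t1 : tc g 1%N = L h by rewrite (tc1 A (hd_on_line h hf)) mul1r.
 have t0 : tc g 0%N = f p by rewrite (tc0 A) scale0r addr0.
 split.
  have := B 1%N; rewrite -/g t1 expr1 => /le_trans; apply.
  by apply: le_of_eq; field; rewrite !gt_eqF.
 move=> h6; have := D 2%N 1; rewrite nm1 -/g !big_ord_recl big_ord0 /= t0 t1 expr0 expr1 !mulr1 addr0.
 rewrite scale1r opprD addrA => hh; apply: le_trans (hh _) _.
  by rewrite mulrAC ler_pdivlMr // mul1r.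
 by apply: le_of_eq; field; rewrite !gt_eqF.
have [l _ _] := hf.
split=> h; have [->|/key [h1 h2]] := eqVneq h 0.
- by rewrite (lin0 l) !nm0 mulr0.
- exact: h1.
- by rewrite addr0 subrr (lin0 l) subrr !nm0 expr0n mulr0.
- exact: h2.
Qed.

Lemma dif_bounded V (f : V -> C^o) p (r : R) : 0 < r -> (forall x, nm (x - p) < r -> dif f x) ->
 exists r' M : R, [/\ 0 < r', r' <= r, 0 <= M & forall x, nm (x - p) < r' -> nm (f x) <= M].
move=> r0 df; have dp : dif f p by apply: df; rewrite subrr nm0.
have [d d0 h] := dif_cont dp ltr01.
exists (minr r d), (nm (f p) + 1); split.
- by side.
- by rewrite ge_min lexx.
- by side.
- move=> x /lt_minP [_ /h hx]; have := nm_rev (f x) (f p); lra.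
Qed.

Lemma pow2_lim0 (c D : R) (N : nat) : (forall n, (N <= n)%N -> c <= D * 2^-1 ^+ n) -> c <= 0.
move=> h; apply/ler_addgt0Pl => e e0; rewrite addr0.
have [s s0 sD] := ex_small e0 (normr_ge0 D); have [m hm] := pow2_small s0.
apply: le_trans (h (maxn N m) (leq_maxl _ _)) _; apply: le_trans (_ : `|D| * s <= _); last by rewrite mulrC ltW.
apply: le_trans (ler_norm _) _; rewrite normrM ler_wpM2l // ger0_norm; last exact/ltW/pow2_gt0.
by apply: le_trans (ltW hm); apply: pow2_le; exact: leq_maxr.
Qed.

(** Weierstrass's theorem. Cauchy estimates for [u n - u m] make the differentials converge
    geometrically, and the quadratic remainder is bounded uniformly in [n], so it passes to the
    limit. *)
Lemma unif_lim V (u : nat -> V -> C^o) (g : V -> C^o) p (r K : R) : 0 < r -> 0 <= K ->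
 (forall n x, nm (x - p) < r -> dif (u n) x) ->
 (forall n x, nm (x - p) < r -> nm (u n x - g x) <= K * 2^-1 ^+ n) -> dif g p.
move=> r0 K0 du ug.
have [r' [B [r'0 r'r B0 hB]]] := dif_bounded r0 (du 0%N).
have lt x : nm (x - p) < r' -> nm (x - p) < r by move=> h; apply: lt_le_trans h r'r.
have p2 n : K * 2^-1 ^+ n <= K by rewrite ler_piMr // -[leRHS](expr0 2^-1) pow2_le.
pose M := B + 2 * K.
have M0 : 0 <= M by rewrite /M; lra.
have uM n x : nm (x - p) < r' -> nm (u n x) <= M.
 move=> hx; have := ug n x (lt _ hx); have := ug 0%N x (lt _ hx); have := hB x hx; have := p2 n.
 have := nm_dist (g x) (u n x) (u 0%N x); rewrite [nm (g x - _)]nmC; have := nm_rev (u n x) (u 0%N x).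
 rewrite expr0 mulr1 /M; lra.
have hp := nm_self p r0.
have/choice [L hL] n : exists L, hd (u n) p L := du n p hp.
have E1 n := (cauchy_est r'0 (fun x hx => du n x (lt x hx)) (uM n) (hL n)).1.
have E2 n := (cauchy_est r'0 (fun x hx => du n x (lt x hx)) (uM n) (hL n)).2.
pose A := 24 * K / r'.
have A0 : 0 <= A by rewrite /A divr_ge0 ?mulr_ge0 // ltW.
have E3 n m h : (n <= m)%N -> nm (L n h - L m h) <= A * nm h * 2^-1 ^+ n.
 move=> nm_; have hLL := hdD (hL n) (hdZ (-1) (hL m)).
 have := (cauchy_est r'0 (M := 2 * K * 2^-1 ^+ n) _ _ hLL).1 => hh.
 have := hh _ _ h; rewrite scaleN1r => hhh; apply: le_trans (hhh _ _) _.
 - by move=> x hx; apply: difD; [|apply: difZ]; apply: du; exact: lt.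
 - move=> x hx; rewrite scaleN1r; apply: le_trans (nm_dist (g x) _ _) _.
  have h1 := ug n x (lt _ hx); have h2 := ug m x (lt _ hx); rewrite [nm (g x - _)]nmC.
  have h3 : K * 2^-1 ^+ m <= K * 2^-1 ^+ n by rewrite ler_wpM2l // pow2_le.
  lra.
 - by rewrite /A; apply: le_of_eq; field; rewrite gt_eqF.
have/choice [Li hLi] h : exists l : C^o, forall n, nm (L n h - l) <= 2 * (A * nm h * 2^-1 ^+ n).
 by apply: complex_complete => n m; exact: E3.
exists Li; split.
- move=> a x y; apply: subr0_eq; apply: nm_le0.
 apply: (@pow2_lim0 _ (2 * (A * nm (a *: x + y)) + nmc a * (2 * (A * nm x)) + 2 * (A * nm y)) 0) => n _.
 have [l _ _] := hL n.
 have -> : Li (a *: x + y) - (a *: Li x + Li y) =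
   - (L n (a *: x + y) - Li (a *: x + y)) + a * (L n x - Li x) + (L n y - Li y).
  by rewrite l /GRing.scale /=; ring.
 apply: le_trans (nmD _ _) _; apply: le_trans (lerD (nmD _ _) (lexx _)) _.
 rewrite nmN nmM; have := hLi (a *: x + y) n; have := hLi x n; have := hLi y n.
 have := nm_ge0 (a : C^o); set a1 := nmc a; set b1 := nm (L n x - _).
 set b2 := nm (L n (a *: x + y) - _); set b3 := nm (L n y - _); set q := 2^-1 ^+ n.
 move=> a10 h1 h2 h3; have : a1 * b1 <= a1 * (2 * (A * nm x * q)) by rewrite ler_wpM2l.
 lra.
- have N0 : 0 <= 12 * M / r' by side.
 exists (12 * M / r' + 2 * A); first by side.
 move=> h; have := hLi h 0%N; have := E1 0%N h; rewrite expr0 mulr1 => h1 h2.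
 rewrite mulrDl -[Li h](subrK (L 0%N h)); apply: le_trans (nmD _ _) _.
 rewrite nmC addrC lerD // -mulrA //.
- move=> e e0; pose D := 72 * M / r' ^+ 2.
 have D0 : 0 <= D by rewrite /D divr_ge0 ?mulr_ge0 ?(ltW r'0).
 have [s s0 sD] := ex_small e0 D0.
 exists (minr s (r' / 6)); first by side.
 move=> h /lt_minP [hs h6].
 have hr : nm h < r' by apply: lt_trans h6 _; lra.
 have h1 : nm (g (p + h) - g p - Li h) <= D * nm h ^+ 2.
  rewrite -subr_le0; apply: (@pow2_lim0 _ (2 * K + 2 * (A * nm h)) 0) => n _.
  have e1 := E2 n h (ltW h6); have e2 := hLi h n; have e3 := ug n p hp.
  have e4 : nm (u n (p + h) - g (p + h)) <= K * 2^-1 ^+ n by apply: ug; rewrite addrC addKr; apply: lt_le_trans hr r'r.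
  have -> : g (p + h) - g p - Li h = (u n (p + h) - u n p - L n h) - (u n (p + h) - g (p + h))
    + (u n p - g p) + (L n h - Li h) by ring.
  rewrite -/D in e1; have := nmD (u n (p + h) - u n p - L n h - (u n (p + h) - g (p + h)) + (u n p - g p)) (L n h - Li h).
  have := nmD (u n (p + h) - u n p - L n h - (u n (p + h) - g (p + h))) (u n p - g p).
  have := nmB (u n (p + h) - u n p - L n h) (u n (p + h) - g (p + h)).
  lra.
 apply: le_trans h1 _; rewrite expr2 mulrA ler_wpM2r ?nm_ge0 //.
 by apply: le_trans (ltW sD); rewrite mulrC ler_wpM2r // ltW.
Qed.

End Taylor.

(** * Holomorphic functions: coefficients with parameters, second derivatives, identity principle *)

Section Hol.
Variable R : realType.
Local Notation C := R[i].
Implicit Types V W : normedModType C.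

(* Along [s n = (r / 6) 2^-n] the [k]-th coefficient is a uniform limit of difference quotients. *)
Lemma tc_approx (r M : R) k : 0 < r -> 0 <= M -> exists (s : nat -> C) (K : R), [/\ 0 <= K,
 forall n, nmc (s n) = r / 6 * 2^-1 ^+ n, forall n, s n != 0, forall n, nmc (s n) < r &
 forall psi : C^o -> C^o, (forall t, nm t < r -> dif psi t) -> (forall t, nm t < r -> nm (psi t) <= M) -> forall n,
  nmc (s n ^- k * (psi (s n) - \sum_(j < k) tc psi j * s n ^+ j) - tc psi k) <= K * 2^-1 ^+ n].
move=> r0 M0; pose s n : C := (r / 6)%:C * (2^-1 ^+ n)%:C.
have ns n : nmc (s n) = r / 6 * 2^-1 ^+ n by rewrite nmM !nm_real !ger0_norm //; pos.
have np n : 0 < nmc (s n) by rewrite ns mulr_gt0 ?pow2_gt0 // divr_gt0.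
have s0 n : s n != 0 by apply: (@nm_neq0 R).
have s6 n : nmc (s n) <= r / 6 by rewrite ns ler_piMr // -?[leRHS](expr0 2^-1) ?pow2_le; pos.
exists s, (8 * M / (r / 3) ^+ k.+1 * (r / 6)); split=> //; first by pos.
 by move=> n; apply: le_lt_trans (s6 n) _; lra.
move=> psi dp bp n; have [_ _ D] := disc_tc r0 dp bp.
have := D k.+1 (s n) (s6 n); rewrite big_ord_recr /= => h.
rewrite [X in nm X](_ : _ = (psi (s n) - (\sum_(j < k) tc psi j * s n ^+ j + tc psi k * s n ^+ k)) / s n ^+ k); last first.
 by field; rewrite expf_neq0.
rewrite nmM nmV nmX ler_pdivrMr ?exprn_gt0 //.
apply: le_trans h _; rewrite expr_div_n [nmc (s n) ^+ k.+1]exprS [X in X * _ ^+ k]ns.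
by apply: le_of_eq; ring.
Qed.

(** Induction on [k]: the difference quotients of [tc_approx] involve only coefficients of lower
    order, and they converge uniformly in the parameter. *)
Lemma tc_holo V (Phi : V -> C^o -> C^o) p (r1 r2 M : R) : 0 < r1 -> 0 < r2 ->
 (forall x t, nm (x - p) < r1 -> nm t < r2 -> dif (fun y => Phi y t) x) ->
 (forall x t, nm (x - p) < r1 -> nm t < r2 -> dif (Phi x) t) ->
 (forall x t, nm (x - p) < r1 -> nm t < r2 -> nm (Phi x t) <= M) ->
 forall k x, nm (x - p) < r1 -> dif (fun y => tc (Phi y) k) x.
move=> r10 r20 dx dt bM; elim/ltn_ind => k IH x hx.
have M0 : 0 <= M by apply: le_trans (nm_ge0 _) (bM x 0 hx _); rewrite (nm0 C^o).
have [s [K [K0 ns s0 sr ap]]] := tc_approx k r20 M0.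
have r10' : 0 < r1 - nm (x - p) by lra.
have lt y : nm (y - x) < r1 - nm (x - p) -> nm (y - p) < r1 by move=> h; have := nm_dist x y p; lra.
apply: (unif_lim r10' K0 (u := fun n y => s n ^- k * (Phi y (s n) - \sum_(j < k) tc (Phi y) j * s n ^+ j))) => n y /lt hy.
 apply: difM; first exact: dif_cst.
 apply: difB; first by apply: dx => //; exact: sr.
 by apply: dif_sum => j _; apply: difM; [exact: IH|exact: dif_cst].
by apply: ap => z zr; [exact: dt|exact: bM].
Qed.

Definition hol V W (f : V -> W) p := exists2 r : R, 0 < r & forall x, nm (x - p) < r -> dif f x.

Lemma hol_holo V (f : V -> C^o) p : hol f p <-> \forall x \near p, differentiable f x.
split=> [[r r0 h]|/nearP [r r0 h]].
 by apply/nearP; exists r => // x /h /difP.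
by exists r => // x /h /difP.
Qed.

Lemma hol_dif V W (f : V -> W) p : hol f p -> dif f p.
by move=> [r r0]; apply; rewrite subrr nm0. Qed.

Lemma hol_near V W (f : V -> W) p : hol f p -> exists2 r : R, 0 < r & forall x, nm (x - p) < r -> hol f x.
move=> [r r0 h]; exists r => // x hx; exists (r - nm (x - p)); first by lra.
by move=> y hy; apply: h; have := nm_dist x y p; lra.
Qed.

Lemma hol_ent V W (f : V -> W) p : (forall x, dif f x) -> hol f p.
by move=> h; exists 1. Qed.

Lemma hol2 V W (U : normedModType C) (W' : normedModType C) (f : V -> W) (g : V -> W') (h : V -> U) p :
 (forall x, dif f x -> dif g x -> dif h x) -> hol f p -> hol g p -> hol h p.
move=> k [r r0 df] [s s0 dg]; exists (minr r s); first by side.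
by move=> x /lt_minP [/df ? /dg ?]; apply: k.
Qed.
Lemma hol_cst V W (c : W) (p : V) : hol (fun=> c) p.
by apply: hol_ent => x; apply: dif_cst. Qed.
Lemma holD V W (f g : V -> W) p : hol f p -> hol g p -> hol (fun x => f x + g x) p.
by apply: hol2 => x; apply: difD. Qed.
Lemma holB V W (f g : V -> W) p : hol f p -> hol g p -> hol (fun x => f x - g x) p.
by apply: hol2 => x; apply: difB. Qed.
Lemma holM V (f g : V -> C^o) p : hol f p -> hol g p -> hol (fun x => f x * g x : C^o) p.
by apply: hol2 => x; apply: difM. Qed.
Lemma hol_eq V W (f g : V -> W) p : (forall x, f x = g x) -> hol f p -> hol g p.
by move=> /funext ->. Qed.
Lemma hol_cont V W (f : V -> W) p (e : R) : hol f p -> 0 < e ->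
 exists2 d : R, 0 < d & forall x, nm (x - p) < d -> nm (f x - f p) < e.
by move=> /hol_dif h; apply: dif_cont. Qed.
Lemma hol_neq0 V (f : V -> C^o) p : dif f p -> f p != 0 ->
 exists2 d : R, 0 < d & forall x, nm (x - p) < d -> f x != 0.
move=> h f0; have n0 : 0 < nm (f p) by side.
have [d d0 k] := dif_cont h n0; exists d => // x /k hx; apply: nm_neq0.
by have := nm_rev (f p) (f x); rewrite nmC; lra.
Qed.
Lemma hol_comp (V W U : normedModType C) (f : V -> W) (g : W -> U) p :
 hol f p -> hol g (f p) -> hol (fun x => g (f x)) p.
move=> h [r r0 dg]; have [s s0 df] := h; have [d d0 k] := hol_cont h r0.
exists (minr s d); first by side.
by move=> x /lt_minP [/df xf /k xd]; apply: dif_comp xf (dg _ xd).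
Qed.
Lemma hol_sum V W I (s : seq I) (P : pred I) (F : I -> V -> W) p :
 (forall i, P i -> hol (F i) p) -> hol (fun x => \sum_(i <- s | P i) F i x) p.
move=> h; elim: s => [|i s IH]; first by apply: hol_eq (hol_cst _ _) => x; rewrite big_nil.
case Pi: (P i); last by apply: hol_eq IH => x; rewrite big_cons Pi.
by apply: hol_eq (holD (h _ Pi) IH) => x; rewrite big_cons Pi.
Qed.

(* Sealing the directional derivative keeps conversion from unfolding it. *)
Lemma dd_sealed : {d : forall V : normedModType C, V -> (V -> C^o) -> V -> C^o |
 forall V (v : V) (f : V -> C^o) p, 'D_v f p = d V v f p}.
by exists (fun V v f p => 'D_v f p). Qed.
Definition dd V (v : V) (f : V -> C^o) (p : V) : C^o := sval dd_sealed V v f p.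
Lemma ddE V (v : V) (f : V -> C^o) p : 'D_v f p = dd v f p.
exact: (svalP dd_sealed). Qed.
Lemma hd_dd V (f : V -> C^o) p L v : hd f p L -> dd v f p = L v.
by move=> h; rewrite -ddE; apply: hd_dir. Qed.

Lemma hol_bd V (f : V -> C^o) p : hol f p -> exists r M : R, [/\ 0 < r, 0 <= M,
 forall x, nm (x - p) < r -> dif f x & forall x, nm (x - p) < r -> nm (f x) <= M].
move=> [r r0 df]; have [r' [M [h1 h2 h3 h4]]] := dif_bounded r0 df.
by exists r', M; split=> // x hx; apply: df; apply: lt_le_trans hx h2.
Qed.

Lemma line_asy V (f : V -> C^o) p v : hol f p ->
 asy (fun z : C^o => f (p + z *' v)) (tc (fun z : C^o => f (p + z *' v))).
move=> /hol_bd [r [M [r0 M0 df bf]]]; have [s s0 sv] := ex_small r0 (nm_ge0 v).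
have lt (z : C^o) : nm z < s -> nm (p + z *' v - p) < r.
 move=> h; rewrite addrC addKr; exact: nmZ_lt sv.
by have [] := disc_tc s0 (fun z h => dif_on_line (df _ (lt z h))) (fun z h => bf _ (lt z h)).
Qed.

Lemma dir_tc V (f : V -> C^o) p v : hol f p -> dd v f p = tc (fun z : C^o => f (p + z *' v)) 1%N.
move=> h; have [L hL] := hol_dif h.
by rewrite (hd_dd v hL) (tc1 (line_asy v h) (hd_on_line v hL)) mul1r.
Qed.

Lemma dif_tc_line V (f : V -> C^o) p v k : hol f p -> dif (fun x => tc (fun z : C^o => f (x + z *' v)) k) p.
move=> /hol_bd [r [M [r0 M0 df bf]]]; have r2 : 0 < r / 2 by lra.
have [s s0 /(_ p) lt] := ex_line v r0.
apply: (@tc_holo _ (fun x z => f (x + z *' v)) p (r / 2) s M) => //; last exact: nm_self.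
- by move=> x z hx hz; apply: (dif_comp (g := f)); [exact: dif_shift|apply/df/lt].
- by move=> x z hx hz; apply/dif_on_line/df/lt.
- by move=> x z hx hz; apply/bf/lt.
Qed.

(** A directional derivative is the coefficient of order 1 along a line, and such coefficients
    depend holomorphically on the base point. *)
Lemma dif_dir V (f : V -> C^o) p v : hol f p -> dif (dd v f) p.
by move=> h; have [r r0 hr] := hol_near h; apply: dif_ext r0 _ (dif_tc_line v 1 h) => x /hr /dir_tc ->. Qed.

Lemma hol_dir V (f : V -> C^o) p v : hol f p -> hol (dd v f) p.
by move=> /hol_near [r r0 h]; exists r => // x /h; apply: dif_dir. Qed.

Lemma dirD V (f g : V -> C^o) p v : dif f p -> dif g p ->
 dd v (fun x => f x + g x : C^o) p = dd v f p + dd v g p.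
by move=> [L h] [M k]; rewrite (hd_dd v (hdD h k)) (hd_dd v h) (hd_dd v k). Qed.
Lemma dirM V (f g : V -> C^o) p v : dif f p -> dif g p ->
 dd v (fun x => f x * g x : C^o) p = f p * dd v g p + g p * dd v f p.
by move=> [L h] [M k]; rewrite (hd_dd v (hdM h k)) (hd_dd v h) (hd_dd v k). Qed.
Lemma dirZ V c (f : V -> C^o) p v : dif f p -> dd v (fun x => c * f x : C^o) p = c * dd v f p.
by move=> [L h]; rewrite (hd_dd v (hdZ c h)) (hd_dd v h). Qed.
Lemma hdN V (f : V -> C^o) p L : hd f p L -> hd (fun x => - f x : C^o) p (fun h => - L h : C^o).
by move=> /(hdZ (-1)); congr hd; apply/funext => x; rewrite scaleN1r. Qed.
Lemma dirN V (f : V -> C^o) p v : dif f p -> dd v (fun x => - f x : C^o) p = - dd v f p.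
by move=> [L h]; rewrite (hd_dd v (hdN h)) (hd_dd v h). Qed.
Lemma dirB V (f g : V -> C^o) p v : dif f p -> dif g p ->
 dd v (fun x => f x - g x : C^o) p = dd v f p - dd v g p.
by move=> h k; rewrite dirD ?dirN //; exact: difN. Qed.
Lemma dir_cst V (c : C^o) (p v : V) : dd v (fun=> c) p = 0.
exact: hd_dd (hd_cst c p). Qed.
Lemma dir_sum V I (s : seq I) (P : pred I) (F : I -> V -> C^o) p v :
 (forall i, P i -> dif (F i) p) ->
 dd v (fun x => \sum_(i <- s | P i) F i x : C^o) p = \sum_(i <- s | P i) dd v (F i) p.
move=> h; elim: s => [|i s IH].
 by rewrite big_nil -[RHS](dir_cst 0 p v); congr (dd v _ p); apply/funext => x; rewrite big_nil.
rewrite big_cons; case Pi: (P i); last first.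
 by rewrite -IH; congr (dd v _ p); apply/funext => x; rewrite big_cons Pi.
rewrite -IH -dirD; [|exact: h|exact: dif_sum].
by congr (dd v _ p); apply/funext => x; rewrite big_cons Pi.
Qed.
Lemma dirX V (f : V -> C^o) p v k : dif f p ->
 dd v (fun x => f x ^+ k : C^o) p = k%:R * f p ^+ k.-1 * dd v f p.
move=> h; elim: k => [|k IH]; first by rewrite !mul0r -[RHS](dir_cst 1 p v).
have -> : (fun x => f x ^+ k.+1 : C^o) = (fun x => f x * f x ^+ k) by apply/funext => x; rewrite exprS.
rewrite dirM // ?IH; last exact: difX.
by case: k {IH} => [|k] /=; rewrite ?mul0r ?mulr0 ?add0r ?expr0 ?exprS -?natr1; ring.
Qed.
Lemma dir_ext V (f g : V -> C^o) p v (e : R) : 0 < e -> (forall x, nm (x - p) < e -> f x = g x) ->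
 dif f p -> dd v f p = dd v g p.
by move=> e0 h [L k]; rewrite (hd_dd v k) (hd_dd v (hd_ext (ex_intro2 _ _ e e0 h) k)). Qed.
Lemma dir_lin V (f : V -> C^o) p a v w : dif f p -> dd (a *: v + w) f p = a * dd v f p + dd w f p.
by move=> [L h]; rewrite !(hd_dd _ h); case: h => l _ _; rewrite l. Qed.
Lemma dir_dirZ V (f : V -> C^o) p a v : dif f p -> dd (a *: v) f p = a * dd v f p.
by move=> [L h]; rewrite !(hd_dd _ h); case: h => l _ _; rewrite (linZ _ _ l). Qed.
Lemma dir_dir0 V (f : V -> C^o) p : dif f p -> dd 0 f p = 0.
by move=> [L h]; rewrite !(hd_dd _ h); case: h => l _ _; rewrite (lin0 l). Qed.
Lemma dir_dirsum V (f : V -> C^o) p I (s : seq I) (P : pred I) (c : I -> C) (v : I -> V) : dif f p ->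
 dd (\sum_(i <- s | P i) c i *: v i) f p = \sum_(i <- s | P i) c i * dd (v i) f p.
move=> h; elim: s => [|i s IH]; first by rewrite !big_nil dir_dir0.
by rewrite !big_cons; case: (P i) => //; rewrite dir_lin // IH.
Qed.

(** Extracting a coefficient in [t] commutes with differentiating in the parameter: both sides are
    limits of the same quotients [u n], one by the Cauchy estimate for their uniform limit, the
    other by the expansion of [psi]. *)
Lemma tc_dir V (Phi : V -> C^o -> C^o) p v (r1 r2 M : R) : 0 < r1 -> 0 < r2 ->
 (forall x t, nm (x - p) < r1 -> nm t < r2 -> dif (fun y => Phi y t) x) ->
 (forall x t, nm (x - p) < r1 -> nm t < r2 -> dif (Phi x) t) ->
 (forall x t, nm (x - p) < r1 -> nm t < r2 -> nm (Phi x t) <= M) ->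
 asy (fun t => dd v (fun y => Phi y t) p) (tc (fun t => dd v (fun y => Phi y t) p)) ->
 forall k, dd v (fun y => tc (Phi y) k) p = tc (fun t => dd v (fun y => Phi y t) p) k.
move=> r10 r20 dx dt bM; set psi := (fun t => dd v _ p) => A; elim/ltn_ind => k IH.
have hp := nm_self p r10.
have tcd j x : nm (x - p) < r1 -> dif (fun y => tc (Phi y) j) x := fun h => tc_holo r10 r20 dx dt bM j h.
have M0 : 0 <= M by apply: le_trans (nm_ge0 _) (bM p 0 hp _); rewrite (nm0 C^o).
have [s [K [K0 ns s0 sr ap]]] := tc_approx k r20 M0.
pose u n y : C^o := s n ^- k * (Phi y (s n) - \sum_(j < k) tc (Phi y) j * s n ^+ j).
have du n y : nm (y - p) < r1 -> dif (u n) y.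
 move=> hy; apply: difM; first exact: dif_cst.
 apply: difB; first by side.
 apply: dif_sum => j _; apply: difM; last exact: dif_cst.
 exact: tcd.
have ub n y : nm (y - p) < r1 -> nm (u n y - tc (Phi y) k) <= K * 2^-1 ^+ n by move=> hy; apply: ap => z zr; [exact: dt|exact: bM].
have e1 n : nm (dd v (u n) p - dd v (fun y => tc (Phi y) k) p) <= 12 * (K * 2^-1 ^+ n) / r1 * nm v.
 have d1 := du n p hp; have d2 := tcd k p hp.
 rewrite -dirB //; have [L hL] := difB d1 d2; rewrite (hd_dd v hL).
 by apply: (cauchy_est r10 _ (ub n) hL).1 => x hx; apply: difB; [exact: du|exact: tcd].
have e2 n : dd v (u n) p = s n ^- k * (psi (s n) - \sum_(j < k) tc psi j * s n ^+ j).
 have dS : dif (fun y => \sum_(j < k) tc (Phi y) j * s n ^+ j : C^o) p by apply: dif_sum => j _; apply: difM; [exact: tcd|exact: dif_cst].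
 have dP : dif (fun y => Phi y (s n)) p by side.
 rewrite /u dirZ; last exact: difB.
 rewrite dirB // -/(psi _); congr (_ * (_ - _)).
 rewrite dir_sum => [|j _]; last by apply: difM; [exact: tcd|exact: dif_cst].
 apply: eq_bigr => j _; rewrite -IH // dirM; [|exact: tcd|exact: dif_cst].
 by rewrite dir_cst mulr0 add0r mulrC.
have [K' [d [K'0 d0 hA]]] := A k.+1.
have d6 : 0 < d / (r2 / 6) by side.
have [N hN] := pow2_small d6.
apply: subr0_eq; apply: nm_le0.
apply: (@pow2_lim0 R _ (12 * K / r1 * nm v + K' * (r2 / 6)) N) => n Nn.
have sd : nmc (s n) < d.
 rewrite ns mulrC -ltr_pdivlMr; last by side.
 by apply: le_lt_trans hN; exact: pow2_le.
have := hA _ sd; rewrite big_ord_recr /= => h.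
have e3 : nm (dd v (u n) p - tc psi k) <= K' * (r2 / 6 * 2^-1 ^+ n).
 have -> : dd v (u n) p - tc psi k = (psi (s n) - (\sum_(j < k) tc psi j * s n ^+ j + tc psi k * s n ^+ k)) / s n ^+ k by rewrite e2; field; rewrite expf_neq0.
 rewrite nmM nmV nmX ler_pdivrMr; last by side.
 by apply: le_trans h _; rewrite -ns exprS mulrA.
have := nm_dist (dd v (u n) p) (dd v (fun y => tc (Phi y) k) p) (tc psi k).
have h4 := e1 n; rewrite nmC in h4 => h5.
apply: le_trans h5 _; apply: le_trans (lerD h4 e3) _.
by apply: le_of_eq; ring.
Qed.

Lemma hd_shift V (f : V -> C^o) p v L : hd f (p + v) L -> hd (fun x => f (x + v)) p L.
move=> h; have := @hd_comp R V V C^o (fun x => x + v) f p (fun h => h + 0) L (hdD (hd_id p) (hd_cst v p)) h.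
by congr hd; apply/funext => y; rewrite addr0.
Qed.

Lemma dir_shift V (f : V -> C^o) p v w : dif f (p + w) -> dd v (fun x => f (x + w)) p = dd v f (p + w).
by move=> [L h]; rewrite (hd_dd v h) (hd_dd v (hd_shift h)). Qed.

Lemma dd_tc_line V (f : V -> C^o) p u v k : hol f p ->
 dd v (fun x => tc (fun z : C^o => f (x + z *' u)) k) p = tc (fun z : C^o => dd v f (p + z *' u)) k.
move=> h; have [r [M [r0 M0 df bf]]] := hol_bd h; have r2 : 0 < r / 2 by lra.
have [s s0 /(_ p) lt] := ex_line u r0.
have A : asy (fun z : C^o => dd v (fun x => f (x + z *' u)) p) (tc (fun z : C^o => dd v f (p + z *' u))).
 apply: asy_ext s0 _ (line_asy u (hol_dir v h)) => z hz.
 by apply: esym; apply: dir_shift; apply/df/lt => //; exact: nm_self.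
rewrite (@tc_dir _ (fun x z => f (x + z *' u)) p v (r / 2) s M) ?(asy_tc A) //.
- by move=> x z hx hz; apply: (dif_comp (g := f)); [exact: dif_shift|apply/df/lt].
- by move=> x z hx hz; apply/dif_on_line/df/lt.
- by move=> x z hx hz; apply/bf/lt.
Qed.

(** Near [p] the function [dd u f] is a coefficient along [u], and [dd v] commutes with taking such
    coefficients. *)
Lemma dir_sym V (f : V -> C^o) p u v : hol f p -> dd u (dd v f) p = dd v (dd u f) p.
move=> h; have [r r0 hr] := hol_near h.
rewrite (@dir_ext V (dd u f) (fun x => tc (fun z : C^o => f (x + z *' u)) 1%N) p v r) //; last exact: dif_dir.
 by rewrite dd_tc_line // -dir_tc //; exact: hol_dir.
by move=> x /hr /dir_tc ->.
Qed.

Lemma disc_zero (g : C^o -> C^o) (x : C^o) (r M d : R) : 0 < r -> 0 < d ->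
 (forall z, nm (z - x) < r -> dif g z) -> (forall z, nm (z - x) < r -> nm (g z) <= M) ->
 (forall z, nm (z - x) < d -> g z = 0) -> forall z, nm (z - x) < r / 6 -> g z = 0.
move=> r0 d0 dg bg g0 z hz.
pose h (w : C^o) := g (x + w).
have lt (w : C^o) : nm w < r -> nm (x + w - x) < r by rewrite addrC addKr.
have dh w : nm w < r -> dif h w.
 move=> hw; apply: (dif_comp (g := g)); last by apply: dg; exact: lt.
 by side.
have [A B D] := disc_tc r0 dh (fun w hw => bg _ (lt w hw)).
have t0 : tc h = fun=> 0.
 apply: asy_tc => m; exists 0, d; split=> // w hw.
 rewrite /h g0; last by rewrite addrC addKr.
 by rewrite big1 ?subr0 ?nm0 ?mul0r // => k _; rewrite mul0r.
have -> : g z = h (z - x) by rewrite /h addrC subrK.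
apply: nm_le0; apply/ler_addgt0Pl => e e0; rewrite addr0.
have M0 : 0 <= M by apply: le_trans (nm_ge0 _) (bg x _); rewrite subrr nm0.
have M80 : 0 <= 8 * M by side.
have [s s0 sM] := ex_small e0 M80; have [N hN] := pow2_small s0.
have := D N (z - x) (ltW hz); rewrite -/h t0 big1 ?subr0 => [hh|k _]; last by rewrite mul0r.
apply: le_trans hh _; apply: le_trans (ltW sM); rewrite mulrC ler_wpM2r //.
apply: le_trans (ltW hN); apply: lerXn2r; rewrite ?nnegrE ?divr_ge0 ?nm_ge0 ?invr_ge0 ?(ltW r0) //.
by rewrite ler_pdivrMr ?divr_gt0 //; lra.
Qed.

(** Analytic continuation along a segment: near each of its points, vanishing on a neighbourhood
    spreads over a disc of fixed size. *)
Lemma segment_zero V (f : V -> C^o) p q (e : R) : 0 < e ->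
 (forall s : R, 0 <= s <= 1 -> hol f (p + s%:C *: (q - p))) ->
 (forall x, nm (x - p) < e -> f x = 0) -> f q = 0.
move=> e0 df f0.
pose g (z : C^o) := f (p + z *' (q - p)).
have hg (s : R) : 0 <= s <= 1 -> hol g s%:C.
 move=> hs; apply: (@hol_comp C^o V C^o (fun z : C^o => p + z *' (q - p)) f); last exact: df.
 by apply: hol_ent => z; exact: dif_line.
pose zn (x : R) := exists2 d : R, 0 < d & forall z : C^o, nm (z - x%:C) < d -> g z = 0.
suff : zn (0 + 1).
 rewrite add0r => -[d d0 h]; have := h 1; rewrite rmorph1 subrr (nm0 C^o) => /(_ d0).
 by rewrite /g scale1r addrC subrK.
have z0 : zn 0.
 have [s s0 sq] := ex_small e0 (nm_ge0 (q - p)).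
 exists s => // z; rewrite rmorph0 subr0 => hz; by apply: f0; rewrite addrC addKr; exact: nmZ_lt sq.
suff : zn 0 -> zn (0 + 1) by exact.
(* Bisection is applied to an implication, which composes when two intervals are joined. *)
apply: (@cousin1 R (fun x s => zn x -> zn (x + s))).
 by move=> x s s0 h1 h2 /h1 /h2; rewrite -addrA -splitr.
move=> x0 hx0; have [r [M [r0 M0 dg bg]]] := hol_bd (hg _ hx0).
exists (r / 20); first by side.
move=> x s /andP [s0 sr] /andP [xa xb] _ _ [d d0 hd].
have nx : nmc (x%:C - x0%:C) < r / 20 by rewrite -rmorphB nm_real ler0_norm; lra.
have r2 : 0 < r / 2 by lra.
have ball (z : C^o) : nm (z - x%:C) < r / 2 -> nm (z - x0%:C) < r by move=> h; have := nm_dist (x%:C : C^o) z x0%:C; lra.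
have key := disc_zero r2 d0 (fun z h => dg _ (ball z h)) (fun z h => bg _ (ball z h)) hd.
exists (r / 60); first by side.
move=> z hz; apply: key; have := nm_dist ((x + s)%:C : C^o) z x%:C.
have : nmc ((x + s)%:C - x%:C) < r / 20 by rewrite -rmorphB nm_real gtr0_norm; lra.
lra.
Qed.

Lemma ball_zero V (f : V -> C^o) p (r e : R) : 0 < e -> (forall x, nm (x - p) < r -> dif f x) ->
 (forall x, nm (x - p) < e -> f x = 0) -> forall x, nm (x - p) < r -> f x = 0.
move=> e0 df f0 x hx; apply: (segment_zero e0 _ f0) => s /andP [s0 s1].
have h : nm (p + s%:C *: (x - p) - p) < r.
 rewrite addrC addKr nmZ nm_real ger0_norm //; apply: le_lt_trans hx.
 by rewrite ler_piMl ?nm_ge0.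
exists (r - nm (p + s%:C *: (x - p) - p)); first by lra.
by move=> y hy; apply: df; have := nm_dist (p + s%:C *: (x - p)) y p; lra.
Qed.

End Hol.

(** * Coordinates, the weighted action and weighted homogeneous components *)

Section Weights.
Import interval_inference.
Variables (R : realType) (n : nat).
Local Notation C := R[i].
Local Notation V := (Cn R n).

Lemma ptE a j : coord (pt a : V) j = a j. by rewrite /Defs.coord mxE. Qed.
Lemma coord_inj (x y : V) : (forall j, coord x j = coord y j) -> x = y.
by move=> h; apply/rowP => j; exact: h. Qed.
Lemma coordD (x y : V) j : coord (x + y) j = coord x j + coord y j. by rewrite /Defs.coord mxE. Qed.
Lemma coordN (x : V) j : coord (- x) j = - coord x j. by rewrite /Defs.coord mxE. Qed.
Lemma coordZ (a : C) (x : V) j : coord (a *: x) j = a * coord x j. by rewrite /Defs.coord mxE. Qed.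
Lemma coord0 j : coord (0 : V) j = 0. by rewrite /Defs.coord mxE. Qed.

Lemma nm_coord (x : V) j : nmc (coord x j) <= nm x.
rewrite -lecR -!nmE /Defs.coord [leRHS]/Num.norm /= mx_normE -[leLHS]nngE num_le.
exact: (le_bigmax _ (fun ij : 'I_1 * 'I_n => `|(x : 'rV_n) ij.1 ij.2|%:nng) (0, j)).
Qed.

Lemma nm_le_coord (x : V) (M : R) : 0 <= M -> (forall j, nmc (coord x j) <= M) -> nm x <= M.
move=> M0 h; have [->|xn0] := eqVneq x 0; first by rewrite nm0.
have : mx_norm (x : 'rV_n) != 0 by apply: contra xn0 => /eqP /mx_norm_eq0 ->.
move=> /mx_norm_neq0 [[i j] /= E]; rewrite -lecR -nmE [`|x|]/Num.norm /= E (ord1 i).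
by rewrite nmE lecR; exact: h.
Qed.

Definition ev (i : 'I_n) : V := delta_mx 0 i.

Lemma coord_ev i j : coord (ev i) j = (j == i)%:R. by rewrite /Defs.coord mxE eqxx. Qed.

Lemma coord_sum I (s : seq I) (P : pred I) (F : I -> V) j :
 coord (\sum_(i <- s | P i) F i) j = \sum_(i <- s | P i) coord (F i) j.
by elim/big_rec2: _ => [|i y x _ <-]; rewrite ?coord0 ?coordD. Qed.

Lemma V_sum (x : V) : x = \sum_i coord x i *: ev i.
apply: coord_inj => j; rewrite coord_sum (bigD1 j) //= big1 ?addr0 => [|i ij].
 by rewrite coordZ coord_ev eqxx mulr1.
by rewrite coordZ coord_ev eq_sym (negbTE ij) mulr0.
Qed.

Lemma hd_coord (j : 'I_n) (p : V) : hd (fun x : V => coord x j : C^o) p (fun x : V => coord x j : C^o).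
apply: hd_lin; first by move=> a x y; rewrite coordD coordZ.
by exists 1 => // x; rewrite mul1r nm_coord.
Qed.

Lemma dif_coord (j : 'I_n) (p : V) : dif (fun x : V => coord x j : C^o) p.
by eexists; exact: hd_coord. Qed.

Lemma hd_eq (U W : normedModType C) (f g : U -> W) p L M : (forall x, f x = g x) -> (forall h, L h = M h) ->
 hd f p L -> hd g p M.
by move=> /funext -> /funext ->. Qed.

Lemma hd_pt (W : normedModType C) (F : 'I_n -> W -> C^o) p L : (forall j, hd (F j) p (L j)) ->
 hd (fun x => pt (fun j => F j x) : V) p (fun h => pt (fun j => L j h) : V).
move=> h.
have E (G : 'I_n -> W -> C^o) : (fun x => pt (fun j => G j x) : V) = (fun x => \sum_j G j x *' ev j) by apply/funext => x; rewrite [LHS]V_sum; apply: eq_bigr => j _; rewrite ptE.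
rewrite !E; elim: (index_enum _) => [|j s IH].
 by apply: hd_eq (hd_cst 0 p) => x; rewrite big_nil.
have h2 : hd (fun x => F j x *' ev j) p (fun x => L j x *' ev j).
 apply: (@hd_comp R W C^o V (F j) (fun z : C^o => z *' ev j) p (L j) (fun z : C^o => z *' ev j)) => //.
 apply: hd_lin; first by move=> a x y; rewrite scalerDl scalerA.
 by exists (nm (ev j)); [exact: nm_ge0|move=> z; rewrite nmZ mulrC].
by apply: hd_eq (hdD h2 IH) => x; rewrite big_cons.
Qed.

Lemma dif_pt (W : normedModType C) (F : 'I_n -> W -> C^o) p : (forall j, dif (F j) p) ->
 dif (fun x => pt (fun j => F j x) : V) p.
move=> h; have k j : {L | hd (F j) p L} by apply: cid; exact: h.
by exists (fun x => pt (fun j => sval (k j) x)); apply: hd_pt => j; case: (k j).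
Qed.

Lemma dir_coord (f : V -> C^o) p v : dif f p -> dd v f p = \sum_i coord v i * dd (ev i) f p.
by move=> h; rewrite {1}[v]V_sum dir_dirsum. Qed.

Variable w : 'I_n -> nat.
Hypothesis w0 : forall j, (0 < w j)%N.

Definition act (t : C) (x : V) : V := pt (fun j => t ^+ w j * coord x j).

Lemma coord_act t x j : coord (act t x) j = t ^+ w j * coord x j. exact: ptE. Qed.
Lemma act_act s t x : act s (act t x) = act (s * t) x.
by apply: coord_inj => j; rewrite !coord_act exprMn mulrA. Qed.
Lemma act1 x : act 1 x = x.
by apply: coord_inj => j; rewrite !coord_act expr1n mul1r. Qed.
Lemma act0 x : act 0 x = 0.
by apply: coord_inj => j; rewrite !coord_act coord0 expr0n gtn_eqF ?w0 // mul0r. Qed.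
Lemma act_lin t : lin (act t).
by move=> a x y; apply: coord_inj => j; rewrite coordD coordZ !coord_act coordD coordZ; ring. Qed.
Lemma nm_act t x : nmc t <= 1 -> nm (act t x) <= nmc t * nm x.
move=> t1; apply: nm_le_coord; first by side.
move=> j; rewrite coord_act nmM nmX; apply: ler_pM; rewrite ?exprn_ge0 ?nm_ge0 ?nm_coord //.
by rewrite -[leRHS]expr1; apply: ler_wiXn2l => //; exact: nm_ge0.
Qed.
Definition wmax := (\max_j w j)%N.
Lemma nm_act_big t x (T : R) : 1 <= T -> nmc t <= T -> nm (act t x) <= T ^+ wmax * nm x.
move=> T1 tT; have T0 : 0 <= T by lra.
apply: nm_le_coord; first by side.
move=> j; rewrite coord_act nmM nmX; apply: ler_pM; rewrite ?exprn_ge0 ?nm_ge0 ?nm_coord //.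
apply: le_trans (_ : T ^+ w j <= _); first by apply: lerXn2r; rewrite ?nnegrE ?nm_ge0.
by apply: ler_weXn2l => //; exact: (@leq_bigmax _ w j).
Qed.

Lemma hd_act t p : hd (act t) p (act t).
apply: hd_lin; first exact: act_lin.
pose T := maxr 1 (nmc t).
have T1 : 1 <= T by rewrite le_max lexx.
exists (T ^+ wmax); first by rewrite exprn_ge0 //; lra.
by move=> x; apply: nm_act_big => //; rewrite le_max lexx orbT.
Qed.
Lemma dif_act t p : dif (act t) p. by eexists; exact: hd_act. Qed.
Lemma dif_act_t x (t : C^o) : dif (fun t : C^o => act t x) t.
apply: dif_pt => j; apply: difM; last exact: dif_cst.
by side.
Qed.

Lemma dd_act (f : V -> C^o) t i p : dif f (act t p) ->
 dd (ev i) (fun x => f (act t x)) p = t ^+ w i * dd (ev i) f (act t p).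
move=> [L h]; rewrite (hd_dd (ev i) (hd_comp (hd_act t p) h)) (hd_dd (ev i) h).
have -> : act t (ev i) = t ^+ w i *: ev i.
 apply: coord_inj => j; rewrite coord_act coordZ coord_ev; case: eqP => [->//|]; by rewrite !mulr0.
by case: h => l _ _; rewrite (linZ _ _ l).
Qed.

(** The part of weight [k] is read off on the orbit of [x] as [t] tends to 0. The orbit enters every
    neighbourhood of the origin, so the part of a mere germ is an entire function. *)
Definition wcomp (g : V -> C^o) k x : C^o := tc (fun t : C^o => g (act t x)) k.

Lemma asy_shift (f : C^o -> C^o) a m : asy f a ->
 asy (fun t => t ^+ m * f t) (fun k => if (m <= k)%N then a (k - m)%N else 0).
move=> h N; have := bigO_M (@bigO_X R m) (h (N - m)%N).
move/(bigO_le (_ : (N <= m + (N - m))%N)) => hh; apply: bigO_ext (hh _) => [z|]; last by rewrite -leq_subLR.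
rewrite mulrBr; congr (_ - _); elim: N {hh} => [|N IH]; first by rewrite sub0n !big_ord0 mulr0.
rewrite big_ord_recr /= -IH; case: leqP => mN; last first.
 by rewrite mul0r addr0; move: (mN); rewrite -subn_eq0 => /eqP ->; rewrite (eqP (ltnW mN : (N - m)%N == 0)%N).
by rewrite subSn // big_ord_recr /= mulrDr; congr (_ + _); rewrite mulrCA -exprD subnKC.
Qed.

Lemma orbit_bd (g : V -> C^o) p : hol g 0 -> exists r1 r2 M : R, [/\ 0 < r1, 0 < r2 & forall x t, nm (x - p) < r1 -> nmc t < r2 ->
 [/\ hol g (act t x), dif (fun y => g (act t y)) x, dif (fun t : C^o => g (act t x)) t & nm (g (act t x)) <= M]].
move=> hg; have [r [M [r0 M0 df bf]]] := hol_bd hg.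
have b0 : 0 <= nm p + 1 by side.
have [s s0 sb] := ex_small r0 b0.
exists 1, (minr s 1), M; split=> //; first by side.
move=> x t hx /lt_minP [ts t1].
have nx : nm x <= nm p + 1 by have := nm_rev x p; lra.
have lt : nm (act t x - 0) < r.
 rewrite subr0; apply: le_lt_trans (nm_act _ (ltW t1)) _; apply: le_lt_trans sb.
 by apply: ler_pM; rewrite ?nm_ge0 // ltW.
split; last exact: bf.
- exists (r - nm (act t x - 0)); first by lra.
 by move=> y hy; apply: df; have := nm_dist (act t x) y 0; lra.
- apply: (dif_comp (g := g)); [exact: dif_act|exact: df].
- apply: (dif_comp (g := g)); [exact: dif_act_t|exact: df].
Qed.

Lemma wcomp_asy (g : V -> C^o) x : hol g 0 -> asy (fun t : C^o => g (act t x)) (fun k => wcomp g k x).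
move=> hg; have [r1 [r2 [M [r10 r20 h]]]] := orbit_bd x hg.
have xx := nm_self x r10.
by have [] := disc_tc r20 (fun t ht => let: And4 _ _ d _ := h x t xx ht in d) (fun t ht => let: And4 _ _ _ b := h x t xx ht in b).
Qed.

Lemma dif_wcomp (g : V -> C^o) k x : hol g 0 -> dif (wcomp g k) x.
move=> hg; have [r1 [r2 [M [r10 r20 h]]]] := orbit_bd x hg.
apply: (@tc_holo R V (fun x t => g (act t x)) x r1 r2 M) => //; last by rewrite subrr nm0.
- by move=> y t hy ht; case: (h y t hy ht).
- by move=> y t hy ht; case: (h y t hy ht).
- by move=> y t hy ht; case: (h y t hy ht).
Qed.

Lemma asy_scale (f : C^o -> C^o) a (s : C^o) : asy f a -> asy (fun t => f (s * t)) (fun k => s ^+ k * a k).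
move=> h m; have [K [d [K0 d0 hd]]] := h m.
have [q q0 qs] := ex_small d0 (nm_ge0 s).
exists (K * nm s ^+ m), q; split=> //; first by side.
move=> z hz; have := hd (s * z); rewrite nmM exprMn mulrA => hh.
have -> : \sum_(k < m) s ^+ k * a k * z ^+ k = \sum_(k < m) a k * (s * z) ^+ k by apply: eq_bigr => k _; rewrite exprMn; ring.
apply: hh; apply: le_lt_trans qs; rewrite mulrC ler_wpM2r ?nm_ge0 // ltW //.
Qed.

Lemma wcomp_act (g : V -> C^o) k s x : hol g 0 -> wcomp g k (act s x) = s ^+ k * wcomp g k x.
move=> hg; rewrite {1}/wcomp; have -> : (fun t : C^o => g (act t (act s x))) = (fun t : C^o => g (act (s * t) x)) by apply/funext => t; rewrite act_act mulrC.
by rewrite (asy_tc (asy_scale s (wcomp_asy x hg))).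
Qed.

Lemma wcomp_pd (g : V -> C^o) k i x : hol g 0 -> dd (ev i) (wcomp g k) x =
 if (w i <= k)%N then wcomp (dd (ev i) g) (k - w i) x else 0.
move=> hg; have [r1 [r2 [M [r10 r20 h]]]] := orbit_bd x hg.
have xx := nm_self x r10.
have hd : hol (dd (ev i) g) 0 := hol_dir (ev i) hg.
have E (t : C^o) : nm t < r2 -> t ^+ w i * dd (ev i) g (act t x) = dd (ev i) (fun y => g (act t y)) x by move=> ht; case: (h x t xx ht) => hh _ _ _; rewrite dd_act //; exact: hol_dif.
have A' := asy_ext r20 E (asy_shift (w i) (wcomp_asy x hd)).
have hh := @tc_dir R V (fun x t => g (act t x)) x (ev i) r1 r2 M r10 r20.
have d1 := fun y t hy ht => let: And4 _ a _ _ := h y t hy ht in a.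
have d2 := fun y t hy ht => let: And4 _ _ a _ := h y t hy ht in a.
have d3 := fun y t hy ht => let: And4 _ _ _ a := h y t hy ht in a.
by have := hh d1 d2 d3 (tcP A') k; rewrite (asy_tc A').
Qed.

Lemma wcomp_ext (g h : V -> C^o) k x (e : R) : 0 < e -> (forall x, nm x < e -> g x = h x) -> hol g 0 ->
 wcomp g k x = wcomp h k x.
move=> e0 E hg; have [s s0 sx] := ex_small e0 (nm_ge0 x).
have m0 : 0 < minr s 1 by side.
rewrite /wcomp (asy_tc (_ : asy (fun t : C^o => h (act t x)) (fun k => wcomp g k x))) //.
apply: asy_ext m0 _ (wcomp_asy x hg) => t; rewrite lt_min => /andP [ts t1]; apply: E.
by apply: le_lt_trans (nm_act _ (ltW t1)) _; apply: le_lt_trans sx; rewrite ler_wpM2r ?nm_ge0 // ltW.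
Qed.

Lemma wcompD (g h : V -> C^o) k x : hol g 0 -> hol h 0 -> wcomp (fun x => g x + h x) k x = wcomp g k x + wcomp h k x.
by move=> hg hh; rewrite {1}/wcomp (asy_tc (asyD (wcomp_asy x hg) (wcomp_asy x hh))). Qed.
Lemma wcompZ c (g : V -> C^o) k x : hol g 0 -> wcomp (fun x => c * g x) k x = c * wcomp g k x.
by move=> hg; rewrite {1}/wcomp (asy_tc (asyZ c (wcomp_asy x hg))). Qed.
Lemma wcompB (g h : V -> C^o) k x : hol g 0 -> hol h 0 -> wcomp (fun x => g x - h x) k x = wcomp g k x - wcomp h k x.
move=> hg hh; rewrite {1}/wcomp.
have -> : (fun t : C^o => g (act t x) - h (act t x)) = (fun t : C^o => g (act t x) + (-1) * h (act t x)) by apply/funext => t; rewrite mulN1r.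
by rewrite (asy_tc (asyD (wcomp_asy x hg) (asyZ (-1) (wcomp_asy x hh)))) mulN1r.
Qed.
Lemma wcomp0 (g : V -> C^o) k x (e : R) : 0 < e -> (forall x, nm x < e -> g x = 0) -> wcomp g k x = 0.
move=> e0 h; rewrite -(@wcomp_ext (fun=> 0) g k x e e0) => [|y /h //|]; last exact: hol_cst.
by rewrite /wcomp (asy_tc (asy_cst 0)); case: eqP.
Qed.

Lemma wcomp_approx (g : V -> C^o) : hol g 0 -> exists r M : R, [/\ 0 < r, 0 <= M &
 forall x m, nm x < r -> nm (g x - \sum_(k < m) wcomp g k x) <= M * 2^-1 ^+ m].
move=> hg; have [r [M [r0 M0 df bf]]] := hol_bd hg.
(* Radius 7 for [t]: the value [t = 1] then lies within a sixth of it, and the remainder has ratio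
   [3 / 7], below [1 / 2]. *)
have T0 : 0 <= (7 : R) ^+ wmax by side.
have [s s0 sT] := ex_small r0 T0.
exists s, (8 * M); split=> //; first by side.
move=> x m hx.
have lt (t : C^o) : nm t < 7 -> nm (act t x - 0) < r.
 move=> t7; rewrite subr0; apply: le_lt_trans (nm_act_big x _ (ltW t7)) _; first by lra.
 by apply: le_lt_trans sT; rewrite mulrC ler_wpM2r // ltW.
have l7 : (0 : R) < 7 by lra.
have dt (t : C^o) : nm t < 7 -> dif (fun t : C^o => g (act t x)) t.
 move=> /lt h; apply: (dif_comp (g := g)); [exact: dif_act_t|exact: df].
have [_ _ D] := disc_tc l7 dt (fun t h => bf _ (lt t h)).
have := D m 1; rewrite nm1 act1 => hh.
have E : \sum_(k < m) wcomp g k x = \sum_(k < m) tc (fun z : C^o => g (act z x)) k * 1 ^+ k by apply: eq_bigr => k _; rewrite expr1n mulr1.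
rewrite E; apply: le_trans (hh _) _; first by lra.
by rewrite ler_wpM2l ?mulr_ge0 //; apply: lerXn2r; rewrite ?nnegrE ?invr_ge0 //; lra.
Qed.

Lemma wcomp_inj (g : V -> C^o) : hol g 0 -> (forall k x, wcomp g k x = 0) ->
 exists2 r : R, 0 < r & forall x, nm x < r -> g x = 0.
move=> /wcomp_approx [r [M [r0 M0 h]]] z; exists r => // x hx; apply: nm_le0.
apply: (@pow2_lim0 R _ M 0) => m _; have := h x m hx; rewrite big1 ?subr0 // => k _; exact: z.
Qed.

Definition whom (k : nat) (g : V -> C^o) := forall t x, g (act t x) = t ^+ k * g x.
Definition ent (g : V -> C^o) := forall x, dif g x.

Lemma asy_mono (c : C^o) m : asy (fun t => t ^+ m * c) (fun k => if k == m then c else 0).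
have := asy_shift m (asy_cst c); congr asy; apply/funext => k; case: (ltngtP m k) => h.
- by rewrite subn_eq0 leqNgt h.
- by [].
- by rewrite h subnn.
Qed.

Lemma wcomp_whom g k j x : whom k g -> wcomp g j x = if j == k then g x else 0.
move=> h; rewrite /wcomp; have -> : (fun t : C^o => g (act t x)) = (fun t : C^o => t ^+ k * g x) by apply/funext => t; rewrite h.
by rewrite (asy_tc (asy_mono _ _)).
Qed.

Lemma whom_wcomp g k : hol g 0 -> whom k (wcomp g k).
by move=> hg t x; apply: wcomp_act. Qed.

(** Weight [k] for the coefficient of a differential that itself has weight [c]. Written without the
    subtraction [k - c], it makes sense for [k < c] too, where it forces [g = 0]. *)
Definition wh (c k : nat) (g : V -> C^o) := forall t x, t ^+ c * g (act t x) = t ^+ k * g x.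

Lemma wh_low c k g x : ent g -> wh c k g -> (k < c)%N -> g x = 0.
move=> eg h kc; have A := asy_shift c (wcomp_asy x (hol_ent 0 eg)).
have := asy_tc A; have -> : (fun t : C^o => t ^+ c * g (act t x)) = (fun t : C^o => t ^+ k * g x) by apply/funext => t; rewrite h.
rewrite (asy_tc (asy_mono _ _)) => /(congr1 (fun F => F k)); by rewrite eqxx leqNgt kc.
Qed.

Lemma wh_whom c k g : ent g -> wh c k g -> (c <= k)%N -> whom (k - c) g.
move=> eg h ck t x; have [->|t0] := eqVneq t 0; last first.
 by apply: (mulfI (expf_neq0 c t0)); rewrite h mulrA -exprD subnKC.
have A := wcomp_asy x (hol_ent 0 eg).
have := asy_tc (asy_shift c A); have -> : (fun t : C^o => t ^+ c * g (act t x)) = (fun t : C^o => t ^+ k * g x) by apply/funext => u; rewrite h.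
rewrite (asy_tc (asy_mono _ _)) => /(congr1 (fun F => F c)); rewrite leqnn subnn.
have -> : wcomp g 0 x = g (act 0 x) by rewrite /wcomp (tc0 A).
move=> <-; rewrite expr0n subn_eq0 [c == k]eqn_leq ck /=.
by case: (k <= c)%N; rewrite ?mul1r ?mul0r.
Qed.

Lemma wh_pd f d i : ent f -> whom d f -> wh (w i) d (dd (ev i) f).
move=> ef h t x; rewrite -dd_act //.
have -> : (fun x => f (act t x)) = (fun x => t ^+ d * f x) by apply/funext => y; exact: h.
by rewrite dirZ.
Qed.

Lemma ent_dd f v : ent f -> ent (dd v f).
by move=> h x; apply: dif_dir; apply: hol_ent. Qed.

Lemma euler f d x : ent f -> whom d f -> \sum_i (w i)%:R * coord x i * dd (ev i) f x = d%:R * f x.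
move=> ef h; have [L hL] := ef x.
have hX (m : nat) : hd (fun t : C^o => t ^+ m : C^o) 1 (fun u => m%:R * u : C^o).
 elim: m => [|m IH].
  by apply: hd_eq (hd_cst (1 : C^o) (1 : C^o)) => y; rewrite ?expr0 ?mul0r.
 apply: hd_eq (hdM (hd_id (1 : C^o)) IH) => y; first by rewrite exprS.
 by rewrite expr1n -natr1; ring.
have hA : hd (fun t : C^o => act t x) 1 (fun u : C^o => pt (fun j => coord x j * ((w j)%:R * u))).
 apply: hd_pt => j; apply: hd_eq (hdM (hX (w j)) (hd_cst (coord x j : C^o) (1 : C^o))) => y //.
 by rewrite mulr0 add0r.
have hL' : hd f (act 1 x) L by rewrite act1.
have h1 := hd_comp hA hL'.
have h2 : hd (fun t : C^o => f (act t x)) 1 (fun u => f x * (d%:R * u) : C^o).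
 apply: hd_eq (hdM (hX d) (hd_cst (f x : C^o) (1 : C^o))) => y; first by rewrite h.
 by rewrite mulr0 add0r.
have := hd_unique h1 h2 1; rewrite -(hd_dd _ hL) dir_coord // mulr1 [RHS]mulrC => <-.
by apply: eq_bigr => i _; rewrite ptE mulr1 [coord x i * _]mulrC.
Qed.

(** A contraction [act t] with [t] of order [1 / (1 + nm x)] brings [x] into a ball where [f] is
    bounded, and homogeneity charges [t ^ d] for it. *)
Lemma whom_growth f d : ent f -> whom d f -> exists2 M : R, 0 <= M & forall x, nm (f x) <= M * (1 + nm x) ^+ d.
move=> ef h; have [r [M [r0 M0 df bf]]] := hol_bd (hol_ent 0 ef).
pose s := minr r 1; have s0 : 0 < s by rewrite lt_min r0 ltr01.
have s1 : s <= 1 by rewrite /s ge_min lexx orbT.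
have sr : s <= r by rewrite /s ge_min lexx.
exists (M / s ^+ d); first by side.
move=> x; have nx := nm_ge0 x; have n1 : 0 < 1 + nm x by lra.
pose t := s / (1 + nm x); have t0 : 0 < t by rewrite divr_gt0.
have t1 : nmc (t%:C) <= 1 by rewrite nm_real gtr0_norm // /t ler_pdivrMr // mul1r; lra.
have := h t%:C x; move=> /(congr1 (fun z : C^o => nm z)); rewrite nmM nmX nm_real gtr0_norm // => E.
have : nm (f (act t%:C x)) <= M.
 apply: bf; rewrite subr0; apply: le_lt_trans (nm_act _ t1) _; rewrite nm_real gtr0_norm //.
 apply: lt_le_trans sr; rewrite /t mulrAC ltr_pdivrMr // ltr_pM2l //; lra.
rewrite E mulrC -ler_pdivlMr ?exprn_gt0 // => /le_trans; apply.
rewrite /t expr_div_n invf_div [leLHS](_ : _ = M / s ^+ d * (1 + nm x) ^+ d) //; ring.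
Qed.

Lemma whom_extend (f : V -> C^o) d (e : R) : 0 < e -> hol f 0 ->
 (forall x, nm x < e -> forall t : C^o, nm t <= 1 -> f (act t x) = t ^+ d * f x) ->
 forall x, nm x < e -> wcomp f d x = f x.
move=> e0 hf h x hx; rewrite /wcomp.
have A : asy (fun t : C^o => f (act t x)) (fun k => if k == d then f x else 0) by apply: asy_ext ltr01 _ (asy_mono (f x) d) => t /ltW t1; rewrite h.
by rewrite (asy_tc A) eqxx.
Qed.

End Weights.

(** * Entire functions of polynomial growth *)

Section Growth.
Variables (R : realType) (n : nat).
Local Notation C := R[i].
Local Notation V := (Cn R n).

Definition dcoef (e : V) (g : V -> C^o) k (x : V) : C^o := tc (fun z : C^o => g (x + z *' e)) k.

Lemma dif_dcoef (f : V -> C^o) p e k : hol f p -> dif (dcoef e f k) p.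
exact: dif_tc_line. Qed.

Lemma dcoef0 (f : V -> C^o) e x : hol f x -> dcoef e f 0 x = f x.
by move=> h; rewrite /dcoef (tc0 (line_asy e h)) scale0r addr0. Qed.

Lemma dcoef1 (f : V -> C^o) e x : hol f x -> dcoef e f 1 x = dd e f x.
by move=> h; rewrite dir_tc. Qed.

(** Entire functions of polynomial growth play the part of polynomials in [n] variables: they are
    stable under ring operations and derivatives, and restrict to polynomials on every line. *)
Definition pgN N (g : V -> C^o) := ent g /\ exists2 M : R, 0 <= M & forall x, nm (g x) <= M * (1 + nm x) ^+ N.
Definition pg g := exists N, pgN N g.

Lemma one_nm (x : V) : 1 <= 1 + nm x. by rewrite lerDl nm_ge0. Qed.

Lemma pgN_le N N' g : (N <= N')%N -> pgN N g -> pgN N' g.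
move=> h [e [M M0 b]]; split=> //; exists M => // x; apply: le_trans (b x) _.
by rewrite ler_wpM2l // ler_weXn2l // one_nm.
Qed.

Lemma pgD f g : pg f -> pg g -> pg (fun x => f x + g x).
move=> [N hf] [N' hg]; exists (maxn N N').
have [e [M M0 b]] := pgN_le (leq_maxl N N') hf; have [e' [M' M0' b']] := pgN_le (leq_maxr N N') hg.
split; first by move=> x; exact: difD.
exists (M + M'); first exact: addr_ge0.
by move=> x; apply: le_trans (nmD _ _) _; rewrite mulrDl lerD.
Qed.

Lemma pgM f g : pg f -> pg g -> pg (fun x => f x * g x).
move=> [N [e [M M0 b]]] [N' [e' [M' M0' b']]]; exists (N + N')%N.
split; first by move=> x; exact: difM.
exists (M * M'); first exact: mulr_ge0.
by move=> x; rewrite nmM exprD mulrACA ler_pM ?nm_ge0.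
Qed.

Lemma pg_cst c : pg (fun=> c).
exists 0%N; split; first by move=> x; exact: dif_cst.
by exists (nm c); [exact: nm_ge0|move=> x; rewrite expr0 mulr1].
Qed.

Lemma pg_ent g : pg g -> ent g. by case=> N []. Qed.

Lemma pg_lin g (L : V -> V) : lin L -> (exists2 K : R, 0 <= K & forall h, nm (L h) <= K * nm h) ->
 pg g -> pg (fun x => g (L x)).
move=> l bL [N [e [M M0 b]]]; exists N; split.
 by move=> x; apply: (dif_comp (g := g)) => //; exists L; exact: hd_lin.
have [K K0 hK] := bL; exists (M * (1 + K) ^+ N); first by side.
move=> x; apply: le_trans (b _) _; rewrite -mulrA ler_wpM2l // -exprMn.
apply: lerXn2r; rewrite ?nnegrE ?mulr_ge0 ?addr_ge0 ?nm_ge0 //.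
have := hK x; have := nm_ge0 x; nra.
Qed.

Lemma line_bd (x e : V) (z : C^o) (r : R) : nm z < r -> 1 + nm (x + z *' e) <= 1 + nm x + r * nm e.
move=> zr; rewrite -addrA lerD2l; apply: le_trans (nmD _ _) _; rewrite nmZ lerD2l.
by rewrite ler_wpM2r ?nm_ge0 // ltW.
Qed.

Lemma pgN_disc N g (x e : V) (r : R) M : 0 < r -> 0 <= M -> ent g ->
  (forall x, nm (g x) <= M * (1 + nm x) ^+ N) ->
 (forall k, nm (dcoef e g k x) <= 4 * (M * (1 + nm x + r * nm e) ^+ N) / (r / 3) ^+ k) /\
 forall m (z : C^o), nm z <= r / 6 -> nm (g (x + z *' e) - \sum_(k < m) dcoef e g k x * z ^+ k) <=
  8 * (M * (1 + nm x + r * nm e) ^+ N) * (nm z / (r / 3)) ^+ m.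
move=> r0 M0 eg b.
have db (z : C^o) : nm z < r -> nm (g (x + z *' e)) <= M * (1 + nm x + r * nm e) ^+ N.
 move=> zr; apply: le_trans (b _) _; rewrite ler_wpM2l //.
 apply: lerXn2r; rewrite ?nnegrE ?addr_ge0 ?nm_ge0 ?mulr_ge0 ?nm_ge0 ?(ltW r0) //.
 exact: line_bd.
by have [_ h1 h2] := disc_tc r0 (fun z _ => dif_on_line (eg _)) db.
Qed.

(** Liouville's argument: on a disc of radius [r] the Taylor remainder of order [N + 1] is of size
    [r ^ N / r ^ (N + 1)], and [r] is taken at least [2 ^ j]. *)
Lemma pgN_poly N g (e x : V) (z : C^o) : pgN N g ->
 g (x + z *' e) = \sum_(k < N.+1) dcoef e g k x * z ^+ k.
move=> [eg [M M0 b]]; apply: subr0_eq; apply: nm_le0.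
pose B := 1 + nm x + nm e; have B0 : 0 <= B by rewrite !addr_ge0 ?nm_ge0.
apply: (@pow2_lim0 R _ (8 * (M * B ^+ N) * (3 * nm z) ^+ N.+1) 0) => j _.
have z0 := nm_ge0 z.
pose r := 6 * (nm z + 1) * 2 ^+ j.
have p2 : 1 <= (2 : R) ^+ j by rewrite exprn_ege1 // ler1n.
have r1 : 1 <= r by rewrite /r; nra.
have r2 : 2 ^+ j <= r by rewrite /r; nra.
have r0 : 0 < r by lra.
have [_ h] := @pgN_disc N g x e r M r0 M0 eg b.
have z6 : nm z <= r / 6 by rewrite /r; nra.
apply: le_trans (h N.+1 z z6) _.
have BN : (1 + nm x + r * nm e) ^+ N <= r ^+ N * B ^+ N.
 have rB0 : 0 <= r * B := mulr_ge0 (ltW r0) B0.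
 have s0 : 0 <= 1 + nm x + r * nm e by side.
 rewrite -exprMn; apply: lerXn2r; rewrite ?nnegrE //.
 have := nm_ge0 x; rewrite /B; move: r1; clear; move: (r) => t; nra.
have rN : 0 < r ^+ N by side.
have q0 : 0 <= (3 * nm z) ^+ N.+1 by side.
have -> : (nm z / (r / 3)) ^+ N.+1 = (3 * nm z) ^+ N.+1 / (r ^+ N * r).
 rewrite -exprSr -expr_div_n; congr (_ ^+ _); field; by rewrite gt_eqF.
apply: le_trans (_ : 8 * (M * (r ^+ N * B ^+ N)) * ((3 * nm z) ^+ N.+1 / (r ^+ N * r)) <= _).
 have qq : 0 <= (3 * nm z) ^+ N.+1 / (r ^+ N * r) by side.
 rewrite (ler_wpM2r qq) //.
 by rewrite ler_wpM2l // ler_wpM2l.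
have -> : 8 * (M * (r ^+ N * B ^+ N)) * ((3 * nm z) ^+ N.+1 / (r ^+ N * r)) = 8 * (M * B ^+ N) * (3 * nm z) ^+ N.+1 / r by field; rewrite !gt_eqF.
have n8 : (0 : R) <= 8 by [].
have c0 := mulr_ge0 (mulr_ge0 n8 (mulr_ge0 M0 (exprn_ge0 N B0))) q0.
rewrite (ler_wpM2l c0) // exprVn lef_pV2 ?posrE //; lra.
Qed.

Lemma pgN_dcoef N g e k : (k <= N)%N -> pgN N g -> pgN (N - k) (dcoef e g k).
move=> kN [eg [M M0 b]]; split; first by move=> x; apply: dif_dcoef; exact: hol_ent.
exists (4 * M * (1 + nm e) ^+ N * 3 ^+ k); first by side.
move=> x; have x1 : 0 < 1 + nm x by side.
have [h _] := @pgN_disc N g x e (1 + nm x) M x1 M0 eg b.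
apply: le_trans (h k) _.
have -> : 1 + nm x + (1 + nm x) * nm e = (1 + nm x) * (1 + nm e) by ring.
rewrite exprMn [X in 4 * (M * (X * _))](_ : _ = (1 + nm x) ^+ (N - k) * (1 + nm x) ^+ k); last by rewrite -exprD subnK.
rewrite expr_div_n; apply: le_of_eq; field.
by rewrite gt_eqF ?exprn_gt0 //= gt_eqF ?exprn_gt0.
Qed.

Lemma pgN_dcoef_high N g e k x : (N < k)%N -> pgN N g -> dcoef e g k x = 0.
move=> Nk h; have := asy_poly (\poly_(i < N.+1) dcoef e g i x).
move=> /asy_tc; have -> : (fun z => (\poly_(i < N.+1) dcoef e g i x).[z]) = (fun z : C^o => g (x + z *' e)) by apply/funext => z; rewrite horner_poly (pgN_poly _ _ _ h).
by rewrite /dcoef => ->; rewrite coef_poly ltnS leqNgt Nk.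
Qed.

Lemma pg_dcoef g e k : pg g -> pg (dcoef e g k).
move=> [N h]; case: (leqP k N) => kN; first by exists (N - k)%N; exact: pgN_dcoef.
have -> : dcoef e g k = (fun=> 0) by apply/funext => x; exact: pgN_dcoef_high kN h.
exact: pg_cst.
Qed.

Lemma pg_dd g v : pg g -> pg (dd v g).
move=> h; have -> : dd v g = dcoef v g 1 by apply/funext => x; rewrite dcoef1 //; apply: hol_ent; exact: pg_ent.
exact: pg_dcoef.
Qed.

Lemma liouville g x : pgN 0 g -> g x = g 0.
move=> h; have := pgN_poly x 0 1 h; rewrite scale1r add0r big_ord1 expr0 mulr1 => ->.
by rewrite dcoef0 //; apply: hol_ent; case: h.
Qed.

(** Take the least growth exponent [N]. The coefficient of order [N] along a direction is constant
    by Liouville; if it vanished for all directions, the lines through 0 would show a smaller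
    exponent. *)
Lemma monic_dir g x0 : pg g -> g x0 != 0 -> exists e N (c : C^o), [/\ c != 0, pgN N g & forall x, dcoef e g N x = c].
move=> hg gx.
have ex : exists N, `[< pgN N g >] by case: hg => N h; exists N; apply/asboolP.
case: (ex_minnP ex) => N /asboolP h hmin.
have cst e x : dcoef e g N x = dcoef e g N 0 by apply: liouville; have := @pgN_dcoef N g e N (leqnn N) h; rewrite subnn.
have [[e he]|no] := pselect (exists e, dcoef e g N 0 != 0); first by exists e, N, (dcoef e g N 0); split.
have z e : dcoef e g N 0 = 0 by apply/eqP; apply: contrapT => /negP hh; apply: no; exists e.
case: N h hmin cst no z => [|N] h hmin cst no z.
 by move: gx; rewrite (liouville _ h) -(@dcoef0 g 0 0) ?z ?eqxx //; apply: hol_ent; case: h.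
suff /asboolP /hmin : pgN N g by rewrite ltnn.
have [eg [M M0 b]] := h; split=> //.
pose K := 4 * (M * (1 + 1) ^+ N.+1) * 3 ^+ N.
have K0 : 0 <= K by rewrite /K mulr_ge0 ?exprn_ge0 // mulr_ge0 // mulr_ge0 ?exprn_ge0 // addr_ge0.
exists (nm (g 0) + K * N.+1%:R); first by side.
move=> x; have [->|xn0] := eqVneq x 0.
 by rewrite nm0 addr0 expr1n mulr1 lerDl (mulr_ge0 K0).
have x0' : 0 < nm x by side.
pose e : V := (nm x)^-1%:C *: x.
have ne : nm e = 1 by rewrite nmZ nm_real gtr0_norm ?invr_gt0 // mulVf // gt_eqF.
have := pgN_poly e 0 (nm x)%:C h; rewrite add0r scalerA -rmorphM /= mulfV ?gt_eqF // scale1r => ->.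
rewrite big_ord_recr /= z mul0r addr0; apply: le_trans (nm_sum _ _ _) _.
have [hk _] := @pgN_disc N.+1 g 0 e 1 M ltr01 M0 eg b.
apply: le_trans (_ : \sum_(k < N.+1) K * (1 + nm x) ^+ N <= _).
 apply: ler_sum => k _; rewrite nmM nmX nm_real gtr0_norm //.
 apply: ler_pM; rewrite ?nm_ge0 ?exprn_ge0 ?(ltW x0') //.
  apply: le_trans (hk k) _; rewrite nm0 addr0 ne mulr1 /K.
  have c0 : 0 <= 4 * (M * (1 + 1) ^+ N.+1) by side.
  rewrite (ler_wpM2l c0) //.
  rewrite -exprVn invf_div divr1; apply: ler_weXn2l; first by lra.
  by rewrite -ltnS.
 apply: le_trans (_ : (1 + nm x) ^+ k <= _); first by apply: lerXn2r; rewrite ?nnegrE ?addr_ge0 ?nm_ge0 // lerDr.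
 by apply: ler_weXn2l; [exact: one_nm|rewrite -ltnS].
have E : \sum_(k < N.+1) K * (1 + nm x) ^+ N = K * N.+1%:R * (1 + nm x) ^+ N by rewrite sumr_const card_ord -[in RHS]mulrA [_%:R * _]mulrC mulrA mulr_natr.
rewrite E; apply: ler_wpM2r; first by side.
by rewrite lerDr nm_ge0.
Qed.

End Growth.

Notation de i := (dd (ev _ i)).
Ltac vring := apply: coord_inj => ?; rewrite !(coordD, coordN, coordZ); ring.
Ltac dif_more ::= first [exact: dif_coord | exact: ent_dd | match goal with |- dif (fun x => ?f (@?g x)) _ => lazymatch g with (fun x => x) => fail | _ => apply: (@dif_comp _ _ _ _ g f); dfs end end].

(** * Polynomials whose coefficients stay in a ring of functions *)

Section Families.
Variables (R : realType) (T : Type).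
Local Notation C := R[i].
Variable K : (T -> C^o) -> Prop.
Hypotheses (Kc : forall c, K (fun=> c)) (KD : forall f g, K f -> K g -> K (fun x => f x + g x)) (KM : forall f g, K f -> K g -> K (fun x => f x * g x)).

Lemma K_sum I (s : seq I) (P : pred I) (F : I -> T -> C^o) : (forall i, P i -> K (F i)) ->
 K (fun x => \sum_(i <- s | P i) F i x).
move=> h; elim: s => [|i s IH].
 by have -> : (fun x => \sum_(i <- [::] | P i) F i x) = (fun=> 0) by apply/funext => x; rewrite big_nil.
case Pi: (P i).
 have -> : (fun x => \sum_(j <- i :: s | P j) F j x) = (fun x => F i x + \sum_(j <- s | P j) F j x) by apply/funext => x; rewrite big_cons Pi.
 by apply: KD => //; exact: h.
by have -> : (fun x => \sum_(j <- i :: s | P j) F j x) = (fun x => \sum_(j <- s | P j) F j x)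
 by apply/funext => x; rewrite big_cons Pi.
Qed.

(** [K] is later taken to be polynomial growth, differentiability at a point or continuity at a
    point, so that the constructions with matrices and polynomials are made once for all three. *)
Definition pf (P : T -> {poly C}) := forall k, K (fun x => (P x)`_k).

Lemma pfD P Q : pf P -> pf Q -> pf (fun x => P x + Q x).
by move=> p q k; under eq_fun do rewrite coefD; exact: KD. Qed.
Lemma pfM P Q : pf P -> pf Q -> pf (fun x => P x * Q x).
by move=> p q k; under eq_fun do rewrite coefM; apply: K_sum => i _; exact: KM. Qed.
Lemma pfC f : K f -> pf (fun x => (f x)%:P).
by move=> h [|k]; under eq_fun do rewrite coefC /=. Qed.
Lemma pf_cst p : pf (fun=> p). by move=> k; exact: Kc. Qed.
Lemma pfN P : pf P -> pf (fun x => - P x).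
move=> p k; have -> : (fun x => (- P x)`_k) = (fun x => (-1) * (P x)`_k) by apply/funext => x; rewrite coefN mulN1r.
by apply: KM.
Qed.
Lemma pf_sum I (s : seq I) (P : pred I) (F : I -> T -> {poly C}) : (forall i, P i -> pf (F i)) ->
 pf (fun x => \sum_(i <- s | P i) F i x).
by move=> h k; under eq_fun do rewrite coef_sum; apply: K_sum => i Pi; exact: h. Qed.
Lemma pf_prod I (s : seq I) (F : I -> T -> {poly C}) : (forall i, pf (F i)) ->
 pf (fun x => \prod_(i <- s) F i x).
move=> h; elim: s => [|i s IH]; first by under eq_fun do rewrite big_nil; exact: pf_cst.
by under eq_fun do rewrite big_cons; exact: pfM.
Qed.

Lemma pf_char_poly N (A : T -> 'M[C]_N) : (forall i j, K (fun x => A x i j)) -> pf (fun x => char_poly (A x)).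
move=> h.
have key i j : pf (fun x => char_poly_mx (A x) i j).
 have -> : (fun x => char_poly_mx (A x) i j) = (fun x => (('X *+ (i == j)) : {poly C}) - (A x i j)%:P) by apply/funext => x; rewrite !mxE.
 by apply: pfD; [exact: pf_cst|apply: pfN; apply: pfC].
rewrite /char_poly /determinant; apply: pf_sum => s _; apply: pfM; first exact: pf_cst.
by apply: pf_prod => i; exact: key.
Qed.

Lemma K_mxpow N (A : T -> 'M[C]_N) : (forall i j, K (fun x => A x i j)) ->
 forall k i j, K (fun x => (iter k (fun B => A x *m B) 1%:M) i j).
move=> h; elim=> [|k IH] i j; first by under eq_fun do rewrite /= mxE; exact: Kc.
have -> : (fun x => (iter k.+1 (fun B => A x *m B) 1%:M) i j) =
  (fun x => \sum_l A x i l * (iter k (fun B => A x *m B) 1%:M) l j).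
 by apply/funext => x; rewrite /= mxE.
by apply: K_sum => l _; exact: KM.
Qed.

(** Division by a monic polynomial never divides by a coefficient, so quotient and remainder keep
    their coefficients in the class [K]. *)
Lemma pf_div N (p : T -> {poly C}) : pf p -> (forall x, p x \is monic) -> (forall x, size (p x) = N.+1) ->
 forall s q, pf q -> (forall x, (size (q x) <= s)%N) -> exists Q r, [/\ pf Q, pf r &
  forall x, q x = Q x * p x + r x /\ (size (r x) <= N)%N].
move=> hp pm ps; have p0 : pf (fun=> (0 : {poly C})) by exact: pf_cst.
elim=> [|s IH] q hq qs.
 exists (fun=> 0), q; split=> // x.
 by rewrite mul0r add0r; split=> //; apply: leq_trans (qs x) _.
case: (leqP s.+1 N) => sN.
 exists (fun=> 0), q; split=> // x.
 by rewrite mul0r add0r; split=> //; apply: leq_trans (qs x) _.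
pose m x : {poly C} := ((q x)`_s)%:P * 'X^(s - N).
have hm : pf m by apply: pfM; [apply: pfC; exact: hq|exact: pf_cst].
have hq' : pf (fun x => q x - m x * p x) by apply: pfD => //; apply: pfN; exact: pfM.
have qs' x : (size (q x - m x * p x)%R <= s)%N.
 apply/leq_sizeP => j; rewrite leq_eqVlt => /orP [/eqP <-|sj].
  rewrite coefB /m -mulrA coefCM coefXnM ltnNge leq_subr /= subKn //.
  have := pm x; rewrite monicE lead_coefE ps /= => /eqP ->; by rewrite mulr1 subrr.
 rewrite coefB nth_default ?(leq_trans (qs x)) // /m -mulrA coefCM coefXnM.
 case: ltnP => _; first by rewrite mulr0 subrr.
 by rewrite (nth_default _ (_ : size (p x) <= _)%N) ?mulr0 ?subrr // ps; lia.
have [Q [r [hQ hr E]]] := IH _ hq' qs'.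
exists (fun x => m x + Q x), r; split=> //; first exact: pfD.
by move=> x; have [E1 E2] := E x; split=> //; rewrite mulrDl -addrA -E1 addrC subrK.
Qed.

End Families.

(** * Companion matrices *)

Section Companion.
Variables (F : fieldType) (N : nat).
(** Companion matrix acting on rows: at a root [z] the row of powers of [z] is an eigenvector, so a
    polynomial in the matrix acts there as evaluation at [z]. *)
Definition cmx (p : {poly F}) : 'M[F]_N.+1 :=
 \matrix_(i, j) if (j == N :> nat) then - p`_i else (i == j.+1 :> nat)%:R.
Definition zrow (z : F) : 'rV[F]_N.+1 := \row_j z ^+ j.

Lemma zrow_cmx p z : p \is monic -> size p = N.+2 -> root p z -> zrow z *m cmx p = z *: zrow z.
move=> pm ps pz; apply/rowP => j; rewrite !mxE -exprS.
case: (altP (val j =P N)) => jN; last first.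
 have lt : (j.+1 < N.+1)%N by rewrite ltnS ltn_neqAle jN -ltnS ltn_ord.
 rewrite (bigD1 (Ordinal lt)) //= !mxE (negbTE jN) eqxx mulr1 big1 ?addr0 // => i ij.
 by rewrite !mxE (negbTE jN) (_ : (i == j.+1 :> nat) = false) ?mulr0 //; apply: negbTE.
have : p.[z] = 0 by apply/eqP.
rewrite horner_coef ps big_ord_recr /=.
have -> : p`_N.+1 = 1 by move: pm; rewrite monicE lead_coefE ps => /eqP.
rewrite mul1r => /eqP; rewrite addrC addr_eq0 jN => /eqP ->.
rewrite -sumrN; apply: eq_bigr => i _; by rewrite !mxE jN eqxx mulrN mulrC.
Qed.

Lemma zrow_neq0 z : zrow z != 0.
by apply/eqP => /rowP /(_ 0); rewrite !mxE expr0 => /eqP; rewrite oner_eq0. Qed.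

Lemma zrow_iter (A : 'M[F]_N.+1) z k : zrow z *m A = z *: zrow z ->
 zrow z *m iter k (fun B => A *m B) 1%:M = z ^+ k *: zrow z.
move=> h; elim: k => [|k IH] /=; first by rewrite mulmx1 expr0 scale1r.
by rewrite mulmxA h -scalemxAl IH scalerA -exprS.
Qed.

Lemma eigen_char (G : 'M[F]_N.+1) z c : zrow z *m G = c *: zrow z -> (char_poly G).[c] = 0.
move=> h; apply/eqP; have : eigenvalue G c by apply/eigenvalueP; exists (zrow z) => //; exact: zrow_neq0.
by rewrite eigenvalue_root_char.
Qed.
End Companion.

(** * Location of roots, divisibility from bounds, interpolation *)

Section Poly.
Variable R : realType.
Local Notation C := R[i].

Lemma poly_split (p : {poly C}) : p \is monic -> exists2 s : seq C, p = \prod_(a <- s) ('X - a%:P) & size p = (size s).+1.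
move=> pm; have [s E] := closed_field_poly_normal p.
have E' : p = \prod_(a <- s) ('X - a%:P) by rewrite {1}E; move: pm; rewrite monicE => /eqP ->; rewrite scale1r.
by exists s => //; rewrite E' size_prod_XsubC.
Qed.

(** The modulus of [p] at [z0] is the product of the distances from [z0] to the roots. *)
Lemma root_near (p : {poly C}) N (z0 : C^o) (e : R) : p \is monic -> size p = N.+2 -> 0 < e ->
 nmc (p.[z0]) < e ^+ N.+1 -> exists2 z : C^o, root p z & nm (z - z0) < e.
move=> pm ps e0 h; have [s E sz] := poly_split pm; rewrite ps in sz; case: sz => sz.
apply: contrapT => no.
have far a : a \in s -> e <= nmc (z0 - a).
 move=> ha; rewrite leNgt; apply/negP => lt; apply: no; exists a; last by rewrite nmC.
 by rewrite E root_prod_XsubC.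
suff : e ^+ N.+1 <= nmc (p.[z0]) by rewrite leNgt h.
rewrite E horner_prod nm_prod sz; elim: s far {E h sz no} => [|a s IH] far; first by rewrite big_nil expr0.
rewrite big_cons exprS /=; apply: ler_pM; rewrite ?exprn_ge0 ?(ltW e0) //.
 by rewrite hornerXsubC; apply: far; rewrite mem_head.
by apply: IH => b hb; apply: far; rewrite in_cons hb orbT.
Qed.

Lemma root_bound (p : {poly C}) N (z : C^o) (B : R) : p \is monic -> size p = N.+1 -> root p z ->
 (forall k, (k < N)%N -> nmc (p`_k) <= B) -> nm z <= 1 + N%:R * B.
move=> pm ps pz hB; case: (leP (nm z) 1) => z1.
 apply: le_trans z1 _; rewrite lerDl mulr_ge0 //.
 case: N ps hB => [|N] ps hB; last by apply: le_trans (nm_ge0 _) (hB 0%N _).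
 by have := root_size_gt1 (monic_neq0 pm) pz; rewrite ps.
have : p.[z] = 0 by apply/eqP.
rewrite horner_coef ps big_ord_recr /=.
have -> : p`_N = 1 by move: pm; rewrite monicE lead_coefE ps => /eqP.
rewrite mul1r => /eqP; rewrite addrC addr_eq0 => /eqP E.
case: N ps hB E => [|N] ps hB E.
 by move: E; rewrite big_ord0 oppr0 expr0 => /eqP; rewrite oner_eq0.
have z0 : 0 < nm z by lra.
have : nm z ^+ N.+1 <= N.+1%:R * B * nm z ^+ N.
 rewrite -nmX E nmN; apply: le_trans (nm_sum _ _ _) _.
 apply: le_trans (_ : \sum_(i < N.+1) B * nm z ^+ N <= _); last by rewrite -mulrA mulr_natl sumr_const card_ord.
 apply: ler_sum => i _; rewrite nmM nmX; apply: ler_pM; rewrite ?nm_ge0 ?exprn_ge0 ?(ltW z0) ?hB //.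
 by apply: ler_weXn2l; [exact: ltW|rewrite -ltnS].
rewrite exprSr mulrC ler_pM2r ?exprn_gt0 //; lra.
Qed.

Lemma horner_dif (p : {poly C}) (z : C^o) : dif (fun z : C^o => p.[z] : C^o) z.
apply: (dif_eq (f := fun z : C^o => \sum_(i < size p) p`_i * z ^+ i : C^o)); first by move=> y; rewrite horner_coef.
by apply: dif_sum => i _; apply: difM; [exact: dif_cst|apply: difX; exact: dif_id].
Qed.

(** Roots of [q] are removed one at a time: the bound forces a root of [q] to be a root of [p], and
    it persists for the two cofactors. *)
Lemma bounded_dvdp (q p : {poly C}) : q != 0 ->
 (forall a : C^o, root q a -> exists K d : R, 0 < d /\ forall u : C^o, 0 < nm (u - a) < d -> nmc (p.[u]) <= K * nmc (q.[u])) ->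
 exists r, p = r * q.
have [m sq] := ubnP (size q); elim: m q p sq => // m IH q p sq q0 h.
have [s E] := closed_field_poly_normal q.
case: s E => [|a s] E.
 rewrite big_nil in E; exists ((lead_coef q)^-1 *: p); rewrite {2}E -scalerAl -scalerAr scalerA mulVf ?scale1r ?mulr1 //.
 by rewrite lead_coef_eq0.
pose q1 := lead_coef q *: \prod_(z <- s) ('X - z%:P).
have Eq : q = q1 * ('X - a%:P) by rewrite {1}E big_cons /q1 -scalerAl mulrC.
have q10 : q1 != 0 by apply: contra q0 => /eqP q10; rewrite Eq q10 mul0r.
have ra : root q a by rewrite Eq rootM root_XsubC eqxx orbT.
have pa : root p a.
 apply/eqP; apply: (@nm_le0 R C^o); apply/ler_addgt0Pl => e e0; rewrite addr0.
 have [K [d [d0 hK]]] := h a ra.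
 have e2 : 0 < e / 2 by lra.
 have [d1 d10 c1] := dif_cont (horner_dif p a) e2.
 have [s1 s10 sK] := ex_small e2 (normr_ge0 K).
 have [d2 d20 c2] := dif_cont (horner_dif q a) s10.
 pose t := minr d (minr d1 d2) / 2.
 have m0 : 0 < minr d (minr d1 d2) by side.
 have t0 : 0 < t by rewrite divr_gt0.
 have : t < minr d (minr d1 d2) by rewrite /t; lra.
 rewrite !lt_min => /and3P [td td1 td2].
 have nt : nmc (a + t%:C - a) = t by rewrite addrC addKr nm_real gtr0_norm.
 have h1 := c1 (a + t%:C); rewrite nt in h1; have {}h1 := h1 td1.
 have h2 := c2 (a + t%:C); rewrite nt (eqP ra) subr0 in h2; have {}h2 := h2 td2.
 have h3 := hK (a + t%:C); rewrite nt t0 td in h3; have {}h3 := h3 isT.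
 have h4 : K * nmc (q.[a + t%:C]) <= e / 2.
  apply: le_trans (ltW sK); rewrite mulrC; apply: le_trans (ler_wpM2l (nm_ge0 _) (ler_norm K)) _.
  by rewrite ler_wpM2r // ltW.
 have := nm_dist (p.[a + t%:C] : C^o) (p.[a] : C^o) 0; rewrite !subr0 nmC; lra.
have [p1 Ep] := factor_theorem _ _ pa.
have [r Er] : exists r, p1 = r * q1; last by exists r; rewrite Ep Er Eq mulrA.
apply: IH => //.
 by move: sq; rewrite Eq size_Mmonic ?monicXsubC // size_XsubC; lia.
move=> b rb; have rb' : root q b by rewrite Eq rootM rb.
have [K [d [d0 hK]]] := h b rb'.
have [ba|nba] := eqVneq b a.
 exists K, d; split=> // u /andP [u0 ud]; have := hK u; rewrite u0 ud => /(_ isT).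
 rewrite Ep Eq !hornerM hornerXsubC !nmM mulrA ler_pM2r -?ba //.
have nb : 0 < nmc (b - a) by rewrite nm_gt0 subr_eq0.
exists K, (minr d (nmc (b - a))); split; first by side.
move=> u /andP [u0] /lt_minP [ud ua]; have := hK u; rewrite u0 ud => /(_ isT).
rewrite Ep Eq !hornerM hornerXsubC !nmM mulrA ler_pM2r //.
by have := nm_dist (u : C^o) b a; rewrite [nm (b - u)]nmC; lra.
Qed.

(** Bound at 0 for the Newton form [b a + (X - a) L], where [L] interpolates the divided difference
    of [b], itself bounded by [24 * M / rho]. *)
Fixpoint interp_bd (rho Z M : R) k : R := if k is k'.+1 then M + Z * interp_bd rho Z (24 * M / rho) k' else 0.

(** The bound ignores the distances between the nodes, which is what allows roots to collide. Each
    divided difference is again holomorphic on [D], and near its node it is bounded through the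
    Taylor expansion rather than through its denominator. *)
Lemma interp_bound (D : C^o -> Prop) (rho Z : R) : 0 < rho -> 0 <= Z -> forall (s : seq C) (b : C^o -> C^o) (M : R),
 uniq s -> 0 <= M -> (forall z, D z -> dif b z) -> (forall z, D z -> nm (b z) <= M) ->
 (forall a : C^o, a \in s -> nm a <= Z /\ forall z, nm (z - a) < rho -> D z) ->
 exists L : {poly C}, [/\ (size L <= size s)%N, forall a, a \in s -> L.[a] = b a & nmc (L.[0]) <= interp_bd rho Z M (size s)].
move=> r0 Z0; elim=> [|a s IH] b M us M0 db bM hs.
 by exists 0; split; rewrite ?size_poly0 // horner0 nm0.
have [za Da] := hs a (mem_head _ _).
have Daa : D a by apply: Da; rewrite subrr nm0.
pose g (w : C^o) := b (a + w).
have lt (w : C^o) : nm w < rho -> D (a + w) by move=> h; apply: Da; rewrite addrC addKr.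
have dg w : nm w < rho -> dif g w.
 move=> h; apply: (dif_comp (g := b)); last by apply: db; exact: lt.
 by apply: difD; [exact: dif_cst|exact: dif_id].
have [A B T] := disc_tc r0 dg (fun w h => bM _ (lt w h)).
have g0 : tc g 0%N = b a by rewrite (tc0 A) /g addr0.
pose q (z : C^o) : C^o := if z == a then tc g 1%N else (b z - b a) / (z - a).
have M20 : 0 <= 24 * M / rho by side.
have dq z : D z -> dif q z.
 move=> Dz; have [->|za0] := eqVneq z a; last first.
  have n0 : 0 < nmc (z - a) by rewrite nm_gt0 subr_eq0.
  apply: (@dif_ext R C^o C^o (fun z => (b z - b a) / (z - a)) _ _ (nmc (z - a))) => //.
   move=> y hy; rewrite /q; case: eqP => // ya; move: hy; rewrite ya nmC ltxx //.
  apply: difM; first by apply: difB; [exact: db|exact: dif_cst].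
  apply: difV; first by rewrite subr_eq0.
  by apply: difB; [exact: dif_id|exact: dif_cst].
 exists (fun h => tc g 2%N * h : C^o); split.
 - by move=> c x y; rewrite /GRing.scale /=; ring.
 - by exists (nm (tc g 2%N)); [exact: nm_ge0|move=> h; rewrite nmM].
 - move=> e e0; have r3 : 0 <= rho / 3 by lra.
  have K0 : 0 <= 8 * M / (rho / 3) ^+ 3 by side.
  have [s1 s10 sK] := ex_small e0 K0.
  exists (minr (rho / 6) s1); first by side.
  move=> h /lt_minP [h6 hs1]; have [->|h0] := eqVneq h 0.
   by rewrite addr0 subrr mulr0 subrr !nm0 mulr0.
  have := T 3%N h (ltW h6); rewrite !big_ord_recl big_ord0 /= addr0 expr0 mulr1 /bump /= expr1 g0 => hh.
  have nh : 0 < nm h by side.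
  rewrite /q eqxx; case: eqP => [/eqP|_]; first by rewrite -subr_eq0 addrC addKr (negbTE h0).
  have -> : (b (a + h) - b a) / (a + h - a) - tc g 1%N - tc g 2%N * h = (g h - (b a + (tc g 1%N * h + tc g 2%N * h ^+ 2))) / h by rewrite [a + h - a]addrC addKr /g; field.
  rewrite nmM nmV ler_pdivrMr //; apply: le_trans hh _.
  rewrite expr_div_n mulrA [_ / _ ^+ 3]mulrAC.
  have -> : nm h ^+ 3 = nm h * nm h * nm h by ring.
  rewrite !mulrA ler_pM2r // ler_pM2r //.
  by apply: le_trans (ltW sK); rewrite mulrC ler_wpM2r // ltW.
have bq z : D z -> nm (q z) <= 24 * M / rho.
 move=> Dz; rewrite /q; case: eqP => [_|/eqP za0].
  have := B 1%N; rewrite expr1 => /le_trans; apply.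
  have -> : 4 * M / (rho / 3) = 12 * M / rho by field; rewrite gt_eqF.
  by rewrite ler_pM2r ?invr_gt0 //; lra.
 have n0 : 0 < nmc (z - a) by rewrite nm_gt0 subr_eq0.
 rewrite nmM nmV ler_pdivrMr //; case: (leP (nmc (z - a)) (rho / 6)) => h6.
  have := T 1%N (z - a) h6; rewrite big_ord1 expr0 mulr1 expr1 g0 /g [a + _]addrC subrK.
  move=> /le_trans; apply.
  by apply: le_of_eq; field; rewrite gt_eqF.
 apply: le_trans (nmB _ _) _; apply: le_trans (lerD (bM _ Dz) (bM _ Daa)) _.
 rewrite mulrAC ler_pdivlMr //; nra.
move: us; rewrite /= => /andP [as_ us].
have [L [sL hL bL]] := IH q _ us M20 dq bq (fun c hc => hs c (mem_behead (s := a :: s) hc)).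
exists ((b a)%:P + ('X - a%:P) * L); split.
- apply: leq_trans (size_polyD _ _) _; rewrite geq_max size_polyC; apply/andP; split; first by case: (_ != _).
 by apply: leq_trans (size_polyMleq _ _) _; rewrite size_XsubC; exact: sL.
- move=> c; rewrite in_cons hornerD hornerC hornerM hornerXsubC => /orP [/eqP ->|cs]; first by rewrite subrr mul0r addr0.
 have ca : c != a by apply: contraNneq as_ => <-.
 rewrite (hL _ cs) /q (negbTE ca); field; by rewrite subr_eq0.
- rewrite hornerD hornerC hornerM hornerXsubC sub0r /=; apply: le_trans (nmD _ _) _.
 apply: lerD; first exact: bM.
 by rewrite nmM nmN; apply: ler_pM; rewrite ?nm_ge0.
Qed.

End Poly.

(** * Projection along a direction *)

Section Direction.
Variables (R : realType) (n : nat).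
Local Notation C := R[i].
Local Notation V := (Cn R n).
Variables (e : V) (j : 'I_n).
Hypothesis ej : coord e j != 0.

Definition zc (x : V) : C^o := coord x j / coord e j.
Definition prj (x : V) : V := x - zc x *' e.

Lemma zc_line x (z : C) : zc (x + z *: e) = zc x + z.
by rewrite /zc coordD coordZ; field. Qed.
Lemma prj_line x (z : C) : prj (x + z *: e) = prj x.
by rewrite /prj zc_line scalerDl opprD addrACA subrr addr0. Qed.
Lemma prjK x : prj x + zc x *' e = x.
by rewrite /prj subrK. Qed.
Lemma zc_lin : lin zc.
by move=> a x y; rewrite /zc coordD coordZ /GRing.scale /=; ring. Qed.
Lemma zc_bd : exists2 K : R, 0 <= K & forall x, nm (zc x) <= K * nm x.
exists (nmc ((coord e j)^-1)); first exact: nm_ge0.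
by move=> x; rewrite nmM mulrC ler_wpM2l ?nm_ge0 ?nm_coord.
Qed.
Lemma prj_lin : lin prj.
move=> a x y; rewrite /prj zc_lin scalerDl opprD addrACA scalerBr; congr (_ - _ + _).
by rewrite -[a *: zc x]/((a * zc x : C)) -scalerA.
Qed.
Lemma prj_bd : exists2 K : R, 0 <= K & forall x, nm (prj x) <= K * nm x.
have [K K0 h] := zc_bd; exists (1 + K * nm e); first by side.
move=> x; apply: le_trans (nmB _ _) _; rewrite nmZ mulrDl mul1r lerD2l.
by rewrite mulrAC ler_wpM2r ?nm_ge0.
Qed.
Lemma dif_prj x : dif prj x. by exists prj; apply: hd_lin; [exact: prj_lin|exact: prj_bd]. Qed.
Lemma pg_prj g : pg g -> pg (fun x => g (prj x)).
by apply: pg_lin; [exact: prj_lin|exact: prj_bd]. Qed.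
End Direction.

(** * Functions that are monic polynomials along a direction *)

Section Monic.
Variables (R : realType) (n : nat).
Local Notation C := R[i].
Local Notation V := (Cn R n).

Record mdir (g : V -> C^o) (e : V) N (c : C^o) : Prop := Mdir {
 md_c : c != 0; md_pg : pgN N g; md_lead : forall x, dcoef e g N x = c }.

Definition mpoly g e N (c : C^o) (x : V) : {poly C} := c^-1 *: \poly_(k < N.+1) dcoef e g k x.

Variables (g : V -> C^o) (e : V) (N : nat) (c : C^o).
Hypothesis h : mdir g e N c.

Lemma mpoly_coef x k : (mpoly g e N c x)`_k = c^-1 * dcoef e g k x.
rewrite coefZ coef_poly; case: ltnP => // k_; rewrite (pgN_dcoef_high e x k_) //; exact: md_pg h.
Qed.
Lemma mpoly_size x : size (mpoly g e N c x) = N.+1.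
have cn := md_c h; rewrite size_scale ?invr_eq0 // size_poly_eq // (md_lead h) //.
Qed.
Lemma mpoly_monic x : mpoly g e N c x \is monic.
by rewrite monicE lead_coefE mpoly_size /= mpoly_coef (md_lead h) mulVf // (md_c h). Qed.
Lemma mpoly_eval x (z : C) : (mpoly g e N c x).[z] = c^-1 * g (x + z *: e).
by rewrite hornerZ horner_poly (pgN_poly e x z (md_pg h)). Qed.
Lemma mpoly_root x (z : C) : root (mpoly g e N c x) z = (g (x + z *: e) == 0).
by rewrite /root mpoly_eval mulf_eq0 invr_eq0 (negbTE (md_c h)). Qed.
Lemma mpoly_pf : pf (@pg R n) (mpoly g e N c).
move=> k; have -> : (fun x => (mpoly g e N c x)`_k) = (fun x => c^-1 * dcoef e g k x) by apply/funext => x; exact: mpoly_coef.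
by apply: pgM; [exact: pg_cst|apply: pg_dcoef; exists N; exact: md_pg h].
Qed.

Lemma zero_near (p : V) (eps : R) : (0 < N)%N -> g p = 0 -> 0 < eps ->
 exists2 del : R, 0 < del & forall y, nm (y - p) < del -> exists2 z : C^o, nm z < eps & g (y + z *' e) = 0.
case: N h => // N' h' _ gp e0.
have e1 : 0 < eps ^+ N'.+1 by side.
have eg : ent g by apply: pg_ent; exists N'.+1; exact: md_pg h'.
have cn := md_c h'.
have [s s0 sc] := ex_small e1 (nm_ge0 (c^-1 : C^o)).
have [d d0 hd] := dif_cont (eg p) s0.
exists d => // y hy; have := hd y hy; rewrite gp subr0 => gy.
have pm : mpoly g e N'.+1 c y \is monic.
 rewrite monicE lead_coefE size_scale ?invr_eq0 // size_poly_eq ?(md_lead h') //=.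
 by rewrite coefZ coef_poly ltnSn (md_lead h') mulVf.
have ps : size (mpoly g e N'.+1 c y) = N'.+2 by rewrite size_scale ?invr_eq0 // size_poly_eq // (md_lead h').
have ev0 : (mpoly g e N'.+1 c y).[0] = c^-1 * g y by rewrite hornerZ horner_poly -(pgN_poly e y 0 (md_pg h')) scale0r addr0.
have lt : nmc ((mpoly g e N'.+1 c y).[0]) < eps ^+ N'.+1.
 rewrite ev0 nmM; apply: le_lt_trans sc; rewrite mulrC ler_wpM2r ?nm_ge0 // ltW //.
have [z rz zs] := root_near pm ps e0 lt; exists z; first by rewrite subr0 in zs.
move: rz; rewrite /root hornerZ horner_poly -(pgN_poly e y z (md_pg h')) mulf_eq0 invr_eq0 (negbTE cn).
by move=> /eqP.
Qed.

End Monic.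

(** * Geometric series and finite maxima *)

Section Series.
Variable R : realType.
Local Notation C := R[i].

Lemma series_cauchy (a : nat -> C^o) (B : R) : (forall k, nm (a k) <= B * 2^-1 ^+ k) ->
 forall m m', (m <= m')%N -> nm (\sum_(k < m) a k - \sum_(k < m') a k) <= 2 * B * 2^-1 ^+ m.
move=> h m m' /subnKC <-.
suff : nm (\sum_(k < m) a k - \sum_(k < m + (m' - m)) a k) <= 2 * B * (2^-1 ^+ m - 2^-1 ^+ (m + (m' - m))).
 move=> /le_trans; apply; have B0 : 0 <= B by have := h 0%N; rewrite expr0 mulr1; apply: le_trans; exact: nm_ge0.
 rewrite ler_wpM2l ?mulr_ge0 // gerBl; exact/ltW/pow2_gt0.
elim: (m' - m)%N => [|k IH]; first by rewrite addn0 !subrr nm0 mulr0.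
rewrite addnS big_ord_recr /= opprD addrA; apply: le_trans (nmB _ _) _.
apply: le_trans (lerD IH (h _)) _; rewrite pow2_half; set p := 2^-1 ^+ m; set q := 2^-1 ^+ (m + k).
by apply: le_of_eq; field.
Qed.

Lemma series_lim (a : nat -> C^o) (B : R) : (forall k, nm (a k) <= B * 2^-1 ^+ k) ->
 exists l : C^o, forall m, nm (\sum_(k < m) a k - l) <= 4 * B * 2^-1 ^+ m.
move=> /series_cauchy h; have [l hl] := complex_complete h; exists l => m.
by apply: le_trans (hl m) _; rewrite !mulrA -natrM.
Qed.

Lemma fin_bd (I : finType) (P : I -> R -> Prop) : (forall i, exists B, P i B) ->
 (forall i B B', B <= B' -> P i B -> P i B') -> exists2 B, 1 <= B & forall i, P i B.
move=> h mono; have k i : {B | P i B} by apply: cid; exact: h.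
exists (1 + \sum_i `|sval (k i)|); first by rewrite lerDl sumr_ge0.
move=> i; apply: (mono i (sval (k i))); last by case: (k i).
apply: le_trans (ler_norm _) _; rewrite (bigD1 i) //= addrCA lerDl addr_ge0 // sumr_ge0 //.
Qed.
End Series.

(** * The zero set: primality, norms and an identity principle *)

Section XSet.
Variables (R : realType) (n : nat).
Local Notation C := R[i].
Local Notation V := (Cn R n).
Variables (w : 'I_n -> nat) (d : nat) (f : V -> C^o).
Hypotheses (w0 : forall i, (0 < w i)%N) (d0 : (0 < d)%N) (ef : ent f) (hf : whom w d f) (red : reduced_germ f) (irr : irreducible_zero_germ f).
Local Notation act := (act w).

Definition near0 (P : V -> Prop) := exists2 r : R, 0 < r & forall x, nm x < r -> P x.

Lemma near0P P : near0 P <-> \forall x \near (0 : V), P x.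
split=> [[r r0 h]|/nearP [r r0 h]]; last by exists r => // x hx; apply: h; rewrite subr0.
by apply/nearP; exists r => // x; rewrite subr0 => /h.
Qed.
Lemma near0I P Q S : near0 P -> near0 Q -> (forall x, P x -> Q x -> S x) -> near0 S.
move=> [r r0 h] [s s0 k] H; exists (minr r s); first by side.
by move=> x /lt_minP [/h ? /k ?]; apply: H.
Qed.
Lemma near0W P Q : near0 P -> (forall x, P x -> Q x) -> near0 Q.
by move=> [r r0 h] H; exists r => // x /h; exact: H. Qed.

Lemma f_0 : f 0 = 0.
by rewrite -(act0 w0 0) hf expr0n gtn_eqF // mul0r. Qed.

Lemma X_act t x : f x = 0 -> f (act t x) = 0. by move=> h; rewrite hf h mulr0. Qed.

(** The zero set is the union of its intersections with [g1 = 0] and [g2 = 0], so irreducibility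
    makes one of them everything. *)
Lemma prime0 (g1 g2 : V -> C^o) : hol g1 0 -> hol g2 0 -> near0 (fun x => f x = 0 -> g1 x * g2 x = 0) ->
 near0 (fun x => f x = 0 -> g1 x = 0) \/ near0 (fun x => f x = 0 -> g2 x = 0).
move=> h1 h2 h12; pose A (g : V -> C^o) : set V := [set x : V | f x = 0 /\ g x = 0]%classic.
have an (g : V -> C^o) : hol g 0 -> analytic_germ (A g).
 move=> hg; exists 2%N, (fun i => if i == 0 then f else g); split.
  move=> i; apply/hol_holo; case: ifP => // _; exact: hol_ent.
 apply/near0P; exists 1 => // x _; split=> [[fx gx] i|k]; first by case: ifP.
 by split; [exact: (k 0)|exact: (k 1)].
have := irr (an _ h1) (an _ h2); case.
- apply: (near0P (fun x => f x = 0 <-> A g1 x \/ A g2 x)).1; apply: (near0W h12) => x hx; split=> [fx|[[]|[]] //].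
 by have /eqP := hx fx; rewrite mulf_eq0 => /orP [/eqP|/eqP] ?; [left|right].
- move=> h; left; apply: (near0W ((near0P (fun x => A g1 x <-> zero_set f x)).2 h)) => x [_ hx] fx; by case: (hx fx).
- move=> h; right; apply: (near0W ((near0P (fun x => A g2 x <-> zero_set f x)).2 h)) => x [_ hx] fx; by case: (hx fx).
Qed.

Lemma red0 (g : V -> C^o) : hol g 0 -> near0 (fun x => f x = 0 -> g x = 0) ->
 exists2 h, hol h 0 & near0 (fun x => g x = f x * h x).
move=> /hol_holo hg /near0P hz; have [h [hh /near0P E]] := red hg hz.
by exists h => //; apply/hol_holo.
Qed.

(* The radial path [act t x] stays in [X], so vanishing near the vertex propagates to the whole cone. *)
Lemma X_extend (g : V -> C^o) x (r : R) : (forall y, nm y < r -> dif g y) -> nm x < r ->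
 near0 (fun x => f x = 0 -> g x = 0) -> f x = 0 -> g x = 0.
move=> dg xr [s s0 h] fx.
have [q q0 qx] := ex_small s0 (nm_ge0 x).
rewrite -(act1 w x).
have m0 : 0 < minr q 1 by side.
apply: (@segment_zero R C^o (fun t : C^o => g (act t x)) 0 1 _ m0).
 move=> t /andP [t0 t1]; rewrite add0r subr0 /GRing.scale /= mulr1.
 have lt : nm (act t%:C x) < r.
  have nt : nmc (t%:C) <= 1 by rewrite nm_real ger0_norm.
  apply: le_lt_trans (nm_act w0 _ nt) _; apply: le_lt_trans xr.
  by rewrite ler_piMl ?nm_ge0.
 apply: (@hol_comp R C^o V C^o (fun t : C^o => act t x) g); first by apply: hol_ent => u; exact: dif_act_t.
 exists (r - nm (act t%:C x)); first by lra.
 by move=> y hy; apply: dg; have := nm_rev y (act t%:C x); lra.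
move=> t; rewrite subr0 lt_min => /andP [tq t1]; apply: h; last exact: X_act.
apply: le_lt_trans (nm_act w0 _ (ltW t1)) _; apply: le_lt_trans qx.
by rewrite ler_wpM2r ?nm_ge0 // ltW.
Qed.

Lemma X_extend_ent g : ent g -> near0 (fun x => f x = 0 -> g x = 0) -> forall x, f x = 0 -> g x = 0.
by move=> eg h x; apply: (@X_extend g x (nm x + 1)) => //; lra. Qed.

Lemma hol_r (g : V -> C^o) (r : R) : 0 < r -> (forall y, nm y < r -> dif g y) -> hol g 0.
by move=> r0 h; exists r => // x; rewrite subr0 => /h. Qed.

Lemma primeX (g1 g2 : V -> C^o) (r : R) : 0 < r -> (forall y, nm y < r -> dif g1 y) -> (forall y, nm y < r -> dif g2 y) ->
 (forall x, nm x < r -> f x = 0 -> g1 x * g2 x = 0) ->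
 (forall x, nm x < r -> f x = 0 -> g1 x = 0) \/ (forall x, nm x < r -> f x = 0 -> g2 x = 0).
move=> r0 d1 d2 h; case: (@prime0 g1 g2); [exact: hol_r d1|exact: hol_r d2|by exists r| |] => k; [left|right] => x xr.
 exact: X_extend d1 xr k.
exact: X_extend d2 xr k.
Qed.

(** In an integral equation for [g] on the zero set, identically zero lowest coefficients leave a
    factor [g], which primality removes. When the lowest nonzero coefficient is reached, the
    equation exhibits it as a multiple of [g]. *)
Lemma chi_reduce (r : R) (chi : nat -> V -> C^o) (g : V -> C^o) N : 0 < r ->
 (forall k y, nm y < r -> dif (chi k) y) -> (forall y, nm y < r -> dif g y) ->
 (forall y, nm y < r -> chi N y = 1) ->
 (forall x, nm x < r -> f x = 0 -> \sum_(k < N.+1) chi k x * g x ^+ k = 0) ->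
 ~ (forall x, nm x < r -> f x = 0 -> g x = 0) ->
 exists k0, (exists2 y, nm y < r & chi k0 y != 0) /\
  forall x, nm x < r -> f x = 0 -> chi k0 x = - (\sum_(k < N - k0) chi (k0.+1 + k)%N x * g x ^+ k) * g x.
move=> r0 dc dg c1 hx gn0.
pose nz k := exists2 y, nm y < r & chi k y != 0.
have exN : exists k, `[< nz k >] by exists N; apply/asboolP; exists 0; rewrite ?nm0 // c1 ?nm0 // oner_neq0.
case: (ex_minnP exN) => k0 /asboolP nz0 hmin; exists k0; split=> //.
have k0N : (k0 <= N)%N by apply: hmin; apply/asboolP; exists 0; rewrite ?nm0 // c1 ?nm0 // oner_neq0.
pose S k x := \sum_(i < N.+1 - k) chi (k + i)%N x * g x ^+ i.
have SS k x : (k <= N)%N -> S k x = chi k x + g x * S k.+1 x.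
 move=> kN; rewrite /S subSn // big_ord_recl addn0 expr0 mulr1 subSS; congr (_ + _).
 by rewrite mulr_sumr; apply: eq_bigr => i _; rewrite lift0 addnS addSn exprS; ring.
have dS k y : nm y < r -> dif (S k) y by move=> hy; apply: dif_sum => i _; apply: difM; [exact: dc|apply: difX; exact: dg].
have S0 k : (k <= k0)%N -> forall x, nm x < r -> f x = 0 -> S k x = 0.
 elim: k => [_|k IH kk] x xr fx; first by rewrite /S subn0; exact: hx.
 have ck y : nm y < r -> chi k y = 0.
  move=> yr; apply/eqP; apply: contrapT => /negP ny.
  have : (k0 <= k)%N by apply: hmin; apply/asboolP; exists y.
  by rewrite leqNgt kk.
 have kN : (k <= N)%N by apply: leq_trans (ltnW kk) k0N.
 have [//|h|h] := @primeX g (S k.+1) r r0 dg (dS k.+1); last exact: h.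
  move=> y yr fy; have := IH (ltnW kk) y yr fy; by rewrite SS // ck // add0r.
 by case: gn0.
move=> x xr fx; have := S0 _ (leqnn k0) x xr fx; rewrite SS // => /eqP; rewrite addr_eq0 => /eqP ->.
by rewrite /S subSS mulNr mulrC.
Qed.

Lemma f_mdir : (exists x, f x != 0) -> exists e N c, mdir f e N.+1 c.
move=> [x fx]; have pf_ : pg f by exists d; split; [|exact: whom_growth].
have [e [N [c [cn hN hc]]]] := monic_dir pf_ fx.
case: N hN hc => [|N] hN hc; last by exists e, N, c.
by move: fx; rewrite (liouville x hN) f_0 eqxx.
Qed.

Lemma mdir_neq0 e N c : mdir f e N.+1 c -> exists j, coord e j != 0.
move=> h; apply: contrapT => no.
have e0 : e = 0 by apply: coord_inj => j; rewrite coord0; apply/eqP; apply: contrapT => /negP k; apply: no; exists j.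
have := md_lead h 0; rewrite e0 /dcoef.
have -> : (fun z : C^o => f (0 + z *' 0)) = (fun=> f 0) by apply/funext => z; rewrite scaler0 addr0.
rewrite (asy_tc (asy_cst (f 0))) /= => c0; have := md_c h; by rewrite -c0 eqxx.
Qed.

Section WithDir.
Variables (e : V) (N : nat) (c : C^o) (j : 'I_n).
Hypotheses (hm : mdir f e N.+1 c) (ej : coord e j != 0).
Local Notation prj := (prj e j).
Local Notation zc := (zc e j).

(** Multiplication by the fibre coordinate [zc] on the roots of [f] over [prj x], as a matrix that
    is constant along [e]. *)
Definition Amx (x : V) : 'M[C]_N.+1 := cmx N (mpoly f e N.+1 c (prj x)).

Lemma zrow_A x : f x = 0 -> zrow N (zc x) *m Amx x = zc x *: zrow N (zc x).
move=> fx; apply: zrow_cmx; [exact: mpoly_monic|exact: mpoly_size|].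
by rewrite (mpoly_root hm) prjK // fx eqxx.
Qed.

Lemma A_pg i k : pg (fun x => Amx x i k).
rewrite /Amx; case kN: (k == N :> nat).
 have -> : (fun x => cmx N (mpoly f e N.+1 c (prj x)) i k) = (fun x => (-1) * (mpoly f e N.+1 c (prj x))`_i) by apply/funext => x; rewrite mxE kN mulN1r.
 by apply: pgM; [exact: pg_cst|apply: (@pg_prj R n e j (fun y => (mpoly f e N.+1 c y)`_i)); exact: mpoly_pf].
have -> : (fun x => cmx N (mpoly f e N.+1 c (prj x)) i k) = (fun=> (i == k.+1 :> nat)%:R) by apply/funext => x; rewrite mxE kN.
exact: pg_cst.
Qed.

Lemma char_coef (G : 'M[C]_N.+1) : (char_poly G)`_N.+1 = 1.
by have := char_poly_monic G; rewrite monicE lead_coefE size_char_poly => /eqP. Qed.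

Lemma char_eigen (G : 'M[C]_N.+1) z (a : C) : zrow N z *m G = a *: zrow N z ->
 \sum_(k < N.+2) (char_poly G)`_k * a ^+ k = 0.
by move=> /eigen_char; rewrite horner_coef size_char_poly. Qed.

(** Substituting the companion matrix for the fibre coordinate in [g] gives a matrix with eigenvalue
    [g x] at points of the zero set. Its characteristic polynomial is an integral equation with
    coefficients constant along [e], and the lowest nonzero coefficient acts as the norm of [g]. *)
Lemma norm_pg g : pg g -> ~ (forall x, f x = 0 -> g x = 0) ->
 exists H B, [/\ pg H, pg B, (forall x (z : C), H (x + z *: e) = H x), (exists x, H x != 0) &
  forall x, f x = 0 -> H x = B x * g x].
move=> [Ng hg] gn0; have pgg : pg g by exists Ng.
pose pw x k := iter k (fun B => Amx x *m B) 1%:M.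
pose G (x : V) : 'M[C]_N.+1 := \sum_(k < Ng.+1) dcoef e g k (prj x) *: pw x k.
have GE x : f x = 0 -> zrow N (zc x) *m G x = g x *: zrow N (zc x).
 move=> fx; have Eg : g x = \sum_(k < Ng.+1) dcoef e g k (prj x) * zc x ^+ k by rewrite -(pgN_poly e (prj x) (zc x) hg) prjK.
 rewrite /G mulmx_sumr Eg scaler_suml.
 by apply: eq_bigr => k _; rewrite -scalemxAr (zrow_iter _ (zrow_A fx)) scalerA.
have G_pg i k : pg (fun x => G x i k).
 have -> : (fun x => G x i k) = (fun x => \sum_(l < Ng.+1) dcoef e g l (prj x) * pw x l i k) by apply/funext => x; rewrite /G summxE; apply: eq_bigr => l _; rewrite mxE.
 apply: K_sum; [exact: pg_cst|exact: pgD|] => l _; apply: pgM; first by apply: pg_prj; exact: pg_dcoef.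
 by apply: (K_mxpow (K := @pg R n)); [exact: pg_cst|exact: pgD|exact: pgM|exact: A_pg].
pose chi k x : C^o := (char_poly (G x))`_k.
have chi_pg k : pg (chi k) by apply: (pf_char_poly (K := @pg R n)); [exact: pg_cst|exact: pgD|exact: pgM|].
have chi_inv k x (z : C) : chi k (x + z *: e) = chi k x by rewrite /chi /G /pw /Amx prj_line.
have chi1 x : chi N.+1 x = 1 by exact: char_coef.
have chiX x : f x = 0 -> \sum_(k < N.+2) chi k x * g x ^+ k = 0 by move=> /GE; exact: char_eigen.
have [[y fy gy]|no] := pselect (exists2 y, f y = 0 & g y != 0); last first.
 by case: gn0 => x fx; apply/eqP; apply: contrapT => /negP gx; apply: no; exists x.
have r0 : 0 < nm y + 1 by side.
have key (r : R) : nm y + 1 <= r -> exists k0, (exists2 y, nm y < r & chi k0 y != 0) /\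
  forall x, nm x < r -> f x = 0 -> chi k0 x = - (\sum_(k < N.+1 - k0) chi (k0.+1 + k)%N x * g x ^+ k) * g x.
 move=> yr; apply: (@chi_reduce r chi g N.+1) => //; first by lra.
 - by move=> k z _; apply: pg_ent.
 - by move=> z _; apply: pg_ent.
 - by move=> x _; exact: chiX.
 - by move=> /(_ y) hh; move: gy; rewrite hh ?eqxx //; lra.
have [k0 [[y0 y0r cy0] hk0]] := key _ (lexx _).
pose B x : C^o := - (\sum_(k < N.+1 - k0) chi (k0.+1 + k)%N x * g x ^+ k).
have pgX k : pg (fun x => g x ^+ k).
 elim: k => [|k IH]; first by under eq_fun do rewrite expr0; exact: pg_cst.
 by under eq_fun do rewrite exprS; exact: pgM.
have B_pg : pg B.
 have -> : B = (fun x => (-1) * \sum_(k < N.+1 - k0) chi (k0.+1 + k)%N x * g x ^+ k) by apply/funext => x; rewrite mulN1r.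
 apply: pgM; first exact: pg_cst.
 by apply: K_sum; [exact: pg_cst|exact: pgD|] => k _; apply: pgM.
exists (chi k0), B; split=> //; first by exists y0.
move=> x fx; apply: subr0_eq.
apply: (@X_extend_ent (fun x => chi k0 x - B x * g x)) fx => [z|].
 by apply: difB; [|apply: difM]; apply: pg_ent.
by exists (nm y + 1) => // z zr fz; rewrite hk0 // subrr.
Qed.

(** A point of the base near [p] has a point of the zero set above it, also near [p]. The norm of
    [g] would therefore vanish on an open set, hence identically. *)
Lemma X_identity g p (eps : R) : pg g -> f p = 0 -> 0 < eps ->
 (forall x, f x = 0 -> nm (x - p) < eps -> g x = 0) -> forall x, f x = 0 -> g x = 0.
move=> hg fp e0 h; apply: contrapT => no.
have [H [B [pH pB Hinv [y Hy] HX]]] := norm_pg hg no.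
have [s s0 hs] := ex_line e e0.
have [del del0 hz] := zero_near hm isT fp s0.
have m0 : 0 < minr del (eps / 2) by side.
have Hz x : nm (x - p) < minr del (eps / 2) -> H x = 0.
 move=> /lt_minP [xd xe]; have [z zs fz] := hz x xd.
 rewrite -(Hinv x z) HX // h ?mulr0 //; exact: hs.
have := @ball_zero R V H p (nm (y - p) + 1) _ m0 (fun x _ => pg_ent pH x) Hz y.
have lt : nm (y - p) < nm (y - p) + 1 by rewrite ltrDl.
by move=> /(_ lt) H0; move: Hy; rewrite H0 eqxx.
Qed.

Local Notation A_ := Amx.

(** The local version of [norm_pg]: [g] is no longer a polynomial, and the substitution of the
    matrix is a convergent series. The radius [rho] must beat the size of the companion matrix over
    the ball of radius [r]; it does not depend on [g]. *)
Lemma norm_ball (r : R) : 0 < r -> exists2 rho : R, r <= rho & forall (g : V -> C^o) (M : R),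
 (forall y, nm y < rho -> dif g y) -> (forall y, nm y < rho -> nm (g y) <= M) ->
 ~ (forall x, nm x < r -> f x = 0 -> g x = 0) ->
 exists H : V -> C^o, [/\ (forall y, nm y < r -> dif H y), (forall x (z : C), H (x + z *: e) = H x),
  (exists2 y, nm y < r & H y != 0) & (forall x, nm x < r -> f x = 0 -> g x = 0 -> H x = 0)].
move=> r0.
have [Kp Kp0 hKp] := prj_bd e j; have [Kz Kz0 hKz] := zc_bd e j.
pose P := Kp * r; pose Z := Kz * r.
have Z0 : 0 <= Z by exact: mulr_ge0 Kz0 (ltW r0).
have hP x : nm x < r -> nm (prj x) <= P by move=> xr; apply: le_trans (hKp x) _; rewrite ler_wpM2l // ltW.
have hZ x : nm x < r -> nm (zc x) <= Z by move=> xr; apply: le_trans (hKz x) _; rewrite ler_wpM2l // ltW.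
have [a a1 ha] : exists2 a : R, 1 <= a & forall ik : 'I_N.+1 * 'I_N.+1, forall x, nm x < r -> nmc (A_ x ik.1 ik.2) <= a.
 apply: fin_bd => [[i k] /=|i B B' BB h x /h]; last by move=> /le_trans; apply.
 have [m [_ [M M0 hM]]] := A_pg i k.
 exists (M * (1 + r) ^+ m) => x xr; apply: le_trans (hM x) _; rewrite ler_wpM2l //.
 by apply: lerXn2r; rewrite ?nnegrE ?addr_ge0 ?nm_ge0 ?(ltW r0) // lerD2l ltW.
pose q := N.+1%:R * a.
have q1 : 1 <= q by rewrite /q -[leLHS]mulr1 ler_pM // ler1n.
pose pw x k := iter k (fun B => A_ x *m B) 1%:M.
have hpw x k i l : nm x < r -> nmc (pw x k i l) <= q ^+ k.
 move=> xr; elim: k i l => [|k IH] i l.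
  by rewrite /pw /= mxE expr0; case: (i == l); rewrite ?nm1 ?nm0.
 rewrite /pw /= mxE; apply: le_trans (nm_sum _ _ _) _.
 apply: le_trans (_ : \sum_(i0 < N.+1) a * q ^+ k <= _).
  by apply: ler_sum => i0 _; rewrite nmM ler_pM ?nm_ge0 ?IH //; exact: (ha (i, i0)).
 by rewrite (sumr_const) (card_ord N.+1) exprS {2}/q -mulrA mulr_natl.
(* A sixth of [rr] exceeds the fibre coordinate bound [Z], and [q / (rr / 3)] is at most [1 / 2], so
   the matrix series converges like powers of [1 / 2]. *)
pose rr := 6 * (Z + q + 1).
have rr0 : 0 < rr by rewrite /rr; lra.
have P0 : 0 <= P by exact: mulr_ge0 Kp0 (ltW r0).
pose rho := P + rr * nm e + 1 + r.
have re0 : 0 <= rr * nm e by side.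
exists rho; first by rewrite /rho; lra.
move=> g M dg bg gn0.
have lt x (z : C^o) : nm x < r -> nm z < rr -> nm (prj x + z *' e) < rho.
 move=> xr zr; apply: le_lt_trans (nmD _ _) _; rewrite nmZ.
 have h1 := hP x xr; have h2 : nm z * nm e <= rr * nm e by rewrite ler_wpM2r ?nm_ge0 // ltW.
 by rewrite /rho; lra.
have T x : nm x < r -> [/\ asy (fun z : C^o => g (prj x + z *' e)) (tc (fun z : C^o => g (prj x + z *' e))),
  (forall k, nm (dcoef e g k (prj x)) <= 4 * M / (rr / 3) ^+ k) &
  forall m (z : C^o), nm z <= rr / 6 -> nm (g (prj x + z *' e) - \sum_(k < m) dcoef e g k (prj x) * z ^+ k) <= 8 * M * (nm z / (rr / 3)) ^+ m].
 move=> xr; exact: (disc_tc rr0 (fun z h => dif_on_line (dg _ (lt x z xr h))) (fun z h => bg _ (lt x z xr h))).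
have rhor : r <= rho by rewrite /rho; lra.
have M0 : 0 <= M.
 apply: le_trans (nm_ge0 (g 0)) (bg 0 _); rewrite nm0; lra.
pose tm x i l k : C^o := dcoef e g k (prj x) * pw x k i l.
have tb x i l k : nm x < r -> nm (tm x i l k) <= 4 * M * 2^-1 ^+ k.
 move=> xr; have [_ h _] := T x xr; rewrite nmM.
 apply: le_trans (ler_pM (nm_ge0 _) (nm_ge0 _) (h k) (hpw x k i l xr)) _.
 rewrite -[_ / _ * _]mulrA ler_wpM2l ?mulr_ge0 // -exprVn -exprMn.
 have a0 : 0 <= a by lra.
 apply: lerXn2r; rewrite ?nnegrE ?invr_ge0 // ?mulr_ge0 ?invr_ge0 ?divr_ge0 ?(ltW rr0) //.
 rewrite mulrC ler_pdivrMr ?divr_gt0 // /rr; lra.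
have dA i l y : dif (fun x => A_ x i l : C^o) y by apply: pg_ent; exact: A_pg.
have dpw k i l y : dif (fun x => pw x k i l : C^o) y.
 apply: (@K_mxpow R V (fun h => dif h y)) => // [b|h1 h2|h1 h2]; [exact: dif_cst|exact: difD|exact: difM].
have dtm i l k y : nm y < r -> dif (fun x => tm x i l k) y.
 move=> yr; apply: difM; last exact: dpw.
 apply: (dif_comp (g := dcoef e g k)); first exact: dif_prj.
 apply: dif_dcoef; exists (rho - P); first by rewrite /rho; lra.
 by move=> u hu; apply: dg; have := nm_rev u (prj y); have := hP y yr; lra.
(* The limit is chosen from data that depend on [prj x] only, which makes it constant along [e] for
   every [x], also outside the ball of convergence. *)
pose lm (x : V) i l : C^o := xget 0 [set z : C^o | forall m, nm (\sum_(k < m) dcoef e g k (prj x) * pw x k i l - z) <= 4 * (4 * M) * 2^-1 ^+ m]%classic.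
have lmP x i l : nm x < r -> forall m, nm (\sum_(k < m) tm x i l k - lm x i l) <= 4 * (4 * M) * 2^-1 ^+ m.
 move=> xr; have [z hz] := series_lim (fun k => tb x i l k xr).
 by rewrite /lm; case: xgetP => [z' _ //|/(_ z)].
have lmE x (z : C) i l : lm (x + z *: e) i l = lm x i l.
 have Eb : prj (x + z *: e) = prj x by rewrite prj_line.
 have AE : A_ (x + z *: e) = A_ x by rewrite /Amx Eb.
 by rewrite /lm /pw AE Eb.
clearbody lm.
pose G (x : V) : 'M[C]_N.+1 := \matrix_(i, l) lm x i l.
have GE x : nm x < r -> f x = 0 -> zrow N (zc x) *m G x = g x *: zrow N (zc x).
 move=> xr fx; apply/rowP => l; apply: subr0_eq; apply: (@nm_le0 R C^o).
 pose z := zc x; have gz : g x = g (prj x + z *' e) by rewrite prjK.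
 pose D := \sum_(i < N.+1) nm z ^+ i * (4 * (4 * M)) + 8 * M * nm z ^+ l.
 apply: (@pow2_lim0 R _ D 0) => m _; rewrite !mxE.
 have e1 : \sum_(i < N.+1) z ^+ i * (\sum_(k < m) tm x i l k) = (\sum_(k < m) dcoef e g k (prj x) * z ^+ k) * z ^+ l.
  under eq_bigr do rewrite mulr_sumr.
  rewrite exchange_big mulr_suml /=; apply: eq_bigr => k _.
  have := zrow_iter k (zrow_A fx) => /rowP /(_ l); rewrite !mxE -/z => E.
  rewrite -mulrA -E mulr_sumr; apply: eq_bigr => i _; rewrite /tm mxE; ring.
 have -> : \sum_(i < N.+1) zrow N (zc x) 0 i * G x i l - g x * z ^+ l =
   - (\sum_(i < N.+1) z ^+ i * (\sum_(k < m) tm x i l k - lm x i l)) -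
    (g x - \sum_(k < m) dcoef e g k (prj x) * z ^+ k) * z ^+ l.
  rewrite mulrBl -e1.
  under [X in _ = - X - _]eq_bigr do rewrite mulrBr.
  rewrite sumrB opprB opprB addrACA; rewrite [X in _ = X]addrC.
  have -> : \sum_(i < N.+1) zrow N (zc x) 0 i * G x i l = \sum_(i < N.+1) z ^+ i * lm x i l by apply: eq_bigr => i _; rewrite !mxE.
  by ring.
 apply: le_trans (nmB _ _) _; rewrite nmN /D [leRHS]mulrDl; apply: lerD.
  apply: le_trans (nm_sum _ _ _) _; rewrite mulr_suml; apply: ler_sum => i _.
  by rewrite nmM nmX -mulrA ler_wpM2l ?exprn_ge0 ?nm_ge0 //; exact: lmP.
 rewrite nmM nmX mulrAC; apply: ler_wpM2r; first by side.
 have [_ _ h] := T x xr; rewrite gz; have zZ := hZ x xr; rewrite -/z in zZ.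
 apply: le_trans (h m z _) _; first by rewrite /rr; lra.
 rewrite ler_wpM2l ?mulr_ge0 //; apply: lerXn2r; rewrite ?nnegrE ?invr_ge0 ?divr_ge0 ?nm_ge0 ?(ltW rr0) //.
 by rewrite ler_pdivrMr ?divr_gt0 // /rr; lra.
have dG i l y : nm y < r -> dif (fun x => G x i l : C^o) y.
 move=> yr; apply: (@dif_eq R V C^o (fun x => lm x i l)); first by move=> x; rewrite mxE.
 have s0 : 0 < r - nm y by lra.
 have lt' x : nm (x - y) < r - nm y -> nm x < r by move=> h; have := nm_rev x y; lra.
 apply: (@unif_lim R V (fun m x => \sum_(k < m) tm x i l k) _ y (r - nm y) (4 * (4 * M)) s0).
 - by side.
 - by move=> m x /lt' xr; apply: dif_sum => k _; exact: dtm.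
 - by move=> m x /lt' xr; exact: lmP.
pose chi k x : C^o := (char_poly (G x))`_k.
have dchi k y : nm y < r -> dif (chi k) y.
 move=> yr; apply: (@pf_char_poly R V (fun h => dif h y)) => [b|h1 h2|h1 h2|i l]; [exact: dif_cst|exact: difD|exact: difM|exact: dG].
have chi_inv k x (z : C) : chi k (x + z *: e) = chi k x by rewrite /chi (_ : G (x + z *: e) = G x) //; exact: eq_mx (lmE x z).
have [k0 [[y yr cy] hk]] : exists k0, (exists2 y, nm y < r & chi k0 y != 0) /\
  forall x, nm x < r -> f x = 0 -> chi k0 x = - (\sum_(k < N.+1 - k0) chi (k0.+1 + k)%N x * g x ^+ k) * g x.
 apply: (chi_reduce r0) => //.
 - by move=> z zr; apply: dg; exact: lt_le_trans zr rhor.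
 - by move=> z _; exact: char_coef.
 - by move=> x xr fx; apply: char_eigen; exact: GE.
exists (chi k0); split; [exact: dchi|exact: chi_inv|by exists y|].
by move=> x xr fx gx; rewrite hk // gx mulr0.
Qed.

End WithDir.
End XSet.

Opaque nm.

(** * Continuity at a point and avoidance of finitely many closed conditions *)

Section Continuity.
Variable R : realType.
Local Notation C := R[i].
Implicit Types V W U : normedModType C.

Definition cts V W (g : V -> W) (p : V) :=
 forall e : R, 0 < e -> exists2 d : R, 0 < d & forall x, nm (x - p) < d -> nm (g x - g p) < e.

Lemma dif_cts V W (g : V -> W) p : dif g p -> cts g p.
by move=> h e e0; exact: dif_cont h e0. Qed.
Lemma cts_cst V W (c : W) (p : V) : cts (fun=> c) p. exact: dif_cts (dif_cst _ _). Qed.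
Lemma cts_comp V W U (f : V -> W) (g : W -> U) p : cts f p -> cts g (f p) -> cts (fun x => g (f x)) p.
by move=> hf hg e /hg [d /hf [d' d0' h'] h]; exists d' => // x /h' /h. Qed.
Lemma ctsD V W (f g : V -> W) p : cts f p -> cts g p -> cts (fun x => f x + g x) p.
move=> hf hg e e0; have e2 : 0 < e / 2 by lra.
have [d d0 h] := hf _ e2; have [d' d0' h'] := hg _ e2.
exists (minr d d'); first by side.
move=> x /lt_minP [/h hx /h' hx']; rewrite opprD addrACA.
by apply: le_lt_trans (nmD _ _) _; lra.
Qed.
Lemma ctsZ V W (f : V -> C^o) (e : W) p : cts f p -> cts (fun x => f x *' e) p.
move=> h; apply: (@cts_comp V C^o W f (fun z => z *' e)) => //.
by apply/dif_cts/(dif_eq (f := fun z : C^o => 0 + z *' e)) => [x|]; [rewrite add0r|exact: dif_line].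
Qed.
Lemma ctsM V (f g : V -> C^o) p : cts f p -> cts g p -> cts (fun x => f x * g x : C^o) p.
move=> hf hg.
have [d1 d10 h1] := hf 1 ltr01.
move=> e e0; pose K := 1 + nm (f p) + nm (g p).
have K0 : 0 < K by rewrite /K -addrA ltr_pwDl // addr_ge0 ?nm_ge0.
have eK : 0 < e / (2 * K) by side.
have [d d0 h] := hf _ eK; have [d' d0' h'] := hg _ eK.
exists (minr d1 (minr d d')); first by side.
move=> x; rewrite !lt_min => /and3P [/h1 x1 /h hx /h' hx'].
have -> : f x * g x - f p * g p = f x * (g x - g p) + (f x - f p) * g p by ring.
apply: le_lt_trans (nmD _ _) _; rewrite !nmM.
have fb : nm (f x) <= K by have := nm_rev (f x) (f p); have := nm_ge0 (g p); rewrite /K; lra.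
have gb : nm (g p) <= K by have := nm_ge0 (f p); rewrite /K; lra.
have a1 : nm (f x) * nm (g x - g p) <= K * nm (g x - g p) by rewrite ler_wpM2r ?nm_ge0.
have a2 : nm (f x - f p) * nm (g p) <= nm (f x - f p) * K by rewrite ler_wpM2l ?nm_ge0.
have a3 : K * nm (g x - g p) < e / 2 by rewrite mulrC -ltr_pdivlMr // -mulrA -invfM.
have a4 : nm (f x - f p) * K < e / 2 by rewrite -ltr_pdivlMr // -mulrA -invfM.
lra.
Qed.

Definition closed_in V (B : V -> Prop) (Z : V -> Prop) :=
 forall x, B x -> ~ Z x -> exists2 d : R, 0 < d & forall y, nm (y - x) < d -> ~ Z y.

Lemma sub_ball V (x0 x1 : V) (r : R) : nm (x1 - x0) < r -> exists2 s : R, 0 < s & forall y, nm (y - x1) < s -> nm (y - x0) < r.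
move=> h; exists (r - nm (x1 - x0)); first by lra.
by move=> y hy; have := nm_dist x1 y x0; lra.
Qed.

(** The finite case of Baire's theorem: if a closed condition does not hold on the whole current
    ball, a smaller ball avoids it, and the next condition is treated there. *)
Lemma finite_avoid V (I : eqType) (s : seq I) (Z : I -> V -> Prop) (x0 : V) (r : R) : 0 < r ->
 (forall i, i \in s -> closed_in (fun x => nm (x - x0) < r) (Z i)) ->
 exists x1 r1, [/\ 0 < r1, forall x, nm (x - x1) < r1 -> nm (x - x0) < r &
  (exists2 i, i \in s & forall x, nm (x - x1) < r1 -> Z i x) \/ (forall i x, i \in s -> nm (x - x1) < r1 -> ~ Z i x)].
elim: s => [|i s IH] r0 h; first by exists x0, r; split=> //; right.
have [x1 [r1 [r10 sub H]]] := IH r0 (fun k hk => h k (mem_behead (s := i :: s) hk)).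
case: H => [[k ks hk]|H].
 by exists x1, r1; split=> //; left; exists k => //; rewrite inE ks orbT.
have [all|no] := pselect (forall x, nm (x - x1) < r1 -> Z i x).
 by exists x1, r1; split=> //; left; exists i; rewrite ?inE ?eqxx.
have [x2 x2r Zx2] : exists2 x2, nm (x2 - x1) < r1 & ~ Z i x2 by apply: contrapT => no2; apply: no => x xr; apply: contrapT => hx; apply: no2; exists x.
have [d d0 hd] := h i (mem_head _ _) x2 (sub _ x2r) Zx2.
have [e e0 he] := sub_ball x2r.
exists x2, (minr d e); split; first by side.
 by move=> x /lt_minP [_ /he /sub].
right=> k x; rewrite inE lt_min => /orP [/eqP ->|ks] /andP [xd /he xe]; [exact: hd|exact: H].
Qed.

End Continuity.

(** * Continuous sections of the roots of a family of polynomials *)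

Section Sheets.
Variable R : realType.
Local Notation C := R[i].
Variables (V : normedModType C) (P : V -> {poly C}) (N : nat) (x0 : V) (r : R).
Hypotheses (r0 : 0 < r) (Pm : forall x, nm (x - x0) < r -> P x \is monic) (Ps : forall x, nm (x - x0) < r -> size (P x) = N.+1) (Pc : forall x, nm (x - x0) < r -> pf (fun g => cts g x) P).

Lemma horner_cts (z : C) x : nm (x - x0) < r -> cts (fun y => (P y).[z] : C^o) x.
move=> xr e e0.
have := @K_sum R V (fun g => cts g x) (fun c => cts_cst c x) (fun f g => @ctsD R V C^o f g x) 'I_N.+1 (index_enum _) predT (fun k y => (P y)`_k * z ^+ k).
case/(_ (fun (i : 'I_N.+1) _ => ctsM (Pc xr i) (cts_cst _ _)) e e0) => d d0 h.
have [s s0 hs] := sub_ball xr.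
exists (minr d s); first by side.
by move=> y /lt_minP [/h yd /hs yr]; rewrite !horner_coef (Ps xr) (Ps yr).
Qed.

Lemma root_cont x (a : C^o) (e : R) : nm (x - x0) < r -> root (P x) a -> 0 < e ->
 exists2 d : R, 0 < d & forall y, nm (y - x) < d -> exists2 b : C^o, root (P y) b & nm (b - a) < e.
move=> xr ra e0; have [s s0 hs] := sub_ball xr.
have N0 : (0 < N)%N.
 rewrite lt0n; apply/eqP => N0; have := Ps xr; rewrite N0 => /eqP/size_poly1P [c c0 E].
 by move: ra; rewrite E /root hornerC (negbTE c0).
have eN : 0 < e ^+ N by side.
have [d d0 h] := horner_cts a xr eN.
exists (minr d s); first by side.
move=> y /lt_minP [/h yd /hs yr].
move: yd; rewrite (rootP ra) subr0 => yd.
by apply: (@root_near R (P y) N.-1 a e); rewrite ?prednK // ?Ps // Pm.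
Qed.

Lemma uniq_roots_le x (s : seq C) : nm (x - x0) < r -> uniq s -> all (root (P x)) s -> (size s <= N)%N.
move=> xr us rs; rewrite -ltnS -(Ps xr); apply: max_poly_roots => //.
exact: monic_neq0 (Pm xr).
Qed.

Lemma separated (s : seq C) : uniq s -> exists2 e : R, 0 < e &
 forall a b : C^o, a \in s -> b \in s -> a != b -> 4 * e <= nm (a - b).
elim: s => [|a s IH] /=; first by exists 1.
move=> /andP [as_ /IH [e e0 h]].
have [f f0 hf] : exists2 f : R, 0 < f & forall b : C^o, b \in s -> 4 * f <= nm ((a : C^o) - b).
 elim: s as_ {IH h} => [|b s IH]; first by exists 1.
 rewrite inE negb_or => /andP [ab /IH [f f0 hf]].
 have ab0 : 0 < nm ((a : C^o) - b) by rewrite nm_gt0 subr_eq0.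
 exists (minr f (nm ((a : C^o) - b) / 4)); first by side.
 move=> c; rewrite inE => /orP [/eqP ->|/hf hc].
  have : minr f (nm ((a : C^o) - b) / 4) <= nm ((a : C^o) - b) / 4 by rewrite ge_min lexx orbT.
  by lra.
 have : minr f (nm ((a : C^o) - b) / 4) <= f by rewrite ge_min lexx.
 by lra.
exists (minr e f); first by side.
have m1 : minr e f <= e by rewrite ge_min lexx.
have m2 : minr e f <= f by rewrite ge_min lexx orbT.
move=> b c; rewrite !inE => /orP [/eqP ->|bs] /orP [/eqP ->|cs].
- by rewrite eqxx.
- by move=> _; have := hf c cs; lra.
- by move=> _; rewrite nmC; have := hf b bs; lra.
- by move=> bc; have := h b c bs cs bc; lra.
Qed.

(* At a point of the ball where the number of distinct roots is maximal the roots cannot split, so each of them extends to a continuous section. *)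
Lemma sheets : exists x1 r1 m (phi : 'I_m -> V -> C^o), [/\ 0 < r1, forall x, nm (x - x1) < r1 -> nm (x - x0) < r,
 forall i x, nm (x - x1) < r1 -> cts (phi i) x & forall x (z : C), nm (x - x1) < r1 -> root (P x) z <-> exists i, z = phi i x].
pose good m := exists2 x, nm (x - x0) < r & exists s : seq C, [/\ uniq s, all (root (P x)) s & size s = m].
have ex : exists m, `[< good m >] by exists 0%N; apply/asboolP; exists x0; rewrite ?subrr ?(nm0 V) //; exists [::].
have ub m : `[< good m >] -> (m <= N)%N by move=> /asboolP [x xr [s [us rs <-]]]; exact: uniq_roots_le rs.
case: (ex_maxnP ex ub) => m /asboolP [x1 x1r [s [us rs sm]]] mx.
have [e e0 he] := separated us.
have [d d0 hd] : exists2 d : R, 0 < d & forall y, nm (y - x1) < d -> forall a : C^o, a \in s -> exists2 b : C^o, root (P y) b & nm (b - a) < e.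
 elim: s rs {us sm he} => [|a s IH] /=; first by exists 1.
 move=> /andP [ra /IH [d d0 hd]]; have [d' d0' hd'] := root_cont x1r ra e0.
 exists (minr d d'); first by side.
 by move=> y /lt_minP [/hd yd /hd' yd'] b; rewrite inE => /orP [/eqP ->|/yd].
have [f f0 hf] := sub_ball x1r.
pose r1 := minr d f.
have sub x : nm (x - x1) < r1 -> nm (x - x0) < r by move=> /lt_minP [_ /hf].
pose phi (i : 'I_m) (x : V) : C^o := xget 0 [set b : C^o | root (P x) b /\ nm (b - nth 0 s i) < e]%classic.
have ins (i : 'I_m) : nth 0 s i \in s by rewrite mem_nth // sm.
have phiP i x : nm (x - x1) < r1 -> root (P x) (phi i x) /\ nm (phi i x - nth 0 s i) < e.
 move=> /lt_minP [/hd xd _]; have [b rb be] := xd _ (ins i).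
 by rewrite /phi; case: xgetP => [b' _ //|/(_ b) []].
have phi_inj x : nm (x - x1) < r1 -> injective (phi^~ x).
 move=> xr i j E; have [_ hi] := phiP i x xr; have [_ hj] := phiP j x xr.
 apply/val_inj/eqP; rewrite -(nth_uniq 0 _ _ us) ?sm ?ltn_ord //; apply: contraT => ne.
 have := he _ _ (ins i) (ins j) ne; rewrite E in hi.
 have := nm_dist (phi j x) (nth 0 s i : C^o) (nth 0 s j); rewrite (nmC (nth 0 s i : C^o) (phi j x)); lra.
have phi_all x (z : C) : nm (x - x1) < r1 -> root (P x) z -> exists i, z = phi i x.
 move=> xr rz; apply: contrapT => no.
 have gm : `[< good m.+1 >].
  apply/asboolP; exists x; first exact: sub.
  exists (z :: [seq phi i x | i <- enum 'I_m]); split.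
  - rewrite /= map_inj_uniq ?enum_uniq ?andbT; last exact: phi_inj.
   by apply/negP => /mapP [i _ zi]; apply: no; exists i.
  - by rewrite /= rz; apply/allP => b /mapP [i _ ->]; case: (phiP i x xr).
  - by rewrite /= size_map size_enum_ord.
 by have := mx _ gm; rewrite ltnn.
exists x1, r1, m, phi; split=> //; first by rewrite lt_min d0.
 move=> i x xr g g0; have [rx nx] := phiP i x xr.
 (* Remaining within [e] of [nth 0 s i] identifies the nearby root as a value of the same
    section. *)
 pose g' := minr g (e - nm (phi i x - nth 0 s i)).
 have g0' : 0 < g' by rewrite lt_min g0 subr_gt0.
 have [h h0 hh] := root_cont (sub _ xr) rx g0'.
 have [k k0 hk] := sub_ball xr.
 exists (minr h k); first by side.
 move=> y /lt_minP [/hh [b rb bg] /hk yr].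
 have [j Ej] := phi_all y b yr rb.
 move: bg; rewrite lt_min => /andP [bg be].
 suff E : i = j by rewrite {1}E -Ej.
 apply/val_inj/eqP; rewrite -(nth_uniq 0 _ _ us) ?sm ?ltn_ord //; apply: contraT => ne.
 have := he _ _ (ins i) (ins j) ne; have [_ hj] := phiP j y yr; rewrite -Ej in hj.
 have := nm_dist b (nth 0 s i : C^o) (nth 0 s j); have := nm_dist (phi i x) b (nth 0 s i).
 rewrite (nmC (nth 0 s i : C^o) b); lra.
by move=> x z xr; split; [exact: phi_all|move=> [i ->]; case: (phiP i x xr)].
Qed.

End Sheets.

(** * From continuous to holomorphic sections *)

Section OrderGraph.
Variable R : realType.
Local Notation C := R[i].
Variables (n : nat).
Local Notation V := (Cn R n).

(** The derivative part of the implicit function theorem. Existence and continuity of [psi] are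
    given, so the first order expansion of [D] alone can be solved for the increment of [psi]. *)
Lemma section_dif (W : normedModType C) (D : V -> C^o) (sg : W -> V) (psi : W -> C^o) (e : V) (r : R) x1 : 0 < r ->
 dif sg x1 -> cts psi x1 -> dif D (sg x1 + psi x1 *' e) -> dd e D (sg x1 + psi x1 *' e) != 0 ->
 (forall x, nm (x - x1) < r -> D (sg x + psi x *' e) = 0) -> dif psi x1.
move=> r0 [S hS] cp [L hL]; rewrite (hd_dd _ hL) => Le hz.
have [lL [KL KL0 bL] oL] := hL; have [lS [KS KS0 bS] oS] := hS.
pose a := nm (L e); have a0 : 0 < a by rewrite nm_gt0.
exists (fun h => - (L (S h) / L e)); split.
- by move=> c u v; rewrite lS lL /GRing.scale /=; field.
- exists (KL * KS / a) => [|h]; first by side.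
 rewrite nmN nmM nmV mulrAC ler_wpM2r ?invr_ge0 ?(ltW a0) //.
 by apply: le_trans (bL _) _; rewrite -mulrA ler_wpM2l.
move=> eps eps0; have e0 := nm_ge0 e.
pose T := (KS + 1) * (1 + 2 / a * (KL + 1) * nm e).
have T0 : 0 <= T by rewrite /T; pos.
have ea : 0 < eps * a by pos.
have [s1 s10 hs1] : exists2 s : R, 0 < s & s * (2 * (1 + nm e)) < a by apply: ex_small => //; pos.
have [s2 s20 hs2] := ex_small ea (addr_ge0 T0 KL0).
pose be := minr 1 (minr s1 s2); have be0 : 0 < be by rewrite !lt_min s10 s20 ltr01.
have be1 : be <= 1 by rewrite ge_min lexx.
have bes1 : be <= s1 by rewrite !ge_min lexx orbT.
have bes2 : be <= s2 by rewrite !ge_min lexx !orbT.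
have [d1 d10 h1] := oL be be0; have [d2 d20 h2] := oS be be0.
have [d3 d30 h3] := cp _ (divr_gt0 d10 (mulr_gt0 (ltr0Sn R 1) (ltr_pwDl ltr01 e0))).
have KS2 : 0 <= 2 * (KS + 1) by pos.
have [d4 d40 h4] := ex_small d10 KS2.
exists (minr (minr d2 d3) (minr d4 r)); first by side.
move=> h; rewrite !lt_min => /andP [/andP [hd2 hd3] /andP [hd4 hr]].
have xh : x1 + h - x1 = h by rewrite addrAC subrr add0r.
have H2 := h2 h hd2; have H3 : nm (psi (x1 + h) - psi x1) < d1 / (2 * (1 + nm e)) by apply: h3; rewrite xh.
set Dl := sg (x1 + h) - sg x1 in H2; set dl := psi (x1 + h) - psi x1 in H3 *.
have nh := nm_ge0 h.
have nD : nm Dl <= (KS + 1) * nm h.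
 have := nm_rev Dl (S h); have := bS h; have : be * nm h <= 1 * nm h by rewrite ler_wpM2r.
 by rewrite mulrDl mul1r; lra.
have nd := nm_ge0 dl; have nDl := nm_ge0 Dl.
pose k := Dl + dl *' e.
have nk : nm k <= nm Dl + nm dl * nm e by apply: le_trans (nmD _ _) _; rewrite nmZ.
have kd : nm k < d1.
 have p1 : (KS + 1) * nm h <= (KS + 1) * d4 by rewrite ler_wpM2l ?addr_ge0 // ltW.
 have p2 : nm dl * (2 * (1 + nm e)) < d1 by rewrite -ltr_pdivlMr // mulr_gt0 // ltr_pwDl.
 apply: le_lt_trans nk _; move: hd4 h4; lra.
have qk : sg x1 + psi x1 *' e + k = sg (x1 + h) + psi (x1 + h) *' e by rewrite /k /Dl /dl scalerBl addrACA !subrKC.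
have Lk : nm (L k) <= be * nm k by have := h1 k kd; rewrite qk !hz ?subrr ?(nm0 W) ?xh // sub0r nmN.
have Lke : L k = L Dl + dl * L e by rewrite /k linD // linZ.
have nLD := bL Dl.
have step : a * nm dl <= 2 * (KL + 1) * nm Dl.
 have q1 : a * nm dl <= nm (L k) + nm (L Dl) by rewrite mulrC -nmM (_ : dl * L e = L k - L Dl) ?nmB // Lke addrAC subrr add0r.
 have q2 : be * nm k <= be * nm Dl + be * nm e * nm dl by rewrite -mulrA [nm e * _]mulrC -mulrDr ler_wpM2l // ltW.
 have q3 : be * nm Dl <= 1 * nm Dl by rewrite ler_wpM2r.
 have q4 : be * (2 * (1 + nm e)) <= s1 * (2 * (1 + nm e)) by rewrite ler_wpM2r // mulr_ge0 // addr_ge0.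
 have q5 : be * nm e * nm dl <= a / 2 * nm dl by rewrite ler_wpM2r //; move: be0 hs1 q4; clear; lra.
 move: q1 q2 q3 q5 nLD Lk; clear; lra.
have tot : nm Dl + nm dl * nm e <= T * nm h.
 have q1 : nm dl <= 2 / a * (KL + 1) * nm Dl by rewrite mulrAC (mulrAC _ a^-1) mulrAC ler_pdivlMr // [nm dl * a]mulrC mulrAC.
 have q2 : nm dl * nm e <= 2 / a * (KL + 1) * nm e * nm Dl by rewrite [leRHS]mulrAC ler_wpM2r.
 have c0 : 0 <= 1 + 2 / a * (KL + 1) * nm e by rewrite addr_ge0 // !mulr_ge0 ?addr_ge0 // invr_ge0 ltW.
 have q3 := ler_wpM2l c0 nD.
 by rewrite /T; move: q2 q3; rewrite mulrDl mul1r; clear; lra.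
have -> : dl - - (L (S h) / L e) = (L k - L (Dl - S h)) / L e.
 rewrite Lke (linB Dl) //; have aux (A B E F : C) : E != 0 -> F - - (B / E) = (A + F * E - (A - B)) / E by move=> ?; field.
 exact: aux.
rewrite nmM nmV ler_pdivrMr //; apply: le_trans (nmB _ _) _.
have r1 : be * nm k <= be * (T * nm h) by rewrite ler_wpM2l ?(le_trans nk tot) ?ltW.
have r2 : nm (L (Dl - S h)) <= KL * (be * nm h) by apply: le_trans (bL _) _; rewrite ler_wpM2l.
have r3 : be * (T + KL) * nm h <= eps * a * nm h by rewrite ler_wpM2r // (le_trans _ (ltW hs2)) // ler_wpM2r // addr_ge0.
by move: r1 r2 r3 Lk; clear; lra.
Qed.

(* Differentiating [f (s t)] in [s] at [s = 1] turns the coefficient [s^k a_k] into [k a_k]. *)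
Lemma asy_deriv (f : C^o -> C^o) : hol f 0 -> asy (dd (1 : C^o) f) (fun k => k.+1%:R * tc f k.+1).
have sub g : hol g 0 -> exists r M : R, [/\ 0 < r, forall z : C^o, nm z < r -> dif g z, forall z : C^o, nm z < r -> nmc (g z) <= M & asy g (tc g)].
 move=> /hol_bd [r [M [r0 M0 dg bg]]]; exists r, M.
 have d1 z : nm z < r -> dif g z by move=> zr; apply: dg; rewrite subr0.
 have b1 z : nm z < r -> nm (g z) <= M by move=> zr; apply: bg; rewrite subr0.
 by split=> //; have [] := disc_tc r0 d1 b1.
move=> hf; have [r [M [r0 df bf A]]] := sub f hf; have [_ [_ [_ _ _ A']]] := sub _ (hol_dir (1 : C^o) hf).
have r2 : 0 < r / 2 by pos.
have lt (s t : C^o) : nm (s - 1) < 1 -> nm t < r / 2 -> nmc (s * t) < r.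
 move=> s1 tr; rewrite nmM; have := nm_rev s 1; rewrite nm1 => s2.
 have : nm s * nm t <= 2 * nm t by rewrite ler_wpM2r ?nm_ge0 //; lra.
 lra.
pose Phi (s t : C^o) : C^o := f (s * t).
have psiE (t : C^o) : nm t < r / 2 -> (t : C^o) ^+ 1 * dd (1 : C^o) f t = dd (1 : C^o) (fun s => Phi s t) 1.
 move=> tr; have [L hL] : dif f (1 * t) by apply/df/lt; rewrite ?subrr ?(nm0 C^o).
 have lL : lin L by case: hL.
 rewrite (hd_dd _ (hd_comp (f := fun s : C^o => s * t : C^o) (L := fun h => 1 * 0 + t * h : C^o) (hdM (hd_id (1 : C^o)) (hd_cst (t : C^o) (1 : C^o))) hL)).
 by rewrite mul1r in hL; rewrite mulr0 add0r mulr1 (lin1 lL t) (hd_dd _ hL) expr1.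
have as1 := asy_ext r2 psiE (asy_shift 1 A').
have E k : dd (1 : C^o) (fun y : C^o => tc (Phi y) k) 1 = k%:R * tc f k.
 have -> : (fun y : C^o => tc (Phi y) k) = (fun y => tc f k * y ^+ k) by apply/funext => y; rewrite (asy_tc (asy_scale y A)) mulrC.
 have di : dif (fun z : C^o => z) 1 := dif_id _.
 by rewrite dirZ ?dirX ?(hd_dd _ (hd_id _)) ?expr1n //; [ring|exact: difX].
suff -> : (fun k => k.+1%:R * tc f k.+1) = tc (dd (1 : C^o) f) by [].
apply/funext => k; rewrite -E (@tc_dir R C^o Phi 1 1 1 (r / 2) M) //.
- by rewrite (asy_tc as1) subSS subn0.
- by move=> x t x1 tr; apply: (dif_comp (g := f)); [dfs|apply/df/lt].
- by move=> x t x1 tr; apply: (dif_comp (g := f)); [dfs|apply/df/lt].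
- by move=> x t x1 tr; apply/bf/lt.
- exact: tcP as1.
Qed.

Lemma dd_dcoef (g : V -> C^o) e k p : hol g p -> dd e (dcoef e g k) p = k.+1%:R * dcoef e g k.+1 p.
move=> hg; have [r r0 df] := hg; have [q q0 /(_ p) lt] := ex_line e r0.
pose Phi (t : C^o) : C^o := g (p + t *' e).
have r2 : 0 < r / 2 by lra.
have pp := nm_self p r2.
rewrite /dcoef dd_tc_line //.
have h0 : hol Phi 0 by exists q => // t; rewrite subr0 => tq; apply/dif_on_line/df/lt.
have as3 := asy_deriv h0.
have E3 t : nm t < q -> dd (1 : C^o) Phi t = dd e g (p + t *' e).
 move=> tq; have [L hL] := df _ (lt p t pp tq); rewrite (hd_dd _ hL).
 pose G (z : C^o) : C^o := g (p + t *' e + z *' e).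
 have hG : hd G (t + - t) (fun z => z * L e : C^o) by rewrite subrr; exact: hd_on_line.
 have hh := hd_shift hG.
 rewrite -[RHS]mul1r; apply: (@hd_dd R C^o Phi t (fun z => z * L e) 1).
 by apply: hd_eq hh => // x; rewrite /Phi /G scalerBl -addrA subrKC.
by rewrite (asy_tc (asy_ext q0 E3 as3)).
Qed.

Lemma dcoef_tail (g : V -> C^o) (s e : V) (q M : R) : 0 < q ->
 (forall z : C^o, nm z < q -> dif g (s + z *' e)) -> (forall z : C^o, nm z < q -> nm (g (s + z *' e)) <= M) ->
 (forall k, nm (dcoef e g k s) <= 4 * M / (q / 3) ^+ k) /\
 forall m (z : C^o), nm z <= q / 6 -> nm (g (s + z *' e) - \sum_(k < m) dcoef e g k s * z ^+ k) <= 8 * M * (nm z / (q / 3)) ^+ m.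
by move=> q0 dg bg; case: (disc_tc q0 (fun z zq => dif_on_line (dg z zq)) bg). Qed.

Opaque dcoef.

(** Choose a point where the vanishing order [m] of [g] along [e] on the graph is least; nearby it
    is exactly [m]. The coefficient of order [m - 1] then vanishes on the graph and has derivative
    [m] times a nonzero one, so [section_dif] applies to it, and the leading term excludes other
    zeros close to the graph. *)
Lemma order_graph (g : V -> C^o) (sg : V -> V) (psi : V -> C^o) (e : V) (x0 : V) (r : R) : 0 < r ->
 (forall x, nm (x - x0) < r -> dif sg x) -> (forall x, nm (x - x0) < r -> cts psi x) ->
 (forall x, nm (x - x0) < r -> hol g (sg x + psi x *' e)) ->
 (forall x, nm (x - x0) < r -> g (sg x + psi x *' e) = 0) ->
 (exists2 x, nm (x - x0) < r & exists m, dcoef e g m (sg x + psi x *' e) != 0) ->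
 exists x1 r1 d1, [/\ 0 < r1, 0 < d1, forall x, nm (x - x1) < r1 -> nm (x - x0) < r,
  forall x, nm (x - x1) < r1 -> dif psi x &
  forall x (v : C^o), nm (x - x1) < r1 -> nm v < d1 -> g (sg x + (psi x + v) *' e) = 0 -> v = 0].
move=> r0 dsg cpsi hg gz [xa xar [ma hma]].
have [s sE] : {s : V -> V | s = fun x => sg x + psi x *' e} by exists (fun x => sg x + psi x *' e).
have hgs x : nm (x - x0) < r -> hol g (s x) by rewrite sE; exact: hg.
have gs x : nm (x - x0) < r -> g (s x) = 0 by rewrite sE; exact: gz.
have cs x : nm (x - x0) < r -> cts s x by move=> xr; rewrite sE; apply: ctsD; [apply: dif_cts; exact: dsg|apply: ctsZ; exact: cpsi].
pose P m := exists2 x, nm (x - x0) < r & dcoef e g m (s x) != 0.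
have exP : exists m, `[< P m >] by exists ma; apply/asboolP; exists xa => //; rewrite sE.
case: (ex_minnP exP) => m /asboolP [x1 x1r hx1] mmin.
have low k x : (k < m)%N -> nm (x - x0) < r -> dcoef e g k (s x) = 0.
 move=> km xr; apply/eqP; apply: contraT => ne.
 have : (m <= k)%N by apply: mmin; apply/asboolP; exists x.
 by rewrite leqNgt km.
have m0 : (0 < m)%N.
 rewrite lt0n; apply/eqP => m0; move: hx1; rewrite m0 dcoef0 ?(gs x1 x1r) ?eqxx //; exact: hgs.
have hs1 := hgs x1 x1r.
have [R1 [M [R10 M0 dg bg]]] := hol_bd hs1.
have [c cE] : {c | c = nm (dcoef e g m (s x1))} by exists (nm (dcoef e g m (s x1))).
have c0 : 0 < c by rewrite cE nm_gt0.
have c2 : 0 < c / 2 by side.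
have [t1 t10 ht1] := dif_cont (dif_dcoef e m hs1) c2.
have R12 : 0 < R1 / 2 by side.
have m10 : 0 < minr t1 (R1 / 2) by side.
have [t2 t20 ht2] := cs x1 x1r _ m10.
have [t3 t30 ht3] := sub_ball x1r.
pose r1 := minr t2 t3.
have r1P x : nm (x - x1) < r1 -> [/\ nm (x - x0) < r, nm (s x - s x1) < t1 & nm (s x - s x1) < R1 / 2] by move=> /lt_minP [/ht2 + /ht3 xr]; rewrite lt_min => /andP [].
have cx x : nm (x - x1) < r1 -> c / 2 <= nm (dcoef e g m (s x)).
 move=> /r1P [_ /ht1 h _]; have := nm_rev (dcoef e g m (s x1)) (dcoef e g m (s x)).
 have aux (a b d : R) : d < a / 2 -> a - b <= d -> a / 2 <= b by clear; lra.
 by rewrite nmC -cE; exact: aux.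
have [q q0 /(_ (s x1)) qe] := ex_line e R10.
have line x (z : C^o) : nm (x - x1) < r1 -> nm z < q -> nm (s x + z *' e - s x1) < R1 by move=> /r1P [_ _ xr]; exact: qe.
have q3 : 0 < q / 3 by side.
have E0 : 0 <= 8 * M / (q / 3) ^+ m.+1 by side.
have [t4 t40 ht4] := ex_small c2 E0.
exists x1, r1, (minr t4 (q / 6)); split.
- by rewrite lt_min t20.
- by side.
- by move=> x /r1P [].
- move=> x xr; have [xr0 _ sR] := r1P x xr.
 have [k k0 hk] := sub_ball xr.
 have sx y : s y = sg y + psi y *' e by rewrite sE.
 apply: (@section_dif V (dcoef e g m.-1) sg psi e k) => //; [exact: dsg|exact: cpsi|apply: dif_dcoef; exact: hg|rewrite -sx|].
  rewrite (dd_dcoef e m.-1 (hgs x xr0)) prednK //.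
  apply: mulf_neq0; first by rewrite pnatr_eq0 -lt0n.
  by apply: nm_neq0; apply: lt_le_trans (cx x xr).
 by move=> y /hk /r1P [yr _ _]; rewrite -sx; apply: low => //; rewrite prednK.
move=> x v xr /lt_minP [v4 vq] gv.
have [xr0 _ sR] := r1P x xr.
have [_ T] := dcoef_tail q0 (fun z zq => dg _ (line x z xr zq)) (fun z zq => bg _ (line x z xr zq)).
apply/eqP; apply: contraT => v0; have nv : 0 < nm v by side.
have := T m.+1 v (ltW vq); rewrite big_ord_recr /= big1; last first.
 by move=> k _; rewrite low // mul0r.
have -> : g (s x + v *' e) = 0 by rewrite sE -addrA -scalerDl.
rewrite sub0r add0r nmN nmM nmX expr_div_n exprS.
have -> : 8 * M * (nm v * nm v ^+ m / (q / 3) ^+ m.+1) = (nm v * (8 * M / (q / 3) ^+ m.+1)) * nm v ^+ m by ring.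
have nvm : 0 < nm v ^+ m by side.
rewrite ler_pM2r // => hh; have := cx x xr.
have : nm v * (8 * M / (q / 3) ^+ m.+1) <= t4 * (8 * M / (q / 3) ^+ m.+1) by rewrite ler_wpM2r ?divr_ge0 ?mulr_ge0 ?exprn_ge0 // ltW.
move: hh ht4; move: (_ * (8 * M / _)) (_ * (8 * M / _)) (nm _) (c / 2); clear => *; lra.
Qed.

Transparent dcoef.
End OrderGraph.

(** * Graphs as regular points *)

Section Core.
Variables (R : realType) (n : nat).
Local Notation C := R[i].
Local Notation V := (Cn R n).

Lemma holo_mapP (phi : V -> V) p : holo_map_at phi p <-> hol phi p.
split=> [/nearP [r r0 h]|[r r0 h]]; first by exists r => // x /h /difP.
by apply/nearP; exists r => // x /h /difP.
Qed.

Lemma biholoI (phi psi : V -> V) p : hol phi p -> hol psi (phi p) -> (forall x, psi (phi x) = x) ->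
 (forall y, phi (psi y) = y) -> local_biholo phi p.
move=> h1 h2 k1 k2; split; first exact/holo_mapP.
by exists psi; split; [exact/holo_mapP|split; apply/nearP; exists 1].
Qed.

Definition mxm (M : 'M[C]_n) (x : V) : V := (x : 'rV[C]_n) *m M.

Lemma mxm_lin M : lin (mxm M).
by move=> a x y; rewrite /mxm mulmxDl -scalemxAl. Qed.
Lemma mx_bd k (M : 'M[C]_(n, k)) : exists2 K : R, 0 <= K & forall (x : V) i, nm (((x : 'rV[C]_n) *m M) 0 i : C^o) <= K * nm x.
exists (\sum_i \sum_j nmc (M j i)); first by side.
move=> x i; rewrite mxE; apply: le_trans (nm_sum _ _ _) _.
apply: le_trans (_ : \sum_j nmc (M j i) * nm x <= _).
 by apply: ler_sum => j _; rewrite nmM mulrC ler_wpM2l ?nm_ge0 //; exact: nm_coord.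
rewrite -mulr_suml ler_wpM2r ?nm_ge0 // [leRHS](bigD1 i) //= lerDl.
by side.
Qed.
Lemma mxm_bd M : exists2 K : R, 0 <= K & forall x, nm (mxm M x) <= K * nm x.
have [K K0 h] := mx_bd M; exists K => // x; apply: nm_le_coord => [|j]; first by side.
exact: h.
Qed.
Lemma dif_mxm M x : dif (mxm M) x.
by exists (mxm M); apply: hd_lin; [exact: mxm_lin|exact: mxm_bd]. Qed.

(** [P] projects along the rows of [E]. The reversal of indices is there because [regular_point_dim]
    asks for the last coordinates to vanish, whereas [pid_mx] selects the first. *)
Lemma adapted_basis k (E : 'M[C]_(k, n)) : row_free E -> exists (A A' P : 'M[C]_n) (F : 'M[C]_(n, k)),
 [/\ A *m A' = 1%:M, A' *m A = 1%:M, E *m P = 0, 1%:M - P = F *m E &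
  forall v : 'rV[C]_n, v *m P = v <-> forall i : 'I_n, (n - k <= i)%N -> (v *m A) 0 i = 0].
move=> rf; have rk : \rank E = k by apply/eqP.
have kn : (k <= n)%N by rewrite -rk rank_leq_col.
set T := row_ebase E; set L := col_ebase E.
have Tu : T \in unitmx by exact: row_ebase_unit.
have Lu : L \in unitmx by exact: col_ebase_unit.
have EE : E = L *m pid_mx k *m T by rewrite -{1}(mulmx_ebase E) rk.
pose A : 'M[C]_n := \matrix_(i, j) invmx T i (rev_ord j).
pose A' : 'M[C]_n := \matrix_(i, j) T (rev_ord i) j.
have AA : A *m A' = 1%:M.
 rewrite -(mulVmx Tu); apply/matrixP => i j; rewrite !mxE (reindex_inj rev_ord_inj) /=.
 by apply: eq_bigr => l _; rewrite !mxE rev_ordK.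
exists A, A', (invmx T *m copid_mx k *m T), (invmx T *m pid_mx k *m invmx L); split=> //.
- exact: mulmx1C.
- by rewrite {1}EE -!mulmxA (mulmxA T) mulmxV // mul1mx (mulmxA (pid_mx k)) mul_pid_mx_copid // mul0mx mulmx0.
- rewrite EE !mulmxA mulmxKV // -[invmx T *m _ *m pid_mx k]mulmxA mul_pid_mx !minnn.
 by rewrite /copid_mx mulmxBr mulmx1 mulmxBl mulVmx // opprB addrC subrK.
move=> v; have key : (v *m (invmx T *m copid_mx k *m T) = v) <-> v *m invmx T *m pid_mx k = 0 :> 'rV_n.
 have E1 : v *m (invmx T *m copid_mx k *m T) = v - v *m invmx T *m pid_mx k *m T by rewrite /copid_mx mulmxBr mulmx1 mulmxBl mulVmx // mulmxBr mulmx1 !mulmxA.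
 rewrite E1; split=> [/eqP|->]; last by rewrite mul0mx subr0.
 rewrite -subr_eq0 addrAC subrr add0r oppr_eq0 => /eqP h.
 by rewrite -[LHS](mulmxK Tu) h mul0mx.
rewrite key; split=> [/rowP h i ki|h].
 have := h (rev_ord i); rewrite [X in X = _]mxE (bigD1 (rev_ord i)) //= big1 ?addr0.
  have ltk : (n - i.+1 < k)%N by have := ltn_ord i; move: ki kn; clear; lia.
  rewrite [pid_mx k _ _]mxE eqxx /= ltk mulr1 [RHS]mxE => <-.
  by rewrite !mxE; apply: eq_bigr => l _; rewrite !mxE.
 by move=> j jn; rewrite [pid_mx _ _ _]mxE (negbTE (_ : j != rev_ord i :> nat)) ?mulr0.
apply/rowP => j; rewrite [LHS]mxE [RHS]mxE (bigD1 j) //= big1 ?addr0.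
 rewrite [pid_mx k _ _]mxE eqxx /=; case: ltnP => jk; last by rewrite mulr0.
 have := h (rev_ord j); rewrite mulr1 => <-; last by have := ltn_ord j; rewrite /=; move: jk kn; clear; lia.
 by rewrite !mxE; apply: eq_bigr => l _; rewrite !mxE rev_ordK.
by move=> l ln; rewrite [pid_mx _ _ _]mxE (negbTE (_ : l != j :> nat)) ?mulr0.
Qed.

(* [phi] straightens the graph of [s]: subtract the vertical displacement, then apply the adapted basis. *)
Lemma graph_regular k (E : 'M[C]_(k, n)) : row_free E -> exists (P : 'M[C]_n) (F : 'M[C]_(n, k)),
 (forall v : V, v = mxm P v + (v *m F *m E : V)) /\
 forall (Z : set V) (s : V -> V) (cf : V -> 'rV[C]_k) x1 (r1 d1 : R), 0 < r1 -> 0 < d1 -> (forall x, nm (x - x1) < r1 -> dif s x) ->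
  (forall x, s x = x + (cf x *m E : V)) ->
  (forall y, nm (y - s x1) < d1 -> (Z y <-> y = s (x1 + mxm P (y - s x1)))) ->
  regular_point_dim Z (s x1) (n - k).
move=> /adapted_basis [A [A' [P [F [AA A'A EP PF iff]]]]]; exists P, F; split.
 by move=> v; rewrite /mxm -mulmxA -PF mulmxBr mulmx1 subrKC.
move=> Z s cf x1 r1 d1 r10 d10 ds sc Zs.
pose tau (x : V) : V := s (x1 + x) - s x1 - x.
have tP x : mxm P (tau x) = 0.
 have -> : tau x = (cf (x1 + x) - cf x1) *m E.
  rewrite /tau !sc mulmxBl; move: (cf _ *m E) (cf _ *m E) => u u'; vring.
 by rewrite /mxm -mulmxA EP mulmx0.
have t0 : tau 0 = 0 by rewrite /tau addr0 subrr subr0.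
have lP := mxm_lin P.
pose phi (y : V) : V := mxm A (y - s x1 - tau (mxm P (y - s x1))).
pose psi (z : V) : V := s x1 + (mxm A' z + tau (mxm P (mxm A' z))).
have phiK y : psi (phi y) = y.
 rewrite /psi /phi; set v := _ - tau _; have -> : mxm A' (mxm A v) = v by rewrite /mxm -mulmxA AA mulmx1.
 by rewrite /v (linB _ _ lP) tP subr0 subrK subrKC.
have psiK z : phi (psi z) = z.
 rewrite /psi /phi [s x1 + _]addrC addrK (linD _ _ lP) tP addr0 addrK /mxm -mulmxA A'A mulmx1 //.
have p0 : phi (s x1) = 0 by rewrite /phi subrr (lin0 lP) t0 subr0 (lin0 (mxm_lin A)).
have dtau x : nm x < r1 -> dif tau x.
 move=> xr; apply: difB; last exact: dif_id; apply: difB; last exact: dif_cst.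
 apply: (dif_comp (g := s)); first by apply: difD; [exact: dif_cst|exact: dif_id].
 by apply: ds; rewrite addrAC subrr add0r.
have [K K0 bP] := mxm_bd P; have [K' K0' bA'] := mxm_bd A'.
have [q q0 qK] := ex_small r10 K0; have [q' q0' qK'] := ex_small q0 K0'.
have sub y : nm y < q -> nm (mxm P y) < r1 by move=> yq; exact: lin_lt (bP y) yq K0 qK.
have sub' y : nm y < q' -> nm (mxm A' y) < q by move=> yq; exact: lin_lt (bA' y) yq K0' qK'.
have dsh (x : V) : dif (fun x => x - s x1) x by apply: difB; [exact: dif_id|exact: dif_cst].
split; first by apply/Zs; rewrite ?subrr ?(nm0 V) // (lin0 lP) addr0.
split; first exact: leq_subr.
exists phi; split; last first.
 split; first exact: p0.
 apply/nearP; exists d1; first exact: d10.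
 move=> y /Zs ->.
 set w := y - s x1; set v := w - tau (mxm P w).
 have vP : mxm P v = mxm P w by rewrite /v (linB _ _ lP) tP subr0.
 have E1 : (v : 'rV_n) *m P = v <-> y = s (x1 + mxm P w).
  rewrite -[v *m P]/(mxm P v) vP /v /tau; move: (mxm P w) => a; rewrite /w; move: (s (x1 + a)) (s x1) => u u'; split=> h.
   apply: subr0_eq; have -> : y - u = (y - u' - (u - u' - a)) - a by vring.
   by rewrite -h subrr.
  by rewrite h; vring.
 by rewrite -E1 iff; split=> h i /h.
apply: (@biholoI phi psi) => //.
 exists q => // y yq; apply: (dif_comp (g := mxm A)); last exact: dif_mxm.
 apply: difB; first exact: dsh.
 apply: (dif_comp (g := tau)); last by apply: dtau; exact: sub.
 by apply: (dif_comp (g := mxm P)); [exact: dsh|exact: dif_mxm].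
rewrite p0; exists q' => // z; rewrite subr0 => zq; apply: difD; first exact: dif_cst.
apply: difD; first exact: dif_mxm.
apply: (dif_comp (g := tau)); last by apply: dtau; apply: sub; exact: sub'.
by apply: (dif_comp (g := mxm P)); exact: dif_mxm.
Qed.

Lemma regular_lin (L L' : V -> V) (Y : set V) p m : (forall x, dif L x) -> (forall x, dif L' x) ->
 (forall x, L' (L x) = x) -> (forall x, L (L' x) = x) ->
 regular_point_dim (fun y => Y (L y)) p m -> regular_point_dim Y (L p) m.
move=> dL dL' K1 K2 [Yp [mn [phi [[hphi [psi [hpsi [k1 k2]]]] [p0 iff]]]]]; split=> //; split=> //.
have hL' : hol L' (L p) by apply: hol_ent.
have back (P : V -> Prop) : (\forall x \near p, P x) -> \forall x \near L p, P (L' x).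
 move=> /nearP [r r0 h]; apply/nearP; have [d d0 hd] := hol_cont hL' r0; exists d => // x /hd.
 by rewrite K1 => /h.
exists (fun x => phi (L' x)); split; last first.
 rewrite K1; split=> //; have := back _ iff; apply: filterS => x; by rewrite K2.
split; first by apply/holo_mapP; apply: (@hol_comp R V V V L' phi) => //; rewrite K1; exact/holo_mapP.
exists (fun y => L (psi y)); rewrite K1; split.
 by apply/holo_mapP; apply: (@hol_comp R V V V psi L); [exact/holo_mapP|exact: hol_ent].
split; last by apply: filterS k2 => y; rewrite K1.
by have := back _ k1; apply: filterS => x ->; rewrite K2.
Qed.

Lemma tri_lt (a b c e r : R) : a - b <= c -> c < e -> b + e <= r -> a < r. by lra. Qed.
Lemma half_lt (a b d : R) : a < d / 2 -> b < d / 2 -> a + b < d. by lra. Qed.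
Lemma quarter_lt (a b c d e : R) (q x y z : R) : a <= q -> b <= q -> q < e / 4 -> c <= d + a -> d <= x + y -> x < e / 4 -> y < e / 4 -> c + b < e.
by lra. Qed.

Lemma fin_small (I : finType) (P : I -> R -> Prop) : (forall i, exists2 d, 0 < d & P i d) ->
 (forall i d d', d' <= d -> P i d -> P i d') -> exists2 d, 0 < d & forall i, P i d.
move=> h mono.
have hp i : exists B, 0 < B /\ P i B^-1 by have [d d0 hd] := h i; exists d^-1; rewrite invr_gt0 invrK.
have mono' i B B' : B <= B' -> 0 < B /\ P i B^-1 -> 0 < B' /\ P i B'^-1.
 move=> BB [B0 hB]; have B0' := lt_le_trans B0 BB; split=> //.
 by apply: mono hB; rewrite lef_pV2 // posrE.
have [B B1 hB] := fin_bd hp mono'.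
exists B^-1; first by rewrite invr_gt0; exact: lt_le_trans ltr01 B1.
by move=> i; case: (hB i).
Qed.

Lemma mdir_neq0v (g : V -> C^o) e N c : mdir g e N.+1 c -> e != 0.
move=> h; apply/eqP => e0; have := md_c h; rewrite -(md_lead h 0) e0 /dcoef.
have -> : (fun z : C^o => g (0 + z *' 0)) = fun=> g 0 by apply/funext => z; rewrite scaler0 addr0.
by rewrite (asy_tc (asy_cst (g 0))) eqxx.
Qed.

Lemma mpoly_cts (g : V -> C^o) e N c x : mdir g e N c -> pf (fun h : V -> C^o => cts h x) (mpoly g e N c).
by move=> h k; apply/dif_cts/pg_ent; exact: mpoly_pf. Qed.

Lemma cts_near0 (g : V -> C^o) x : cts g x -> g x != 0 -> exists2 d : R, 0 < d & forall y, nm (y - x) < d -> g y != 0.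
move=> h g0; have p : 0 < nm (g x) by side.
have [d d0 hd] := h _ p; exists d => // y /hd; apply: contraTneq => ->.
by rewrite sub0r nmN ltxx.
Qed.

Lemma tail_zero (g : V -> C^o) (e y0 : V) : hol g y0 -> exists r q : R, [/\ 0 < r, 0 < q &
 forall y, nm (y - y0) < r -> (forall m, dcoef e g m y = 0) -> forall v : C^o, nm v < q -> g (y + v *' e) = 0].
move=> h; have [r [M [r0 M0 dg bg]]] := hol_bd h.
have r2 : 0 < r / 2 by side.
have [q q0 qe] := ex_line e r0.
exists (r / 2), (q / 6); split=> //; first by side.
move=> y yr dz v vq.
have line z := qe y0 y z yr.
have [_ T] := dcoef_tail q0 (fun z zq => dg _ (line z zq)) (fun z zq => bg _ (line z zq)).
apply: (@nm_le0 R C^o); apply: (@pow2_lim0 R _ (8 * M) 0) => m _.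
have := T m v (ltW vq); rewrite big1 ?subr0; last by move=> k _; rewrite dz mul0r.
move=> /le_trans; apply; rewrite ler_wpM2l ?mulr_ge0 //; apply: lerXn2r; rewrite ?nnegrE ?divr_ge0 ?nm_ge0 ?(ltW q0) ?invr_ge0 //.
by rewrite ler_pdivrMr ?divr_gt0 //; move: vq; clear; lra.
Qed.

Lemma hol_in_ball (H : V -> C^o) (r : R) p : (forall y, nm y < r -> dif H y) -> nm p < r -> hol H p.
move=> dH; rewrite -{1}(subr0 p) => /sub_ball [s s0 hs]; exists s => // y /hs.
by rewrite subr0; exact: dH.
Qed.

Lemma row1E k (c : 'rV[C]_k) (E : 'M[C]_(k, n)) : (c *m E : V) = \sum_i c 0 i *: (row i E : V).
by rewrite mulmx_sum_row. Qed.

(** * A generic fibre avoids the codimension 3 set *)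

Section Ctx.
Variables (w : 'I_n -> nat) (d : nat) (f : V -> C^o).
Hypotheses (w0 : forall i, (0 < w i)%N) (ef : ent f) (hf : whom w d f) (irr : irreducible_zero_germ f).
Local Notation act := (act w).
Variables (e1 : V) (N : nat) (c1 : C^o).
Hypothesis hm : mdir f e1 N.+1 c1.

(** [sheets] provides continuous roots over a ball and [order_graph] makes one of them holomorphic
    and isolated from the others. The base is an open set of the whole space, not of a hyperplane;
    [graph_regular] removes the redundancy along [e1]. *)
Lemma X_graph p (eps : R) : f p = 0 -> 0 < eps -> exists x1 r1 d1 (psi : V -> C^o), [/\ 0 < r1, 0 < d1,
 (forall x, nm (x - x1) < r1 -> dif psi x),
 (forall x, nm (x - x1) < r1 -> f (x + psi x *' e1) = 0 /\ nm (x + psi x *' e1 - p) < eps) &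
 forall x (v : C^o), nm (x - x1) < r1 -> nm v < d1 -> f (x + (psi x + v) *' e1) = 0 -> v = 0].
move=> fp e0; have e4 : 0 < eps / 4 by side.
have [q q0 qe] := ex_small e4 (nm_ge0 e1).
have [d0 d00 hz] := zero_near hm isT fp q0.
pose rr := minr d0 (eps / 4).
have rr0 : 0 < rr by rewrite lt_min d00.
have [xa [ra [m [psi [ra0 sub cp roots]]]]] := @sheets R V (mpoly f e1 N.+1 c1) N.+1 p rr rr0
 (fun x _ => mpoly_monic hm x) (fun x _ => mpoly_size hm x) (fun x _ => mpoly_cts x hm).
have xaa := nm_self xa ra0.
have [xd xe] : nm (xa - p) < d0 /\ nm (xa - p) < eps / 4 by have := sub xa xaa; rewrite lt_min => /andP.
have [z zq fz] := hz xa xd.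
have /(roots _ _ xaa) [i zi] : root (mpoly f e1 N.+1 c1 xa) z by rewrite (mpoly_root hm) fz.
have [db db0 hb] := cp i xa xaa q q0.
pose rb := minr ra (minr db (eps / 4)).
have rb0 : 0 < rb by rewrite !lt_min ra0 db0.
have fz' x : nm (x - xa) < rb -> f (x + psi i x *' e1) = 0.
 move=> /lt_minP [xr _]; apply/eqP; rewrite -(mpoly_root hm); apply/(roots _ _ xr); by exists i.
have cpb x : nm (x - xa) < rb -> cts (psi i) x by move=> /lt_minP [xr _]; exact: cp.
have [|x1 [r1 [d1 [r10 d10 sb dp un]]]] := @order_graph R n f id (psi i) e1 xa rb rb0 (fun x _ => dif_id x) cpb
  (fun x _ => hol_ent (x + psi i x *' e1) ef) fz'.
 exists xa; first by rewrite subrr (nm0 V).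
 by exists N.+1; rewrite (md_lead hm) (md_c hm).
exists x1, r1, d1, (psi i); split=> // x xr; split; first exact/fz'/sb.
have := sb x xr; rewrite !lt_min => /and3P [_ /hb pq xx].
have E : x + psi i x *' e1 - p = (x - xa) + (xa - p) + (psi i x - psi i xa) *' e1 + z *' e1 by rewrite zi; vring.
rewrite E; apply: le_lt_trans (nmD _ _) _; rewrite nmZ.
have t2 := nmD (x - xa + (xa - p)) ((psi i x - psi i xa) *' e1); rewrite nmZ in t2.
have a1 : nm (psi i x - psi i xa) * nm e1 <= q * nm e1 by rewrite ler_wpM2r ?nm_ge0 // ltW.
have a2 : nm z * nm e1 <= q * nm e1 by rewrite ler_wpM2r ?nm_ge0 // ltW.
exact: (quarter_lt 0 a1 a2 qe t2 (nmD (x - xa) (xa - p)) xx xe).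
Qed.

Lemma act_inv (t : C) : t != 0 -> (forall x, act t^-1 (act t x) = x) /\ (forall x, act t (act t^-1 x) = x).
by move=> t0; split=> x; rewrite act_act ?mulVf ?mulfV // act1. Qed.

Lemma X_act_inv (t : C) x : t != 0 -> f (act t x) = 0 -> f x = 0.
by move=> t0 /eqP; rewrite hf mulf_eq0 expf_eq0 (negbTE t0) andbF => /eqP. Qed.

Lemma graph_X (Z : set V) p (eps : R) : (0 < n)%N -> f p = 0 -> 0 < eps -> (forall y, nm (y - p) < eps -> (Z y <-> f y = 0)) ->
 exists2 q, nm (q - p) < eps & regular_point_dim Z q (n - 1).
move=> n0 fp e0 ZX; have [x1 [r1 [d1 [psi [r10 d10 dp fz un]]]]] := X_graph fp e0.
have rf : row_free (e1 : 'M[C]_(1, n)) by rewrite /row_free rank_rV (mdir_neq0v hm).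
have [P [F [dec reg]]] := graph_regular rf.
have x11 := nm_self x1 r10.
have [s sE] : {s : V -> V | forall x, s x = x + psi x *' e1} by exists (fun x => x + psi x *' e1).
have [_ se] := fz x1 x11; rewrite -sE in se.
exists (s x1) => //.
have [KP KP0 bP] := mxm_bd P; have [KF KF0 bF] := mx_bd F.
have d2 : 0 < d1 / 2 by side.
have [a a0 ha] := dif_cts (dp x1 x11) d2.
have m0 : 0 < minr a r1 by side.
have [b b0 hb] := ex_small m0 KP0; have [g g0 hg] := ex_small d2 KF0.
have e'0 : 0 < eps - nm (s x1 - p) by side.
apply: (@reg Z s (fun x => (psi x : C)%:M) x1 r1 (minr (minr b g) (eps - nm (s x1 - p))) r10).
- by side.
- move=> x xr; apply: (dif_eq (f := fun x => x + psi x *' e1)) => [y|]; first by rewrite sE.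
 by apply: difD; [exact: dif_id|apply/difZl/dp].
- by move=> x; rewrite mul_scalar_mx sE.
move=> y; rewrite !lt_min => /andP [/andP [yb yg] ye].
rewrite ZX; last by have := nm_dist (s x1) y p; move: ye; lra.
set ww := y - s x1; set x := x1 + mxm P ww.
have xx : x - x1 = mxm P ww by rewrite /x addrAC subrr add0r.
have [xa xr] : nm (x - x1) < a /\ nm (x - x1) < r1.
 suff : nm (x - x1) < minr a r1 by rewrite lt_min => /andP.
 by rewrite xx; exact: lin_lt (bP _) yb KP0 hb.
split=> [fy|->]; last by rewrite sE; case: (fz x xr).
pose cF := (ww *m F) 0 0.
have yE : y = x + (psi x1 + cF) *' e1.
 have := dec ww; rewrite row1E big_ord1 -/cF.
 have -> : (row 0 e1 : V) = e1 by apply/rowP => j; rewrite mxE.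
 move=> h; have -> : y = s x1 + ww by rewrite subrKC.
 by rewrite {1}h /x sE; vring.
have cF2 : nmc cF < d1 / 2.
 exact: lin_lt (bF _ _) yg KF0 hg.
have v0 : psi x1 + cF - psi x = 0.
 apply: un xr _ _; last by rewrite subrKC -yE.
 have -> : psi x1 + cF - psi x = cF - (psi x - psi x1) by ring.
 by apply: le_lt_trans (nmB _ _) _; exact: half_lt cF2 (ha x xa).
by rewrite sE {1}yE -(subrK (psi x) (psi x1 + cF)) v0 add0r.
Qed.

Variables (Y : set V) (h : V -> C^o) (e2 : V) (N2 : nat) (c2 : C^o).
Hypotheses (hinv : forall x (z : C), h (x + z *: e1) = h x) (hm2 : mdir h e2 N2.+1 c2).

Lemma indep : row_free (col_mx (e1 : 'rV[C]_n) (e2 : 'rV[C]_n)).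
have n1 := mdir_neq0v hm; have n2 := mdir_neq0v hm2.
rewrite -kermx_eq0; apply/eqP/row_matrixP => i; rewrite row0.
have := sub_kermxP (row_sub i (kermx (col_mx (e1 : 'rV[C]_n) e2))).
set u := row i _; rewrite -[u]hsubmxK mul_row_col.
set a := lsubmx u; set b := rsubmx u; rewrite [a]mx11_scalar [b]mx11_scalar !mul_scalar_mx => E.
have b0 : b 0 0 = 0.
 apply/eqP; apply: contraT => b0.
 have E2 : e2 = (- (a 0 0 / b 0 0)) *: e1.
  have E' : b 0 0 *: (e2 : 'rV_n) = - (a 0 0 *: (e1 : 'rV_n)) by apply/eqP; rewrite -addr_eq0 addrC E.
  by rewrite -[LHS]scale1r -(mulVf b0) -scalerA E' scalerN scaleNr scalerA mulrC.
 have := md_c hm2; rewrite -(md_lead hm2 0) /dcoef.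
 have -> : (fun z : C^o => h (0 + z *' e2)) = fun=> h 0 by apply/funext => z; rewrite E2 scalerA hinv.
 by rewrite (asy_tc (asy_cst (h 0))) eqxx.
have a0 : a 0 0 = 0.
 apply/eqP; move: E; rewrite b0 scale0r addr0 => /eqP; rewrite scaler_eq0 => /orP [//|/eqP e0].
 by move: n1; rewrite -[e1]/(e1 : 'rV[C]_n) e0 eqxx.
by rewrite a0 b0 raddf0 row_mx0.
Qed.

(** The roots of [f] over all the points [x + phi i x *' e2] are put into one product [Q], so that
    [sheets] is used only once more. A pair [phi i], [psi k] need not lie on the zero set, but every
    point of the fibre is such a pair. *)
Lemma fibre_sections : exists xb rb m m' (phi : 'I_m -> V -> C^o) (psi : 'I_m' -> V -> C^o), [/\ 0 < rb,
 (forall i x, nm (x - xb) < rb -> cts (phi i) x), (forall k x, nm (x - xb) < rb -> cts (psi k) x),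
 (forall i x, nm (x - xb) < rb -> h (x + phi i x *' e2) = 0) &
 forall x (u z : C), nm (x - xb) < rb -> h (x + u *: e2) = 0 -> f (x + u *: e2 + z *: e1) = 0 ->
  exists i k, u = phi i x /\ z = psi k x].
have [xa [ra [m [phi [ra0 _ cp roots]]]]] := @sheets R V (mpoly h e2 N2.+1 c2) N2.+1 0 1 ltr01
 (fun x _ => mpoly_monic hm2 x) (fun x _ => mpoly_size hm2 x) (fun x _ => mpoly_cts x hm2).
pose Q (x : V) : {poly C} := \prod_(i < m) mpoly f e1 N.+1 c1 (x + phi i x *' e2).
have Qm x : nm (x - xa) < ra -> Q x \is monic by move=> _; apply: monic_prod => i _; exact: mpoly_monic hm _.
have Qs x : nm (x - xa) < ra -> size (Q x) = (\sum_(i < m) N.+1)%N.+1.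
 move=> _; rewrite size_prod_seq; last by move=> i _; apply: monic_neq0; exact: mpoly_monic hm _.
 under eq_bigr do rewrite (mpoly_size hm).
 by rewrite -sum1_size !sum_nat_const !card_ord; lia.
have Qc x : nm (x - xa) < ra -> pf (fun g : V -> C^o => cts g x) Q.
 move=> xr; apply: (@pf_prod R V (fun g : V -> C^o => cts g x)) => //.
 - by move=> c; exact: cts_cst.
 - by move=> g1 g2; exact: ctsD.
 - by move=> g1 g2; exact: ctsM.
 move=> i k; apply: (@cts_comp R V V C^o (fun x => x + phi i x *' e2) (fun y => (mpoly f e1 N.+1 c1 y)`_k)).
  by apply: ctsD; [apply: dif_cts; exact: dif_id|apply: ctsZ; exact: cp].
 exact: mpoly_cts hm k.
have [xb [rb [m' [psi [rb0 sub cp' roots']]]]] := @sheets R V Q _ xa ra ra0 Qm Qs Qc.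
exists xb, rb, m, m', phi, psi; split=> //.
- by move=> i x /sub; exact: cp.
- by move=> i x /sub xr; apply/eqP; rewrite -(mpoly_root hm2); apply/(roots _ _ xr); exists i.
move=> x u z xr hu fz; have /(roots _ _ (sub _ xr)) [i Ei] : root (mpoly h e2 N2.+1 c2 x) u by rewrite (mpoly_root hm2) hu.
have /(roots' _ _ xr) [k Ek] : root (Q x) z.
 rewrite /Q (bigD1 i) //= rootM (mpoly_root hm) -Ei fz eqxx //.
by exists i, k.
Qed.

Hypotheses (Yan : analytic_germ Y) (YX : \forall x \near (0 : V), Y x -> f x = 0) (Ydim : germ_dim_le Y (n - 3)) (n3 : (3 <= n)%N).

Lemma Y_equations (eps : R) : 0 < eps -> exists k (g : 'I_k -> V -> C^o) (r M : R), [/\ 0 < r, r <= eps,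
 (forall j y, nm y < r -> dif (g j) y /\ nm (g j y) <= M),
 (forall y, nm y < r -> (Y y <-> forall j, g j y = 0)) &
 forall y, nm y < r -> (Y y -> f y = 0) /\ forall m, regular_point_dim Y y m -> (m <= n - 3)%N].
move=> eps0; have [k [g [hg /near0P [r1 r10 h1]]]] := Yan.
have /near0P [r2 r20 h2] := YX; have /near0P [r3 r30 h3] := Ydim.
(* The one number [r4] is a radius and the inverse of a bound, a form in which finitely many
   requirements are met by shrinking it. *)
have [r4 r40 h4] : exists2 r4 : R, 0 < r4 & forall j y, nm y < r4 -> dif (g j) y /\ nm (g j y) <= r4^-1.
 apply: (@fin_small _ (fun j r4 => forall y, nm y < r4 -> dif (g j) y /\ nm (g j y) <= r4^-1)).
  move=> j; have [r [M [r0 M0 dg bg]]] := hol_bd ((hol_holo (g j) 0).2 (hg j)).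
  have M1 : 0 < M + 1 by side.
  exists (minr r (M + 1)^-1); first by side.
  move=> y /lt_minP [yr _]; split; first by apply: dg; rewrite subr0.
  apply: le_trans (_ : M + 1 <= _); first by apply: le_trans (bg y _) _; rewrite ?subr0 // lerDl.
  rewrite -[leLHS]invrK lef_pV2 ?posrE ?lt_min ?r0 ?invr_gt0 //.
  by rewrite ge_min lexx orbT.
 move=> j r r' rr hj y yr; have [|? b] := hj y; first exact: lt_le_trans yr rr.
 have r'0 : 0 < r' by apply: le_lt_trans yr; exact: nm_ge0.
 by split=> //; apply: le_trans b _; rewrite lef_pV2 // posrE // (lt_le_trans r'0).
exists k, g, (minr eps (minr r1 (minr r2 (minr r3 r4)))), r4^-1.
split.
- by side.
- by rewrite ge_min lexx.
- by move=> j y; rewrite !lt_min => /and5P [_ _ _ _ /h4].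
- by move=> y; rewrite !lt_min => /and5P [_ /h1].
- by move=> y; rewrite !lt_min => /and5P [_ _ /h2 ? /h3].
Qed.

Section SectionInY.
Variables (phi psi : V -> C^o) (x1 : V) (r1 r : R) (t : C) (Z : set V) (H : V -> C^o).
Hypotheses (r10 : 0 < r1) (cphi : forall x, nm (x - x1) < r1 -> cts phi x) (cpsi : forall x, nm (x - x1) < r1 -> cts psi x) (sr : forall x, nm (x - x1) < r1 -> nm (x + phi x *' e2 + psi x *' e1) < r) (sZ : forall x, nm (x - x1) < r1 -> Z (x + phi x *' e2 + psi x *' e1)) (ZX : forall y, nm y < r -> Z y -> f y = 0) (ZH : forall y, nm y < r -> Z y -> H y = 0) (dH : forall y, nm y < r -> dif H y) (Hinv : forall x (z : C), H (x + z *: e1) = H x) (Hn0 : exists2 y, nm y < r & H y != 0).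

(** [order_graph] is used twice: [H] along [e2] makes [phi] holomorphic and isolated, then [f] along
    [e1] does the same for [psi]. Near the section [Z] is then exactly a graph over [n - 2]
    dimensions. *)
Lemma section_regular : exists2 x, nm (x - x1) < r1 &
 regular_point_dim Z (x + phi x *' e2 + psi x *' e1) (n - 2).
have x11 := nm_self x1 r10.
have holH x : nm (x - x1) < r1 -> hol H (x + phi x *' e2).
 move=> xr; apply: (@hol_eq R V C^o (fun y => H (y + psi x *' e1))); first by move=> y; rewrite Hinv.
 apply: (@hol_comp R V V C^o (fun y => y + psi x *' e1) H); first by apply: hol_ent => y; exact: dif_shift.
 by apply: hol_in_ball dH _; exact: sr.
have Hz x : nm (x - x1) < r1 -> H (x + phi x *' e2) = 0 by move=> xr; rewrite -(Hinv _ (psi x)); apply: ZH; [exact: sr|exact: sZ].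
(* If [H] vanished to infinite order along [e2] at all points of the section, it would vanish on an
   open set and, by continuation along segments in the ball, contradict [Hn0]. *)
have fin : exists2 x, nm (x - x1) < r1 & exists m, dcoef e2 H m (x + phi x *' e2) != 0.
 apply: contrapT => no.
 have dz x m : nm (x - x1) < r1 -> dcoef e2 H m (x + phi x *' e2) = 0 by move=> xr; apply/eqP; apply: contraT => hx; case: no; exists x => //; exists m.
 have [ra [q [ra0 q0 tz]]] := tail_zero e2 (holH x1 x11).
 have cs : cts (fun x : V => x + phi x *' e2) x1 by apply: ctsD; [apply: dif_cts; exact: dif_id|apply: ctsZ; exact: cphi].
 have [da da0 hda] := cs _ ra0; have [db db0 hdb] := cphi x11 q0.
 have y1z y : nm (y - (x1 + phi x1 *' e2)) < minr r1 (minr da db) -> H y = 0.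
  pose x := y - phi x1 *' e2.
  have -> : y - (x1 + phi x1 *' e2) = x - x1 by rewrite /x opprD addrA addrAC.
  rewrite !lt_min => /and3P [xr xa xb].
  have := tz _ (hda x xa) (fun m => dz x m xr) (phi x1 - phi x); rewrite nmC => /(_ (hdb x xb)) <-.
  by congr H; rewrite /x scalerBl; vring.
 have [y0 y0r] := Hn0; case/eqP.
 pose p1 := x1 + phi x1 *' e2 + psi x1 *' e1.
 have p1r : nm p1 < r by exact: sr.
 have mn : 0 < minr r1 (minr da db) by side.
 apply: (@segment_zero R V H p1 y0 _ mn).
  move=> s /andP [s0 s1].
  have lt : nm (p1 + s%:C *: (y0 - p1)) < r.
   have -> : p1 + s%:C *: (y0 - p1) = (1 - s)%:C *: p1 + s%:C *: y0.
    rewrite rmorphB rmorph1; vring.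
   apply: le_lt_trans (nmD _ _) _; rewrite !nmZ !nm_real !ger0_norm ?subr_ge0 //.
   have h1 : (1 - s) * nm p1 <= (1 - s) * maxr (nm p1) (nm y0) by rewrite ler_wpM2l ?subr_ge0 // le_max lexx.
   have h2 : s * nm y0 <= s * maxr (nm p1) (nm y0) by rewrite ler_wpM2l // le_max lexx orbT.
   have h3 : maxr (nm p1) (nm y0) < r by rewrite gt_max p1r.
   move: h1 h2 h3; move: (maxr _ _) ((1 - s) * nm p1) (s * nm y0) => M u v h1 h2 h3.
   have : (1 - s) * M + s * M = M by ring.
   by lra.
  exact: hol_in_ball dH lt.
 move=> y hy; rewrite -(Hinv y (- psi x1)); apply: y1z.
 suff -> : y + (- psi x1) *: e1 - (x1 + phi x1 *' e2) = y - p1 by [].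
 by rewrite /p1; vring.
have [x2 [r2 [d2 [r20 d20 sub2 dphi un2]]]] := @order_graph R n H id phi e2 x1 r1 r10 (fun x _ => dif_id x) cphi holH Hz fin.
have x22 := nm_self x2 r20.
have dsg x : nm (x - x2) < r2 -> dif (fun x : V => x + phi x *' e2) x by move=> xr; apply: difD; [exact: dif_id|apply/difZl/dphi].
have [|x3 [r3 [d3 [r30 d30 sub3 dpsi un3]]]] := @order_graph R n f (fun x : V => x + phi x *' e2) psi e1 x2 r2 r20
  dsg (fun x xr => cpsi (sub2 x xr)) (fun x _ => hol_ent (x + phi x *' e2 + psi x *' e1) ef)
  (fun x xr => ZX (sr (sub2 x xr)) (sZ (sub2 x xr))).
 by exists x2 => //; exists N.+1; rewrite (md_lead hm) (md_c hm).
exists x3; first by apply/sub2/sub3; rewrite subrr (nm0 V).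
have x33 := nm_self x3 r30.
have [P [F [dec reg]]] := graph_regular indep.
have [s sE] : {s : V -> V | forall x, s x = x + phi x *' e2 + psi x *' e1} by exists (fun x => x + phi x *' e2 + psi x *' e1).
have [KP KP0 bP] := mxm_bd P; have [KF KF0 bF] := mx_bd F.
have d22 : 0 < d2 / 2 by side.
have d32 : 0 < d3 / 2 by side.
have [a a0 ha] := cphi (sub2 _ (sub3 _ x33)) d22.
have [b b0 hb] := cpsi (sub2 _ (sub3 _ x33)) d32.
have m0 : 0 < minr r3 (minr a b) by side.
have [g g0 hg] := ex_small m0 KP0.
have [g1 g10 hg1] := ex_small d22 KF0; have [g2 g20 hg2] := ex_small d32 KF0.
have s3r : nm (s x3) < r by rewrite sE; apply/sr/sub2/sub3.
rewrite -sE; apply: (@reg Z s (fun x => row_mx (psi x : C)%:M (phi x : C)%:M) x3 r3 (minr (r - nm (s x3)) (minr g (minr g1 g2))) r30).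
- by side.
- move=> x xr; apply: (dif_eq (f := fun x => x + phi x *' e2 + psi x *' e1)) => [y|]; first by rewrite sE.
 by apply: difD; [apply/dsg/sub3|apply/difZl/dpsi].
- by move=> x; rewrite mul_row_col !mul_scalar_mx sE [_ *: _ + _]addrC addrA.
move=> y; rewrite !lt_min => /and4P [yr yg yg1 yg2].
set ww := y - s x3; set x := x3 + mxm P ww.
have yr' : nm y < r by have := nm_rev y (s x3); move: yr; lra.
have xx : x - x3 = mxm P ww by rewrite /x addrAC subrr add0r.
have : nm (x - x3) < minr r3 (minr a b) by rewrite xx; exact: lin_lt (bP _) yg KP0 hg.
rewrite !lt_min => /and3P [xr xa xb].
split=> [Zy|->]; last by rewrite sE; apply/sZ/sub2/sub3.
pose al := (ww *m F) 0 (lshift 1 0); pose be := (ww *m F) 0 (rshift 1 0).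
have yE : y = x + (phi x3 + be) *' e2 + (psi x3 + al) *' e1.
 have := dec ww; rewrite -[ww *m F]hsubmxK mul_row_col [lsubmx _]mx11_scalar [rsubmx _]mx11_scalar !mul_scalar_mx.
 rewrite [lsubmx _ 0 0]mxE [rsubmx _ 0 0]mxE -/al -/be => hh.
 have -> : y = s x3 + ww by rewrite subrKC.
 by rewrite {1}hh /x sE; vring.
have be2 : nmc be < d2 / 2.
 exact: lin_lt (bF _ _) yg1 KF0 hg1.
have al2 : nmc al < d3 / 2.
 exact: lin_lt (bF _ _) yg2 KF0 hg2.
have v0 : phi x3 + be - phi x = 0.
 apply: (un2 x _ (sub3 _ xr)); last by rewrite subrKC -(Hinv _ (psi x3 + al)) -yE; apply: ZH.
 have -> : phi x3 + be - phi x = be - (phi x - phi x3) by ring.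
 by apply: le_lt_trans (nmB _ _) _; exact: half_lt be2 (ha x xa).
have v0' := subr0_eq v0.
have u0 : psi x3 + al - psi x = 0.
 apply: (un3 x _ xr); last by rewrite subrKC -v0' -yE; apply: ZX.
 have -> : psi x3 + al - psi x = al - (psi x - psi x3) by ring.
 by apply: le_lt_trans (nmB _ _) _; exact: half_lt al2 (hb x xb).
have u0' := subr0_eq u0.
by rewrite sE -u0' -v0' -yE.
Qed.
End SectionInY.

(** If no small ball of fibres avoids [Y], then [finite_avoid] finds one section that stays inside
    [Y] over a ball, and this produces a regular point of dimension above [n - 3]. *)
Lemma generic_fibre (eps : R) : 0 < eps -> exists x0 r0 t, [/\ 0 < r0, t != 0 &
 forall x (u z : C), nm (x - x0) < r0 -> h (x + u *: e2) = 0 -> f (x + u *: e2 + z *: e1) = 0 ->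
  nm (act t (x + u *: e2 + z *: e1)) < eps /\ ~ Y (act t (x + u *: e2 + z *: e1))].
move=> eps0; have [xb [rb [m [m' [phi [psi [rb0 cphi cpsi hz roots]]]]]]] := fibre_sections.
have [j ej] : exists j, coord e1 j != 0.
 apply: contrapT => no; have := mdir_neq0v hm; case/eqP; apply: coord_inj => j; rewrite coord0.
 by apply/eqP; apply: contraT => hj; case: no; exists j.
pose s (i : 'I_m * 'I_m') (x : V) : V := x + phi i.1 x *' e2 + psi i.2 x *' e1.
have cs i x : nm (x - xb) < rb -> cts (s i) x.
 move=> xr; apply: ctsD; last by apply: ctsZ; exact: cpsi.
 by apply: ctsD; [apply: dif_cts; exact: dif_id|apply: ctsZ; exact: cphi].
have xbb := nm_self xb rb0.
have [rc rc0 hrc] : exists2 rc : R, 0 < rc & forall i x, nm (x - xb) < rc -> nm (s i x - s i xb) < 1.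
 apply: (@fin_small _ (fun i rc => forall x, nm (x - xb) < rc -> nm (s i x - s i xb) < 1)) => [i|i a b ab ha x xa].
  exact: cs i xb xbb 1 ltr01.
 by apply: ha; exact: lt_le_trans xa ab.
have [r r1 hr] : exists2 r : R, 1 <= r & forall i, nm (s i xb) + 1 <= r.
 apply: (@fin_bd R _ (fun i r => nm (s i xb) + 1 <= r)) => [i|i a b ab ha]; first by exists (nm (s i xb) + 1).
 exact: le_trans ha ab.
have r0 : 0 < r by exact: lt_le_trans ltr01 r1.
pose rd := minr rb rc; have rd0 : 0 < rd by rewrite lt_min rb0.
have sr i x : nm (x - xb) < rd -> nm (s i x) < r.
 move=> /lt_minP [_ /(hrc i) xr]; exact: tri_lt (nm_rev (s i x) (s i xb)) xr (hr i).
have [rho rrho NB] := norm_ball w0 ef hf irr hm ej r0.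
have [k [g [ry [M [ry0 rye gd Yg YP]]]]] := Y_equations eps0.
have rho0 : 0 < rho by exact: lt_le_trans r0 rrho.
(* The fibres are bounded but not small. The action of a small [t] carries them into the ball on
   which the germ [Y] is described by its equations. *)
have [tr tr0 htr] := ex_small ry0 (ltW rho0).
pose tt := minr 1 tr; have tt0 : 0 < tt by rewrite lt_min ltr01.
pose t : C := tt%:C.
have nt : nmc t = tt by rewrite nm_real gtr0_norm.
have t0 : t != 0 by apply: nm_neq0; rewrite nt.
have at_ y : nm y < rho -> nm (act t y) < ry.
 move=> yr; have t1 : nmc t <= 1 by rewrite nt ge_min lexx.
 apply: le_lt_trans (nm_act w0 y t1) _; rewrite nt; apply: le_lt_trans htr.
 by apply: ler_pM; rewrite ?nm_ge0 ?(ltW tt0) ?(ltW yr) // ge_min lexx orbT.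
pose G jj (y : V) : C^o := g jj (act t y).
have dG jj y : nm y < rho -> dif (G jj) y by move=> yr; apply: (dif_comp (g := g jj)); [exact: dif_act|case: (gd jj _ (at_ y yr))].
have bG jj y : nm y < rho -> nm (G jj y) <= M by move=> yr; case: (gd jj _ (at_ y yr)).
pose Z : set V := fun y => Y (act t y).
have ZG y : nm y < rho -> (Z y <-> forall jj, G jj y = 0) by move=> yr; exact: Yg (at_ y yr).
have ZX y : nm y < rho -> Z y -> f y = 0 by move=> yr Zy; apply: (X_act_inv t0); case: (YP _ (at_ y yr)) => hh _; exact: hh.
have regZ y mm : nm y < rho -> regular_point_dim Z y mm -> (mm <= n - 3)%N.
 move=> yr; have [k1 k2] := act_inv t0.
 move=> /(@regular_lin (act t) (act t^-1) Y y mm (dif_act w t) (dif_act w t^-1) k1 k2).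
 by case: (YP _ (at_ y yr)) => _; apply.
have srho i x : nm (x - xb) < rd -> nm (s i x) < rho by move=> /(sr i) h1; exact: lt_le_trans h1 rrho.
have cl i : closed_in (fun x => nm (x - xb) < rd) (fun x => Z (s i x)).
 move=> x xr nZ; have [jj Gj] : exists jj, G jj (s i x) != 0.
  apply: contrapT => no; apply: nZ; apply/(ZG _ (srho i x xr)) => jj; apply/eqP; apply: contraT => hj.
  by case: no; exists jj.
 have xrb : nm (x - xb) < rb by case/lt_minP: xr.
 have cG : cts (fun x => G jj (s i x)) x by apply: (@cts_comp R V V C^o (s i) (G jj)); [exact: cs|apply: dif_cts; apply: dG; exact: srho].
 have [da da0 hda] := cts_near0 cG Gj; have [db db0 hdb] := sub_ball xr.
 exists (minr da db); first by side.
 move=> y /lt_minP [/hda Gy /hdb yr] /(ZG _ (srho i y yr)) /(_ jj) Gy0.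
 by move: Gy; rewrite Gy0 eqxx.
have [x1 [r1' [r10 sub]]] := finite_avoid (s := enum {: 'I_m * 'I_m'}) rd0 (fun i _ => cl i).
case=> [[i _ inZ]|avoid]; last first.
 exists x1, r1', t; split=> // x u z xr hu fu; have xrd := sub x xr.
 have xrb : nm (x - xb) < rb by case/lt_minP: xrd.
 have [i [kk [-> ->]]] := roots x u z xrb hu fu.
 rewrite -[x + _ + _]/(s (i, kk) x); split; first by apply: lt_le_trans (at_ _ (srho _ _ xrd)) rye.
 by apply: avoid xr; rewrite mem_enum.
exfalso.
have sub' x : nm (x - x1) < r1' -> nm (x - xb) < rb by move=> /sub /lt_minP [].
(* Either an equation of [Y] is not identically zero on the zero set, and its norm confines the
   section to dimension [n - 2], or [Y] contains an open piece of the zero set, of dimension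
   [n - 1]. *)
have [[jj nz]|all0] := pselect (exists jj, ~ (forall x, nm x < r -> f x = 0 -> G jj x = 0)).
 have [H [dH Hinv Hn0 HX]] := NB (G jj) M (dG jj) (bG jj) nz.
 have lt (y : V) : nm y < r -> nm y < rho by move=> yr; exact: lt_le_trans yr rrho.
 have [|||||||||x xr reg] := @section_regular (phi i.1) (psi i.2) x1 r1' r Z H r10.
 - by move=> x /sub'; exact: cphi.
 - by move=> x /sub'; exact: cpsi.
 - by move=> x /sub; exact: sr i x.
 - exact: inZ.
 - by move=> y /lt; exact: ZX.
 - by move=> y yr Zy; apply: HX => //; [apply: ZX => //; exact: lt|exact: ((ZG _ (lt _ yr)).1 Zy jj)].
 - exact: dH.
 - exact: Hinv.
 - exact: Hn0.
 have := regZ _ _ (srho i x (sub x xr)) reg; move: n3; clear; lia.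
have x11 : nm (x1 - x1) < r1' by rewrite subrr (nm0 V).
have p1r := sr i x1 (sub _ x11).
have e'0 : 0 < r - nm (s i x1) by side.
have lt y : nm (y - s i x1) < r - nm (s i x1) -> nm y < r by have := nm_rev y (s i x1); lra.
have n0 : (0 < n)%N by move: n3; clear; lia.
have fp1 : f (s i x1) = 0 by apply: ZX (inZ _ x11); exact: srho (sub _ x11).
have ZXX y : nm (y - s i x1) < r - nm (s i x1) -> (Z y <-> f y = 0).
 move=> /lt yr; have yrho := lt_le_trans yr rrho; split=> [|fy]; first exact: ZX.
 apply/(ZG _ yrho) => jj; apply: contrapT => hj; apply: all0; exists jj => hall; apply: hj; exact: hall.
have [q qe reg] := @graph_X Z (s i x1) (r - nm (s i x1)) n0 fp1 e'0 ZXX.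
have := regZ _ _ (lt_le_trans (lt _ qe) rrho) reg; move: n3; clear; lia.
Qed.

End Ctx.

(** * Interpolation of the quotient over the fibres *)

Lemma dup_ex (T : eqType) (s : seq T) : ~~ uniq s -> exists2 a, a \in s & a \in rem a s.
elim: s => //= x s IH; rewrite negb_and negbK; case: (boolP (x \in s)) => [xs _|xs /= /IH [a as_ ar]].
 by exists x; rewrite ?mem_head ?eqxx.
have ax : a == x = false by apply/negP => /eqP E; move: xs; rewrite -E as_.
by exists a; [rewrite inE as_ orbT|rewrite eq_sym ax inE ar orbT].
Qed.

Variables (f : V -> C^o) (e1 : V) (N : nat) (c1 : C^o).
Hypothesis hm : mdir f e1 N.+1 c1.
Local Notation p := (mpoly f e1 N.+1 c1).

Lemma simple_roots y (s : seq C) : p y = \prod_(a <- s) ('X - a%:P) ->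
 (forall z : C, f (y + z *: e1) = 0 -> dd e1 f (y + z *: e1) != 0) -> uniq s.
move=> E sim; apply: contraT => /dup_ex [a as_ ar].
have ef : ent f by apply: pg_ent; exists N.+1; exact: md_pg hm.
have [q Eq] : exists q, p y = ('X - a%:P) * ('X - a%:P) * q.
 exists (\prod_(b <- rem a (rem a s)) ('X - b%:P)).
 by rewrite E (perm_big _ (perm_to_rem as_)) big_cons (perm_big _ (perm_to_rem ar)) big_cons -mulrA.
have fE (z : C) : f (y + z *: e1) = c1 * (p y).[z] by rewrite (mpoly_eval hm) mulVKf // (md_c hm).
have f0 : f (y + a *: e1) = 0 by rewrite fE Eq !hornerM hornerXsubC subrr !mul0r mulr0.
have := sim a f0; rewrite -dcoef1; last exact: hol_ent.
rewrite /dcoef.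
have -> : (fun z : C^o => f (y + a *: e1 + z *' e1)) = (fun z : C^o => (c1%:P * ('X * 'X * (q \Po ('X + a%:P)))).[z]).
 apply/funext => z; rewrite -addrA -scalerDl fE Eq !hornerM horner_comp !hornerE.
 by rewrite (_ : a + z - a = z) ?[a + z]addrC // addrK.
by rewrite (asy_tc (asy_poly _)) coefCM -[('X * 'X * _)]mulrA coefXM /= coefXM /= mulr0 eqxx.
Qed.

Lemma mpoly_coef_bd y0 : exists2 d : R, 0 < d & exists2 B : R, 0 <= B & forall y k, nm (y - y0) < d -> nmc ((p y)`_k) <= B.
have hp k : cts (fun y => (p y)`_k : C^o) y0 by exact: (mpoly_cts y0 hm).
have [d d0 hd] : exists2 d : R, 0 < d & forall (k : 'I_N.+2) y, nm (y - y0) < d -> nmc ((p y)`_k - (p y0)`_k) < 1.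
 apply: (@fin_small _ (fun (k : 'I_N.+2) d => forall y, nm (y - y0) < d -> nmc ((p y)`_k - (p y0)`_k) < 1)) => [k|k a b ab ha y ya].
  exact: hp k 1 ltr01.
 by apply: ha; exact: lt_le_trans ya ab.
exists d => //; exists (\sum_(k < N.+2) nmc ((p y0)`_k) + 1).
 by side.
move=> y k yd; have [kN|kN] := ltnP k N.+2; last first.
 rewrite nth_default ?(mpoly_size hm) // (nm0 C^o); apply: addr_ge0 => //; apply: sumr_ge0 => l _; exact: nm_ge0.
have h1 := hd (Ordinal kN) y yd; have h2 := nm_rev ((p y)`_k : C^o) (p y0)`_k.
have : nmc ((p y0)`_k) <= \sum_(k < N.+2) nmc ((p y0)`_k) by rewrite (bigD1 (Ordinal kN)) //= lerDl; apply: sumr_ge0 => l _; exact: nm_ge0.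
move: h1 h2 => /=; lra.
Qed.

(** A root of the polynomial over [y] nearly annihilates the one over [y0], since the coefficients
    are continuous and the roots bounded; [root_near] concludes. *)
Lemma roots_near y0 (rho : R) : 0 < rho -> exists2 d : R, 0 < d & exists2 Z : R, 0 <= Z & forall y (z : C^o), nm (y - y0) < d -> root (p y) z ->
 nm z <= Z /\ exists2 z0 : C^o, root (p y0) z0 & nm (z - z0) < rho.
move=> rho0; have [d d0 [B B0 hB]] := mpoly_coef_bd y0.
pose Z := 1 + N.+1%:R * B; have Z1 : 1 <= Z by rewrite lerDl mulr_ge0.
have Z0 : 0 <= Z by exact: le_trans ler01 Z1.
have rN : 0 < rho ^+ N.+1 by side.
have c0 : 0 <= N.+2%:R * Z ^+ N.+2 by side.
have [s s0 hs] := ex_small rN c0.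
have [d' d0' hd'] : exists2 d : R, 0 < d & forall (k : 'I_N.+2) y, nm (y - y0) < d -> nmc ((p y)`_k - (p y0)`_k) < s.
 apply: (@fin_small _ (fun (k : 'I_N.+2) d => forall y, nm (y - y0) < d -> nmc ((p y)`_k - (p y0)`_k) < s)) => [k|k a b ab ha y ya].
  exact: (mpoly_cts y0 hm k s0).
 by apply: ha; exact: lt_le_trans ya ab.
exists (minr d d'); first by side.
exists Z => // y z; rewrite lt_min => /andP [yd yd'] rz.
have zZ : nm z <= Z by apply: (@root_bound R (p y) N.+1 z B (mpoly_monic hm y) (mpoly_size hm y) rz) => k _; exact: hB.
split=> //.
have small : nmc ((p y0).[z]) < rho ^+ N.+1.
 have -> : (p y0).[z] = - \sum_(k < N.+2) ((p y)`_k - (p y0)`_k) * z ^+ k.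
  under eq_bigr do rewrite mulrBl.
  by rewrite sumrB opprB -!(mpoly_size hm y) -horner_coef (mpoly_size hm y) -(mpoly_size hm y0) -horner_coef (rootP rz) subr0.
 rewrite nmN; apply: le_lt_trans (nm_sum _ _ _) _; apply: le_lt_trans hs.
 rewrite mulrCA mulr_natl -[in leRHS](card_ord N.+2) -sumr_const; apply: ler_sum => k _.
 rewrite nmM nmX; apply: ler_pM; rewrite ?nm_ge0 ?exprn_ge0 ?nm_ge0 //; first exact/ltW/hd'.
 apply: le_trans (_ : Z ^+ k <= _); first by apply: lerXn2r; rewrite ?nnegrE ?nm_ge0.
 by rewrite card_ord; apply: ler_weXn2l => //; exact: ltnW.
by have [z0 r0 h] := root_near (mpoly_monic hm y0) (mpoly_size hm y0) rho0 small; exists z0; rewrite // nmC.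
Qed.

Definition nice (g1 g2 : V -> C^o) (x : V) := exists2 b : V -> C^o, hol b x &
 exists2 d : R, 0 < d & forall y, nm (y - x) < d -> f y = 0 -> g1 y = b y * g2 y.

(* The local quotients [b] near the points of the fibre over [y0] are glued to one function on a union of disjoint discs;
  the remainder of [B g1] modulo [f] is then [h] times the Lagrange interpolant of [b] at the simple roots over [y]. *)
Lemma fibre_bound (g1 B h : V -> C^o) (r : V -> {poly C}) y0 :
 (forall x, f x = 0 -> h x = B x * dd e1 f x) -> (forall x (z : C), h (x + z *: e1) = h x) ->
 (forall x, (size (r x) <= N.+1)%N) -> (forall x (z : C), f (x + z *: e1) = 0 -> (r x).[z] = B (x + z *: e1) * g1 (x + z *: e1)) ->
 (forall z : C, f (y0 + z *: e1) = 0 -> nice g1 (dd e1 f) (y0 + z *: e1)) ->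
 exists2 d : R, 0 < d & exists2 K : R, 0 <= K & forall y, nm (y - y0) < d -> h y != 0 -> nmc ((r y)`_0) <= K * nm (h y).
move=> hB hinv rs rE ni.
have [s0 E0 sz0] := poly_split (mpoly_monic hm y0).
pose s := undup s0.
have us : uniq s by exact: undup_uniq.
have sP (z : C) : (z \in s) = root (p y0) z by rewrite mem_undup E0 root_prod_XsubC.
have [sep sep0 hsep] := @separated R s us.
have fs (i : 'I_(size s)) : f (y0 + s`_i *: e1) = 0 by apply/eqP; rewrite -(mpoly_root hm) -sP mem_nth.
have nb (i : 'I_(size s)) : {b : V -> C^o | hol b (y0 + s`_i *: e1) /\ exists2 d : R, 0 < d &
  forall y, nm (y - (y0 + s`_i *: e1)) < d -> f y = 0 -> g1 y = b y * dd e1 f y}.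
 by apply: cid; have [b hb hd] := ni _ (fs i); exists b.
pose b i := sval (nb i).
have [de de0 hde] : exists2 de : R, 0 < de & forall (i : 'I_(size s)) y, nm (y - (y0 + s`_i *: e1)) < de ->
  [/\ dif (b i) y, nm (b i y) <= de^-1 & f y = 0 -> g1 y = b i y * dd e1 f y].
 apply: (@fin_small _ (fun (i : 'I_(size s)) de => forall y, nm (y - (y0 + s`_i *: e1)) < de ->
  [/\ dif (b i) y, nm (b i y) <= de^-1 & f y = 0 -> g1 y = b i y * dd e1 f y])).
  move=> i; rewrite /b; case: (nb i) => bi /= [/hol_bd [r1 [M [r10 M0 db bb]]] [d1 d10 hd1]].
  have M1 : 0 < M + 1 by side.
  exists (minr (minr r1 d1) (M + 1)^-1); first by side.
  move=> y; rewrite !lt_min => /andP [/andP [yr yd] ym]; split; [exact: db| |exact: hd1].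
  apply: le_trans (_ : M + 1 <= _); first by apply: le_trans (bb y yr) _; rewrite lerDl.
  rewrite -[leLHS]invrK lef_pV2 ?posrE ?lt_min ?r10 ?d10 ?invr_gt0 //.
  by rewrite ge_min lexx orbT.
 move=> i a a' aa ha y ya; have [|? b1 ?] := ha y; first exact: lt_le_trans ya aa.
 have a'0 : 0 < a' by apply: le_lt_trans ya; exact: nm_ge0.
 by split=> //; apply: le_trans b1 _; rewrite lef_pV2 // posrE // (lt_le_trans a'0).
have de4 : 0 < de / 4 by side.
have [rh rh0 hrh] := ex_small de4 (nm_ge0 e1).
pose rho := minr rh sep; have rho0 : 0 < rho by rewrite lt_min rh0.
have rhoe : rho * nm e1 < de / 4 by apply: le_lt_trans hrh; rewrite ler_wpM2r ?nm_ge0 // ge_min lexx.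
have rhos : rho <= sep by rewrite ge_min lexx orbT.
have [d1 d10 [Z Z0 hZ]] := roots_near y0 rho0.
exists (minr d1 (de / 2)); first by side.
exists `|interp_bd rho Z de^-1 N.+1|; first exact: normr_ge0.
move=> y /lt_minP [yd1 yde] hy.
have [t Et st] := poly_split (mpoly_monic hm y); rewrite (mpoly_size hm) in st; case: st => st.
have tP (z : C) : (z \in t) = (f (y + z *: e1) == 0) by rewrite -(mpoly_root hm) Et root_prod_XsubC.
have ut : uniq t.
 apply: simple_roots Et _ => z fz; apply/eqP => g0; move: hy.
 by rewrite -(hinv y z) hB // g0 mulr0 eqxx.
pose D (z : C^o) := exists i : 'I_(size s), nm (z - s`_i) < 2 * rho.
pose bb (z : C^o) : C^o := if [pick i : 'I_(size s) | nm (z - s`_i) < 2 * rho] is Some i then b i (y + z *' e1) else 0.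
have close (i : 'I_(size s)) (z : C^o) : nm (z - s`_i) < 2 * rho -> nm (y + z *' e1 - (y0 + s`_i *: e1)) < de.
 move=> zi; have -> : y + z *' e1 - (y0 + s`_i *: e1) = (y - y0) + (z - s`_i) *: e1 by vring.
 apply: le_lt_trans (nmD _ _) _; rewrite nmZ.
 have : nm (z - s`_i) * nm e1 <= 2 * rho * nm e1 by rewrite ler_wpM2r ?nm_ge0 // ltW.
 move: yde rhoe; lra.
have bbE (i : 'I_(size s)) (z : C^o) : nm (z - s`_i) < 2 * rho -> bb z = b i (y + z *' e1).
 move=> zi; rewrite /bb; case: pickP => [k zk|/(_ i)]; last by rewrite zi.
 suff -> : k = i by [].
 apply/val_inj/eqP; rewrite -(nth_uniq 0 _ _ us) ?ltn_ord //; apply: contraT => ne.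
 have := hsep _ _ (mem_nth 0 (ltn_ord k)) (mem_nth 0 (ltn_ord i)) ne.
 have := nm_dist z (s`_k : C^o) s`_i; rewrite (nmC (s`_k : C^o) z); move: zi zk rhos; lra.
have bbd z : D z -> dif bb z.
 move=> [i zi]; have sb := subr_gt0; have g0 : 0 < 2 * rho - nm (z - s`_i) by side.
 apply: (@dif_ext R C^o C^o (fun z : C^o => b i (y + z *' e1)) bb z _ g0).
  by move=> x xz; rewrite (bbE i) //; have := nm_dist z x (s`_i : C^o); move: xz; lra.
 by apply: dif_on_line; case: (hde i _ (close i z zi)).
have bbb z : D z -> nm (bb z) <= de^-1 by move=> [i zi]; rewrite (bbE i) //; case: (hde i _ (close i z zi)).
have tD (a : C^o) : a \in t -> nm a <= Z /\ exists2 i : 'I_(size s), nm (a - s`_i) < rho & True.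
 rewrite tP -(mpoly_root hm) => ra; have [aZ [z0 rz0 az]] := hZ y a yd1 ra; split=> //.
 have z0s : z0 \in s by rewrite sP.
 have lt : (index z0 s < size s)%N by rewrite index_mem.
 by exists (Ordinal lt) => //=; rewrite nth_index.
have tDD (a : C^o) : a \in t -> nm a <= Z /\ forall z, nm (z - a) < rho -> D z.
 move=> /tD [aZ [i ai _]]; split=> // z za; exists i; have := nm_dist a z (s`_i : C^o); move: za ai; lra.
have M0 : 0 <= de^-1 by side.
have [L [Ls La L0]] := @interp_bound R D rho Z rho0 Z0 t bb de^-1 ut M0 bbd bbb tDD.
rewrite -st in L0 Ls.
have rL : r y = h y *: L.
 apply: subr0_eq; apply: (@roots_geq_poly_eq0 _ _ t) => //; last first.
  rewrite -st; apply: leq_trans (size_polyD _ _) _; rewrite size_polyN geq_max rs.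
  exact: leq_trans (size_scale_leq _ _) Ls.
 apply/allP => a at_; rewrite /root hornerD hornerN hornerZ (La a at_) subr_eq0.
 have fa : f (y + a *: e1) = 0 by apply/eqP; rewrite -tP.
 have [_ [i ai _]] := tD a at_.
 have ai2 : nm ((a : C^o) - s`_i) < 2 * rho by move: ai rho0; lra.
 have [_ _ ge] := hde i _ (close i a ai2).
 by rewrite rE // (bbE i) // ge // -(hinv y a) hB // mulrCA mulrC.
rewrite rL coefZ nmM mulrC ler_wpM2r ?nm_ge0 //.
by rewrite -horner_coef0; apply: le_trans L0 (ler_norm _).
Qed.

Variables (w : 'I_n -> nat) (d : nat).
Hypotheses (w0 : forall i, (0 < w i)%N) (hf : whom w d f) (irr : irreducible_zero_germ f).

(** On the zero set [B * g1] equals the constant coefficient [R0] of its remainder modulo [f]. By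
    [fibre_bound], [R0] is [O(h)] near the zeros of [h] in generic fibres, so [h] divides it and
    [R0 = v * h = v * B * dd e1 f]; primality cancels [B]. *)
Lemma core (g1 h B : V -> C^o) e2 N2 c2 x0 (r0 : R) : 0 < r0 -> pg g1 -> pg h -> pg B ->
 (forall x, f x = 0 -> h x = B x * dd e1 f x) -> (forall x (z : C), h (x + z *: e1) = h x) ->
 mdir h e2 N2 c2 ->
 (forall x (u z : C), nm (x - x0) < r0 -> h (x + u *: e2) = 0 -> f (x + u *: e2 + z *: e1) = 0 ->
   nice g1 (dd e1 f) (x + u *: e2 + z *: e1)) ->
 exists2 v, pg v & forall x, f x = 0 -> g1 x = v x * dd e1 f x.
move=> r00 pg1 ph pB hB hinv hm2 ni.
have ef : ent f by apply: pg_ent; exists N.+1; exact: md_pg hm.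
have pff : pg f by exists N.+1; exact: md_pg hm.
have pG : pg (fun x => B x * g1 x) by exact: pgM.
have [NG hG] := pG.
pose q (x : V) : {poly C} := \poly_(k < NG.+1) dcoef e1 (fun x => B x * g1 x) k x.
have qE x (z : C) : (q x).[z] = B (x + z *: e1) * g1 (x + z *: e1) by rewrite horner_poly -(pgN_poly e1 x z hG).
have pfq : pf (@pg R n) q.
 move=> k; rewrite /q; case: (ltnP k NG.+1) => kN; last first.
  by under eq_fun do rewrite coef_poly ltnNge kN; exact: pg_cst.
 by under eq_fun do rewrite coef_poly kN; exact: pg_dcoef.
have kc (c : C^o) : pg (fun _ : V => c) by exact: pg_cst.
have [Q [r [pQ pr Er]]] := @pf_div R V (@pg R n) kc (@pgD R n) (@pgM R n) N.+1 p (mpoly_pf hm) (mpoly_monic hm) (mpoly_size hm) NG.+1 q pfq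
 (fun x => size_poly _ _).
have rE x (z : C) : f (x + z *: e1) = 0 -> (r x).[z] = B (x + z *: e1) * g1 (x + z *: e1) by move=> fz; rewrite -qE; case: (Er x) => -> _; rewrite hornerD hornerM (mpoly_eval hm) fz mulr0 mulr0 add0r.
pose R0 (x : V) : C^o := (r x)`_0.
have pR0 : pg R0 by exact: pr.
have [N0 hR0] := pR0.
pose q2 (x : V) : {poly C} := \poly_(k < N0.+1) dcoef e2 R0 k x.
have q2E x (z : C) : (q2 x).[z] = R0 (x + z *: e2) by rewrite horner_poly -(pgN_poly e2 x z hR0).
have pfq2 : pf (@pg R n) q2.
 move=> k; rewrite /q2; case: (ltnP k N0.+1) => kN; last first.
  by under eq_fun do rewrite coef_poly ltnNge kN; exact: pg_cst.
 by under eq_fun do rewrite coef_poly kN; exact: pg_dcoef.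
have [Q2 [r2 [pQ2 pr2 Er2]]] := @pf_div R V (@pg R n) kc (@pgD R n) (@pgM R n) N2 (mpoly h e2 N2 c2) (mpoly_pf hm2) (mpoly_monic hm2) (mpoly_size hm2) N0.+1 q2 pfq2
 (fun x => size_poly _ _).
(* On each line along [e2] near [x0] the bound gives divisibility by [bounded_dvdp], so the
   remainder modulo [h] is zero there, and by the identity principle everywhere. *)
have r2z x : nm (x - x0) < r0 -> r2 x = 0.
 move=> xr; have mn0 : mpoly h e2 N2 c2 x != 0 by exact: monic_neq0 (mpoly_monic hm2 x).
 have [|qq Eqq] := @bounded_dvdp R (mpoly h e2 N2 c2 x) (q2 x) mn0.
  move=> a; rewrite (mpoly_root hm2) => /eqP ha.
  have [|dl dl0 [K K0 hK]] := @fibre_bound g1 B h r (x + a *: e2) hB hinv (fun x => (Er x).2) rE.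
   by move=> z fz; exact: ni xr ha fz.
  have [t t0 ht] := ex_small dl0 (nm_ge0 e2).
  have [t' t'0 ht'] : exists2 t' : R, 0 < t' & forall u : C^o, 0 < nm (u - a) < t' -> h (x + u *' e2) != 0.
   have [s E sz] := poly_split (mpoly_monic hm2 x).
   have [t' t'0 hs] := @separated R (undup s) (undup_uniq s).
   have sP (z : C) : (z \in undup s) = (h (x + z *: e2) == 0) by rewrite mem_undup -root_prod_XsubC -E (mpoly_root hm2).
   exists t' => // u /andP [u0 ut]; apply/negP => hu; have := hs a u; rewrite !sP ha hu eqxx => /(_ isT isT).
   rewrite nmC; have un : a != u by apply: contraTneq u0 => ->; rewrite subrr (nm0 C^o) ltxx.
   by move=> /(_ un); move: ut t'0; lra.
  exists (K * nm c2), (minr t t'); split; first by side.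
  move=> u /andP [u0] /lt_minP [ut ut'].
  have hu : h (x + u *' e2) != 0 by apply: ht'; rewrite u0.
  rewrite q2E (mpoly_eval hm2) nmM nmV -mulrA (mulrA (nm c2)) mulfV ?mul1r; last by rewrite nm_eq0 (md_c hm2).
  apply: hK => //.
  have -> : x + u *' e2 - (x + a *: e2) = (u - a) *: e2 by vring.
  exact: nmZ_lt ht.
 have [E sz] := Er2 x; apply/eqP; apply: contraT => rn0.
 have Er' : r2 x = (qq - Q2 x) * mpoly h e2 N2 c2 x by rewrite mulrBl -Eqq E addrAC subrr add0r.
 have qn0 : qq - Q2 x != 0 by apply: contraNneq rn0 => q0; rewrite Er' q0 mul0r.
 move: sz; rewrite Er' size_mul // (mpoly_size hm2) addnS /= leqNgt.
 by rewrite -[X in (X < _)%N]add0n ltn_add2r size_poly_gt0 qn0.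
have r2z' x : r2 x = 0.
 apply/polyP => k; rewrite coef0.
 apply: (@ball_zero R V (fun x => (r2 x)`_k : C^o) x0 (nm (x - x0) + 1) r0 r00 _ _ x); last by rewrite ltrDl.
  by move=> y _; apply: pg_ent; exact: pr2.
 by move=> y yr; rewrite r2z // coef0.
pose v (x : V) : C^o := (Q2 x)`_0 * c2^-1.
have pv : pg v by apply: pgM; [exact: pQ2|exact: pg_cst].
have R0E x : R0 x = v x * h x.
 have := q2E x 0; rewrite scale0r addr0 => <-; have [-> _] := Er2 x.
 by rewrite r2z' addr0 hornerM (mpoly_eval hm2) scale0r addr0 horner_coef0 /v mulrA.
have BX x : f x = 0 -> B x * (g1 x - v x * dd e1 f x) = 0.
 move=> fx; have := rE x 0; rewrite scale0r addr0 => /(_ fx); rewrite horner_coef0 -/(R0 x) R0E hB // => E.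
 by rewrite mulrBr -E; ring.
exists v => //.
have dB y : dif B y by exact: pg_ent.
have dg y : dif (fun x => g1 x - v x * dd e1 f x : C^o) y.
 apply: difB; first exact: pg_ent.
 by apply: difM; [exact: pg_ent|apply: pg_ent; exact: pg_dd].
case: (prime0 ef irr (hol_ent 0 dB) (hol_ent 0 dg)) => [|k|k].
- by exists 1 => // x _; exact: BX.
(* If [B] vanished on the zero set, so would [h]; being constant along [e1], it would vanish
   everywhere, against its nonzero leading coefficient. *)
- have B0 := X_extend_ent w0 hf dB k.
 have h0 x : h x = 0.
  have [s E sz] := poly_split (mpoly_monic hm x); rewrite (mpoly_size hm) in sz.
  case: s E sz => // a s E _; have : root (p x) a by rewrite E root_prod_XsubC mem_head.
  rewrite (mpoly_root hm) => /eqP fa; by rewrite -(hinv x a) hB // B0 // mul0r.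
 have := md_c hm2; rewrite -(md_lead hm2 0) /dcoef.
 have -> : (fun z : C^o => h (0 + z *' e2)) = fun=> 0 by apply/funext => z; exact: h0.
 by rewrite (asy_tc (asy_cst 0)); case: ifP; rewrite eqxx.
- have := X_extend_ent w0 hf dg k => g0 x fx.
 by apply/eqP; rewrite -subr_eq0 g0.
Qed.
End Core.

(** * Hurwitz's theorem and division by coordinates *)

Section Transport.
Variables (R : realType) (n : nat).
Local Notation C := R[i].
Local Notation V := (Cn R n).

(** A maximum principle with a loss: Cauchy's formula at 0, with contour length [8 * r] and the
    lower bound 2 for [J0], gives the factor 4. *)
Lemma square_max (r : R) (F : C^o -> C^o) (M : R) : 0 < r -> (forall z, nm z <= 2 * r -> dif F z) ->
 (forall z, r <= nm z <= 2 * r -> nm (F z) <= M) -> nm (F 0) <= 4 * M.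
move=> r0 dF bF.
have z0 : nm (0 : C^o) <= r / 2 by rewrite (nm0 C^o) divr_ge0 // ltW.
have := @J_cauchy R r r0 F 0 z0 dF.
have -> : J r (fun z => F z / (z - 0)) = J r (fun z => F z / z ^+ 1) by apply: J_ext => // j t _; rewrite subr0 expr1.
have -> : J r (fun z => 1 / (z - 0)) = J0 r by apply: J_ext => // j t _; rewrite subr0.
move=> E.
have b1 : nm (J r (fun z => F z / z ^+ 1)) <= 8 * r * (M / r).
 apply: J_le => //; [exact: (onb_pow r0 1 dF)|] => j t t01; have /andP [lo hi] := sid_bd r0 j t01.
 rewrite nmM nmV nmX expr1; apply: ler_pM; rewrite ?nm_ge0 ?invr_ge0 ?nm_ge0 //; first by apply: bF; rewrite lo.
 by rewrite lef_pV2 // posrE //; exact: lt_le_trans lo.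
have b2 := J0_ge r0; rewrite E nmM in b1.
have : nm (F 0) * 2 <= nm (F 0) * nm (J0 r) by rewrite ler_wpM2l ?nm_ge0.
have : 8 * r * (M / r) = 8 * M by field; rewrite gt_eqF.
by move=> E8; move: b1; rewrite E8; lra.
Qed.

Lemma lipschitz (g : V -> C^o) p (r M : R) x y : 0 < r -> (forall x, nm (x - p) < 2 * r -> dif g x) -> (forall x, nm (x - p) < 2 * r -> nm (g x) <= M) ->
 nm (x - p) < r -> nm (y - x) <= r / 6 -> nm (g y - g x) <= 24 * M / r * nm (y - x).
move=> r0 dg bg xr yx.
have sub z : nm (z - x) < r -> nm (z - p) < 2 * r by have := nm_dist x z p; move: xr; lra.
have xx : nm (x - p) < 2 * r by apply: sub; rewrite subrr (nm0 V).
have [L hL] := dg x xx.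
have [b1 b2] := cauchy_est r0 (fun z h => dg z (sub z h)) (fun z h => bg z (sub z h)) hL.
have M0 : 0 <= M by apply: le_trans (bg x xx); exact: nm_ge0.
have := b2 (y - x) yx; rewrite subrKC => h2; have h1 := b1 (y - x).
have h3 : 72 * M / r ^+ 2 * nm (y - x) ^+ 2 <= 12 * M / r * nm (y - x).
 rewrite [nm (y - x) ^+ 2]expr2 mulrA ler_wpM2r ?nm_ge0 //.
 have -> : 12 * M / r = 72 * M / r ^+ 2 * (r / 6) by field; rewrite gt_eqF.
 by apply: ler_wpM2l => //; apply: divr_ge0; [exact: mulr_ge0|apply: exprn_ge0; exact: ltW].
have := nmD (g y - g x - L (y - x)) (L (y - x)); rewrite subrK.
have -> : 24 * M / r * nm (y - x) = 12 * M / r * nm (y - x) + 12 * M / r * nm (y - x) by ring.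
by move: h1 h2 h3; lra.
Qed.

(** On an annulus around [p] in the direction [v] the modulus of [g] is at least [c]. Without a zero
    near [x], [square_max] for [1 / g] would give a value of at least [2 * c / 9] at [x], while
    continuity gives at most [c / 9]. *)
Lemma hurwitz (g : V -> C^o) p v (eps : R) : hol g p -> g p = 0 -> 0 < eps ->
 (exists2 r : R, 0 < r & forall z : C^o, 0 < nm z < r -> g (p + z *' v) != 0) ->
 exists2 d : R, 0 < d & forall x, nm (x - p) < d -> exists2 z : C^o, nm z < eps & g (x + z *' v) = 0.
move=> hg gp e0 [r1 r10 nz]; have [r [M [r0 M0 dg bg]]] := hol_bd hg.
have r4 : 0 < r / 4 by side.
have r2 : 0 < r / 2 by lra.
have [q q0 qv] := ex_line v r2.
have line x (z : C^o) : nm (x - p) < r / 4 -> nm z < q -> nm (x + z *' v - p) < r / 2 by move=> xr; apply: qv; move: xr; lra.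
have half y : nm (y - p) < r / 2 -> nm (y - p) < r by move: r0; lra.
have pp : nm (p - p) < r / 4 by rewrite subrr (nm0 V).
have [_ T] := dcoef_tail q0 (fun z zq => dg _ (half _ (line p z pp zq))) (fun z zq => bg _ (half _ (line p z pp zq))).
have [k ak low] : exists2 k, dcoef v g k p != 0 & forall j, (j < k)%N -> dcoef v g j p = 0.
 have [ex|no] := pselect (exists k, dcoef v g k p != 0).
  case: (ex_minnP ex) => k hk mk; exists k => // j jk; apply/eqP; apply: contraT => /mk; by rewrite leqNgt jk.
 exfalso; pose z : C^o := (minr (q / 12) (r1 / 2))%:C.
 have zp : 0 < minr (q / 12) (r1 / 2) by side.
 have nzz : nm z = minr (q / 12) (r1 / 2) by rewrite nm_real gtr0_norm.
 have z1 : nm z < r1 by rewrite nzz gt_min; apply/orP; right; move: r10; lra.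
 have z2 : nm z <= q / 12 by rewrite nzz ge_min lexx.
 have := nz z; rewrite z1 nzz zp => /(_ isT) /eqP; apply.
 apply: (@nm_le0 R C^o); apply: (@pow2_lim0 R _ (8 * M) 0) => m _.
 have := T m z; rewrite big1 ?subr0; last first.
  by move=> j _; rewrite (_ : dcoef v g j p = 0) ?mul0r //; apply/eqP; apply: contraT => h; case: no; exists j.
 move=> h; apply: le_trans (h _) _; first by move: z2 q0; lra.
 rewrite ler_wpM2l ?mulr_ge0 //; apply: lerXn2r; rewrite ?nnegrE ?divr_ge0 ?nm_ge0 ?(ltW q0) ?invr_ge0 //.
 by rewrite ler_pdivrMr ?divr_gt0 //; move: z2 q0; lra.
pose a := nm (dcoef v g k p); have a0 : 0 < a by rewrite nm_gt0.
have a2 : 0 < a / 2 by side.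
have E0 : 0 <= 8 * M / (q / 3) ^+ k.+1 by side.
have [s s0 hs] := ex_small a2 E0.
pose rho := minr (minr (s / 2) (q / 12)) (eps / 4).
have rho0 : 0 < rho by rewrite !lt_min !divr_gt0.
have rs : 2 * rho <= s by have : rho <= s / 2 by [rewrite !ge_min lexx]; lra.
have rq : 2 * rho <= q / 6 by have : rho <= q / 12 by [rewrite !ge_min lexx orbT]; lra.
have re : 2 * rho < eps by have : rho <= eps / 4 by [rewrite !ge_min lexx !orbT]; move: e0; lra.
have lower (z : C^o) : rho <= nm z <= 2 * rho -> a / 2 * rho ^+ k <= nm (g (p + z *' v)).
 move=> /andP [z1 z2]; have zq : nm z <= q / 6 by move: z2 rq; lra.
 have := T k.+1 z zq; rewrite big_ord_recr /= big1; last by move=> j _; rewrite low // mul0r.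
 rewrite add0r => h; have h2 := nm_rev (dcoef v g k p * z ^+ k) (g (p + z *' v)).
 rewrite nmC in h2; rewrite nmM nmX -/a in h2.
 have zk0 : 0 <= nm z ^+ k by side.
 have h3 : 8 * M * (nm z / (q / 3)) ^+ k.+1 <= a / 2 * nm z ^+ k.
  rewrite expr_div_n exprS.
  have -> : 8 * M * (nm z * nm z ^+ k / (q / 3) ^+ k.+1) = (nm z * (8 * M / (q / 3) ^+ k.+1)) * nm z ^+ k by ring.
  rewrite ler_wpM2r //; apply: le_trans (ltW hs); rewrite ler_wpM2r //; move: z2 rs; lra.
 have h4 : a / 2 * rho ^+ k <= a / 2 * nm z ^+ k by rewrite ler_wpM2l ?(ltW a2) //; apply: lerXn2r; rewrite ?nnegrE ?nm_ge0 // ltW.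
 have h5 : a * nm z ^+ k = a / 2 * nm z ^+ k + a / 2 * nm z ^+ k by field.
 by move: h h2 h3 h4 h5; lra.
pose c := a / 2 * rho ^+ k; have c0 : 0 < c by rewrite mulr_gt0 // exprn_gt0.
have c9 : 0 < c / 9 by side.
have L0 : 0 <= 24 * M / (r / 2) by side.
have [d d0 hd] := ex_small c9 L0.
have r12 : 0 < r / 12 by side.
exists (minr d (r / 12)); first by side.
move=> x /lt_minP [xd xr12]; apply: contrapT => no.
have xr : nm (x - p) < r / 4 by move: xr12 r0; lra.
have rr : 2 * (r / 2) = r by field.
have close (z : C^o) : nm z < q -> nm (g (x + z *' v) - g (p + z *' v)) <= c / 9.
 move=> zq; have E : x + z *' v - (p + z *' v) = x - p by rewrite opprD addrACA subrr addr0.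
 have := @lipschitz g p (r / 2) M (p + z *' v) (x + z *' v) r2.
 rewrite rr E => /(_ dg bg (line p z pp zq)) h; apply: le_trans (h _) _; first by move: xr12; lra.
 by rewrite mulrC; apply: le_trans (ltW hd); rewrite ler_wpM2r // ltW.
have nz' (z : C^o) : nm z <= 2 * rho -> g (x + z *' v) != 0 by move=> z2; apply/eqP => gz; apply: no; exists z => //; move: z2 re; lra.
have ltq (z : C^o) : nm z <= 2 * rho -> nm z < q by move: rq q0; lra.
pose F (z : C^o) : C^o := (g (x + z *' v))^-1.
have dF z : nm z <= 2 * rho -> dif F z.
 move=> z2; apply: difV; first exact: nz'.
 by apply: dif_on_line; apply: dg; apply: half; apply: line => //; exact: ltq.
have c8 : 0 < c * (8 / 9) by side.
have h : nm (F 0) <= 4 * (c * (8 / 9))^-1.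
 apply: (square_max rho0 dF) => z zb.
 have z2 : nm z <= 2 * rho by case/andP: zb.
 have gp0 : 0 < nm (g (x + z *' v)) by rewrite nm_gt0 nz'.
 rewrite nmV lef_pV2 ?posrE //.
 have := lower z zb; have := close z (ltq z z2); have := nm_rev (g (p + z *' v)) (g (x + z *' v)).
 by rewrite nmC -/c; lra.
have rh2 : 0 <= 2 * rho by side.
have gx0 : 0 < nm (g x) by have := nz' 0; rewrite scale0r addr0 (nm0 C^o) nm_gt0; apply.
have := close 0; rewrite !scale0r !addr0 gp subr0 (nm0 C^o) => /(_ q0) gx.
move: h; rewrite /F nmV scale0r addr0 => h.
have := ler_wpM2l (ltW (mulr_gt0 gx0 c8)) h.
have -> : nm (g x) * (c * (8 / 9)) / nm (g x) = c * (8 / 9) by field; rewrite gt_eqF.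
have -> : nm (g x) * (c * (8 / 9)) * (4 / (c * (8 / 9))) = 4 * nm (g x) by field; rewrite gt_eqF.
by move: gx c0; lra.
Qed.

(* Clearing a nonzero factor: along [ev j] the zero set of the coordinate [j] is a single point. *)
Lemma cancel_coords (T : seq 'I_n) (S : V -> Prop) (g : V -> C^o) (r : R) : (forall y, nm y < r -> cts g y) ->
 (forall y j (z : C), j \in T -> S y -> S (y + z *: ev R j)) ->
 (forall y, nm y < r -> S y -> (\prod_(j <- T) coord y j) * g y = 0) -> forall y, nm y < r -> S y -> g y = 0.
elim: T g => [|j T IH] g cg mv h; first by move=> y yr Sy; have := h y yr Sy; rewrite big_nil mul1r.
apply: IH => [//|y i z iT|y yr Sy]; first by apply: mv; rewrite inE iT orbT.
pose G (y : V) : C^o := (\prod_(j <- T) coord y j) * g y.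
have cG : cts G y.
 apply: ctsM; last exact: cg; apply: dif_cts; apply: dif_prod => i _; exact: dif_coord.
apply/eqP; apply: contraT; rewrite -/(G y) => Gy; have [d d0 hd] := cts_near0 cG Gy.
have [yj|yj] := eqVneq (coord y j) 0; last first.
 by have := h y yr Sy; rewrite big_cons -mulrA => /eqP; rewrite mulf_eq0 (negbTE yj) /= -/(G y) (negbTE Gy).
have m0 : 0 < minr d (r - nm y) by side.
have [s s0 hs] := ex_small m0 (nm_ge0 (ev R j)).
pose y' := y + s%:C *: ev R j.
have ny : nm (y' - y) < minr d (r - nm y) by rewrite /y' addrAC subrr add0r nmZ nm_real gtr0_norm.
move: ny; rewrite lt_min => /andP [/hd Gy' yr'].
have y'r : nm y' < r by have := nm_rev y' y; move: yr'; lra.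
have := h y' y'r (mv y j s%:C (mem_head _ _) Sy); rewrite big_cons -mulrA => /eqP.
rewrite mulf_eq0 -/(G y') (negbTE Gy') orbF /y' coordD coordZ coord_ev eqxx mulr1 yj add0r.
by move=> /eqP /(congr1 (fun z : C^o => nm z)); rewrite nm_real (nm0 C^o) gtr0_norm // => s00; move: s0; rewrite s00 ltxx.
Qed.

Definition zk (k : 'I_n) (y : V) : V := y - coord y k *: ev R k.
Lemma coord_zk k y j : coord (zk k y) j = if j == k then 0 else coord y j.
rewrite /zk coordD coordN coordZ coord_ev; case: eqP => [->|]; first by rewrite mulr1 subrr.
by rewrite mulr0 subr0.
Qed.
Lemma nm_zk k y : nm (zk k y) <= nm y.
apply: nm_le_coord; first exact: nm_ge0.
by move=> j; rewrite coord_zk; case: ifP => _; [rewrite (nm0 C^o) nm_ge0|exact: nm_coord].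
Qed.
Lemma dif_zk k y : dif (zk k) y.
by apply: difB; [exact: dif_id|apply: (difZl (f := fun y => coord y k)); exact: dif_coord]. Qed.
Lemma zk_id k y : coord y k = 0 -> zk k y = y.
by rewrite /zk => ->; rewrite scale0r subr0. Qed.
Lemma nm_ev (k : 'I_n) : nm (ev R k) <= 1.
by apply: nm_le_coord => // j; rewrite coord_ev; case: (j == k); rewrite ?nm1 ?(nm0 C^o). Qed.

(** In the expansion along [ev k] from the hyperplane the term of order 0 vanishes, and shifting the
    series by one gives the quotient, with the coefficient of order 1 as its value on the
    hyperplane. *)
Lemma div_coord (g : V -> C^o) (k : 'I_n) (r : R) : 0 < r -> (forall y, nm y < r -> dif g y) ->
 (forall y, nm y < r -> coord y k = 0 -> g y = 0) ->
 exists2 q : V -> C^o, hol q 0 & exists2 r' : R, 0 < r' <= r & forall y, nm y < r' -> g y = coord y k * q y.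
move=> r0 dg gz.
have hg : hol g 0 by exists r => // y; rewrite subr0; exact: dg.
have [r1 [M [r10 M0 dg1 bg1]]] := hol_bd hg.
pose q (y : V) : C^o := if coord y k == 0 then dcoef (ev R k) g 1 (zk k y) else g y / coord y k.
pose s := minr r r1 / 2.
have s0 : 0 < s by rewrite divr_gt0 // lt_min r0.
have sr : 2 * s <= r by have : minr r r1 <= r by [rewrite ge_min lexx]; rewrite /s; lra.
have sr1 : 2 * s <= r1 by have : minr r r1 <= r1 by [rewrite ge_min lexx orbT]; rewrite /s; lra.
clearbody s.
have line y (z : C^o) : nm y < s -> nm z < s -> nm (zk k y + z *' ev R k) < 2 * s.
 move=> ys zs; apply: le_lt_trans (nmD _ _) _; rewrite nmZ.
 have h1 := nm_zk k y; have : nm z * nm (ev R k) <= nm z * 1 by rewrite ler_wpM2l ?nm_ge0 ?nm_ev.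
 by move: ys zs; lra.
have T y (ys : nm y < s) := @dcoef_tail R n g (zk k y) (ev R k) s M s0
 (fun z zs => dg _ (lt_le_trans (line y z ys zs) sr))
 (fun z zs => bg1 _ (eq_ind_r (fun u => is_true (nm u < r1)) (lt_le_trans (line y z ys zs) sr1) (subr0 _))).
have d0 y : nm y < s -> dcoef (ev R k) g 0 (zk k y) = 0.
 move=> ys; have zr : nm (zk k y) < r by apply: le_lt_trans (nm_zk k y) _; move: ys sr s0; lra.
 by rewrite dcoef0; [apply: gz => //; rewrite coord_zk eqxx|exact: hol_in_ball dg zr].
pose u m (y : V) : C^o := \sum_(j < m) dcoef (ev R k) g j.+1 (zk k y) * coord y k ^+ j.
have s6 : 0 < s / 6 by side.
have du m y : nm y < s -> dif (u m) y.
 move=> ys; apply: dif_sum => j _; apply: difM; last by apply: difX; exact: dif_coord.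
 apply: (dif_comp (g := dcoef (ev R k) g j.+1)); first exact: dif_zk.
 apply: dif_dcoef; apply: hol_in_ball dg _; apply: le_lt_trans (nm_zk k y) _; move: ys sr s0; lra.
pose K := 24 * M / s.
have K0 : 0 <= K by apply: divr_ge0; [exact: mulr_ge0|exact: ltW].
have bu m y : nm y < s / 6 -> nm (u m y - q y) <= K * 2^-1 ^+ m.
 move=> y6; have ys : nm y < s by move: y6 s0; lra.
 have [T1 T2] := T y ys; rewrite /q; case: eqP => [yk|/eqP yk].
  case: m => [|m].
   rewrite /u big_ord0 sub0r nmN expr0 mulr1; apply: le_trans (T1 1%N) _.
   by rewrite expr1 /K invf_div mulrA ler_wpM2r ?invr_ge0 ?(ltW s0) //; move: M0; lra.
  rewrite /u big_ord_recl expr0 mulr1 big1 ?addr0 ?subrr ?(nm0 C^o); last by move=> j _; rewrite lift0 yk exprS mul0r mulr0.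
  by side.
 have nk : 0 < nmc (coord y k) by rewrite nm_gt0.
 have -> : u m y - g y / coord y k = - (g y - \sum_(j < m.+1) dcoef (ev R k) g j (zk k y) * coord y k ^+ j) / coord y k.
  rewrite big_ord_recl d0 // mul0r add0r opprB mulrBl; congr (_ - _); rewrite /u mulr_suml; apply: eq_bigr => j _.
  by rewrite lift0 exprSr mulrA mulfK.
 rewrite nmM nmN nmV ler_pdivrMr //.
 have := T2 m.+1 (coord y k); rewrite subrK => h; apply: le_trans (h _) _.
  by apply: le_trans (nm_coord y k) (ltW y6).
 rewrite expr_div_n exprS.
 have -> : 8 * M * (nmc (coord y k) * nmc (coord y k) ^+ m / (s / 3) ^+ m.+1) = K * (nmc (coord y k) / (s / 3)) ^+ m * nmc (coord y k).
  rewrite [(s / 3) ^+ m.+1]exprS [(nmc (coord y k) / (s / 3)) ^+ m]expr_div_n /K; have s3 : (s / 3) ^+ m != 0 by rewrite expf_neq0 // gt_eqF // divr_gt0.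
  have sn : s != 0 by rewrite gt_eqF.
  by move: ((s / 3) ^+ m) (nmc (coord y k) ^+ m) s3 => B A s3; field; rewrite sn s3.
 rewrite ler_wpM2r ?nm_ge0 // ler_wpM2l //; apply: lerXn2r; rewrite ?nnegrE ?divr_ge0 ?nm_ge0 ?invr_ge0 ?(ltW s0) //.
 by rewrite ler_pdivrMr ?divr_gt0 //; have := nm_coord y k; move: y6; lra.
have q_dif y : nm y < s / 12 -> dif q y.
 move=> y12; have s12 : 0 < s / 12 by rewrite divr_gt0.
 have near x : nm (x - y) < s / 12 -> nm x < s / 6 by have := nm_rev x y; move: y12; lra.
 apply: (@unif_lim R V u q y (s / 12) K s12 K0) => m x /near x6; last exact: bu.
 by apply: du; move: x6 s0; lra.
exists q; first by exists (s / 12); [rewrite divr_gt0|move=> y; rewrite subr0; exact: q_dif].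
exists s; first by rewrite s0 /=; move: sr s0; lra.
move=> y ys; rewrite /q; case: eqP => [yk|/eqP yk]; last by rewrite mulrCA mulfV ?mulr1.
by rewrite yk mul0r gz //; move: ys sr s0; lra.
Qed.

Local Notation ev := (ev R).

Definition pk (K : seq 'I_n) (y : V) : C^o := \prod_(k <- K) coord y k.
Lemma dif_pk K y : dif (pk K) y. by apply: dif_prod => k _; exact: dif_coord. Qed.

Lemma pk_eq0 K (y : V) : (pk K y == 0) = has (fun k => coord y k == 0) K.
by elim: K => [|k K IH]; rewrite /pk ?big_nil ?oner_eq0 // big_cons mulf_eq0 /= -IH. Qed.

Lemma div_coords (K : seq 'I_n) (g : V -> C^o) : uniq K -> hol g 0 ->
 (exists2 r : R, 0 < r & forall y k, nm y < r -> k \in K -> coord y k = 0 -> g y = 0) ->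
 exists2 q : V -> C^o, hol q 0 & exists2 r : R, 0 < r & forall y, nm y < r -> g y = pk K y * q y.
elim: K g => [|k K IH] g /=; first by move=> _ hg _; exists g => //; exists 1 => // y _; rewrite /pk big_nil mul1r.
move=> /andP [kK uK] [r1 r10 dg] [r r0 gz].
have m0 : 0 < minr r1 r by rewrite lt_min r10.
have [|y yr yk|q hq [r2 /andP [r20 r2m] Eq]] := @div_coord g k (minr r1 r) m0.
- by move=> y /lt_minP [yr _]; apply: dg; rewrite subr0.
- by move: yr; rewrite lt_min => /andP [_ yr]; apply: gz yr _ yk; exact: mem_head.
have [r3 r30 dq] := hq.
have [|q' hq' [r4 r40 Eq']] := IH q uK hq.
 have mm0 : 0 < minr r2 r3 by rewrite lt_min r20.
 exists (minr r2 r3) => // y l yr lK yl.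
 apply: (@cancel_coords [:: k] (fun y => coord y l = 0) q (minr r2 r3)) => //.
 - by move=> x /lt_minP [_ xr]; apply: dif_cts; apply: dq; rewrite subr0.
 - move=> x i z; rewrite inE => /eqP -> xl; rewrite coordD coordZ coord_ev xl.
  by case: eqP => [lk|]; [move: kK; rewrite -lk lK|rewrite mulr0 addr0].
 move=> x xr xl; rewrite big_seq1; move: xr; rewrite lt_min => /andP [xr _]; rewrite -Eq //.
 apply: gz xl; last by rewrite inE lK orbT.
 by apply: lt_le_trans xr _; apply: le_trans r2m _; rewrite ge_min lexx orbT.
exists q' => //; exists (minr r2 r4); first by rewrite lt_min r20.
by move=> y /lt_minP [y2 y4]; rewrite Eq // Eq' // /pk big_cons mulrA.
Qed.

Lemma coord_line (y : V) (z : C) j l : coord (y + z *: ev j) l = coord y l + (l == j)%:R * z.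
by rewrite coordD coordZ coord_ev mulrC. Qed.

(** * The local quotient at a normal crossing *)

Section NC.
Variables (F : V -> C^o) (sg : 'I_n -> V -> C^o) (K : seq 'I_n) (r : R) (d D : nat).
Hypotheses (r0 : 0 < r) (dF : forall y, nm y < r -> dif F y) (dsg : forall j y, nm y < r -> dif (sg j) y) (uK : uniq K) (FK : forall y, nm y < r -> (F y = 0 <-> pk K y = 0)) (d0 : (0 < d)%N) (D0 : (0 < D)%N) (dD : d != D) (star : forall y j k, nm y < r -> d%:R * F y * (de j (sg k) y - de k (sg j) y) =
 D%:R * (de j F y * sg k y - de k F y * sg j y)) (F0 : F 0 = 0) (ND : forall q (eps : R), nm q < r -> F q = 0 -> 0 < eps -> exists y j, [/\ nm (y - q) < eps, nm y < r, F y = 0 & de j F y != 0]).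

(** Division by the coordinates gives [F = pk K * U]. Points with nonzero differential are dense in
    [F = 0] by [ND], so no branch is counted twice, and this keeps [U] from vanishing at the
    origin. *)
Lemma nc_unit : exists U : V -> C^o, exists2 s : R, 0 < s <= r &
 [/\ forall y, nm y < s -> dif U y, forall y, nm y < s -> F y = pk K y * U y & forall y, nm y < s -> U y != 0].
have hF : hol F 0 by exists r => // y; rewrite subr0; exact: dF.
have [|U [r1 r10 dU] [r2 r20 FU]] := div_coords uK hF.
 by exists r => // y k yr kK yk; apply/(FK yr)/eqP; rewrite pk_eq0; apply/hasP; exists k; rewrite ?yk.
pose s1 := minr r (minr r1 r2).
have s10 : 0 < s1 by rewrite !lt_min r0 r10.
have sP y : nm y < s1 -> [/\ nm y < r, dif U y & F y = pk K y * U y] by rewrite !lt_min => /and3P [? yr ?]; split=> //; [apply: dU; rewrite subr0|exact: FU].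
have [U0|U0] := eqVneq (U 0) 0; last first.
 have hU : dif U 0 by apply: dU; rewrite subrr (nm0 V).
 have [s2 s20 hs2] := hol_neq0 hU U0.
 exists U, (minr s1 s2); first by rewrite lt_min s10 s20 /= !ge_min lexx.
 by split=> y; rewrite lt_min => /andP [/sP [? ? ?]] //; rewrite -{1}(subr0 y) => /hs2.
exfalso.
(* If U(0) = 0 then by Hurwitz U has a zero near 0 on every line of direction v; it lies on some y_k = 0, so U vanishes on an open piece of a branch. *)
pose v : V := \sum_(k <- K) ev k.
have vk k : k \in K -> coord v k = 1.
 move=> kK; rewrite coord_sum (bigD1_seq k) //= coord_ev eqxx big1 ?addr0 // => l lk.
 by rewrite coord_ev eq_sym (negbTE lk).
have K0 : K != [::].
 apply/eqP => K0; have : pk K (0 : V) = 0 by apply/FK; rewrite ?(nm0 V).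
 by rewrite K0 /pk big_nil => /eqP; rewrite oner_eq0.
have nU y : nm y < s1 -> U y = 0 -> has (fun k => coord y k == 0) K by move=> /sP [yr _ E] Uy; rewrite -pk_eq0; apply/eqP/(FK yr); rewrite E Uy mulr0.
have hU : hol U 0 by exists r1.
have [sv sv0 hsv] := ex_small s10 (nm_ge0 v).
have s2 : 0 < s1 / 2 by rewrite divr_gt0.
have [ep ep0 hep] := ex_small s2 (nm_ge0 v).
have [|del del0 hz] := @hurwitz U 0 v ep hU U0 ep0.
 exists sv => // z /andP [z0 zs]; apply/eqP => Uz.
 have zv : nm (0 + z *' v) < s1 by rewrite add0r; exact: nmZ_lt hsv.
 have /hasP [k kK] := nU _ zv Uz; rewrite add0r coordZ vk // mulr1 => /eqP z00.
 by move: z0; rewrite z00 (nm0 C^o) ltxx.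
pose p k (y : V) : V := y - coord y k *: v.
have pkk k y : k \in K -> coord (p k y) k = 0 by move=> kK; rewrite /p coordD coordN coordZ vk // mulr1 subrr.
have dp k y : dif (p k) y by apply: difB; [exact: dif_id|apply: (difZl (f := fun y => coord y k)); exact: dif_coord].
have v1 : 0 <= 1 + nm v by rewrite addr_ge0 ?nm_ge0.
have [t t0 ht] := ex_small s10 v1.
have pt_ k y : nm y < t -> nm (p k y) < s1.
 move=> yt; apply: le_lt_trans (nmB _ _) _; rewrite nmZ.
 have h1 : nmc (coord y k) * nm v <= nm y * nm v by rewrite ler_wpM2r ?nm_ge0 ?nm_coord.
 have h2 : nm y * (1 + nm v) <= t * (1 + nm v) by rewrite ler_wpM2r // ltW.
 by move: ht; rewrite mulrDr mulr1 in h2; lra.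
pose rr := minr t (minr del (s1 / 2)).
have rr0 : 0 < rr by rewrite !lt_min t0 del0.
have clo k : k \in K -> closed_in (fun y => nm (y - 0) < rr) (fun y => U (p k y) = 0).
 move=> kK y; rewrite subr0 !lt_min => /and3P [yt _ _] /eqP ny.
 have cU : cts (fun y => U (p k y)) y by apply: dif_cts; apply: (dif_comp (g := U)); [exact: dp|case: (sP _ (pt_ k y yt))].
 by have [da da0 hda] := cts_near0 cU ny; exists da => // x /hda /eqP.
have [y1 [ra [ra0 sub]]] := finite_avoid rr0 clo.
have sub' y : nm (y - y1) < ra -> nm y < rr by move=> /sub; rewrite subr0.
case=> [[k kK Uz]|avoid]; last first.
 have y1a := nm_self y1 ra0.
 have := sub' y1 y1a; rewrite !lt_min => /and3P [_ y1d y1s].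
 have [z ze Uz] := hz y1 (eq_ind_r (fun u => is_true (nm u < del)) y1d (subr0 y1)).
 have yz : nm (y1 + z *' v) < s1 by apply: le_lt_trans (nmD _ _) _; have := nmZ_lt ze hep; move: y1s; lra.
 have /hasP [k kK] := nU _ yz Uz; rewrite coordD coordZ vk // mulr1 addrC addr_eq0 => /eqP zk_.
 by apply: (avoid k y1 kK y1a); rewrite /p -scaleNr -zk_.
(* Away from the diagonals [coord y l = coord y k] the projected point [q] lies on the branch [k]
   and on no other. *)
have clo2 l : l \in rem k K -> closed_in (fun y => nm (y - y1) < ra) (fun y => coord y l - coord y k = 0 :> C^o).
 move=> _ y _ /eqP ny.
 have cU : cts (fun y => coord y l - coord y k : C^o) y by apply/dif_cts/difB; exact: dif_coord.
 by have [da da0 hda] := cts_near0 cU ny; exists da => // x /hda /eqP.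
have [y2 [rb [rb0 sub2]]] := finite_avoid ra0 clo2.
case=> [[l lK El]|dist].
 have [x x0 xs] := ex_small rb0 (nm_ge0 (ev l)).
 have h1 := nm_self y2 rb0.
 have h2 : nm (y2 + x%:C *: ev l - y2) < rb by rewrite addrAC subrr add0r nmZ nm_real gtr0_norm.
 have kl : k == l = false by apply/negP => /eqP kl; move: lK; rewrite -kl mem_rem_uniq // inE eqxx.
 have := El _ h2; rewrite !coord_line eqxx kl mul1r mul0r addr0 addrAC El // add0r.
 by move=> /(congr1 (fun z : C^o => nm z)); rewrite nm_real (nm0 C^o) gtr0_norm // => x00; move: x0; rewrite x00 ltxx.
pose q := p k y2.
have y2b := nm_self y2 rb0.
have y2a := sub2 _ y2b.
have y2t : nm y2 < t by have := sub' _ y2a; rewrite !lt_min => /andP [].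
have qs : nm q < s1 by exact: pt_.
have [qr _ _] := sP _ qs.
have Fq : F q = 0 by apply/(FK qr)/eqP; rewrite pk_eq0; apply/hasP; exists k => //; apply/eqP; exact: pkk.
have qP : pk (rem k K) q != 0.
 rewrite pk_eq0; apply/hasPn => l lK; have lK' := mem_rem lK.
 rewrite /q /p coordD coordN coordZ vk // mulr1; apply/eqP; exact: dist lK y2b.
have [db db0 hdb] := hol_neq0 (dif_pk (rem k K) q) qP.
have [dc dc0 hdc] := @sub_ball R V 0 q s1 (eq_ind_r (fun u => is_true (nm u < s1)) qs (subr0 q)).
have md : 0 < minr rb (minr db dc) by rewrite !lt_min rb0 db0.
have [y [j [+ yr Fy]]] := ND qr Fq md; rewrite !lt_min => /and3P [yb /hdb yd /hdc]; rewrite subr0 => ys /eqP; apply.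
have pkE x : pk K x = coord x k * pk (rem k K) x by rewrite /pk (perm_big _ (perm_to_rem kK)) big_cons.
have yk : coord y k = 0 by have /eqP := (FK yr).1 Fy; rewrite pkE mulf_eq0 (negbTE yd) orbF => /eqP.
have Uy : U y = 0.
 have := Uz (y + coord y2 k *: v); rewrite /p !coordD !coordZ vk // yk add0r mulr1 addrK; apply.
 apply: sub2; have -> : y + coord y2 k *: v - y2 = y - q by rewrite /q /p opprB addrA addrAC.
 exact: yb.
have [e0 e00 he] := @sub_ball R V 0 y s1 (eq_ind_r (fun u => is_true (nm u < s1)) ys (subr0 y)).
have [_ dUy _] := sP y ys.
rewrite -(@dir_ext R V (fun x => coord x k * (pk (rem k K) x * U x) : C^o) F y (ev j) e0 e00).
- rewrite (@dirM R V (fun x => coord x k) (fun x => pk (rem k K) x * U x)); [|exact: dif_coord|by apply: difM; [exact: dif_pk|]].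
 by rewrite yk Uy mulr0 !mul0r addr0.
- by move=> x /he; rewrite subr0 => /sP [_ _ ->]; rewrite pkE mulrA.
by apply: difM; [exact: dif_coord|apply: difM; [exact: dif_pk|]].
Qed.

Lemma dd_coord (j k : 'I_n) (y : V) : de j (fun x => coord x k : C^o) y = (k == j)%:R.
by rewrite (hd_dd _ (hd_coord k y)) coord_ev. Qed.

Lemma dd_cmul (G : V -> C^o) j k y : dif G y -> de j (fun x => coord x k * G x : C^o) y = coord y k * de j G y + (k == j)%:R * G y.
by move=> dG; rewrite (@dirM R V (fun x => coord x k) G) //; [rewrite dd_coord mulrC (mulrC (G y))|exact: dif_coord]. Qed.

Lemma ball_ext (g h : V -> C^o) (s : R) y j : nm y < s -> (forall x, nm x < s -> g x = h x) -> dif h y -> de j g y = de j h y.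
move=> ys gh dh; have e0 : 0 < s - nm y by rewrite subr_gt0.
symmetry; apply: (@dir_ext R V h g y (ev j) _ e0) => // x xe; rewrite gh //.
by have := nm_rev x y; move: xe; lra.
Qed.

Lemma pk_rem k (y : V) : k \in K -> pk K y = coord y k * pk (rem k K) y.
by move=> kK; rewrite /pk (perm_big _ (perm_to_rem kK)) big_cons. Qed.

(** On the branch [k] the relation [star] leaves only the component [sg k], which is divisible by
    the other coordinates, so the quotient there is [q k / U]. The branch quotients agree on
    intersections because [d] differs from [D], and functions that agree on coordinate hyperplanes
    extend together. *)
Lemma nc_local : exists2 b : V -> C^o, hol b 0 & exists2 s : R, 0 < s & forall y j, nm y < s -> F y = 0 -> sg j y = b y * de j F y.
have [U [s /andP [s0 sr] [dU FU Un]]] := nc_unit.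
have lt (y : V) : nm y < s -> nm y < r by move=> ys; exact: lt_le_trans ys sr.
have dP k y : nm y < s -> dif (fun x => pk (rem k K) x * U x : C^o) y by move=> ys; apply: difM; [exact: dif_pk|exact: dU].
have dFk k j y : k \in K -> nm y < s -> coord y k = 0 -> de j F y = (k == j)%:R * (pk (rem k K) y * U y).
 move=> kK ys yk; rewrite (@ball_ext F (fun x => coord x k * (pk (rem k K) x * U x)) s y j ys).
 - by rewrite dd_cmul ?yk ?mul0r ?add0r //; exact: dP.
 - by move=> x xs; rewrite FU // (pk_rem x kK) mulrA.
 by apply: difM; [exact: dif_coord|exact: dP].
have Fk k y : k \in K -> nm y < s -> coord y k = 0 -> F y = 0 by move=> kK ys yk; rewrite FU // (pk_rem y kK) yk !mul0r.
have Dn : D%:R != 0 :> C by rewrite pnatr_eq0 -lt0n.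
have sgz k j y : k \in K -> j != k -> nm y < s -> coord y k = 0 -> sg j y = 0.
 move=> kK jk ys yk.
 suff : U y * sg j y = 0 by move/eqP; rewrite mulf_eq0 (negbTE (Un y ys)) => /eqP.
 apply: (@cancel_coords (rem k K) (fun y => coord y k = 0) (fun y => U y * sg j y) s) => //.
 - by move=> x xs; apply: dif_cts; apply: difM; [exact: dU|apply: dsg; exact: lt].
 - move=> x l z lK xk; rewrite coord_line xk; case: eqP => [kl|]; last by rewrite mul0r addr0.
  by move: lK; rewrite -kl mem_rem_uniq // inE eqxx.
 move=> x xs xk; have := star j k (lt x xs); rewrite (Fk k) // mulr0 mul0r !(dFk k) // eqxx eq_sym (negbTE jk).
 rewrite mul0r mul0r sub0r mul1r => /esym /eqP; rewrite mulf_eq0 (negbTE Dn) oppr_eq0 /= => /eqP.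
 by rewrite -[\prod_(_ <- _) _]/(pk (rem k K) x) mulrA.
have/choice [q hq] k : exists q : V -> C^o, k \in K -> hol q 0 /\ exists2 s' : R, 0 < s' & forall y, nm y < s' -> sg k y = pk (rem k K) y * q y.
 case: (boolP (k \in K)) => kK; last by exists (fun=> 0).
 have hk : hol (sg k) 0 by exists r => // y; rewrite subr0; exact: dsg.
 have [|q hq hs] := div_coords (rem_uniq k uK) hk; last by exists q.
 exists s => // y l ys lK yl; apply: (sgz l) => //; first exact: mem_rem lK.
 by apply: contraTneq lK => ->; rewrite mem_rem_uniq // inE eqxx.
have [s1 s10 hs1] : exists2 s1 : R, 0 < s1 & forall k, k \in K -> forall y, nm y < s1 -> dif (q k) y /\ sg k y = pk (rem k K) y * q k y.
 apply: (@fin_small R _ (fun k s1 => k \in K -> forall y, nm y < s1 -> dif (q k) y /\ sg k y = pk (rem k K) y * q k y)).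
  move=> k; case: (boolP (k \in K)) => kK; last by exists 1.
  have [[a a0 da] [b b0 hb]] := hq k kK; exists (minr a b); first by rewrite lt_min a0.
  by move=> _ y /lt_minP [ya yb]; split; [apply: da; rewrite subr0|exact: hb].
 by move=> k a b ba ha kK y yb; apply: ha => //; exact: lt_le_trans yb ba.
pose t := minr s s1; have t0 : 0 < t by rewrite lt_min s0.
have ts (y : V) : nm y < t -> nm y < s by move=> /lt_minP [].
have ts1 (y : V) : nm y < t -> nm y < s1 by move=> /lt_minP [].
(* [star] for the pair [k], [l] is divided by [coord y k * coord y l] and then both coordinates are
   set to 0. What remains is [d - D] times the difference of the two quotients, up to factors that
   [cancel_coords] and the unit [U] dispose of. *)
have comp k l y : k \in K -> l \in K -> k != l -> nm y < t -> coord y k = 0 -> coord y l = 0 -> q k y = q l y.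
 move=> kK lK kl yt yk yl; have lk : l \in rem k K by rewrite mem_rem_uniq // inE eq_sym kl.
 have kl' : k \in rem l K by rewrite mem_rem_uniq // inE kl.
 pose T := rem l (rem k K).
 have uT : uniq T by rewrite !rem_uniq.
 have kT : k \notin T by apply/negP => /mem_rem; rewrite mem_rem_uniq // inE eqxx.
 have lT : l \notin T by rewrite mem_rem_uniq ?rem_uniq // inE eqxx.
 have pT1 x : pk (rem k K) x = coord x l * pk T x by rewrite /pk (perm_big _ (perm_to_rem lk)) big_cons.
 have pT2 x : pk (rem l K) x = coord x k * pk T x.
  rewrite /pk (perm_big _ (perm_to_rem kl')) big_cons; congr (_ * _); apply: perm_big.
  apply: uniq_perm; rewrite ?rem_uniq // => i.
  rewrite (mem_rem_uniq _ (rem_uniq l uK)) inE /= (mem_rem_uniq l uK) inE /= (mem_rem_uniq l (rem_uniq k uK)) inE /= (mem_rem_uniq k uK) inE /=.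
  exact: andbCA.
 pose A (x : V) : C^o := pk T x * U x; pose Bk (x : V) : C^o := pk T x * q k x; pose Bl (x : V) : C^o := pk T x * q l x.
 have dU' x : nm x < t -> dif U x by move=> /ts /dU.
 have dq i x : i \in K -> nm x < t -> dif (q i) x by move=> iK /ts1 /(hs1 i iK) [].
 have dA x : nm x < t -> dif A x by move=> /dU' ?; apply: difM => //; exact: dif_pk.
 have dBk x : nm x < t -> dif Bk x by move=> /(dq k x kK) ?; apply: difM => //; exact: dif_pk.
 have dBl x : nm x < t -> dif Bl x by move=> /(dq l x lK) ?; apply: difM => //; exact: dif_pk.
 have EF x : nm x < t -> F x = coord x k * (coord x l * A x) by move=> xt; rewrite (FU x (ts x xt)) (pk_rem x kK) pT1 /A; ring.
 have EF2 x : nm x < t -> F x = coord x l * (coord x k * A x) by move=> xt; rewrite EF // mulrCA.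
 have Ek x : nm x < t -> sg k x = coord x l * Bk x by move=> xt; case: (hs1 k kK x (ts1 x xt)) => _ ->; rewrite pT1 /Bk mulrA.
 have El x : nm x < t -> sg l x = coord x k * Bl x by move=> xt; case: (hs1 l lK x (ts1 x xt)) => _ ->; rewrite pT2 /Bl mulrA.
 pose G (x : V) : C^o := d%:R * A x * (Bl x + coord x k * de k Bl x - Bk x - coord x l * de l Bk x)
   - D%:R * ((A x + coord x k * de k A x) * Bl x - (A x + coord x l * de l A x) * Bk x).
 have hB (g : V -> C^o) (x : V) : (forall y, nm y < t -> dif g y) -> nm x < t -> hol g x by move=> dg; exact: hol_in_ball dg.
 have G0 x : nm x < t -> G x = 0.
  move=> xt; apply: (@cancel_coords [:: k; l] (fun=> True) G t) => //.
   move=> z zt; apply: dif_cts; rewrite /G.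
   have := dA z zt; have := dBk z zt; have := dBl z zt.
   have := dif_dir (ev k) (hB A z dA zt); have := dif_dir (ev l) (hB A z dA zt).
   by have := dif_dir (ev l) (hB Bk z dBk zt); have := dif_dir (ev k) (hB Bl z dBl zt); intros; dfs.
  move=> z zt _; rewrite !big_cons big_nil mulr1.
  have S := star k l (lt _ (ts _ zt)).
  have e1 i (B h : V -> C^o) : (forall x, nm x < t -> dif B x) -> (forall x, nm x < t -> h x = coord x i * B x) -> de i h z = B z + coord z i * de i B z.
   move=> dB E; rewrite (@ball_ext h (fun x => coord x i * B x) t z i zt E) ?dd_cmul ?eqxx ?mul1r ?[_ + B z]addrC //; first exact: dB.
   by apply: difM; [exact: dif_coord|exact: dB].
  have e3 i j : (j == i) = false -> (forall x, nm x < t -> F x = coord x i * (coord x j * A x)) -> de i F z = coord z j * (A z + coord z i * de i A z).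
   move=> ji E; rewrite (e1 i (fun x => coord x j * A x : C^o)) //; last by move=> ? ?; apply: difM; [exact: dif_coord|exact: dA].
   by rewrite dd_cmul ?ji ?mul0r ?addr0; [ring|exact: dA].
  have lk' : (l == k) = false by rewrite eq_sym (negbTE kl).
  move: S; rewrite (e1 k Bl _ dBl El) (e1 l Bk _ dBk Ek) (e3 k l lk' EF) (e3 l k (negbTE kl) EF2) (EF z zt) (Ek z zt) (El z zt) /G => S.
  by apply/eqP; move/eqP: S; rewrite -subr_eq0 => /eqP <-; apply/eqP; ring.
 have key x : nm x < t -> coord x k = 0 -> coord x l = 0 -> pk T x * (pk T x * (U x * (q l x - q k x))) = 0.
  move=> xt xk xl; have := G0 x xt; rewrite /G xk xl !mul0r !addr0 !subr0 /A /Bk /Bl => E.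
  have dDn : d%:R - D%:R != 0 :> C by rewrite subr_eq0 eqr_nat.
  apply/eqP; move: E; move: (pk T x) (U x) (q l x) (q k x) => a b c e E.
  have : (d%:R - D%:R) * (a * (a * (b * (c - e)))) = 0 by rewrite -E; ring.
  by move/eqP; rewrite mulf_eq0 (negbTE dDn).
 have mvT (x : V) i (z : C) : i \in T -> coord x k = 0 /\ coord x l = 0 -> coord (x + z *: ev i) k = 0 /\ coord (x + z *: ev i) l = 0.
  move=> iT [xk xl]; rewrite !coord_line xk xl.
  have -> : k == i = false by apply/negP => /eqP ki; move: kT; rewrite ki iT.
  have -> : l == i = false by apply/negP => /eqP ki; move: lT; rewrite ki iT.
  by rewrite !mul0r !addr0.
 have cq x : nm x < t -> dif (fun x => U x * (q l x - q k x) : C^o) x by move=> xt; have := dU' x xt; have := dq k x kK xt; have := dq l x lK xt; intros; dfs.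
 have z1 x : nm x < t -> coord x k = 0 /\ coord x l = 0 -> pk T x * (U x * (q l x - q k x)) = 0.
  apply: (@cancel_coords T (fun x => coord x k = 0 /\ coord x l = 0) (fun x => pk T x * (U x * (q l x - q k x))) t) => //.
   by move=> z zt; apply: dif_cts; apply: difM; [exact: dif_pk|exact: cq].
  by move=> z zt [zk_ zl]; exact: key.
 have : U y * (q l y - q k y) = 0 by apply: (@cancel_coords T (fun x => coord x k = 0 /\ coord x l = 0) (fun x => U x * (q l x - q k x)) t) => // z zt; apply: dif_cts; exact: cq.
 by move/eqP; rewrite mulf_eq0 (negbTE (Un y (ts y yt))) subr_eq0 => /eqP.
pose rk k (y : V) : C^o := q k y / U y.
have drk k y : k \in K -> nm y < t -> dif (rk k) y.
 move=> kK yt; apply: difM; first by case: (hs1 k kK y (ts1 y yt)).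
 by apply: difV; [apply: Un; exact: ts|apply: dU; exact: ts].
(* Hyperplanes are added one at a time: the discrepancy on the new one is pulled back by [zk k], and
   by [comp] this correction vanishes on those already treated. *)
have [b db bk] : exists2 b : V -> C^o, forall y, nm y < t -> dif b y & forall k y, k \in K -> nm y < t -> coord y k = 0 -> b y = rk k y.
 have : forall L : seq 'I_n, {subset L <= K} -> exists2 b : V -> C^o, forall y, nm y < t -> dif b y & forall k y, k \in L -> nm y < t -> coord y k = 0 -> b y = rk k y.
  elim=> [|k L IH] LK; first by exists (fun=> 0) => // y _; exact: dif_cst.
  have kK : k \in K by apply: LK; exact: mem_head.
  have [|b db hb] := IH; first by move=> l lL; apply: LK; rewrite inE lL orbT.
  have zt y : nm y < t -> nm (zk k y) < t by move=> yt; apply: le_lt_trans (nm_zk k y) yt.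
  exists (fun y => b y + (rk k (zk k y) - b (zk k y)) : C^o).
   move=> y yt; apply: difD; first exact: db.
   apply: (dif_comp (g := fun y => rk k y - b y : C^o)); first exact: dif_zk.
   by apply: difB; [apply: drk => //; exact: zt|apply: db; exact: zt].
  move=> l y; rewrite inE => /orP [/eqP ->|lL] yt yl; first by rewrite zk_id // addrC subrK.
  have [E|lk] := eqVneq l k.
   by rewrite E in yl *; rewrite zk_id // addrC subrK.
  have zl : coord (zk k y) l = 0 by rewrite coord_zk (negbTE lk).
  have zkk : coord (zk k y) k = 0 by rewrite coord_zk eqxx.
  have lK : l \in K by apply: LK; rewrite inE lL orbT.
  rewrite (hb l y lL yt yl) (hb l (zk k y) lL (zt y yt) zl) /rk (comp k l) // ?subrr ?addr0 //; last exact: zt.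
  by rewrite eq_sym.
 by move=> /(_ K) [] // b; exists b.
exists b; first by exists t => // y; rewrite subr0; exact: db.
exists t => // y j yt Fy.
have /eqP := (FK (lt _ (ts _ yt))).1 Fy; rewrite pk_eq0 => /hasP [k kK /eqP yk].
rewrite (dFk k) ?(bk k) ?ts //; have [kj|kj] := eqVneq k j.
 case: (hs1 k kK y (ts1 y yt)) => _; rewrite -kj => ->; rewrite mul1r /rk.
 by rewrite [RHS]mulrCA mulrC mulfVK ?Un ?ts // mulrC.
by rewrite mul0r mulr0; apply: (sgz k) => //; [rewrite eq_sym|exact: ts].
Qed.

End NC.

Lemma dd_comp (g : V -> C^o) (phi : V -> V) x v : dif phi x -> dif g (phi x) ->
 dd v (fun x => g (phi x)) x = \sum_i dd v (fun x => coord (phi x) i : C^o) x * de i g (phi x).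
move=> [L hL] [M hM]; rewrite (hd_dd v (hd_comp hL hM)).
have [lM _ _] := hM.
have -> : L v = \sum_i coord (L v) i *: ev i by exact: V_sum.
have lsum (s : seq 'I_n) : M (\sum_(i <- s) coord (L v) i *: ev i) = \sum_(i <- s) coord (L v) i * M (ev i) by elim: s => [|i s IH]; rewrite ?big_nil ?(lin0 lM) // !big_cons (linD _ _ lM) (linZ _ _ lM) IH.
rewrite lsum; apply: eq_bigr => i _; rewrite (hd_dd _ hM); congr (_ * _).
by rewrite (hd_dd v (hd_comp hL (hd_coord i (phi x)))).
Qed.

Lemma dif_cc (phi : V -> V) x i : dif phi x -> dif (fun x => coord (phi x) i : C^o) x.
by move=> h; apply: (dif_comp (g := fun y => coord y i : C^o)) => //; exact: dif_coord. Qed.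

Variables (f : V -> C^o) (rho : 'I_n -> V -> C^o) (d D : nat) (e1 : V).
Hypotheses (ef : ent f) (erho : forall i, ent (rho i)) (d0 : (0 < d)%N) (D0 : (0 < D)%N) (dD : d != D) (star : forall x i j, d%:R * f x * (de i (rho j) x - de j (rho i) x) =
 D%:R * (de i f x * rho j x - de j f x * rho i x)) (NDX : forall p (eps : R), f p = 0 -> 0 < eps -> exists x, [/\ nm (x - p) < eps, f x = 0 & dd e1 f x != 0]).

Definition vnice p := exists2 b : V -> C^o, hol b p & exists2 del : R, 0 < del &
 forall x i, nm (x - p) < del -> f x = 0 -> rho i x = b x * de i f x.

(** [star] is a relation between differential forms, so it holds for the pullback [sg] of [rho] by
    the inverse chart: the second derivatives of [psi] cancel by symmetry. The quotient found in the
    chart is carried back by [phi]. *)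
Lemma vnice_chart p (phi psi : V -> V) (K : seq 'I_n) : f p = 0 -> hol phi p -> hol psi 0 -> phi p = 0 -> uniq K ->
 (exists2 r : R, 0 < r & forall x, nm (x - p) < r -> psi (phi x) = x) ->
 (exists2 r : R, 0 < r & forall y, nm y < r -> phi (psi y) = y) ->
 (exists2 r : R, 0 < r & forall x, nm (x - p) < r -> (f x = 0 <-> pk K (phi x) = 0)) -> vnice p.
move=> fp hphi hpsi p0 uK [r1 r10 h1] [r2 r20 h2] [r3 r30 h3].
have psi0 : psi 0 = p by rewrite -p0 h1 // subrr (nm0 V).
have [r4 r40 dphi] := hphi; have [r5 r50 hpsi'] := hol_near hpsi.
pose rp := minr r1 (minr r3 r4).
have rp0 : 0 < rp by rewrite !lt_min r10 r30 r40.
have [r6 r60 h6] := hol_cont hpsi rp0; rewrite psi0 in h6.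
pose r := minr r2 (minr r5 r6).
have r0 : 0 < r by rewrite !lt_min r20 r50 r60.
have rP y : nm y < r -> [/\ phi (psi y) = y, hol psi y & nm (psi y - p) < rp].
 move=> yr; rewrite !lt_min in yr; case/and3P: yr => /h2 E y5 y6; split=> //; first by apply: hpsi'; rewrite subr0.
 by apply: h6; rewrite subr0.
have rpP x : nm (x - p) < rp -> [/\ psi (phi x) = x, (f x = 0 <-> pk K (phi x) = 0) & dif phi x] by rewrite !lt_min => /and3P [/h1 ? /h3 ? /dphi ?].
pose F (y : V) : C^o := f (psi y).
pose A i j (y : V) : C^o := de j (fun y => coord (psi y) i : C^o) y.
pose sg j (y : V) : C^o := \sum_i rho i (psi y) * A i j y.
have dpsi y : nm y < r -> dif psi y by move=> /rP [_ /hol_dif].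
have hpc i y : nm y < r -> hol (fun y => coord (psi y) i : C^o) y.
 move=> /rP [_ hy _]; apply: (@hol_comp R V V C^o psi (fun y => coord y i : C^o)); first exact: hy.
 by apply: hol_ent => x; exact: dif_coord.
have dA i j y : nm y < r -> dif (A i j) y by move=> /(hpc i); exact: dif_dir.
have dcomp g y : ent g -> nm y < r -> dif (fun y => g (psi y)) y by move=> eg yr; apply: (dif_comp (g := g)); [exact: dpsi|exact: eg].
have dF y : nm y < r -> dif F y by exact: dcomp.
have dsg j y : nm y < r -> dif (sg j) y by move=> yr; apply: dif_sum => i _; apply: difM; [exact: dcomp|exact: dA].
have FK y : nm y < r -> (F y = 0 <-> pk K y = 0) by move=> /rP [E _ /rpP [_ h _]]; rewrite /F h E.
have cF j y : nm y < r -> de j F y = \sum_i A i j y * de i f (psi y) by move=> yr; rewrite /F dd_comp //; exact: dpsi.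
have csg j k y : nm y < r -> de j (sg k) y = \sum_i \sum_l A l j y * de l (rho i) (psi y) * A i k y + \sum_i rho i (psi y) * de j (A i k) y.
 move=> yr; rewrite /sg (@dir_sum R V _ _ _ (fun i y => rho i (psi y) * A i k y)); last by move=> i _; apply: difM; [exact: dcomp|exact: dA].
 rewrite -big_split; apply: eq_bigr => i _.
 rewrite (@dirM R V (fun y => rho i (psi y)) (A i k)); [|exact: dcomp|exact: dA].
 rewrite [LHS]addrC /= (@dd_comp (rho i) psi y (ev j) (dpsi y yr) (erho i _)) mulr_sumr; congr (_ + _).
 by apply: eq_bigr => l _; rewrite /A; ring.
have S y j k : nm y < r -> d%:R * F y * (de j (sg k) y - de k (sg j) y) = D%:R * (de j F y * sg k y - de k F y * sg j y).
 move=> yr; rewrite !csg // !cF //.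
 have -> : \sum_i rho i (psi y) * de k (A i j) y = \sum_i rho i (psi y) * de j (A i k) y by apply: eq_bigr => i _; congr (_ * _); rewrite /A dir_sym //; exact: hpc.
 rewrite opprD addrACA subrr addr0.
 have -> : \sum_i \sum_l A l k y * de l (rho i) (psi y) * A i j y = \sum_i \sum_l A l j y * de i (rho l) (psi y) * A i k y by rewrite exchange_big; apply: eq_bigr => i _; apply: eq_bigr => l _; ring.
 have E1 : \sum_i \sum_l A l j y * de l (rho i) (psi y) * A i k y - \sum_i \sum_l A l j y * de i (rho l) (psi y) * A i k y
   = \sum_i \sum_l (de l (rho i) (psi y) - de i (rho l) (psi y)) * (A l j y * A i k y).
  by rewrite -sumrB; apply: eq_bigr => i _; rewrite -sumrB; apply: eq_bigr => l _; ring.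
 rewrite E1.
 rewrite [X in _ * (X - _)]mulrC /sg !big_distrlr /= -sumrB !mulr_sumr; apply: eq_bigr => i _.
 rewrite -sumrB !mulr_sumr; apply: eq_bigr => l _.
 by rewrite mulrA (star (psi y) l i); ring.
have [b hb [s s0 hs]] : exists2 b : V -> C^o, hol b 0 & exists2 s : R, 0 < s & forall y j, nm y < s -> F y = 0 -> sg j y = b y * de j F y.
 apply: (@nc_local F sg K r d D) => //; first by rewrite /F psi0.
 move=> q eps qr Fq eps0; have [Eq _ qp] := rP q qr; have [_ _ dq] := rpP _ qp.
 have m0 : 0 < minr eps (r - nm q) by rewrite lt_min eps0 subr_gt0.
 have [a a0 ha] := dif_cont dq m0; have [c c0 hc] := sub_ball qp.
 have [|x [+ fx nx]] := @NDX (psi q) (minr a c) Fq; first by rewrite lt_min a0.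
 move=> /lt_minP [/ha + /hc xp]; rewrite Eq lt_min => /andP [xe xr].
 have [Ex _ dx] := rpP x xp.
 have phr : nm (phi x) < r by have := nm_rev (phi x) q; move: xr; lra.
 have nj : exists j, de j F (phi x) != 0.
  apply: contrapT => no; case/eqP: nx.
  have [g g0 hg] := sub_ball xp.
  rewrite (@dir_ext R V f (fun x => F (phi x)) x e1 g g0) //; last by move=> z /hg /rpP [E _ _]; rewrite /F E.
  rewrite dd_comp //; last exact: dF.
  rewrite big1 // => j _; rewrite (_ : de j F (phi x) = 0) ?mulr0 //.
  by apply/eqP; apply: contraT => hj; case: no; exists j.
 by have [j hj] := nj; exists (phi x), j; split=> //; rewrite /F Ex.
have sr0 : 0 < minr s r by rewrite lt_min s0.
have dphip : dif phi p by apply: dphi; rewrite subrr (nm0 V).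
have [g g0 hg] := dif_cont dphip sr0; rewrite p0 in hg.
exists (fun x => b (phi x)); first by apply: (@hol_comp R V V C^o phi b); [exact: hphi|rewrite p0].
exists (minr rp g); first by rewrite lt_min rp0.
move=> x m /lt_minP [xp /hg]; rewrite subr0 lt_min => /andP [ys yr] fx.
have [Ex _ dx] := rpP x xp.
have [u u0 hu] := sub_ball xp.
have Fy : F (phi x) = 0 by rewrite /F Ex.
have E1 : de m f x = \sum_j de m (fun x => coord (phi x) j : C^o) x * de j F (phi x).
 rewrite (@dir_ext R V f (fun x => F (phi x)) x (ev m) u u0) //; last by move=> z /hu /rpP [E _ _]; rewrite /F E.
 by rewrite dd_comp //; exact: dF.
have E2 i : \sum_j de m (fun x => coord (phi x) j : C^o) x * A i j (phi x) = (i == m)%:R.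
 rewrite -(@dd_comp (fun y => coord (psi y) i : C^o) phi x (ev m)) //; last by apply: dif_cc; exact: dpsi.
 rewrite -(dd_coord m i x); symmetry; apply: (@dir_ext R V _ _ x (ev m) u u0); last exact: dif_coord.
 by move=> z /hu /rpP [-> _ _].
rewrite E1 mulr_sumr.
have -> : \sum_i b (phi x) * (de m (fun x => coord (phi x) i : C^o) x * de i F (phi x)) =
 \sum_j de m (fun x => coord (phi x) j : C^o) x * sg j (phi x).
 by apply: eq_bigr => j _; rewrite hs //; ring.
have -> : \sum_j de m (fun x => coord (phi x) j : C^o) x * sg j (phi x) = \sum_i rho i x * \sum_j de m (fun x => coord (phi x) j : C^o) x * A i j (phi x).
 rewrite /sg Ex; under eq_bigr do rewrite mulr_sumr.
 by rewrite exchange_big; apply: eq_bigr => i _; rewrite mulr_sumr; apply: eq_bigr => j _; ring.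
rewrite (bigD1 m) //= E2 eqxx mulr1 big1 ?addr0 // => i im.
by rewrite E2 (negbTE im) mulr0.
Qed.

Hypothesis fn0 : exists x, f x != 0.

(** A normal crossing is already a chart. At a regular point the dimension is not given and must be
    shown to be [n - 1] before the chart is that of a single coordinate hyperplane. *)
Lemma vnice_nc p : f p = 0 -> smooth_or_normal_crossing f p -> vnice p.
move=> fp [[m [_ [mn [phi [[hphi [psi [hpsi [k1 k2]]]] [p0 iff]]]]]]|[phi [k [kn [[hphi [psi [hpsi [k1 k2]]]] [p0 iff]]]]]]; last first.
 move: hphi hpsi k1 k2 iff; rewrite p0 => /holo_mapP hphi /holo_mapP hpsi /nearP k1 /near0P k2 /nearP iff.
 pose K : seq 'I_n := [seq i : 'I_n <- enum 'I_n | (i < k)%N].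
 have uK : uniq K by rewrite filter_uniq // enum_uniq.
 apply: (vnice_chart fp hphi hpsi p0 uK k1 k2).
 have [r r0 h] := iff; exists r => // x /h ->.
 by rewrite /pk big_filter big_enum_cond.
move: hphi hpsi k1 k2 iff; rewrite p0 => /holo_mapP hphi /holo_mapP hpsi /nearP k1 /near0P k2 /nearP [r r0 iff'].
have iff x : nm (x - p) < r -> (f x = 0 <-> forall i : 'I_n, (m <= i)%N -> coord (phi x) i = 0) by exact: iff'.
have [r1 r10 h1] := k1; have [r2 r20 h2] := k2.
have psi0 : psi 0 = p by rewrite -p0 h1 // subrr (nm0 V).
have [s s0 hs] := hol_cont hpsi r0; rewrite psi0 in hs.
pose F (y : V) : C^o := f (psi y).
have FP y : nm y < minr r2 s -> (F y = 0 <-> forall i : 'I_n, (m <= i)%N -> coord y i = 0).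
 move=> /lt_minP [y2 ys]; rewrite /F iff; last by apply: hs; rewrite subr0.
 by split=> h i /h; rewrite h2.
have ms : 0 < minr r2 s by rewrite lt_min r20.
have mn' : (m < n)%N.
 rewrite ltn_neqAle mn andbT; apply/eqP => E; have [x0 fx0] := fn0; case/eqP: fx0.
 apply: (@ball_zero R V f p (nm (x0 - p) + 1) r r0 (fun x _ => ef x) _ x0); last by rewrite ltrDl.
 by move=> x /iff ->  i; rewrite E leqNgt ltn_ord.
have hF : hol F 0 by apply: (@hol_comp R V V C^o psi f); [exact: hpsi|exact: hol_ent].
(* If two coordinates vanished on the zero set, Hurwitz's theorem in the direction of one of them
   would give a zero where the other is nonzero. *)
have mn1 : m = n.-1.
 apply/eqP; rewrite eqn_leq -ltnS (ltn_predK mn') mn' /= leqNgt; apply/negP => lt.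
 have n1 : (n.-1 < n)%N by rewrite (ltn_predK mn').
 have n2 : (n.-2 < n)%N by apply: leq_ltn_trans n1; exact: leq_pred.
 pose i1 := Ordinal n1; pose i2 := Ordinal n2.
 have i12 : i2 != i1 by apply/eqP => /(congr1 val) /=; move: lt mn'; clear; lia.
 have F0 : F 0 = 0 by rewrite /F psi0.
 have [a a0 ha] := ex_small ms (nm_ge0 (ev i1)).
 have [||del del0 hz] := @hurwitz F 0 (ev i1) (minr r2 s / 2 / (1 + nm (ev i1))) hF F0.
 - by rewrite !divr_gt0 // ltr_pwDl // nm_ge0.
 - exists a => // z /andP [z0 za]; apply/eqP => Fz.
  have zl : nm (0 + z *' ev i1) < minr r2 s by rewrite add0r; exact: nmZ_lt ha.
  have := (FP _ zl).1 Fz i1 (ltnW lt); rewrite coord_line coord0 eqxx add0r mul1r => z00.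
  by move: z0; rewrite z00 (nm0 C^o) ltxx.
 have m2 : 0 < minr del (minr r2 s / 2) by rewrite lt_min del0 divr_gt0.
 have [t t0 ht] := ex_small m2 (nm_ge0 (ev i2)).
 have ny : nm (t%:C *: ev i2) < minr del (minr r2 s / 2) by rewrite nmZ nm_real gtr0_norm.
 move: ny; rewrite lt_min => /andP [yd y2].
 have [z ze Fz] := hz (t%:C *: ev i2) (eq_ind_r (fun u => is_true (nm u < del)) yd (subr0 _)).
 have zl : nm (t%:C *: ev i2 + z *' ev i1) < minr r2 s.
  apply: le_lt_trans (nmD _ _) _; rewrite [nm (z *' _)]nmZ.
  have e0 : 0 < 1 + nm (ev i1) by rewrite ltr_pwDl // nm_ge0.
  move: ze; rewrite ltr_pdivlMr // mulrDr mulr1 => ze.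
  by have := nm_ge0 z; move: ze y2; lra.
 have l2 : (m <= i2)%N by rewrite /=; move: lt mn'; clear; lia.
 have := (FP _ zl).1 Fz i2 l2; rewrite coord_line coordZ coord_ev eqxx (negbTE i12) mul0r addr0 mulr1.
 by move=> /(congr1 (fun z : C^o => nm z)); rewrite nm_real (nm0 C^o) gtr0_norm // => t00; move: t0; rewrite t00 ltxx.
have n1 : (n.-1 < n)%N by rewrite (ltn_predK mn').
have uK : uniq [:: Ordinal n1] by [].
apply: (vnice_chart fp hphi hpsi p0 uK k1 k2).
exists r => // x /iff ->; rewrite /pk big_seq1; split=> [h|h i mi]; first by apply: h; rewrite mn1.
by rewrite (_ : i = Ordinal n1) //; apply: val_inj => /=; have := ltn_ord i; move: mi; rewrite mn1; clear; lia.
Qed.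

End Transport.

(** * Weights of forms and of their coefficients *)

Section FormDegree.
Variables (R : realType) (n : nat).
Local Notation C := R[i].
Local Notation V := (Cn R n).
Local Notation ev := (ev R).
Variable w : 'I_n -> nat.
Hypothesis w0 : forall i, (0 < w i)%N.
Local Notation act := (act w).
Local Notation wh := (@wh R n w).
Local Notation whom := (@whom R n w).
Local Notation wcomp := (@wcomp R n w).
Implicit Types g h : V -> C^o.

(* The part of weight [k] of [g dx], where [dx] has weight [c]. *)
Definition fcomp (c : nat) (g : V -> C^o) (k : nat) (x : V) : C^o := if (c <= k)%N then wcomp g (k - c) x else 0.

Lemma fcomp_asy c g x : hol g 0 -> asy (fun t : C^o => t ^+ c * g (act t x)) (fun k => fcomp c g k x).
by move=> hg; apply: asy_shift; exact: wcomp_asy. Qed.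

Lemma fcompM c1 c2 g h k x : hol g 0 -> hol h 0 ->
 fcomp (c1 + c2) (fun x => g x * h x) k x = \sum_(i < k.+1) fcomp c1 g i x * fcomp c2 h (k - i)%N x.
move=> hg hh; have A := asyM (fcomp_asy c1 x hg) (fcomp_asy c2 x hh).
have B := fcomp_asy (c1 + c2) x (holM hg hh).
suff A' : asy (fun t : C^o => t ^+ (c1 + c2) * (g (act t x) * h (act t x))) (fun k => \sum_(i < k.+1) fcomp c1 g i x * fcomp c2 h (k - i)%N x).
 by have := asy_uniq B A' => /(congr1 (fun a => a k)).
by apply: asy_ext ltr01 _ A => z _; rewrite exprD; ring.
Qed.

Lemma fcompD c g h k x : hol g 0 -> hol h 0 -> fcomp c (fun x => g x + h x) k x = fcomp c g k x + fcomp c h k x.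
by move=> hg hh; rewrite /fcomp; case: ifP => _; rewrite ?wcompD ?addr0. Qed.
Lemma fcompB c g h k x : hol g 0 -> hol h 0 -> fcomp c (fun x => g x - h x) k x = fcomp c g k x - fcomp c h k x.
by move=> hg hh; rewrite /fcomp; case: ifP => _; rewrite ?wcompB ?subr0. Qed.
Lemma fcompZ c a g k x : hol g 0 -> fcomp c (fun x => a * g x) k x = a * fcomp c g k x.
by move=> hg; rewrite /fcomp; case: ifP => _; rewrite ?wcompZ ?mulr0. Qed.
Lemma fcomp_ext c g h k x : hol g 0 -> near0 (fun x => g x = h x) -> fcomp c g k x = fcomp c h k x.
by move=> hg [r r0 E]; rewrite /fcomp; case: ifP => // _; exact: wcomp_ext r0 E hg. Qed.
Lemma fcomp_pd i c g k x : hol g 0 -> de i (fcomp c g k) x = fcomp (w i + c) (de i g) k x.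
move=> hg; rewrite /fcomp; case: (leqP c k) => ck; last first.
 by rewrite dir_cst (_ : (w i + c <= k)%N = false) //; apply/negbTE; move: ck; clear; lia.
rewrite wcomp_pd //; have -> : (w i + c <= k)%N = (w i <= k - c)%N by apply/idP/idP; move: ck; clear; lia.
by case: ifP => // _; congr wcomp; clear; lia.
Qed.
Lemma ent_fcomp c g k : hol g 0 -> ent (fcomp c g k).
move=> hg x; rewrite /fcomp; case: (leqP c k) => ck; [exact: dif_wcomp|exact: dif_cst].
Qed.
Lemma wh_fcomp c g k : hol g 0 -> wh c k (fcomp c g k).
move=> hg t x; rewrite /fcomp; case: (leqP c k) => ck; last by rewrite !mulr0.
by rewrite wcomp_act // mulrA -exprD subnKC.
Qed.
Lemma fcomp_wh c g k j x : ent g -> wh c k g -> fcomp c g j x = if j == k then g x else 0.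
move=> eg hg; rewrite /fcomp; case: (leqP c k) => ck; last first.
 have g0 y : g y = 0 by exact: wh_low hg ck.
 have -> : g = fun=> 0 by apply/funext.
 have z : wcomp (fun=> 0) (j - c) x = 0 by apply: (wcomp0 w0 _ _ ltr01).
 by rewrite z; do 2 case: ifP.
have hk := wh_whom w0 eg hg ck; rewrite (wcomp_whom _ _ hk).
case: (leqP c j) => cj; last by rewrite (_ : j == k = false) //; apply/negbTE; move: cj ck; clear; lia.
by have -> : (j - c == k - c)%N = (j == k) by apply/eqP/eqP; move: ck cj; clear; lia.
Qed.
Lemma fcomp_inj c g : hol g 0 -> (forall k x, fcomp c g k x = 0) -> near0 (fun x => g x = 0).
move=> hg h; apply: (wcomp_inj (w := w)) => // k x; have := h (k + c)%N x.
by rewrite /fcomp leq_addl addnK.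
Qed.

Lemma wh_pdc i c k g : ent g -> wh c k g -> wh (w i + c) k (de i g).
move=> eg hg t x; have hg0 : hol g 0 by exact: hol_ent.
have E : g = fcomp c g k by apply/funext => y; rewrite (fcomp_wh k y eg hg) eqxx.
have E2 y : de i g y = fcomp (w i + c) (de i g) k y by rewrite {1}E fcomp_pd.
have hd0 : hol (de i g) 0 by exact: hol_dir.
have := wh_fcomp (w i + c) k hd0 t x; by rewrite -!E2.
Qed.

Lemma whM c1 c2 k1 k2 g h : wh c1 k1 g -> wh c2 k2 h -> wh (c1 + c2) (k1 + k2) (fun x => g x * h x).
by move=> hg hh t x; rewrite !exprD mulrACA hg hh; ring. Qed.
Lemma whD c k g h : wh c k g -> wh c k h -> wh c k (fun x => g x + h x).
by move=> hg hh t x; rewrite !mulrDr hg hh. Qed.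
Lemma whZ c k a g : wh c k g -> wh c k (fun x => a * g x).
by move=> hg t x; rewrite mulrCA hg; ring. Qed.
Lemma whom_wh0 k g : whom k g <-> wh 0 k g.
by split=> h t x; have := h t x; rewrite expr0 mul1r. Qed.
Lemma wh_sum c k I (s : seq I) (P : pred I) (G : I -> V -> C^o) : (forall i, P i -> wh c k (G i)) -> wh c k (fun x => \sum_(i <- s | P i) G i x).
by move=> h t x; rewrite !mulr_sumr; apply: eq_bigr => i Pi; exact: h. Qed.

Lemma euler_wh c k g x : ent g -> wh c k g -> \sum_i (w i)%:R * coord x i * de i g x = (k%:R - c%:R) * g x.
move=> eg hg; case: (leqP c k) => ck; last first.
 have g0 y : g y = 0 by exact: wh_low hg ck.
 have -> : g = fun=> 0 by apply/funext.
 by rewrite mulr0 big1 // => i _; rewrite dir_cst mulr0.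
by rewrite (euler x eg (wh_whom w0 eg hg ck)) natrB.
Qed.

Lemma fcomp_whM c m (g e : V -> C^o) k x : ent g -> wh 0 m g -> hol e 0 ->
 fcomp c (fun x => g x * e x) k x = if (m <= k)%N then g x * fcomp c e (k - m) x else 0.
move=> eg wg he; rewrite -[c in LHS]add0n fcompM //; last exact: hol_ent.
have E a := fcomp_wh a x eg wg; case: (leqP m k) => mk.
 rewrite (bigD1 (Ordinal (mk : (m < k.+1)%N))) //= E eqxx big1 ?addr0 // => i ik.
 rewrite E (_ : i == m :> nat = false) ?mul0r //.
 by apply/negbTE; apply: contraNneq ik => ik; apply/eqP/val_inj.
rewrite big1 // => i _; rewrite E (_ : i == m :> nat = false) ?mul0r //.
by apply/negbTE; have := ltn_ord i; move: mk; clear; lia.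
Qed.

Lemma fcomp0 c k x : fcomp c (fun=> 0) k x = 0.
by rewrite /fcomp; case: ifP => // _; rewrite (wcomp0 w0 _ _ ltr01). Qed.

Lemma fcomp_sum c I (s : seq I) (F : I -> V -> C^o) k x : (forall i, hol (F i) 0) ->
 fcomp c (fun x => \sum_(i <- s) F i x) k x = \sum_(i <- s) fcomp c (F i) k x.
move=> hF; elim: s => [|i s IH].
 by rewrite big_nil -[RHS](fcomp0 c k x); congr fcomp; apply/funext => y; rewrite big_nil.
rewrite big_cons -IH -fcompD //; last by apply: hol_sum.
by congr fcomp; apply/funext => y; rewrite big_cons.
Qed.

End FormDegree.

Lemma rder_dd (R : realType) (W : normedModType R[i]) (g : W -> R[i]^o) (p v : W) (t : R) : dif g (p + t%:C *: v) ->
 rder (fun s => g (p + s%:C *: v)) t (dd v g (p + t%:C *: v)).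
by move=> [L hL]; rewrite (hd_dd _ hL); exact: rder_seg. Qed.

(** * Division by [df] and relative exactness *)

Section Division.
Variables (R : realType) (n : nat).
Local Notation C := R[i].
Local Notation V := (Cn R n).
Local Notation ev := (ev R).
Variables (w : 'I_n -> nat) (d : nat) (f : V -> C^o).
Hypotheses (w0 : forall i, (0 < w i)%N) (d0 : (0 < d)%N) (ef : ent f) (hf : whom w d f) (red : reduced_germ f) (irr : irreducible_zero_germ f) (fn0 : exists x, f x != 0).
Local Notation act := (act w).
Local Notation wh := (@wh R n w).
Local Notation fcomp := (@fcomp R n w).
Local Notation df i := (de i f).

Lemma f_cancel (g : V -> C^o) : hol g 0 -> near0 (fun x => f x * g x = 0) -> near0 (fun x => g x = 0).
move=> [r r0 dg] [s s0 h]; exists (minr r s); first by side.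
move=> x /lt_minP [xr xs]; apply/eqP; apply: contraT => gx.
have dgx : dif g x by apply: dg; rewrite subr0.
have [e e0 he] := hol_neq0 dgx gx.
have [e' e0' he'] := @sub_ball R V 0 x s (eq_ind_r (fun u => is_true (nm u < s)) xs (subr0 x)).
have [y fy] := fn0; case/eqP: fy.
apply: (@ball_zero R V f x (nm (y - x) + 1) (minr e e') _ (fun z _ => ef z) _ y); last by rewrite ltrDl.
 by side.
move=> z /lt_minP [/he gz /he']; rewrite subr0 => /h /eqP.
by rewrite mulf_eq0 (negbTE gz) orbF => /eqP.
Qed.

Lemma ent_cancel (g : V -> C^o) : ent g -> (forall x, f x * g x = 0) -> forall x, g x = 0.
move=> eg h x; have [|r r0 hr] := f_cancel (hol_ent 0 eg); first by exists 1.
apply: (@ball_zero R V g 0 (nm x + 1) r r0 (fun z _ => eg z) _ x); last by rewrite subr0 ltrDl.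
by move=> z; rewrite subr0; exact: hr.
Qed.

Lemma wh_pg c k g : ent g -> wh c k g -> pg g.
move=> eg hg; case: (leqP c k) => ck.
 exists (k - c)%N; split=> //; exact: whom_growth eg (wh_whom w0 eg hg ck).
have -> : g = fun=> 0 by apply/funext => x; exact: (wh_low w0 x eg hg ck).
exact: pg_cst.
Qed.

Lemma wh_f : wh 0 d f. exact/whom_wh0. Qed.
Lemma wh_df i : wh (w i) d (df i). exact: wh_pd. Qed.
Lemma ent_df i : ent (df i). exact: ent_dd. Qed.
Lemma pg_f : pg f. exact: wh_pg wh_f. Qed.

Lemma fcomp_fM c (e : V -> C^o) k x : hol e 0 -> fcomp c (fun x => f x * e x) k x = if (d <= k)%N then f x * fcomp c e (k - d) x else 0.
by move=> he; rewrite (fcomp_whM w0 c k x ef wh_f he).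
Qed.

Lemma fcomp_vdf (v : V -> C^o) i k x : hol v 0 -> fcomp (w i) (fun x => v x * df i x) k x = if (d <= k)%N then fcomp 0 v (k - d) x * df i x else 0.
move=> hv; rewrite -[w i in LHS]add0n fcompM //; last by apply: hol_ent; exact: ent_df.
have E a := fcomp_wh w0 a x (ent_df i) (wh_df i).
case: (leqP d k) => dk.
 have lt : (k - d < k.+1)%N by rewrite ltnS leq_subr.
 rewrite (bigD1 (Ordinal lt)) //= E subKn // eqxx big1 ?addr0 // => j jk.
 rewrite E (_ : (k - j == d)%N = false) ?mulr0 //.
 by apply/negbTE; apply: contraNneq jk => jk; apply/eqP/val_inj => /=; have := ltn_ord j; move: jk dk; clear; lia.
rewrite big1 // => j _; rewrite E (_ : (k - j == d)%N = false) ?mulr0 //.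
by apply/negbTE; have := ltn_ord j; move: dk; clear; lia.
Qed.

(** Vanishing on the zero set means divisibility by [f], which already has weight [d]; a coefficient
    of total weight below [d + c] has no room for that factor. *)
Lemma X_zero_low c k g : ent g -> wh c k g -> (k < d + c)%N -> (forall x, f x = 0 -> g x = 0) -> forall x, g x = 0.
move=> eg hg kd gX x; have [|h hh E] := @red0 R n f red g (hol_ent 0 eg); first by exists 1 => // y _; exact: gX.
have := fcomp_wh w0 k x eg hg; rewrite eqxx => <-.
rewrite (fcomp_ext w0 c k x (hol_ent 0 eg) E) fcomp_fM //; case: (leqP d k) => // dk.
by rewrite /fcomp (_ : (c <= k - d)%N = false) ?mulr0 //; apply/negbTE; move: kd dk; clear; lia.
Qed.

Variables (e1 : V) (N : nat) (c1 : C^o) (j1 : 'I_n).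
Hypotheses (hm : mdir f e1 N.+1 c1) (ej1 : coord e1 j1 != 0).

Lemma dd_e1 x : dd e1 f x = \sum_i coord e1 i * df i x. exact: dir_coord. Qed.

(** A multiple of [f] has no component of weight below [d], while the first derivatives of [f] have
    only such components. So [dd e1 f] would be zero, against the leading term of [f] along [e1]. *)
Lemma dd_e1_nz : ~ (forall x, f x = 0 -> dd e1 f x = 0).
move=> gX.
have edd : ent (dd e1 f) by exact: ent_dd.
have [|h hh E] := @red0 R n f red (dd e1 f) (hol_ent 0 edd); first by exists 1 => // y _; exact: gX.
have z0 x : dd e1 f x = 0.
 have [|r r0 hr] := @fcomp_inj R n w 0 (dd e1 f) (hol_ent 0 edd).
  move=> k y; case: (leqP d k) => dk; last by rewrite (fcomp_ext w0 0 k y (hol_ent 0 edd) E) fcomp_fM // leqNgt dk.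
  have hol_i i : hol (fun x => coord e1 i * df i x : C^o) 0 by apply: holM; [exact: hol_cst|apply: hol_ent; exact: ent_df].
  have -> : dd e1 f = fun x => \sum_i coord e1 i * df i x by apply/funext => x'; exact: dd_e1.
  rewrite (fcomp_sum w0) // big1 // => i _; rewrite (fcompZ w0); last by apply: hol_ent; exact: ent_df.
  rewrite /fcomp leq0n subn0; case: (leqP (w i) d) => wd; last first.
   have -> : df i = fun=> 0 by apply/funext => z; exact: (wh_low w0 z (ent_df i) (wh_df i) wd).
   by rewrite (wcomp0 w0 k y ltr01) // mulr0.
  rewrite (wcomp_whom _ _ (wh_whom w0 (ent_df i) (wh_df i) wd)) (_ : (k == d - w i)%N = false) ?mulr0 //.
  by apply/negbTE; have := w0 i; move: dk wd; clear; lia.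
 apply: (@ball_zero R V (dd e1 f) 0 (nm x + 1) r r0 (fun z _ => edd z) _ x); last by rewrite subr0 ltrDl.
 by move=> z; rewrite subr0; exact: hr.
have dk k x : dcoef e1 f k.+1 x = 0.
 elim: k x => [|k IH] x; first by rewrite dcoef1 ?z0 //; exact: hol_ent.
 have := dd_dcoef e1 k.+1 (hol_ent x ef); have -> : dcoef e1 f k.+1 = fun=> 0 by apply/funext.
 by rewrite dir_cst => /esym/eqP; rewrite mulf_eq0 pnatr_eq0 => /eqP.
by have := md_c hm; rewrite -(md_lead hm 0) dk eqxx.
Qed.

(** By [X_identity], a failure near one point of the zero set would propagate to all of it. *)
Lemma NDX p (eps : R) : f p = 0 -> 0 < eps -> exists x, [/\ nm (x - p) < eps, f x = 0 & dd e1 f x != 0].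
move=> fp e0; apply: contrapT => no; apply: dd_e1_nz.
apply: (X_identity w0 ef hf irr hm ej1 (pg_dd e1 pg_f) fp e0) => x fx xe.
by apply/eqP; apply: contraT => h; case: no; exists x.
Qed.

Lemma dd0_const (g : V -> C^o) p (r : R) : (forall x, nm (x - p) < r -> dif g x /\ forall i, de i g x = 0) ->
 forall x, nm (x - p) < r -> g x = g p.
move=> h x xr; apply/eqP; rewrite -subr_eq0 -nm_eq0 eq_le nm_ge0 andbT.
have E1 : p + 1%:C *: (x - p) = x by rewrite scale1r addrC subrK.
have E0 : p + 0%:C *: (x - p) = p by rewrite scale0r addr0.
have := @rder_le R (fun t => g (p + t%:C *: (x - p))) (fun=> 0) 0 0 1 ler01; rewrite mul0r E1 E0; apply=> t t01; last by rewrite nm0.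
have tr : nm (p + t%:C *: (x - p) - p) < r.
 rewrite addrAC subrr add0r nmZ nm_real; apply: le_lt_trans xr.
 by case/andP: t01 => t0 t1; rewrite ger0_norm // ler_piMl // nm_ge0.
have [dg hz] := h _ tr; have := rder_dd dg.
by rewrite dir_coord // big1 // => i _; rewrite hz mulr0.
Qed.

(** * Forms that are proportional to [df] along the zero set *)

Section Form.
Variables (rho : 'I_n -> V -> C^o) (D : nat).
Hypotheses (erho : forall i, ent (rho i)) (wrho : forall i, wh (w i) D (rho i)) (star : forall x i j, d%:R * f x * (de i (rho j) x - de j (rho i) x) =
 D%:R * (df i x * rho j x - df j x * rho i x)) (D0 : (0 < D)%N).

Lemma star_X x i j : f x = 0 -> df i x * rho j x = df j x * rho i x.
move=> fx; have := star x i j; rewrite fx mulr0 mul0r => /esym/eqP.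
by rewrite mulf_eq0 pnatr_eq0 (gtn_eqF D0) /= subr_eq0 => /eqP.
Qed.

Lemma vnice_act t p : t != 0 -> vnice f rho (act t p) -> vnice f rho p.
move=> t0 [b hb [del del0 h]].
exists (fun x => t ^+ d / t ^+ D * b (act t x)).
 apply: holM; first exact: hol_cst.
 by apply: (@hol_comp R V V C^o (act t) b) => //; apply: hol_ent; exact: dif_act.
have [e e0 he] := dif_cont (dif_act w t p) del0.
exists e => // x i /he xe fx; have := h (act t x) i xe (X_act hf t fx).
have tD : t ^+ D != 0 by rewrite expf_neq0.
move=> /(congr1 (fun z => t ^+ w i * z)); rewrite wrho mulrCA (wh_df i t x) => E.
by apply: (mulfI tD); rewrite E; field.
Qed.

(** By [star_X] the form is proportional to [df] on the zero set, so the factor found in the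
    direction [e1] works for each component after multiplication by [dd e1 f], which primality
    cancels. *)
Lemma rho_on_X v : ent v -> (forall x, f x = 0 -> \sum_i coord e1 i * rho i x = v x * dd e1 f x) ->
 forall i x, f x = 0 -> rho i x = v x * df i x.
move=> ev_ hv i.
have dg x : dif (fun x => rho i x - v x * df i x : C^o) x by side.
have edd : ent (dd e1 f) by exact: ent_dd.
case: (prime0 ef irr (hol_ent 0 edd) (hol_ent 0 dg)) => [|h|h].
- exists 1 => // x _ fx; have E : dd e1 f x * (v x * df i x) = \sum_j coord e1 j * rho j x * df i x by rewrite -mulr_suml hv //; ring.
 rewrite mulrBr E dd_e1 mulr_suml -sumrB big1 // => j _.
 by rewrite -[X in X - _]mulrA -[X in _ - X]mulrA [rho j x * _]mulrC -mulrBr (star_X j i fx) subrr mulr0.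
- by case: dd_e1_nz; exact: X_extend_ent h.
move=> x fx; have := X_extend_ent w0 hf dg h fx.
by move/eqP; rewrite subr_eq0 => /eqP.
Qed.

Local Notation rE := (fun x => \sum_i coord e1 i * rho i x : C^o).

Lemma ent_rE : ent rE.
by move=> x; apply: dif_sum => i _; apply: difM; [exact: dif_cst|exact: erho]. Qed.

Lemma pg_rho i : pg (rho i). exact: wh_pg (wrho i). Qed.

Lemma pg_rE : pg rE.
elim: (index_enum _) => [|i s IH].
 by have -> : (fun x : V => \sum_(i <- [::]) coord e1 i * rho i x : C^o) = fun=> 0; [apply/funext => x; rewrite big_nil|exact: pg_cst].
have -> : (fun x : V => \sum_(i <- i :: s) coord e1 i * rho i x : C^o) = fun x => coord e1 i * rho i x + \sum_(i <- s) coord e1 i * rho i x by apply/funext => x; rewrite big_cons.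
by apply: pgD => //; apply: pgM; [exact: pg_cst|exact: pg_rho].
Qed.

Lemma star_E x j : d = D -> f x * (dd e1 (rho j) x - de j rE x) = dd e1 f x * rho j x - df j x * rE x.
move=> dD; rewrite (dir_coord e1 (erho j x)) dir_sum; last by move=> i _; apply: difM; [exact: dif_cst|exact: erho].
rewrite dd_e1 -sumrB !(mulr_suml, mulr_sumr) -sumrB; apply: eq_bigr => i _.
rewrite dirZ; last exact: erho.
have := star x i j; rewrite -dD -mulrA => /(mulfI (_ : d%:R != 0)); rewrite pnatr_eq0 -lt0n => /(_ d0) E.
by rewrite -mulrBr mulrCA E; ring.
Qed.

(** The derivative of [star_E] along [e1], restricted to the zero set. For the quotient [Q] of [rE]
    by [dd e1 f] it says that [dQ] is proportional to [df] at points of the zero set where [dd e1 f]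
    is nonzero. *)
Lemma star_E' x j : d = D -> f x = 0 -> dd e1 f x ^+ 2 * de j rE x - dd e1 f x * rE x * de j (dd e1 f) x =
 df j x * (dd e1 f x * dd e1 rE x - rE x * dd e1 (dd e1 f) x).
move=> dD fx; have edf := ent_dd e1 ef.
have e1r : dif (dd e1 (rho j)) x by side.
have ejr : dif (de j rE) x by apply: ent_dd; exact: ent_rE.
have L : dd e1 (fun x => f x * (dd e1 (rho j) x - de j rE x) : C^o) x = dd e1 (fun x => dd e1 f x * rho j x - df j x * rE x : C^o) x by congr dd; apply/funext => y; exact: star_E.
move: L; rewrite dirM //; last exact: difB.
rewrite [X in _ = X -> _]dirB; [|by side|by apply: difM; [exact: ent_df|exact: ent_rE]].
rewrite dirM; [|exact: edf|exact: erho]; rewrite dirM; [|exact: ent_df|exact: ent_rE].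
rewrite fx mul0r add0r (dir_sym (ev j) e1 (hol_ent x ef)) => E.
have := star_E x j dD; rewrite fx mul0r => /esym/eqP; rewrite subr_eq0 => /eqP E2.
have := congr1 (fun z => dd e1 f x * z) E; rewrite !mulrDr !mulrN => E3.
apply: subr0_eq.
transitivity (dd e1 (dd e1 f) x * (df j x * rE x - dd e1 f x * rho j x)); last by rewrite E2 subrr mulr0.
apply: subr0_eq; move: E3 => /eqP; rewrite -subr_eq0 => /eqP E3.
by rewrite -[RHS]oppr0 -[in RHS]E3; ring.
Qed.

(** For [d = D] the relation [star] says that [rho / f] is closed, and [Q] is its residue. On a
    holomorphic graph inside the zero set the tangential derivatives of [Q] vanish by [star_E'], and
    [X_identity] extends the resulting equation to the whole zero set. *)
Lemma residue_const : d = D -> exists lam : C^o, forall x, f x = 0 -> rE x = lam * dd e1 f x.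
move=> dD; have edf : ent (dd e1 f) := ent_dd e1 ef.
have [p [_ fp gp]] := @NDX 0 1 (f_0 w0 d0 hf) ltr01.
have [eps eps0 hg] := hol_neq0 (edf p) gp.
have [x1 [r1 [d1 [psi [r10 d10 dpsi hpsi hu]]]]] := X_graph ef hm fp eps0.
have [s sE] : {s : V -> V | forall x, s x = x + psi x *' e1} by exists (fun x => x + psi x *' e1).
have [Q QE] : {Q : V -> C^o | forall y, Q y = rE y * (dd e1 f y)^-1} by exists (fun y => rE y * (dd e1 f y)^-1).
have fs x : nm (x - x1) < r1 -> f (s x) = 0 /\ dd e1 f (s x) != 0 by move=> xr; rewrite sE; have [? ?] := hpsi x xr; split=> //; exact: hg.
have dQ x : dd e1 f x != 0 -> dif Q x.
 move=> gx; apply: (dif_eq (fun y => esym (QE y))).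
 by apply: difM; [exact: ent_rE|apply: difV => //; exact: edf].
have Qd v x : dd e1 f x != 0 -> dd e1 f x ^+ 2 * dd v Q x = dd e1 f x * dd v rE x - rE x * dd v (dd e1 f) x.
 move=> gx; have [e e0 he] := hol_neq0 (edf x) gx.
 have := @dir_ext R V (fun y => Q y * dd e1 f y) rE x v e e0.
 rewrite dirM; [|exact: dQ|exact: edf]; move=> <-; last 2 first.
 - by move=> y ye; rewrite QE -mulrA mulVf ?mulr1 //; exact: he.
 - by side.
 have -> : rE x = Q x * dd e1 f x by rewrite QE -mulrA mulVf ?mulr1.
 by ring.
have ds x : nm (x - x1) < r1 -> dif s x by move=> xr; apply: (dif_eq (fun y => esym (sE y))); apply: difD; [exact: dif_id|apply/difZl/dpsi].
have chain (g : V -> C^o) x j : nm (x - x1) < r1 -> dif g (s x) ->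
  de j (fun x => g (s x)) x = de j g (s x) + de j psi x * dd e1 g (s x).
 move=> xr gs; rewrite dd_comp //; last exact: ds.
 rewrite (dir_coord e1 gs) (dir_coord (ev j) gs) mulr_sumr -big_split; apply: eq_bigr => i _ /=.
 have -> : (fun x => coord (s x) i : C^o) = fun x => coord x i + coord e1 i * psi x by apply/funext => y; rewrite sE coordD coordZ [coord e1 i * _]mulrC.
 rewrite dirD; [|exact: dif_coord|by side].
 by rewrite dirZ ?dd_coord; [rewrite coord_ev; ring|exact: dpsi].
have cst : forall x, nm (x - x1) < r1 -> Q (s x) = Q (s x1).
 apply: dd0_const => x xr; have [fx gx] := fs x xr; split.
  by apply: dif_comp; [exact: ds|exact: dQ].
 move=> j; rewrite chain //; last exact: dQ.
 have z0 : df j (s x) + de j psi x * dd e1 f (s x) = 0.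
  rewrite -(chain f x j xr) //; have [e e0 he] := sub_ball xr.
  rewrite -(@dir_ext R V (fun=> 0) _ x (ev j) e e0); [exact: dir_cst| |exact: dif_cst].
  by move=> y ye; case: (fs y (he y ye)) => ->.
 have := star_E' j dD fx; have := Qd (ev j) _ gx; have := Qd e1 _ gx.
 set g := dd e1 f (s x) in gx z0 *; set a := dd e1 Q _; set b := de j Q _; set u := de j psi x in z0 *.
 move=> E1 E2 E3; have E4 : g ^+ 3 * b = df j (s x) * (g ^+ 2 * a) by rewrite E1 -E3 exprSr -mulrA [g * b]mulrC mulrA E2; ring.
 have uE : df j (s x) = - (u * g) by apply/eqP; rewrite -addr_eq0 z0.
 have g3 : g ^+ 3 != 0 by rewrite expf_neq0.
 by apply: (mulfI g3); rewrite mulr0 mulrDr E4 uE; ring.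
have x1r := nm_self x1 r10.
have pl : pg (fun x => rE x - Q (s x1) * dd e1 f x) by apply: pgD; [exact: pg_rE|have := pgM (pg_cst n (- Q (s x1))) (pg_dd e1 pg_f); congr pg; apply/funext => x; rewrite mulNr].
have [e e0 he] := dif_cont (dpsi x1 x1r) d10.
have m0 : 0 < minr e r1 by side.
have zero := X_identity w0 ef hf irr hm ej1 pl (fs x1 x1r).1 m0.
exists (Q (s x1)) => x fx; apply: subr0_eq; apply: zero => // y fy.
have yE : y - s x1 = (y - psi x1 *' e1) - x1 by rewrite sE opprD [- x1 + _]addrC addrA.
rewrite yE lt_min => /andP [ye yr]; have [_ gy] := fs _ yr.
have ys : y = s (y - psi x1 *' e1).
 rewrite sE; set x' := y - _; have y' : y = x' + (psi x' + (psi x1 - psi x')) *' e1 by rewrite [psi x' + _]addrC subrK /x' subrK.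
 have v0 : psi x1 - psi x' = 0 by apply: (hu x' _ yr); [rewrite nmC; exact: he|rewrite -y'].
 by rewrite {1}y' v0 addr0.
move: gy; rewrite -ys => gy; have := cst _ yr; rewrite -ys => <-.
by rewrite QE -mulrA mulVf // mulr1 subrr.
Qed.

(** [rho - lam * df] vanishes on the zero set but has weight only [d], hence is zero by
    [X_zero_low]. Contracting [rho = lam * df] with the Euler field gives [lam * d * f = 0]. *)
Lemma residue_zero : d = D -> (forall x, \sum_i (w i)%:R * coord x i * rho i x = 0) -> forall i x, rho i x = 0.
move=> dD iR; have [lam hl] := residue_const dD.
have H := rho_on_X (fun x => dif_cst lam x) hl.
have E i x : rho i x = lam * df i x.
 apply: subr0_eq; move: x; apply: (@X_zero_low (w i) D).
 - by move=> x; apply: difB; [exact: erho|apply: difM; [exact: dif_cst|exact: ent_df]].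
 - have -> : (fun x => rho i x - lam * df i x) = fun x => rho i x + (- lam) * df i x by apply/funext => x; rewrite mulNr.
  by apply: whD => //; apply: whZ; rewrite -dD; exact: wh_df.
 - by rewrite dD -[X in (X < _)%N]addn0 ltn_add2l.
 by move=> x fx; rewrite H // subrr.
have lf x : lam * (d%:R * f x) = 0 by rewrite -(euler x ef hf) mulr_sumr -[RHS](iR x); apply: eq_bigr => i _; rewrite E; ring.
have [y fy] := fn0; move: (lf y) => /eqP; rewrite !mulf_eq0 (negbTE fy) pnatr_eq0 (gtn_eqF d0) !orbF => /eqP l0.
by move=> i x; rewrite E l0 mul0r.
Qed.

Hypotheses (n3 : (3 <= n)%N) (nc : nc_off_codim3 f).
Lemma vnice_nice p : vnice f rho p -> nice f rE (dd e1 f) p.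
move=> [b hb [del del0 h]]; exists b => //; exists del => // y yp fy.
by rewrite dd_e1 mulr_sumr; apply: eq_bigr => i _; rewrite (h y i yp fy) mulrCA.
Qed.

(** [h] is the norm of [dd e1 f]. If [h] is constant, its zero set is empty and there is nothing to
    check over it; otherwise a generic fibre avoids [Y] after rescaling by [act t], and [vnice_act]
    undoes the rescaling. *)
Lemma form_on_X : d != D -> exists2 v, pg v & forall i x, f x = 0 -> rho i x = v x * df i x.
move=> dD; have [h [B [ph pB hinv [x1 hx1] hB]]] := norm_pg w0 ef hf irr hm ej1 (pg_dd e1 pg_f) dd_e1_nz.
have [e2 [N2 [c2 [c20 p2 l2]]]] := monic_dir ph hx1.
have hm2 : mdir h e2 N2 c2 by [].
have [x0 [r0 [r00 hn]]] : exists x0 (r0 : R), 0 < r0 /\ forall x (u z : C), nm (x - x0) < r0 -> h (x + u *: e2) = 0 ->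
  f (x + u *: e2 + z *: e1) = 0 -> nice f rE (dd e1 f) (x + u *: e2 + z *: e1).
 case: N2 p2 l2 hm2 => [|N2] p2 l2 hm2.
  exists 0, 1; split=> // x u z _ /eqP.
  by rewrite -(dcoef0 e2 (hol_ent _ (pg_ent ph))) l2 (negbTE c20).
 have [Y [Yan [YX [Ydim /nearP [eps eps0 hY]]]]] := nc.
 have [x0 [r0 [t [r00 t0 ht]]]] := generic_fibre w0 ef hf irr hm hinv hm2 Yan YX Ydim n3 eps0.
 exists x0, r0; split=> // x u z xr hx fx; apply: vnice_nice; apply: (vnice_act t0).
 have [te tY] := ht x u z xr hx fx; have ft := X_act hf t fx.
 apply: (vnice_nc ef erho D0 dD star NDX fn0 ft).
 by apply: hY => //; rewrite subr0.
have [v pv hv] := core hm w0 hf irr r00 pg_rE ph pB hB hinv hm2 hn.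
by exists v => // i x; exact: (rho_on_X (pg_ent pv) hv).
Qed.

(** Reducedness gives [rho = v df + f q] as germs. Only the parts of weight [D] count; [v] and [q]
    enter them with weight [D - d], and nothing is left when [D < d]. *)
Lemma form_decomp (v : V -> C^o) : ent v -> (forall i x, f x = 0 -> rho i x = v x * df i x) ->
 exists b (q : 'I_n -> V -> C^o), [/\ ent b, wh 0 (D - d) b, forall i, ent (q i), forall i, wh (w i) (D - d) (q i) &
  forall i x, rho i x = if (d <= D)%N then b x * df i x + f x * q i x else 0].
move=> hv H.
have hg i : hol (fun x => rho i x - v x * df i x : C^o) 0 by apply: hol_ent => x; apply: difB; [exact: erho|apply: difM; [exact: hv|exact: ent_df]].
have/choice [q hq] : forall i, exists q : V -> C^o, hol q 0 /\ near0 (fun x => rho i x - v x * df i x = f x * q x).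
 move=> i; have [|q q1 q2] := @red0 R n f red _ (hg i); last by exists q.
 by exists 1 => // x _ fx; rewrite H // subrr.
have h0 := hol_ent 0 hv; have hq1 i := (hq i).1.
exists (fcomp 0 v (D - d)), (fun i => fcomp (w i) (q i) (D - d)); split.
- exact: ent_fcomp.
- exact: wh_fcomp.
- by move=> i; exact: ent_fcomp.
- by move=> i; exact: wh_fcomp.
move=> i x; have hvd : hol (fun x => v x * df i x : C^o) 0 by apply: hol_ent => y; apply: difM; [exact: hv|exact: ent_df].
have := fcomp_wh w0 D x (erho i) (wrho i); rewrite eqxx => E; rewrite -[LHS]E.
have := fcomp_ext w0 (w i) D x (hg i) (hq i).2; rewrite fcompB //; last by apply: hol_ent; exact: erho.
move/eqP; rewrite subr_eq => /eqP ->; rewrite fcomp_fM // fcomp_vdf //.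
by case: ifP => _; rewrite ?addr0 // addrC.
Qed.

End Form.
Hypotheses (n3 : (3 <= n)%N) (nc : nc_off_codim3 f).

(** Induction on the weight. The decomposition [rho = b df + f q] leads to the form [q + k db],
    which satisfies the same hypotheses in weight [D - d]; its potential [b1] gives the potential
    [- k b + f b1]. For [D = 0], [D = d] and [D < d] the form itself is zero. *)
Lemma form_potential D (rho : 'I_n -> V -> C^o) : (forall i, ent (rho i)) -> (forall i, wh (w i) D (rho i)) ->
 (forall x i j, d%:R * f x * (de i (rho j) x - de j (rho i) x) = D%:R * (df i x * rho j x - df j x * rho i x)) ->
 (forall x, \sum_i (w i)%:R * coord x i * rho i x = 0) ->
 exists b, [/\ ent b, wh d D b & forall i x, d%:R * rho i x = (d%:R - D%:R) * b x * df i x + d%:R * f x * de i b x].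
elim/ltn_ind: D rho => D IH rho erho wrho star iR.
have zero : (forall i x, rho i x = 0) -> exists b, [/\ ent b, wh d D b &
  forall i x, d%:R * rho i x = (d%:R - D%:R) * b x * df i x + d%:R * f x * de i b x].
 move=> h; exists (fun=> 0); split=> [x|t x|i x]; [exact: dif_cst|by rewrite !mulr0|].
 by rewrite h dir_cst !(mulr0, mul0r) addr0.
case: (posnP D) => [D0|D0].
 by apply: zero => i x; apply: (wh_low w0 x (erho i) (wrho i)); rewrite D0.
case: (eqVneq d D) => [dD|dD].
 by apply: zero; exact: (residue_zero erho wrho star D0 dD iR).
have [v pv hv] := form_on_X erho wrho star D0 n3 nc dD.
have [b [q [eb wb eq wq E]]] := form_decomp erho wrho (pg_ent pv) hv.
case: (leqP d D) E => [le|lt] E; last by apply: zero.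
have lt : (d < D)%N by rewrite ltn_neqAle dD.
have D'0 : (0 < D - d)%N by rewrite subn_gt0.
have ltD : (D - d < D)%N by rewrite -subn_gt0 subKn.
have DE : D%:R = d%:R + (D - d)%:R :> C by rewrite -natrD subnKC.
move: (D - d)%N D'0 ltD DE wb wq => D' D'0 ltD DE wb wq.
have Dn : D'%:R != 0 :> C by rewrite pnatr_eq0 -lt0n.
(* Contraction with the Euler field forces this factor: [rho] contracts to 0, so [q] contracts to
   [- d b], while [db] contracts to [D' b]. *)
pose k : C := d%:R / D'%:R.
have kD : k * D'%:R = d%:R by rewrite divfK.
have edb i : ent (de i b) by exact: ent_dd.
pose r1 i x : C^o := q i x + k * de i b x.
have er1 i : ent (r1 i) by move=> x; apply: difD; [exact: eq|apply: difM; [exact: dif_cst|exact: edb]].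
have dr i j x : de i (rho j) x = b x * de i (df j) x + df j x * de i b x + (f x * de i (q j) x + q j x * df i x).
 have -> : rho j = fun x => b x * df j x + f x * q j x by apply/funext => y; exact: E.
 rewrite dirD; [|by side|by side].
 by rewrite dirM; [|exact: eb|exact: ent_df]; rewrite dirM; [|exact: ef|exact: eq].
have star1 x i j : d%:R * f x * (de i (q j) x - de j (q i) x) = D'%:R * (df i x * r1 j x - df j x * r1 i x).
 move: x; suff z0 x : d%:R * f x * (de i (q j) x - de j (q i) x) - D'%:R * (df i x * r1 j x - df j x * r1 i x) = 0.
  by move=> x; apply: subr0_eq.
 move: x; apply: ent_cancel => [x|x].
  apply: difB; apply: difM.
  - by side.
  - by side.
  - exact: dif_cst.
  - by apply: difB; apply: difM; [exact: ent_df|exact: er1|exact: ent_df|exact: er1].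
 have := star x i j; rewrite !dr (dir_sym (ev j) (ev i) (hol_ent x ef)) !E DE => /eqP; rewrite -subr_eq0 => /eqP S.
 by rewrite -[RHS]S /r1 -kD; ring.
have iR1 x : \sum_i (w i)%:R * coord x i * r1 i x = 0.
 have := euler_wh w0 x eb wb; rewrite subr0 => E1.
 have S : forall x, b x * d%:R + \sum_i (w i)%:R * coord x i * q i x = 0.
  apply: ent_cancel => [y|y].
   apply: difD; first by side.
   by apply: dif_sum => i _; apply: difM; [apply: difM; [exact: dif_cst|exact: dif_coord]|exact: eq].
  transitivity (b y * (d%:R * f y) + f y * \sum_i (w i)%:R * coord y i * q i y); first by ring.
  rewrite -[RHS](iR y) -(euler y ef hf) !mulr_sumr -big_split; apply: eq_bigr => i _ /=.
  by rewrite E; ring.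
 rewrite -[RHS](S x) -kD [b x * _]mulrC -mulrA -E1 mulr_sumr addrC -big_split; apply: eq_bigr => i _ /=.
 by rewrite /r1; ring.
have [||//|b1 [eb1 wb1 E1]] := IH D' ltD r1 er1.
- by move=> i; apply: whD => //; apply: whZ; rewrite -[w i]addn0; exact: wh_pdc.
- move=> x i j; rewrite -star1 /r1; congr (_ * _).
 rewrite !dirD; try by [exact: eq|apply: difM; [exact: dif_cst|exact: edb]].
 by rewrite !dirZ; try exact: edb; rewrite (dir_sym (ev j) (ev i) (hol_ent x eb)); ring.
have DN : D = (d + D')%N by apply/eqP; rewrite -(eqr_nat C) natrD DE.
exists (fun x => - k * b x + f x * b1 x); split.
- by move=> x; apply: difD; [apply: difM; [exact: dif_cst|exact: eb]|apply: difM; [exact: ef|exact: eb1]].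
- rewrite DN; apply: whD; last by rewrite -{1}[d]add0n; apply: whM => //; exact: wh_f.
 by apply: whZ => t x; have := wb t x; rewrite expr0 mul1r exprD -mulrA => ->.
move=> i x; rewrite dirD; [|by apply: difM; [exact: dif_cst|exact: eb]|by side].
rewrite dirZ; last exact: eb.
rewrite dirM; [|exact: ef|exact: eb1].
have := E1 i x; rewrite /r1 mulrDr => /eqP; rewrite -subr_eq0 -addrA addrC addr_eq0 => /eqP E3.
by rewrite E mulrDr [d%:R * (f x * _)]mulrCA -[d%:R * q i x]opprK -E3 DE -kD; ring.
Qed.

(** By Cartan's formula [rho = D tau - dS] is the contraction of [d tau] with the Euler field.
    Contracting [df /\ d tau = 0] gives [d f d tau = df /\ rho], and since [d rho = D d tau] this is
    the hypothesis of [form_potential]; its potential divided by [d] is [th]. *)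
Lemma relative_closed D (tau : 'I_n -> V -> C^o) : (forall i, ent (tau i)) -> (forall i, wh (w i) D (tau i)) ->
 (forall x i j k, df i x * (de j (tau k) x - de k (tau j) x) + df j x * (de k (tau i) x - de i (tau k) x)
  + df k x * (de i (tau j) x - de j (tau i) x) = 0) ->
 exists th, [/\ ent th, wh d D th & forall i j x, de i (tau j) x + de i th x * df j x =
  de j (tau i) x + de j th x * df i x].
move=> et wt clo; case: (posnP D) => [D0|D0].
 have z i : tau i = fun=> 0 by apply/funext => x; apply: (wh_low w0 x (et i) (wt i)); rewrite D0.
 exists (fun=> 0); split=> [x|t x|i j x]; [exact: dif_cst|by rewrite !mulr0|].
 by rewrite !z !dir_cst !mul0r.
have dn : d%:R != 0 :> C by rewrite pnatr_eq0 -lt0n.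
have Dn : D%:R != 0 :> C by rewrite pnatr_eq0 -lt0n.
pose S x : C^o := \sum_i (w i)%:R * coord x i * tau i x.
have dS i x : dif (fun x => (w i)%:R * coord x i * tau i x : C^o) x by apply: difM; [apply: difM; [exact: dif_cst|exact: dif_coord]|exact: et].
have eS : ent S by move=> x; apply: dif_sum.
have wS : wh 0 D S.
 move=> t x; rewrite expr0 mul1r mulr_sumr; apply: eq_bigr => i _; rewrite coord_act.
 rewrite -!mulrA [t ^+ w i * _]mulrCA wt; ring.
pose rho j x : C^o := D%:R * tau j x - de j S x.
have er j : ent (rho j) by move=> x; apply: difB; [apply: difM; [exact: dif_cst|exact: et]|exact: ent_dd].
have wr j : wh (w j) D (rho j).
 have -> : rho j = fun x => D%:R * tau j x + (-1) * de j S x by apply/funext => x; rewrite mulN1r.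
 by apply: whD; apply: whZ => //; rewrite -[w j]addn0; exact: wh_pdc.
have rE j x : rho j x = \sum_k (w k)%:R * coord x k * (de k (tau j) x - de j (tau k) x).
 have -> : \sum_k (w k)%:R * coord x k * (de k (tau j) x - de j (tau k) x) =
   \sum_k (w k)%:R * coord x k * de k (tau j) x - \sum_k (w k)%:R * coord x k * de j (tau k) x.
  by rewrite -sumrB; apply: eq_bigr => k _; rewrite mulrBr.
 rewrite (euler_wh w0 x (et j) (wt j)) /rho /S dir_sum; last by move=> i _; exact: dS.
 rewrite mulrBl -addrA; congr (_ + _); rewrite -opprD; congr (- _).
 have -> : (w j)%:R * tau j x = \sum_k (if k == j then (w k)%:R * tau k x else 0 : C) by rewrite -big_mkcond big_pred1_eq.
 rewrite -big_split; apply: eq_bigr => k _ /=; rewrite dirM; [|by side|exact: et].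
 rewrite dirZ; last exact: dif_coord.
 by rewrite dd_coord; case: eqP => _ /=; ring.
have dr i j x : de i (rho j) x - de j (rho i) x = D%:R * (de i (tau j) x - de j (tau i) x).
 rewrite !dirB; try by [exact: ent_dd|apply: difM; [exact: dif_cst|exact: et]].
 by rewrite !dirZ; try exact: et; rewrite (dir_sym (ev j) (ev i) (hol_ent x eS)); ring.
have [||b [eb wb hb]] := @form_potential D rho er wr.
- move=> x i j; rewrite dr [in LHS]mulrCA; congr (_ * _); rewrite !rE -(euler x ef hf) mulr_suml !mulr_sumr -sumrB.
 apply: eq_bigr => k _; apply: subr0_eq.
 by rewrite -[RHS](mulr0 ((w k)%:R * coord x k)) -(clo x i j k); ring.
- move=> x; have E := euler_wh w0 x eS wS; rewrite mulr0n subr0 in E.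
 rewrite -[RHS](subrr (D%:R * S x)) -{2}E {1}/S mulr_sumr -sumrB.
 by apply: eq_bigr => i _; rewrite /rho; ring.
exists (fun x => d%:R^-1 * b x); split.
- by move=> x; apply: difM; [exact: dif_cst|exact: eb].
- exact: whZ.
move=> i j x; rewrite !dirZ; try exact: eb.
have hd j' i' : d%:R * de i' (rho j') x = (d%:R - D%:R) * (b x * de i' (df j') x + df j' x * de i' b x)
  + d%:R * (f x * de i' (de j' b) x + de j' b x * df i' x).
 rewrite -dirZ; last exact: er.
 have -> : (fun x => d%:R * rho j' x : C^o) = fun x => (d%:R - D%:R) * (b x * df j' x) + d%:R * (f x * de j' b x) by apply/funext => y; rewrite hb !mulrA.
 have d1 : dif (fun x => b x * df j' x : C^o) x by side.
 have d2 : dif (fun x => f x * de j' b x : C^o) x by side.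
 rewrite dirD; [|by side|by side].
 by rewrite !dirZ // dirM; [|exact: eb|exact: ent_df]; rewrite dirM; [|exact: ef|exact: ent_dd].
have := hd j i; have := hd i j; rewrite (dir_sym (ev j) (ev i) (hol_ent x ef)) (dir_sym (ev j) (ev i) (hol_ent x eb)) => E1 E2.
have E3 := congr1 (fun z => d%:R * z) (dr i j x); rewrite mulrBr E1 E2 in E3.
apply: subr0_eq.
have dDn : d%:R * D%:R != 0 :> C by rewrite mulf_neq0.
apply: (mulfI dDn); rewrite mulr0.
transitivity (d%:R * (D%:R * (de i (tau j) x - de j (tau i) x)) + D%:R * (de i b x * df j x - de j b x * df i x)).
 by field.
by rewrite -E3; ring.
Qed.

End Division.

(** Course-of-values recursion with a choice at each step. [Q] sees the sequence only below [k], so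
    the finite prefixes [h k] fit together. *)
Lemma strong_rec (T : Type) (x0 : T) (Q : (nat -> T) -> nat -> T -> Prop) :
 (forall e e' k x, (forall i, (i < k)%N -> e i = e' i) -> Q e k x -> Q e' k x) ->
 (forall e k, (forall i, (i < k)%N -> Q e i (e i)) -> exists x, Q e k x) -> exists e, forall k, Q e k (e k).
move=> ext step.
have/choice [G hG] : forall ek : (nat -> T) * nat, exists x, (forall i, (i < ek.2)%N -> Q ek.1 i (ek.1 i)) -> Q ek.1 ek.2 x.
 move=> [e k] /=; have [h|h] := pselect (forall i, (i < k)%N -> Q e i (e i)); last by exists x0.
 by have [x hx] := step e k h; exists x.
pose h := fix h k : nat -> T := if k is k'.+1 then fun i => if i == k' then G (h k', k') else h k' i else fun=> x0.
pose e k := h k.+1 k; have he k i : (i < k)%N -> h k i = e i.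
 elim: k => // k IH; rewrite ltnS leq_eqVlt => /orP [/eqP ->//|ik] /=.
 by rewrite (ltn_eqF ik); exact: IH.
exists e; elim/ltn_ind => k IH; rewrite /e /= eqxx.
apply: (ext (h k) e); first exact: he.
by apply: (hG (h k, k)) => i ik /=; rewrite he //; apply: (ext e (h k)) (IH i ik) => j ji; rewrite he // (ltn_trans ji).
Qed.

(** * Formal power series and their derivations *)

Section Fps.
Variable R : realType.
Local Notation C := R[i].
(** Coefficient sequences with a commutative ring structure of their own, so that identities between
    series are proved by [ring]. *)
Definition fps := nat -> C.
HB.instance Definition _ := gen_eqMixin fps.
HB.instance Definition _ := gen_choiceMixin fps.
Implicit Types a b c : fps.
Definition fps0 : fps := fun=> 0.
Definition fpsN a : fps := fun k => - a k.
Definition fpsD a b : fps := fun k => a k + b k.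
Lemma fpsDA : associative fpsD. by move=> a b c; apply/funext => k; exact: addrA. Qed.
Lemma fpsDC : commutative fpsD. by move=> a b; apply/funext => k; exact: addrC. Qed.
Lemma fps0D : left_id fps0 fpsD. by move=> a; apply/funext => k; exact: add0r. Qed.
Lemma fpsND : left_inverse fps0 fpsN fpsD. by move=> a; apply/funext => k; exact: addNr. Qed.
HB.instance Definition _ := GRing.isZmodule.Build fps fpsDA fpsDC fps0D fpsND.
Definition fpsc (x : C) : fps := fun k => if k == 0%N then x else 0.
Definition fpsM a b : fps := fun k => \sum_(i < k.+1) a i * b (k - i)%N.
Local Notation tr K a := (\poly_(i < K) (a : fps) i).
Lemma fpsM_poly a b K k : (k < K)%N -> fpsM a b k = (tr K a * tr K b)`_k.
move=> kK; rewrite coefM; apply: eq_bigr => i _; have ik : (i <= k)%N by rewrite -ltnS.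
by rewrite !coef_poly (leq_ltn_trans ik kK) (leq_ltn_trans (leq_subr _ _) kK).
Qed.
Lemma fpsMC : commutative fpsM.
by move=> a b; apply/funext => k; rewrite !(fpsM_poly _ _ (ltnSn k)) mulrC. Qed.
Lemma fpsMA : associative fpsM.
move=> a b c; apply/funext => k.
transitivity ((tr k.+1 a * (tr k.+1 b * tr k.+1 c))`_k); last first.
 rewrite mulrA coefM; apply: eq_bigr => i _; rewrite -fpsM_poly // coef_poly.
 by rewrite ltnS leq_subr.
rewrite coefM; apply: eq_bigr => i _; rewrite -fpsM_poly ?ltnS ?leq_subr // coef_poly.
by rewrite ltn_ord.
Qed.
Lemma fpscM x a k : fpsM (fpsc x) a k = x * a k.
by rewrite /fpsM big_ord_recl /= subn0 big1 ?addr0 // => i _; rewrite mul0r. Qed.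
Lemma fps1M : left_id (fpsc 1) fpsM. by move=> a; apply/funext => k; rewrite fpscM mul1r. Qed.
Lemma fpsMD : left_distributive fpsM +%R.
by move=> a b c; apply/funext => k; rewrite -[RHS]big_split; apply: eq_bigr => i _; exact: mulrDl. Qed.
Lemma fps1_neq0 : fpsc 1 != 0.
by apply/eqP => /(congr1 (fun a => a 0%N))/eqP; rewrite oner_eq0. Qed.
HB.instance Definition _ := GRing.Zmodule_isComNzRing.Build fps fpsMA fpsMC fps1M fpsMD fps1_neq0.

Lemma fDE a b k : (a + b) k = a k + b k. by []. Qed.
Lemma fME a b k : (a * b) k = \sum_(i < k.+1) a i * b (k - i)%N. by []. Qed.
Lemma fcM x a k : (fpsc x * a) k = x * a k. exact: fpscM. Qed.
Lemma fpscMM x y : fpsc (x * y) = fpsc x * fpsc y.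
by apply/funext => k; rewrite fcM /fpsc; case: eqP => _; rewrite ?mulr0. Qed.
Lemma fpscX x k : fpsc (x ^+ k) = fpsc x ^+ k.
by elim: k => // k IH; rewrite !exprS fpscMM IH. Qed.
Lemma fpsc_nat k : fpsc k%:R = k%:R.
by elim: k => [|k IH]; [apply/funext => -[]|rewrite !mulrS -IH; apply/funext => -[|i] //; rewrite fDE /= addr0]. Qed.

Lemma fX_low a k i : a 0%N = 0 -> (i < k)%N -> (a ^+ k) i = 0.
move=> a0; elim: k i => // k IH i; rewrite ltnS => ik; rewrite exprS fME big_ord_recl a0 mul0r add0r big1 // => j _.
rewrite IH ?mulr0 // lift0; have := ltn_ord j; move: ik; clear; lia.
Qed.

Lemma fX_diag a k : a 0%N = 0 -> (a ^+ k) k = a 1%N ^+ k.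
move=> a0; elim: k => // k IH; rewrite exprS fME big_ord_recl a0 mul0r add0r big_ord_recl /= subn1 IH exprS big1 ?addr0 // => j _.
by rewrite fX_low ?mulr0 //= /bump; have := ltn_ord j; clear; lia.
Qed.

(** The Euler operator [T d/dT]. When the index of a coefficient is its weight, it is the derivative
    along the Euler field. *)
Definition fth a : fps := fun k => k%:R * a k.
Lemma fthM a b : fth (a * b) = fth a * b + a * fth b.
apply/funext => k; rewrite fDE {1}/fth !fME mulr_sumr -big_split; apply: eq_bigr => i _ /=.
by rewrite /fth -{1}(subnKC (_ : i <= k)%N) ?natrD -1?ltnS //; ring.
Qed.
Lemma fthX a k : fth (a ^+ k) = k%:R * a ^+ k.-1 * fth a.
elim: k => [|k IH]; first by rewrite !mul0r expr0; apply/funext => -[|i]; rewrite /fth ?mul0r // mulr0.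
by rewrite exprS fthM IH; case: k {IH} => [|k]; rewrite ?mul0r ?mulr0 ?addr0 ?mul1r ?expr0 ?mulr1 //= exprS mulrS; ring.
Qed.

Variable W : normedModType C.
Implicit Types A B : W -> fps.
Definition difS A x := forall k, dif (fun x => A x k : C^o) x.
Definition ddS v A x : fps := fun k => dd v (fun x => A x k : C^o) x.
Lemma difS_M A B x : difS A x -> difS B x -> difS (fun x => A x * B x) x.
by move=> a b k; apply: dif_sum => i _; apply: difM. Qed.
Lemma difS_X A n x : difS A x -> difS (fun x => A x ^+ n) x.
move=> a; elim: n => [|n IH]; first by move=> k; exact: dif_cst.
by have -> : (fun x => A x ^+ n.+1) = fun x => A x * A x ^+ n; [apply/funext => y; rewrite exprS|exact: difS_M].
Qed.
Lemma ddS_M v A B x : difS A x -> difS B x -> ddS v (fun x => A x * B x) x = ddS v A x * B x + A x * ddS v B x.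
move=> a b; apply/funext => k; rewrite fDE !fME -big_split /ddS /= dir_sum; last by move=> i _; exact: difM.
by apply: eq_bigr => i _; rewrite dirM // addrC [B x _ * _]mulrC.
Qed.
Lemma ddS_X v A n x : difS A x -> ddS v (fun x => A x ^+ n) x = n%:R * A x ^+ n.-1 * ddS v A x.
move=> a; elim: n => [|n IH]; first by rewrite !mul0r; apply/funext => k; rewrite /ddS dir_cst.
have -> : (fun x => A x ^+ n.+1) = fun x => A x * A x ^+ n by apply/funext => y; rewrite exprS.
rewrite ddS_M //; last exact: difS_X.
by rewrite IH; case: n {IH} => [|n]; rewrite ?mul0r ?mulr0 ?addr0 ?mul1r ?expr0 ?mulr1 //= exprS mulrS; ring.
Qed.
Lemma difS_c (g : W -> C^o) x : dif g x -> difS (fun x => fpsc (g x)) x.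
by move=> h [|k] /=; [exact: h|exact: dif_cst]. Qed.
Lemma ddS_c v (g : W -> C^o) x : ddS v (fun x => fpsc (g x)) x = fpsc (dd v g x).
by apply/funext => -[|k] //=; rewrite /ddS dir_cst. Qed.

(** The infinite sum of the [e k * tau k]. Stopping at [k = m] in degree [m] is right when [tau k]
    has order at least [k], as it has in all uses. *)
Definition fsup (e : fps) (tau : nat -> fps) : fps := fun m => \sum_(k < m.+1) e k * tau k m.
Lemma fsupE e (tau : nat -> fps) m i : (forall k i, (i < k)%N -> tau k i = 0) -> (i <= m)%N -> fsup e tau i = \sum_(k < m.+1) e k * tau k i.
move=> t0 im; rewrite /fsup -!(big_mkord xpredT (fun k => e k * tau k i)) [RHS](big_cat_nat _ (n := i.+1)) //=.
by rewrite [X in _ + X]big_nat_cond [X in _ + X]big1 ?addr0 // => k /andP [/andP [ik _] _]; rewrite t0 ?mulr0.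
Qed.
Lemma fsup_mul e (tau : nat -> fps) b m : (forall k i, (i < k)%N -> tau k i = 0) -> (b * fsup e tau) m = \sum_(k < m.+1) e k * (b * tau k) m.
move=> t0; under eq_bigr do rewrite fME mulr_sumr; rewrite fME exchange_big; apply: eq_bigr => i _ /=.
rewrite (fsupE e t0 (leq_subr i m)) mulr_sumr; apply: eq_bigr => k _; ring.
Qed.

End Fps.

(** * The formal potential, weight by weight *)

Section Formal.
Variables (R : realType) (n : nat).
Local Notation C := R[i].
Local Notation V := (Cn R n).
Local Notation ev := (ev R).
Variables (w : 'I_n -> nat) (d : nat) (f : V -> C^o).
Hypotheses (w0 : forall i, (0 < w i)%N) (d0 : (0 < d)%N) (ef : ent f) (hf : whom w d f) (fn0 : exists x, f x != 0).
Local Notation act := (act w).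
Local Notation wh := (@wh R n w).
Local Notation fcomp := (@fcomp R n w).
Local Notation df i := (de i f).
Hypothesis RC : forall D (tau : 'I_n -> V -> C^o), (forall i, ent (tau i)) -> (forall i, wh (w i) D (tau i)) ->
 (forall x i j k, df i x * (de j (tau k) x - de k (tau j) x) + df j x * (de k (tau i) x - de i (tau k) x)
  + df k x * (de i (tau j) x - de j (tau i) x) = 0) ->
 exists th, [/\ ent th, wh d D th & forall i j x, de i (tau j) x + de i th x * df j x =
  de j (tau i) x + de j th x * df i x].
Variable eta : 'I_n -> V -> C^o.
Hypothesis heta : forall i, hol (eta i) 0.
Local Notation om i := (fun x => df i x + f x * eta i x).
Local Notation et K j := (fcomp (w j) (eta j) K).
Hypothesis integ : forall i j k, near0 (fun x => om i x * (de j (om k) x - de k (om j) x)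
 + om j x * (de k (om i) x - de i (om k) x) + om k x * (de i (om j) x - de j (om i) x) = 0).

Let edf i : ent (df i). exact: ent_dd. Qed.
Let wdf i : wh (w i) d (df i). exact: wh_pd. Qed.
Let hfx x : hol f x. exact: (hol_ent x ef). Qed.
Let hdf i x : hol (df i) x. exact: hol_dir. Qed.
Let ho i : hol (om i) 0. by apply: holD; [|apply: holM]. Qed.
Let eet k j x : dif (et k j) x. exact: ent_fcomp. Qed.

Lemma et0 j x : et 0 j x = 0. by rewrite /fcomp leqNgt w0. Qed.

Lemma near_hol (g : V -> C^o) : hol g 0 -> near0 (fun x => hol g x).
by move=> /hol_near [r r0 h]; exists r => // x xr; apply: h; rewrite subr0. Qed.

Lemma near_eta : near0 (fun x => forall i, hol (eta i) x).
have [r r0 h] : exists2 r : R, 0 < r & forall i x, nm x < r -> hol (eta i) x.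
 apply: fin_small => [i|i r r' le h x xr]; last by apply: h; exact: lt_le_trans le.
 by have [r r0 h] := near_hol (heta i); exists r.
by exists r => // x xr i; exact: h.
Qed.

Lemma dom i j x : dif (eta j) x -> de i (om j) x = de i (df j) x + (f x * de i (eta j) x + eta j x * df i x).
by move=> h; rewrite dirD; [rewrite dirM //; exact: ef|exact: edf|apply: difM => //; exact: ef]. Qed.

(* [om /\ d om = f om /\ d eta], and [f] may be cancelled. *)
Lemma om_deta i j k : near0 (fun x => om i x * (de j (eta k) x - de k (eta j) x)
 + om j x * (de k (eta i) x - de i (eta k) x) + om k x * (de i (eta j) x - de j (eta i) x) = 0).
apply: (f_cancel ef fn0).
 have hd a b : hol (fun x => de a (eta b) x - de b (eta a) x : C^o) 0 by apply: holB; exact: hol_dir.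
 by apply: holD; [apply: holD|]; apply: holM.
apply: near0I (integ i j k) near_eta _ => x E he; have h i := hol_dif (he i).
rewrite -[RHS]E !dom // (dir_sym (ev k) (ev j) (hfx x)) (dir_sym (ev k) (ev i) (hfx x)) (dir_sym (ev j) (ev i) (hfx x)).
ring.
Qed.

(** The weight [K] part of [eta + Th om], where [Th] is the sum of the [e i] with last term [th].
    The function [e i] has weight [i - d], so that [e i * df] has weight [i]. *)
Definition kap (e : nat -> V -> C^o) K (th : V -> C^o) j y : C^o :=
 et K j y + th y * df j y + f y * \sum_(i < K) e i y * et (K - i) j y.
Definition thk e K (th : V -> C^o) := [/\ ent th, wh d K th & forall i j x, de i (kap e K th j) x = de j (kap e K th i) x].

Lemma fcomp_om i a x : fcomp (w i) (om i) a x = if a == d then df i x else if (d < a)%N then f x * et (a - d) i x else 0.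
rewrite (fcompD w0) ?(fcomp_whM w0 _ _ _ ef ((whom_wh0 w d f).1 hf)) //; last by apply: holM.
rewrite (fcomp_wh w0 a x (edf i) (wdf i)); case: (ltngtP a d) => [_|_|->]; rewrite ?add0r ?addr0 //.
by rewrite subnn et0 mulr0 addr0.
Qed.

Section Step.
Variables (K : nat) (e : nat -> V -> C^o).
Hypothesis he : forall i, (i < K)%N -> thk e i (e i).
Local Notation Th := (fun x => \sum_(i < K) e i x : C^o).
Local Notation kp j := (fun x => eta j x + \sum_(i < K) (e i x * df j x + f x * e i x * eta j x) : C^o).

Let ee (i : 'I_K) x : dif (e i) x. by case: (he (ltn_ord i)). Qed.
Let we (i : 'I_K) : wh d i (e i). by case: (he (ltn_ord i)). Qed.

Lemma wh_fe (i : 'I_K) : wh 0 i (fun x => f x * e i x).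
by move=> t x; rewrite expr0 mul1r hf -mulrA mulrCA (we i t x) mulrCA. Qed.

Lemma wh_edf (i : 'I_K) j : wh (w j) i (fun x => e i x * df j x).
by move=> t x; rewrite mulrCA (wdf j t x) mulrCA mulrA (we i t x) mulrA. Qed.

Lemma fcomp_kp j b x : (b <= K)%N -> fcomp (w j) (kp j) b x = if (b < K)%N then kap e b (e b) j x else et K j x + f x * \sum_(i < K) e i x * et (K - i) j x.
move=> bK.
have h1 (i : 'I_K) : hol (fun x => e i x * df j x : C^o) 0 by apply: holM => //; apply: hol_ent; exact: ee.
have h2 (i : 'I_K) : hol (fun x => f x * e i x * eta j x : C^o) 0 by apply: holM => //; apply: hol_ent => y; apply: difM; [exact: ef|exact: ee].
rewrite (fcompD w0) //; last by apply: hol_sum => i _; exact: holD.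
rewrite (fcomp_sum w0); last by move=> i; exact: holD.
have E (i : 'I_K) : fcomp (w j) (fun x => e i x * df j x + f x * e i x * eta j x) b x =
  (if b == i then e i x * df j x else 0) + (if (i <= b)%N then f x * (e i x * et (b - i) j x) else 0).
 rewrite (fcompD w0) // (fcomp_wh w0 b x _ (wh_edf i j)); last by move=> y; apply: difM; [exact: ee|exact: edf].
 by rewrite (fcomp_whM w0 _ _ _ _ (wh_fe i)) //; [case: ifP => // _; rewrite mulrA|by move=> y; apply: difM; [exact: ef|exact: ee]].
rewrite (eq_bigr _ (fun i _ => E i)) big_split /=.
case: (ltnP b K) => bK'.
 rewrite (bigD1 (Ordinal bK')) //= eqxx big1 ?addr0; last first.
  by move=> i ib; rewrite (_ : b == i = false) //; apply: contraNF ib => /eqP ib; apply/eqP/val_inj.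
 rewrite -big_mkcond -(big_ord_widen _ (fun i => f x * (e i x * et (b - i) j x)) bK') big_ord_recr /= subnn.
 by rewrite et0 !mulr0 addr0 /kap -mulr_sumr addrA.
have {bK bK'} -> : b = K by apply/eqP; rewrite eqn_leq bK.
rewrite big1 ?add0r; last by move=> i _; rewrite gtn_eqF.
by rewrite mulr_sumr; congr (_ + _); apply: eq_bigr => i _; rewrite ltnW.
Qed.

(** [kp] is [eta + Th om]; the wedge of [om] with each of [d eta], [Th d om] and [dTh /\ om] is
    zero. *)
Lemma om_dkp i j k : near0 (fun x => om i x * (de j (kp k) x - de k (kp j) x)
 + om j x * (de k (kp i) x - de i (kp k) x) + om k x * (de i (kp j) x - de j (kp i) x) = 0).
apply: near0I (om_deta i j k) (near0I (integ i j k) near_eta (fun x h1 h2 => conj h1 h2)) _ => x E1 [E2 hx].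
have h i' := hol_dif (hx i').
have dT : dif Th x by side.
have dk a b : de a (kp b) x = de a (eta b) x + (Th x * de a (om b) x + om b x * de a Th x).
 have -> : kp b = fun x => eta b x + Th x * om b x by apply/funext => y; congr (_ + _); rewrite mulr_suml; apply: eq_bigr => l _; ring.
 have dob : dif (om b) x by apply: difD; [exact: edf|apply: difM; [exact: ef|exact: h]].
 rewrite dirD; [|exact: h|by apply: difM].
 by rewrite dirM.
rewrite !dk -[RHS]addr0 -[0 in X in _ = X + _]E1 -[0 in X in _ = _ + X](mulr0 (Th x)) -[X in _ = _ + _ * X]E2.
ring.
Qed.

(** The component of weight [K + d] of [om_dkp]. The parts of [kp] of weight below [K] are closed by
    induction and [df] is the part of [om] of lowest weight, so only [df /\ d tau] contributes. *)
Lemma tau_rel x i j k : let tau j y : C^o := et K j y + f y * \sum_(i < K) e i y * et (K - i) j y in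
 df i x * (de j (tau k) x - de k (tau j) x) + df j x * (de k (tau i) x - de i (tau k) x)
  + df k x * (de i (tau j) x - de j (tau i) x) = 0.
move=> tau.
have hk b : hol (kp b) 0 by apply: holD => //; apply: hol_sum => l _; apply: holD; apply: holM => //; apply: hol_ent => y; [|apply: difM; [exact: ef|]]; exact: ee.
have hX a b : hol (fun x => de a (kp b) x - de b (kp a) x : C^o) 0 by apply: holB; exact: hol_dir.
have T a b c s : s = (w a + (w b + w c))%N -> fcomp s (fun x => om a x * (de b (kp c) x - de c (kp b) x)) (K + d) x =
  df a x * (de b (tau c) x - de c (tau b) x).
 move=> ->; have dl : (d < (K + d).+1)%N by rewrite ltnS leq_addl.
 have D l : fcomp (w b + w c) (fun x => de b (kp c) x - de c (kp b) x : C^o) l x = de b (fcomp (w c) (kp c) l) x - de c (fcomp (w b) (kp b) l) x by rewrite (fcompB w0) ?(fcomp_pd w0) // 1?[(w c + w b)%N]addnC //; exact: hol_dir.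
 rewrite (fcompM w0) // (bigD1 (Ordinal dl)) //= big1 ?addr0 => [|l ld]; rewrite fcomp_om ?eqxx D.
  have kE l : fcomp (w l) (kp l) K = tau l by apply/funext => y; rewrite fcomp_kp // ltnn.
  by rewrite addnK !kE.
 case: (ltngtP l d) => [_|dl'|lE]; rewrite ?mul0r //; last by case/eqP: ld; apply/val_inj.
 have lt : (K + d - l < K)%N by move: dl' (ltn_ord l); clear; lia.
 have kE c' : fcomp (w c') (kp c') (K + d - l) = kap e (K + d - l) (e (K + d - l)%N) c' by apply/funext => y; rewrite fcomp_kp ?lt // ltnW.
 by rewrite !kE; case: (he lt) => _ _ ->; rewrite subrr mulr0.
rewrite -(T i j k _ erefl) -(T j k i (w i + (w j + w k))%N); last by clear; lia.
rewrite -(T k i j (w i + (w j + w k))%N); last by clear; lia.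
rewrite -[RHS](fcomp0 w0 (w i + (w j + w k)) (K + d) x).
have hM a b c : hol (fun x => om a x * (de b (kp c) x - de c (kp b) x) : C^o) 0 by apply: holM.
rewrite -(fcompD w0 _ _ _ (hM i j k) (hM j k i)) -(fcompD w0 _ _ _ (holD (hM i j k) (hM j k i)) (hM k i j)).
exact: (fcomp_ext w0 _ _ _ (holD (holD (hM i j k) (hM j k i)) (hM k i j)) (om_dkp i j k)).
Qed.

Lemma thk_step : exists th, thk e K th.
pose tau j y : C^o := et K j y + f y * \sum_(i < K) e i y * et (K - i) j y.
have et_ j : ent (tau j) by move=> x; rewrite /tau; dfs.
have wt j : wh (w j) K (tau j).
 apply: whD; first exact: wh_fcomp.
 have -> : (fun y => f y * \sum_(i < K) e i y * et (K - i) j y) = fun y => \sum_(i < K) (f y * e i y) * et (K - i) j y by apply/funext => y; rewrite mulr_sumr; apply: eq_bigr => i _; rewrite mulrA.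
 apply: wh_sum => i _; rewrite -[w j]add0n -{1}(subnKC (ltnW (ltn_ord i))).
 by apply: whM; [exact: wh_fe|exact: wh_fcomp].
have [th [eth wth cl]] := RC et_ wt (fun x i j k => tau_rel x i j k).
exists th; split=> // i j x.
have D a b : de a (kap e K th b) x = de a (tau b) x + (th x * de a (df b) x + df b x * de a th x).
 have -> : kap e K th b = fun y => tau b y + th y * df b y by apply/funext => y; rewrite /kap addrAC.
 rewrite dirD; [|exact: et_|by apply: difM; [exact: eth|exact: edf]].
 by rewrite dirM; [|exact: eth|exact: edf].
have := cl i j x; rewrite !D (dir_sym (ev j) (ev i) (hfx x)) => H.
by rewrite addrCA [df j x * _]mulrC H addrCA [de j th x * _]mulrC.
Qed.

End Step.

Lemma formal_theta : exists th, forall K, thk th K (th K).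
apply: (@strong_rec (V -> C^o) (fun=> 0) thk) => [e e' K th E [a b c]|e k he]; last exact: thk_step.
split=> //; have -> : kap e' K th = kap e K th; last by [].
by apply/funext => j; apply/funext => y; rewrite /kap; congr (_ + _ * _); apply: eq_bigr => i _; rewrite E.
Qed.

Lemma wh_kap th K j : (forall K, thk th K (th K)) -> wh (w j) K (kap th K (th K) j) /\ ent (kap th K (th K) j).
move=> H; have eth k x : dif (th k) x by case: (H k).
split; last by move=> x; rewrite /kap; dfs.
have -> : kap th K (th K) j = fun y => et K j y + th K y * df j y + \sum_(i < K) (f y * th i y) * et (K - i) j y by apply/funext => y; rewrite /kap mulr_sumr; congr (_ + _); apply: eq_bigr => i _; rewrite mulrA.
have HK i k : (i < k)%N -> thk th i (th i) by [].
apply: whD; first by apply: whD; [exact: wh_fcomp|exact: (wh_edf (K := K.+1) (HK^~ _) ord_max)].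
apply: wh_sum => i _; rewrite -[w j]add0n -{1}(subnKC (ltnW (ltn_ord i))).
by apply: whM; [exact: (wh_fe (HK^~ _) i)|exact: wh_fcomp].
Qed.

(* [H = 1 + f th] and [v] is a formal potential of [eta + th om], so that [H om = df + f dv]. *)
Lemma formal_potential : exists (H : V -> fps R) (v : nat -> V -> C^o), [/\ forall k, ent (v k), forall k, wh 0 k (v k),
 forall x, v 0%N x = 0 & forall x j, H x * (fpsc (df j x) + fpsc (f x) * (fun k => et k j x)) =
  fpsc (df j x) + fpsc (f x) * (fun k => de j (v k) x)].
have [th hth] := formal_theta.
pose ka K j := kap th K (th K) j.
have ek K j : ent (ka K j) by case: (wh_kap K j hth).
have wk K j : wh (w j) K (ka K j) by case: (wh_kap K j hth).
have th0 x : th 0%N x = 0 by case: (hth 0%N) => a b _; exact: (wh_low _ x a b).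
(* Poincare's lemma for weighted forms: a closed form of weight [K] is the differential of its
   contraction with the Euler field divided by [K]. In weight 0 the form is zero. *)
pose v K x : C^o := (K%:R)^-1 * \sum_i (w i)%:R * coord x i * ka K i x.
have dt K i x : dif (fun x => (w i)%:R * coord x i * ka K i x : C^o) x by dfs.
have ev_ K : ent (v K) by move=> x; apply: difM; [exact: dif_cst|apply: dif_sum].
have ka0 j x : ka 0%N j x = 0 by apply: (wh_low w0 x (ek _ j) (wk _ j)).
have dv K j x : de j (v K) x = ka K j x.
 case: (posnP K) => [->|K0].
  rewrite ka0 -[RHS](dir_cst 0 x (ev j)); congr dd; apply/funext => y.
  by rewrite /v big1 ?mulr0 // => i _; rewrite ka0 mulr0.
 have Kn : K%:R != 0 :> C by rewrite pnatr_eq0 -lt0n.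
 rewrite dirZ; last exact: dif_sum.
 rewrite dir_sum // -[RHS](mulKf Kn); congr (_ * _).
 have -> : K%:R * ka K j x = (K%:R - (w j)%:R) * ka K j x + (w j)%:R * ka K j x by ring.
 rewrite -(euler_wh w0 x (ek K j) (wk K j)).
 have -> : (w j)%:R * ka K j x = \sum_k (if k == j then (w k)%:R * ka K k x else 0 : C) by rewrite -big_mkcond big_pred1_eq.
 rewrite -big_split; apply: eq_bigr => k _ /=; rewrite dirM; [|by dfs|exact: ek].
 rewrite dirZ; last exact: dif_coord.
 rewrite dd_coord; case: (hth K) => _ _ ->.
 by case: eqP => [->|_] /=; ring.
exists (fun x k => if k == 0%N then 1 else f x * th k x), v; split=> //.
- move=> K t x; rewrite expr0 mul1r /v mulrCA; congr (_ * _); rewrite mulr_sumr; apply: eq_bigr => i _.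
 by rewrite coord_act -!mulrA [t ^+ w i * _]mulrCA wk; ring.
- by move=> x; rewrite /v big1 ?mulr0 // => i _; rewrite ka0 mulr0.
move=> x j; have HE : (fun k => if k == 0%N then 1 else f x * th k x : C) = 1 + fpsc (f x) * (fun k => th k x) :> fps R by apply/funext => -[|k]; rewrite fDE fcM ?th0 ?mulr0 ?addr0 //= add0r.
rewrite HE; pose e : fps R := fun k => et k j x; pose t : fps R := fun k => th k x; rewrite -/e -/t.
have -> : (fun k => de j (v k) x) = e + t * fpsc (df j x) + fpsc (f x) * (t * e) :> fps R; last by ring.
apply/funext => k; have -> : (e + t * fpsc (df j x) + fpsc (f x) * (t * e)) k = e k + df j x * t k + f x * (t * e) k by rewrite [t * fpsc _]mulrC -!fcM.
by rewrite dv fME big_ord_recr /= subnn /e et0 mulr0 addr0 [df j x * t k]mulrC.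
Qed.

End Formal.

(** * Geometric bounds for a linear transport equation *)

Section Transport.
Variable R : realType.
Local Notation C := R[i].

Lemma rder_pow (k x : R) m : rder (fun s => (k * (1 + s) ^+ m.+1)%:C) x (k * (m.+1%:R * (1 + x) ^+ m))%:C.
have di z : dif (fun z : C^o => z) z := dif_id z.
have D (z : C^o) : dd (1 : C^o) (fun z => k%:C * z ^+ m.+1 : C^o) z = k%:C * (m.+1%:R * z ^+ m * 1) by rewrite dirZ ?dirX ?(hd_dd _ (hd_id _)) //; exact: difX.
have h := @rder_dd R C^o (fun z => k%:C * z ^+ m.+1 : C^o) 1 1 x; rewrite D in h.
have E (s : R) : 1 + s%:C *: (1 : C^o) = (1 + s)%:C by rewrite /GRing.scale /= mulr1 rmorphD rmorph1.
have -> : (k * (m.+1%:R * (1 + x) ^+ m))%:C = k%:C * (m.+1%:R * (1 + x%:C *: (1 : C^o)) ^+ m * 1) by rewrite E mulr1 !(rmorphM, rmorphXn, rmorph_nat).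
have -> : (fun s => (k * (1 + s) ^+ m.+1)%:C) = (fun s => k%:C * (1 + s%:C *: (1 : C^o)) ^+ m.+1) by apply/funext => s; rewrite E rmorphM rmorphXn.
by apply: h; apply: difM; [exact: dif_cst|exact: difX].
Qed.

Lemma sum_half m : \sum_(j < m.+1) (2^-1 : R) ^+ (m - j) <= 2.
elim: m => [|m IH]; first by rewrite big_ord1 expr0 ler1n.
rewrite big_ord_recr /= subnn expr0 (eq_bigr (fun j : 'I_m.+1 => 2^-1 * 2^-1 ^+ (m - j))) -?mulr_sumr; first by lra.
by move=> j _; rewrite subSn ?exprS // -ltnS.
Qed.

(** A majorant for an infinite triangular linear system. The factor [j] makes the [m]-th coefficient
    grow at a rate proportional to [m], which costs a factor of the form [const ^ m] over the unit
    interval and keeps the bound geometric. *)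
Lemma geo_transport (M c K r : R) : 0 <= M -> 0 < c -> 0 < K -> 0 < r -> exists K' r' : R, [/\ 0 < K', 0 < r' & forall u a : nat -> R -> C^o,
 (forall m x, 0 <= x <= 1 -> rder (u m) x (\sum_(j < m.+1) j%:R * a (m - j)%N x * u j x)) ->
 (forall k x, 0 <= x <= 1 -> nm (a k x) <= M * c ^+ k) -> (forall m, nm (u m 0) <= K * r ^+ m) ->
 forall m, nm (u m 1) <= K' * r' ^+ m].
move=> M0 c0 K0 r0.
have [N hN] : exists N : nat, 4 * M <= N%:R by have M4 : 0 <= 4 * M; [rewrite mulr_ge0|exists (Num.Def.archi_bound (4 * M)); exact: ltW (archi_boundP M4)].
(* [p] dominates the initial rate [r], and [c] is at most [p / 2], so the convolution is controlled
   by a geometric sum of ratio [1 / 2]. *)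
pose p := r + 2 * c; have p0 : 0 < p by rewrite addr_gt0 // mulr_gt0.
(* The exponent [N * m] with [N] at least [4 * M] absorbs the convolution; the extra 1 makes the
   comparison of derivatives strict, also for [m = 0]. *)
pose y m (s : R) := K * p ^+ m * (1 + s) ^+ (N * m).+1.
have B0 m : 0 < K * p ^+ m by side.
have B1 m := ltW (B0 m).
have ym m (x z : R) : 0 <= x -> x <= z -> y m x <= y m z.
 move=> x0 xz; apply: ler_wpM2l => //; apply: lerXn2r; rewrite ?nnegrE ?lerD2l // addr_ge0 //; exact: le_trans xz.
exists (2 * K), (p * (1 + 1) ^+ N); split; [by side|by side|move=> u a du ba h0].
(* Finitely many coefficients are treated together, so that near each point one step size serves
   them all. *)
suff all1 J : forall m, (m < J.+1)%N -> nm (u m 1) <= y m 1.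
 move=> m; by apply: le_trans (all1 m m (ltnSn m)) _; rewrite /y exprS exprM exprMn; lra.
pose P x := forall m, (m < J.+1)%N -> nm (u m x) <= y m x.
suff G1 : P 0 -> P (0 + 1).
 move=> m mJ; rewrite -[1]add0r; apply: G1 => // k _; rewrite /y addr0 expr1n mulr1; apply: le_trans (h0 k) _.
 apply: (ler_wpM2l (ltW K0)); apply: lerXn2r; rewrite ?nnegrE; [exact: ltW|exact: ltW|].
 by rewrite lerDl mulr_ge0 // ltW.
apply: (@cousin1 R (fun x s => P x -> P (x + s))) => [x s _ h1 h2 /h1/h2|x0 x01].
 by rewrite -addrA -splitr.
have [x00 x11] := andP x01.
(* If the bound already fails at [x0], continuity makes it fail slightly before, so on short
   intervals around [x0] the implication has a false premise. *)
have [Px|] := pselect (P x0); last first.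
 move=> /existsNP [m /not_implyP [mJ /negP]]; rewrite -ltNge => lt.
 set q := \sum_(j < m.+1) j%:R * a (m - j)%N x0 * u j x0; have [e e0 he] := du m x0 x01 1 ltr01.
 have g0 : 0 < nm (u m x0) - y m x0 by side.
 have k0 : 0 < nmc q + 1 by side.
 exists (minr e ((nm (u m x0) - y m x0) / (nmc q + 1))); first by side.
 move=> x s /andP [s0]; rewrite lt_min ltr_pdivlMr // => /andP [se sk] /andP [xx0 x0s] x_0 xs1 /(_ m mJ) le.
 have hx : `|x - x0| <= s by rewrite ler0_norm ?subr_le0 //; move: x0s; clear; lra.
 have := he (x - x0) (le_lt_trans hx se); rewrite (_ : x0 + (x - x0) = x) ?mul1r; [|by rewrite addrC subrK]; move=> h1; exfalso.
 have h2 : nm (u m x0) <= nm (u m x) + (nmc q + 1) * `|x - x0|.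
  have -> : u m x0 = u m x - ((u m x - u m x0 - (x - x0)%:C * q) + (x - x0)%:C * q) by ring.
  apply: le_trans (nmB _ _) _; rewrite lerD2l; apply: le_trans (nmD _ _) _.
  by rewrite nmM nm_real mulrDl mul1r [`|_| * _]mulrC addrC lerD2l.
 have h3 : (nmc q + 1) * `|x - x0| <= (nmc q + 1) * s by rewrite ler_wpM2l // ltW.
 by move: (ym m x x0 x_0 xx0) le h2 h3 sk; clear; lra.
have [e e0 he] : exists2 e : R, 0 < e & forall (m : 'I_J.+1) x s, 0 < s < e -> x <= x0 <= x + s -> 0 <= x -> x + s <= 1 ->
  nm (u m x) <= y m x -> nm (u m (x + s)) <= y m (x + s); last first.
 by exists e => // x s s0 xs x_0 xs1 Pxx m mJ; apply: (he (Ordinal mJ)) => //; exact: Pxx.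
apply: fin_small => [[m mJ] /=|i e e' le h x s /andP [s0 se]]; last by apply: h; rewrite s0 (lt_le_trans se).
set q : C^o := \sum_(j < m.+1) j%:R * a (m - j)%N x0 * u j x0.
have x2 : 1 + x0 <= 2 by move: x11; clear; lra.
have x1 : 1 <= 1 + x0 by rewrite lerDl.
pose D := K * p ^+ m * ((N * m).+1%:R * (1 + x0) ^+ (N * m)).
have qD : nm q < D.
 have t j : (j < m.+1)%N -> nmc (j%:R * a (m - j)%N x0 * u j x0) <= m%:R * M * y m x0 * 2^-1 ^+ (m - j).
  rewrite ltnS => jm; have -> : m%:R * M * y m x0 * 2^-1 ^+ (m - j) = m%:R * (M * (p / 2) ^+ (m - j)) * (K * p ^+ j * (1 + x0) ^+ (N * m).+1).
   rewrite /y; have -> : p ^+ m = p ^+ j * p ^+ (m - j) by rewrite -exprD subnKC.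
   by rewrite exprMn; ring.
  rewrite !nmM nm_nat; apply: ler_pM; rewrite ?mulr_ge0 ?nm_ge0 //.
   apply: ler_pM; rewrite ?nm_ge0 ?ler_nat //; apply: le_trans (ba _ _ x01) _; apply: ler_wpM2l => //.
   by rewrite lerXn2r ?nnegrE ?ltW //; move: r0 c0; rewrite /p; clear; lra.
  apply: le_trans (Px j (leq_ltn_trans jm mJ)) _; apply: ler_wpM2l => //.
  by apply: ler_weXn2l => //; rewrite ltnS leq_mul2l jm orbT.
 apply: le_lt_trans (nm_sum _ _ _) _; apply: (@le_lt_trans _ _ (m%:R * M * y m x0 * 2)).
  apply: le_trans (_ : _ <= \sum_(j < m.+1) m%:R * M * y m x0 * 2^-1 ^+ (m - j)) _; first by apply: ler_sum => j _; exact: t.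
  have y0 : 0 <= y m x0 by rewrite /y mulr_ge0 // exprn_ge0 // addr_ge0.
  by rewrite -mulr_sumr; apply: ler_wpM2l (sum_half m); apply: mulr_ge0 => //; exact: mulr_ge0.
 have -> : m%:R * M * y m x0 * 2 = K * p ^+ m * (m%:R * (2 * M * (1 + x0)) * (1 + x0) ^+ (N * m)) by rewrite /y exprS; ring.
 rewrite ltr_pM2l // ltr_pM2r ?exprn_gt0 //; last by side.
 rewrite (_ : (N * m).+1%:R = N%:R * m%:R + 1); last by rewrite -natr1 natrM.
 rewrite mulrC; apply: (@le_lt_trans _ _ (N%:R * m%:R)); last by rewrite ltrDl.
 by rewrite ler_wpM2r //; apply: le_trans hN; have := ler_wpM2l M0 x2; clear; lra.
pose g := (D - nm q) / 2; have g0 : 0 < g by rewrite divr_gt0 // subr_gt0.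
have [e e0 he] := rder_straddle (du m x0 x01) g0.
have [e' e0' he'] := rder_straddle (rder_pow (K * p ^+ m) x0 (N * m)) g0.
exists (minr e e'); first by side.
move=> x s /andP [s0 /lt_minP [se se']] xs _ _ le.
have := he' x s; rewrite s0 se' => /(_ isT xs); rewrite -rmorphB -rmorphM -rmorphB nm_real ler_norml => /andP [low _].
have := he x s; rewrite s0 se => /(_ isT xs) h.
have hu : nm (u m (x + s)) <= nm (u m x) + s * nm q + g * s.
 have -> : u m (x + s) = u m x + s%:C * q + (u m (x + s) - u m x - s%:C * q) by ring.
 apply: le_trans (nmD _ _) _; apply: lerD h; apply: le_trans (nmD _ _) _.
 by rewrite nmM nm_real gtr0_norm.
have Dg : D = nm q + 2 * g by rewrite /g; lra.
by move: low; rewrite -/(y m x) -/(y m (x + s)) -/D Dg; move: hu le; clear; lra.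
Qed.

End Transport.

(** * The formal first integral and its transport equation *)

Section FirstIntegral.
Variables (R : realType) (n : nat).
Local Notation C := R[i].
Local Notation V := (Cn R n).
Local Notation ev := (ev R).
Implicit Types (a b : fps R).

Lemma ar1 (z S B Q : R) : z * (2 * S * B * Q) <= 1 -> S * Q * (z * B) <= 1 / 2. by clear; lra. Qed.
Lemma ar2 (d l m : R) : l <= 1 / 2 -> 1 <= d -> d - l <= m -> 1 / 2 <= m. by clear; lra. Qed.
Lemma ar3 (a b k : R) : 0 <= k -> 0 <= a -> 0 <= b -> 4 * (2 * (a + k * b)) <= 8 * (1 + k) * (a + b). by clear; nra. Qed.

Lemma asy_sum (I : Type) (s : seq I) (g : I -> C^o -> C^o) (a : I -> nat -> C^o) : (forall i, asy (g i) (a i)) ->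
 asy (fun t => \sum_(i <- s) g i t) (fun k => \sum_(i <- s) a i k).
move=> h; elim: s => [|i s IH].
 have -> : (fun t => \sum_(i <- [::]) g i t) = fun=> 0 by apply/funext => t; rewrite big_nil.
 by have := @asy_cst R 0; congr asy; apply/funext => k; rewrite big_nil; case: eqP.
have -> : (fun t => \sum_(i <- i :: s) g i t) = fun t => g i t + \sum_(i <- s) g i t by apply/funext => t; rewrite big_cons.
by have := asyD (h i) IH; congr asy; apply/funext => k; rewrite big_cons.
Qed.

Lemma fsumE (I : Type) (s : seq I) (F : I -> fps R) k : (\sum_(i <- s) F i) k = \sum_(i <- s) F i k.
by elim: s => [|i s IH]; rewrite ?big_nil // !big_cons fDE IH. Qed.

Lemma fpsc_sum (I : Type) (s : seq I) (F : I -> C) : fpsc (\sum_(i <- s) F i) = \sum_(i <- s) fpsc (F i).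
by apply/funext => k; rewrite fsumE /fpsc; case: ifP => // _; rewrite big1. Qed.

Lemma fth_zero a Z : fth Z = a * Z -> a 0%N = 0 -> Z 0%N = 0 -> Z = 0.
move=> h a0 Z0; apply/funext; elim/ltn_ind => -[//|k] IH; have /eqP := congr1 (fun z => z k.+1) h.
rewrite /fth fME big1 => [|[[|i] ik] _] /=; last by rewrite IH ?mulr0 // subSS ltnS leq_subr.
 by rewrite mulf_eq0 pnatr_eq0 => /eqP.
by rewrite a0 mul0r.
Qed.

Definition fX : fps R := fun k => (k == 1%N)%:R.
Lemma fXE a k : (fX * a) k = if k is k'.+1 then a k' else 0.
rewrite fME big_ord_recl mul0r add0r; case: k => [|k]; first by rewrite big_ord0.
by rewrite big_ord_recl mul1r subSS subn0 big1 ?addr0 // => i _; rewrite mul0r.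
Qed.
Lemma fXn m a k : (fX ^+ m * a) k = if (m <= k)%N then a (k - m)%N else 0.
by elim: m k => [|m IH] k; [rewrite mul1r subn0|rewrite exprS -mulrA fXE; case: k => // k; rewrite IH]. Qed.
Lemma fth_c x a : fth (fpsc x * a) = fpsc x * fth a.
by apply/funext => k; rewrite /fth !fcM; ring. Qed.
Lemma fpscK (x : C) : x != 0 -> fpsc x * fpsc x^-1 = 1.
by move=> h; rewrite -fpscMM mulfV. Qed.

Variables (w : 'I_n -> nat) (d : nat) (f : V -> C^o).
Hypotheses (w0 : forall i, (0 < w i)%N) (d0 : (0 < d)%N) (ef : ent f) (hf : whom w d f).
Local Notation act := (act w).
Local Notation wh := (@wh R n w).
Local Notation fcomp := (@fcomp R n w).
Local Notation df i := (de i f).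
Variable eta : 'I_n -> V -> C^o.
Hypothesis heta : forall i, hol (eta i) 0.
Local Notation et j x := ((fun k => fcomp (w j) (eta j) k x) : fps R).
Variables (H : V -> fps R) (v : nat -> V -> C^o).
Hypotheses (ev_ : forall k, ent (v k)) (wv : forall k, wh 0 k (v k)) (v0 : forall x, v 0%N x = 0).
Local Notation vS := ((fun x k => v k x) : V -> fps R).
Hypothesis REL : forall x j, H x * (fpsc (df j x) + fpsc (f x) * et j x) = fpsc (df j x) + fpsc (f x) * ddS (ev j) vS x.
Let dn : d%:R != 0 :> C. by rewrite pnatr_eq0 -lt0n. Qed.
Local Notation c := (fpsc (d%:R^-1 : C)).

Definition etu (u x : V) : fps R := \sum_i fpsc (coord u i) * et i x.
Definition eul (x : V) : V := pt (fun i => (w i)%:R * coord x i).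

Lemma RELu u x : H x * (fpsc (dd u f x) + fpsc (f x) * etu u x) = fpsc (dd u f x) + fpsc (f x) * ddS u vS x.
have E (G : 'I_n -> fps R) : fpsc (dd u f x) + fpsc (f x) * \sum_i fpsc (coord u i) * G i = \sum_i fpsc (coord u i) * (fpsc (df i x) + fpsc (f x) * G i).
 rewrite dir_coord // fpsc_sum mulr_sumr -big_split; apply: eq_bigr => i _; rewrite fpscMM /=; ring.
have -> : ddS u vS x = \sum_i fpsc (coord u i) * ddS (ev i) vS x by apply/funext => k; rewrite fsumE /ddS dir_coord; [apply: eq_bigr => i _; rewrite fcM|exact: ev_].
by rewrite !E mulr_sumr; apply: eq_bigr => i _; rewrite -REL; ring.
Qed.

Lemma REL_eul x : f x != 0 -> H x * (fpsc d%:R + etu (eul x) x) = fpsc d%:R + fth (vS x).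
move=> fx; have E g : dif g x -> dd (eul x) g x = \sum_i (w i)%:R * coord x i * de i g x by move=> dg; rewrite dir_coord //; apply: eq_bigr => i _; rewrite ptE.
have fE : dd (eul x) f x = f x * d%:R by rewrite E // (euler x ef hf) mulrC.
have := RELu (eul x) x; rewrite fE fpscMM -mulrDr.
have -> : ddS (eul x) vS x = fth (vS x) by apply/funext => k; rewrite /ddS E ?(euler_wh w0 x (ev_ k) (wv k)) ?mulr0n ?subr0 //; exact: ev_.
rewrite mulrCA -mulrDr => /(congr1 (fun z => fpsc (f x)^-1 * z)).
by rewrite !mulrA [fpsc _^-1 * _]mulrC fpscK // !mul1r.
Qed.

(** The factor [H], which is only formal, cancels between the relation in the direction [u] and the
    one in the Euler direction. The coefficient [a] is thereby defined from [f] and [eta] alone. *)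
Lemma ode_coef x u a : f x != 0 -> a * (fpsc d%:R + etu (eul x) x) = fpsc (dd u f x / f x) + etu u x ->
 a * (fpsc d%:R + fth (vS x)) = fpsc (dd u f x / f x) + ddS u vS x.
move=> fx ha; rewrite -REL_eul // mulrCA ha; have := RELu u x.
have -> : fpsc (dd u f x) = fpsc (f x) * fpsc (dd u f x / f x) by rewrite -fpscMM mulrC divfK.
rewrite -!mulrDr mulrCA => /(congr1 (fun z => fpsc (f x)^-1 * z)).
by rewrite !mulrA [fpsc _^-1 * _]mulrC fpscK // !mul1r.
Qed.

(** [E] is [exp (v / d)], obtained from its differential equation for [fth] by recursion on the
    weight; this keeps each coefficient entire and homogeneous. *)
Lemma exp_ex : exists E : nat -> V -> C^o, [/\ forall k, ent (E k), forall k, wh 0 k (E k), forall x, E 0%N x = 1 &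
 forall x, fth (fun k => E k x : C) = c * fth (vS x) * (fun k => E k x)].
have [E hE] := @strong_rec (V -> C^o) (fun=> 0) (fun e k y => forall x, y x = if k == 0%N then 1 else
 k%:R^-1 * \sum_(i < k) d%:R^-1 * (k - i)%:R * v (k - i)%N x * e i x)
 (fun e e' k y h => fun hy x => etrans (hy x) (congr1 (fun z => if k == 0%N then 1 else k%:R^-1 * z)
  (eq_bigr _ (fun (i : 'I_k) _ => congr1 (fun z => _ * z) (congr1 (fun g => g x) (h i (ltn_ord i)))))))
 (fun e k _ => ex_intro _ _ (fun x => erefl)).
have fE k : E k = fun x => if k == 0%N then 1 else k%:R^-1 * \sum_(i < k) d%:R^-1 * (k - i)%:R * v (k - i)%N x * E i x by apply/funext => x; exact: hE.
exists E; split.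
- elim/ltn_ind => -[|k] IH; rewrite fE => x /=; first exact: dif_cst.
 by apply: difM; [exact: dif_cst|apply: dif_sum => i _]; apply: difM; [apply: difM; [exact: dif_cst|exact: ev_]|exact: IH].
- elim/ltn_ind => -[|k] IH; rewrite fE => t x /=; rewrite ?expr0 ?mul1r // mulrCA; congr (_ * _); rewrite mulr_sumr.
 apply: eq_bigr => i _; have := IH i (ltn_ord i) t x; have := wv (k.+1 - i) t x; rewrite !expr0 !mul1r => -> ->.
 have -> : t ^+ k.+1 = t ^+ (k.+1 - i) * t ^+ i by rewrite -exprD subnK // ltnW.
 by ring.
- by move=> x; rewrite hE.
move=> x; apply/funext => k; rewrite -mulrA fcM {1}/fth hE; case: k => [|k] /=; first by rewrite mul0r fME big_ord1 /fth !mul0r mulr0.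
rewrite mulrA mulfV ?pnatr_eq0 // mul1r [fth _ * _]mulrC fME [in RHS]big_ord_recr /= subnn /fth mul0r mulr0 addr0 mulr_sumr.
by apply: eq_bigr => i _; ring.
Qed.

Variable E : nat -> V -> C^o.
Hypotheses (eE : forall k, ent (E k)) (wE : forall k, wh 0 k (E k)) (E0 : forall x, E 0%N x = 1).
Local Notation ES := ((fun x k => E k x) : V -> fps R).
Hypothesis thE : forall x, fth (ES x) = c * fth (vS x) * ES x.

(** The difference of the two sides satisfies the linear equation of [E] itself and has no constant
    term, so [fth_zero] applies. *)
Lemma ddE_exp u x : ddS u ES x = c * ddS u vS x * ES x.
have dE y : difS ES y by move=> k; exact: eE.
have dv y : difS vS y by move=> k; exact: ev_.
have tS (A : V -> fps R) : difS A x -> ddS u (fun x => fth (A x)) x = fth (ddS u A x) by move=> dA; apply/funext => k; rewrite /fth /ddS dirZ.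
have dtv : difS (fun x => fth (vS x)) x by move=> k; apply: difM; [exact: dif_cst|exact: dv].
have cE A : difS A x -> ddS u (fun x => c * A x) x = c * ddS u A x.
 move=> dA; rewrite ddS_M //; last by move=> k; exact: dif_cst.
 rewrite (_ : ddS u (fun=> c) x = 0) ?mul0r ?add0r //; by apply/funext => k; rewrite /ddS dir_cst.
have := tS ES (dE x); have -> : (fun x => fth (ES x)) = fun x => c * (fth (vS x) * ES x) by apply/funext => y; rewrite thE mulrA.
rewrite cE ?ddS_M ?tS //; last exact: difS_M.
move=> h; apply: subr0_eq; apply: (@fth_zero (c * fth (vS x))).
- rewrite (_ : fth (_ - _) = fth (ddS u ES x) - c * (fth (ddS u vS x) * ES x + ddS u vS x * fth (ES x))); last first.
  rewrite -fthM -fth_c; apply/funext => k; rewrite /fth mulrA; exact: mulrBr.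
 by rewrite -h thE; ring.
- by rewrite fcM /fth mul0r mulr0.
have dc0 : ddS u ES x 0%N = 0 by rewrite /ddS (_ : E 0%N = fun=> 1) ?dir_cst //; apply/funext.
have dv0 : ddS u vS x 0%N = 0 by rewrite /ddS (_ : v 0%N = fun=> 0) ?dir_cst //; apply/funext.
change (ddS u ES x 0%N - (c * ddS u vS x * ES x) 0%N = 0).
by rewrite dc0 -mulrA fcM fME big_ord1 dv0 mul0r mulr0 subrr.
Qed.

(** The shift [fX] accounts for the weight of [f]: the series [f * Wf ^ d] is the expansion of the
    formal first integral [f exp v] along the orbit of [x], and [Wf] is its [d]-th root up to the
    root of [f]. *)
Definition Wf x : fps R := fX * ES x.
Definition Fh x : fps R := fpsc (f x) * Wf x ^+ d.

Lemma difS_W x : difS Wf x. by apply: difS_M => k; [exact: dif_cst|exact: eE]. Qed.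
Lemma difS_Fh x : difS Fh x. by apply: difS_M; [apply: difS_c|apply: difS_X; exact: difS_W]. Qed.
Lemma ddW u x : ddS u Wf x = c * ddS u vS x * Wf x.
rewrite ddS_M; [|by move=> k; exact: dif_cst|by move=> k; exact: eE].
rewrite (_ : ddS u (fun=> fX) x = 0); last by apply/funext => k; rewrite /ddS dir_cst.
by rewrite ddE_exp /Wf; ring.
Qed.
Lemma thW x : fth (Wf x) = (1 + c * fth (vS x)) * Wf x.
rewrite fthM thE (_ : fth fX = fX) /Wf; first by ring.
by apply/funext => -[|[|k]]; rewrite /fth /fX ?mulr0 ?mul0r ?mulr1.
Qed.
Let dc : d%:R * c = 1 :> fps R. by rewrite -fpsc_nat fpscK. Qed.
Let Wd x : Wf x ^+ d.-1 * Wf x = Wf x ^+ d. by rewrite -exprSr prednK. Qed.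

Lemma ddFh u x : ddS u Fh x = Wf x ^+ d * (fpsc (dd u f x) + fpsc (f x) * ddS u vS x).
rewrite ddS_M; [|by apply: difS_c|by apply: difS_X; exact: difS_W].
rewrite ddS_c ddS_X; [rewrite ddW -(Wd x)|exact: difS_W].
transitivity (fpsc (dd u f x) * (Wf x ^+ d.-1 * Wf x) + d%:R * c * (fpsc (f x) * ddS u vS x) * (Wf x ^+ d.-1 * Wf x)); first by ring.
by rewrite dc; ring.
Qed.

(** The transport equation. Both [ddS u] and [fth] are derivations, so powers of a solution and
    series in it are solutions with the same coefficient [a]. *)
Definition sol (W : normedModType C) (A : W -> fps R) u x a := ddS u A x = a * fth (A x).

Lemma sol_Fh x u a : f x != 0 -> a * (fpsc d%:R + etu (eul x) x) = fpsc (dd u f x / f x) + etu u x -> sol Fh u x a.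
move=> fx /(ode_coef fx) ha; rewrite /sol ddFh fth_c fthX thW.
have -> : fpsc (dd u f x) = fpsc (f x) * fpsc (dd u f x / f x) by rewrite -fpscMM mulrC divfK.
rewrite -mulrDr -ha fpsc_nat -(Wd x).
transitivity (a * (d%:R + d%:R * c * fth (vS x)) * (fpsc (f x) * (Wf x ^+ d.-1 * Wf x))); last by ring.
by rewrite dc; ring.
Qed.

Lemma sol_sup (W : normedModType C) (A : nat -> W -> fps R) (e : fps R) u x a : (forall k, difS (A k) x) ->
 (forall k y i, (i < k)%N -> A k y i = 0) -> (forall k, sol (A k) u x a) -> sol (fun y => fsup e (A^~ y)) u x a.
move=> dA lo h; apply/funext => m; rewrite /ddS dir_sum => [|k _]; last by apply: difM; [exact: dif_cst|exact: dA].
have -> : fth (fsup e (A^~ x)) = fsup e (fun k => fth (A k x)) by apply/funext => i; rewrite /fth mulr_sumr; apply: eq_bigr => k _; ring.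
rewrite fsup_mul => [|k i ik]; last by rewrite /fth lo ?mulr0.
by apply: eq_bigr => k _; rewrite dirZ; [have := congr1 (fun z => z m) (h k) => /= <-|exact: dA].
Qed.

Lemma sol_X (W : normedModType C) (A : W -> fps R) u x a k : difS A x -> sol A u x a -> sol (fun y => A y ^+ k) u x a.
by move=> dA h; rewrite /sol ddS_X // fthX h; ring. Qed.

(** [a] is the Taylor series in the orbit parameter of a quotient of holomorphic functions, on a
    disc of radius uniform for [nm x <= R0]. Only the term [dd u f x / f x] becomes large near the
    zero set, and it enters linearly. *)
Lemma coef_bound (R0 : R) : exists t M : R, [/\ 0 < t, 0 < M & forall x u, nm x <= R0 -> f x != 0 ->
 exists2 a : fps R, a * (fpsc d%:R + etu (eul x) x) = fpsc (dd u f x / f x) + etu u x &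
  forall k, nmc (a k) <= M * (nmc (dd u f x / f x) + nm u) * t ^+ k].
have [r r0 hr] : exists2 r : R, 0 < r & forall i y, nm y < r -> dif (eta i) y.
 apply: fin_small => [i|i r r' le h y yr]; last by apply: h; exact: lt_le_trans le.
 by have [r r0 h] := heta i; exists r => // y yr; apply: h; rewrite subr0.
have [B0 B01 hB] : exists2 B : R, 1 <= B & forall i, exists2 s : R, 0 < s & forall y, nm y < s -> nm (eta i y) <= B.
 apply: fin_bd => [i|i B B' le [s s0 h]]; last by exists s => // y /h /le_trans; apply.
 by have [s [B [s0 _ _ h]]] := hol_bd (heta i); exists B, s => // y ys; apply: h; rewrite subr0.
have [s s0 hs] : exists2 s : R, 0 < s & forall i y, nm y < s -> nm (eta i y) <= B0 by apply: fin_small => [i|i s s' le h y ys]; [exact: hB|apply: h; exact: lt_le_trans le].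
pose Q := 1 + `|R0|; have Q0 : 0 < Q by rewrite ltr_pwDl.
pose S : R := \sum_(i < n) (w i)%:R + n%:R + 1; have Sw : 0 <= \sum_(i < n) (w i)%:R :> R by side.
have S0 : 0 < S by rewrite ltr_wpDl // addr_ge0.
(* The last constraint bounds the contraction of [eta] with the Euler field by [1 / 2], which keeps
   the denominator at least [1 / 2] in modulus. *)
pose t := minr (minr 1 (r / Q)) (minr (s / Q) (1 / (2 * S * B0 * Q))).
have b0 : 0 < B0 by apply: lt_le_trans B01.
have t0 : 0 < t by rewrite !lt_min ltr01 !divr_gt0 // !mulr_gt0.
exists (t / 3)^-1, (8 * (1 + n%:R * B0)); split; [by side|by side|move=> x u xR fx].
have xQ : nm x <= Q by apply: le_trans xR _; apply: le_trans (ler_norm _) _; rewrite /Q lerDr.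
have ht (z : C^o) : nm z < t -> [/\ nm z <= 1, nm (act z x) < r, nm (act z x) < s & nm z * (2 * S * B0 * Q) <= 1].
 rewrite !lt_min !ltr_pdivlMr ?mulr_gt0 // => /andP [/andP [z1 zr] /andP [zs zq]]; have z1' := ltW z1.
 have az : nm (act z x) <= nm z * Q by apply: le_trans (nm_act w0 x z1') _; apply: ler_wpM2l; [exact: nm_ge0|exact: xQ].
 by split=> //; [exact: le_lt_trans zr|exact: le_lt_trans zs|exact: ltW].
pose G i (z : C^o) : C^o := z ^+ w i * eta i (act z x).
have aG i : asy (G i) (et i x) by exact: fcomp_asy.
have dG i z : nm z < t -> dif (G i) z.
 move=> zt; apply: difM; [by apply: difX; exact: dif_id|].
 by apply: (dif_comp (f := fun z : C^o => act z x)); [exact: dif_act_t|apply: hr; case: (ht z zt)].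
have bG i z : nm z < t -> nm (G i z) <= nm z * B0.
 move=> /ht [z1 _ zs _]; rewrite nmM nmX; apply: ler_pM; rewrite ?exprn_ge0 ?nm_ge0 ?hs //.
 by rewrite -{2}[nm z]expr1 ler_wiXn2l ?nm_ge0.
pose lc (q : V) (z : C^o) : C^o := \sum_i coord q i * G i z.
have al q (k : C^o) : asy (fun z => k + lc q z) (fpsc k + etu q x).
 have := asyD (asy_cst k) (@asy_sum _ (index_enum _) _ _ (fun i => asyZ (coord q i) (aG i))); congr asy.
 apply/funext => m; transitivity (fpsc k m + etu q x m); last by [].
 by rewrite /etu fsumE; congr (_ + _); apply: eq_bigr => i _; rewrite fcM.
have dl q (k : C^o) z : nm z < t -> dif (fun z => k + lc q z) z by move=> zt; apply: difD; [exact: dif_cst|apply: dif_sum => i _; apply: difM; [exact: dif_cst|exact: dG]].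
have bu z : nm z < t -> nm (lc u z) <= n%:R * B0 * nm u.
 move=> zt; apply: le_trans (nm_sum _ _ _) _.
 have -> : n%:R * B0 * nm u = \sum_(i < n) B0 * nm u by rewrite sumr_const card_ord -[RHS]mulr_natl mulrA.
 apply: ler_sum => i _; rewrite nmM mulrC; apply: ler_pM; rewrite ?nm_ge0 ?nm_coord //.
 by apply: le_trans (bG i z zt) _; rewrite ler_piMl ?(ltW b0) //; case: (ht z zt).
have be z : nm z < t -> nm (lc (eul x) z) <= 1 / 2.
 move=> zt; have [_ _ _ zq] := ht z zt; apply: (@le_trans _ _ (S * Q * (nm z * B0))); last exact: ar1.
 apply: le_trans (nm_sum _ _ _) _; apply: (@le_trans _ _ ((\sum_(i < n) (w i)%:R) * Q * (nm z * B0))).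
  rewrite !mulr_suml; apply: ler_sum => i _; rewrite ptE nmM; apply: ler_pM; rewrite ?nm_ge0 //; last exact: bG.
  by rewrite nmM nm_nat; apply: ler_wpM2l => //; exact: le_trans (nm_coord _ _) xQ.
 by rewrite !ler_wpM2r ?mulr_ge0 ?nm_ge0 ?(ltW b0) ?(ltW Q0) // /S -addrA lerDl addr_ge0.
pose q1 : C^o := dd u f x / f x.
have ge z : nm z < t -> 1 / 2 <= nmc (d%:R + lc (eul x) z).
 move=> zt; have := nm_rev (d%:R : C^o) (- lc (eul x) z); rewrite opprK nmN nm_nat.
 have : 1 <= d%:R :> R by rewrite ler1n.
 exact: ar2 (be z zt).
have nz z : nm z < t -> d%:R + lc (eul x) z != 0 by move=> zt; apply: nm_neq0; apply: lt_le_trans (ge z zt); rewrite divr_gt0.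
pose q (z : C^o) : C^o := (q1 + lc u z) / (d%:R + lc (eul x) z).
have dq z : nm z < t -> dif q z by move=> zt; apply: difM; [exact: dl|apply: difV; [exact: nz|exact: dl]].
have bq z : nm z < t -> nm (q z) <= 2 * (nm q1 + n%:R * B0 * nm u).
 move=> zt; rewrite nmM nmV mulrC; apply: ler_pM; rewrite ?invr_ge0 ?nm_ge0 //.
  by rewrite invf_ple ?posrE ?(lt_le_trans _ (ge z zt)) ?divr_gt0 // -div1r ge.
 by apply: le_trans (nmD _ _) _; rewrite lerD2l bu.
have [aq tb _] := disc_tc t0 dq bq.
exists (tc q).
 apply: (asy_uniq (g := fun z => q z * (d%:R + lc (eul x) z))); first exact: asyM aq (al (eul x) d%:R).
 by apply: (asy_ext t0 _ (al u q1)) => z zt; rewrite divfK ?nz.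
move=> k; apply: le_trans (tb k) _; rewrite exprVn; apply: ler_wpM2r; first by side.
have := nm_ge0 u; have := nm_ge0 q1; have : 0 <= n%:R * B0 by side.
by rewrite -/q1; exact: ar3.
Qed.

Lemma coef_sol (R0 : R) : exists t M : R, [/\ 0 < t, 0 < M & forall x u, nm x <= R0 -> f x != 0 ->
 exists a : fps R, [/\ forall k, nmc (a k) <= M * (nmc (dd u f x / f x) + nm u) * t ^+ k, sol Fh u x a &
  forall xi z : C, xi != 0 -> dd u f x / f x = d%:R * z / xi -> fpsc z * Wf x + fpsc xi * ddS u Wf x = a * fth (fpsc xi * Wf x)]].
have [t [M [t0 M0 h]]] := coef_bound R0; exists t, M; split=> // x u xR fx; have [a ha ba] := h x u xR fx.
exists a; split=> [//||xi z xi0 E1]; first exact: sol_Fh.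
have := ode_coef fx ha; rewrite E1 fth_c thW ddW => E2.
have -> : fpsc z * Wf x = c * fpsc xi * fpsc (d%:R * z / xi) * Wf x by rewrite -!fpscMM; congr (fpsc _ * _); field; rewrite ?pnatr_eq0 -?lt0n ?d0 ?xi0.
transitivity (c * fpsc xi * (fpsc (d%:R * z / xi) + ddS u vS x) * Wf x); first by ring.
rewrite -E2 fpsc_nat; transitivity (a * fpsc xi * (d%:R * c + c * fth (vS x)) * Wf x); first by ring.
by rewrite dc; ring.
Qed.

Definition fsc (t : C) a : fps R := fun k => t ^+ k * a k.
Lemma fscX t a k : fsc t (a ^+ k) = fsc t a ^+ k.
have fscM b b' : fsc t (b * b') = fsc t b * fsc t b'.
 apply/funext => m; rewrite {1}/fsc !fME mulr_sumr; apply: eq_bigr => i _; rewrite /fsc.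
 by have -> : t ^+ m = t ^+ i * t ^+ (m - i) by [rewrite -exprD subnKC // -ltnS]; ring.
elim: k => [|k IH]; last by rewrite !exprS fscM IH.
by apply/funext => -[|k]; rewrite /fsc ?expr0 ?mul1r // mulr0.
Qed.

Lemma Fh_act t x : Fh (act t x) = fsc t (Fh x).
have -> : fsc t (Fh x) = fpsc (f x) * fsc t (Wf x) ^+ d by rewrite -fscX; apply/funext => k; rewrite /Fh /fsc !fcM mulrCA.
have -> : fsc t (Wf x) = fpsc t * Wf (act t x).
 apply/funext => -[|k]; rewrite fcM /fsc /Wf !fXE ?mulr0 //.
 by have := wE k t x; rewrite expr0 mul1r => ->; rewrite exprS mulrA.
by rewrite /Fh hf [(fpsc t * _) ^+ d]exprMn -fpscX mulrA -fpscMM [f x * _]mulrC.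
Qed.

Lemma Fh_om x i j : (fpsc (df i x) + fpsc (f x) * et i x) * ddS (ev j) Fh x = (fpsc (df j x) + fpsc (f x) * et j x) * ddS (ev i) Fh x.
by rewrite !ddFh -!REL; ring. Qed.

Lemma Wf01 x : Wf x 0%N = 0 /\ Wf x 1%N = 1. by rewrite /Wf !fXE E0. Qed.

End FirstIntegral.

Lemma lin_half (R : realType) (a b c t : R) : 0 <= t <= 1 -> a < c -> b < c -> a + t * (b - a) < c.
move=> /andP [t0 t1] ac bc; case: (lerP a b) => ab.
 by have : 0 <= (1 - t) * (b - a); [rewrite mulr_ge0 ?subr_ge0|lra].
by have : 0 <= t * (a - b); [rewrite mulr_ge0 ?subr_ge0 // ltW|lra].
Qed.

Lemma nm_half (R : realType) (W : normedModType R[i]) (x y : W) : nm (y - x) < nm x / 2 -> nm x / 2 <= nm y.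
by have := nm_rev x (x - y); rewrite subKr [nm (x - y)]nmC; lra. Qed.

(** * A curve transverse to the zero set *)

Section Curve.
Variables (R : realType) (n : nat).
Local Notation C := R[i].
Local Notation V := (Cn R n).
Variables (d : nat) (f : V -> C^o) (e1 : V) (N : nat) (c1 : C^o) (p : V).
Hypotheses (d0 : (0 < d)%N) (ef : ent f) (hm : mdir f e1 N.+1 c1) (fp : f p = 0).
Local Notation g z := (f (p + z *' e1)).
Local Notation g' z := (dd e1 f (p + z *' e1)).

Lemma half_mul (c v a b : R) : a <= c / 2 * v -> c * v - a <= b -> c / 2 * v <= b.
lra. Qed.
Lemma half_sq (e q v h c l : R) : q <= e * c ^+ 2 * v -> c * v <= h -> c <= l -> 0 <= h -> 0 < c -> 0 < e -> q <= e * h * l.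
move=> qe cv cl h0 c0 e0; apply: le_trans qe _; have := ler_pM (ltW c0) h0 cl (lexx h) => H.
by rewrite expr2 -!mulrA; apply: ler_wpM2l; [exact: ltW|apply: le_trans (ler_wpM2l (ltW c0) cv) _; rewrite [h * l]mulrC].
Qed.

Lemma small_root (eps : R) : 0 < eps -> exists2 del : R, 0 < del & forall y : C^o, nm y < del -> exists2 z : C^o, nm z < eps & g z = y.
move=> e0; have cn := md_c hm; have c0 : 0 < nm c1 by side.
exists (eps ^+ N.+1 * nm c1); first by side.
move=> y yd; pose q := mpoly f e1 N.+1 c1 p - (c1^-1 * y)%:P.
have sq : (size (- (c1^-1 * y)%:P) < size (mpoly f e1 N.+1 c1 p))%N by rewrite (mpoly_size hm) size_polyN; apply: leq_ltn_trans (size_polyC_leq1 _) _.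
have [||||z rz zn] := @root_near R q N 0 eps.
- by rewrite monicE lead_coefDl //; exact: mpoly_monic hm p.
- by rewrite size_polyDl // (mpoly_size hm).
- by [].
- by rewrite hornerD hornerN hornerC (mpoly_eval hm) scale0r addr0 fp mulr0 sub0r nmN nmM nmV mulrC ltr_pdivrMr.
exists z; first by rewrite subr0 in zn.
by move: rz; rewrite /root hornerD hornerN hornerC (mpoly_eval hm) subr_eq0 (inj_eq (mulfI _)) ?invr_eq0 // => /eqP.
Qed.

Lemma hd_line_g (z : C^o) : hd (fun z : C^o => g z) z (fun h => h * g' z : C^o).
have [L hL] := ef (p + z *' e1); have := hd_on_line e1 hL; rewrite -(hd_dd e1 hL) => h.
have := @hd_shift R C^o (fun t : C^o => f (p + z *' e1 + t *' e1)) z (- z) _.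
rewrite subrr => /(_ _ h); apply: hd_eq => // t.
by rewrite -addrA -scalerDl [z + _]addrC subrK.
Qed.

(** The local inverse of [f] on the line along [e1], precomposed with the [d]-th power, hence
    invariant under [d]-th roots of unity. Roots of a polynomial give surjectivity, and the mean
    value inequality gives injectivity and the derivative. *)
Lemma curve : dd e1 f p != 0 -> exists (s : C^o -> C^o) (rho c : R), [/\ 0 < rho, 0 < c & forall x : C^o, nm x < rho ->
 [/\ dif s x, nm (s x) <= 1, g (s x) = x ^+ d, c <= nm (g' (s x)) & forall y, y ^+ d = x ^+ d -> s y = s x]].
rewrite -(prednK d0).
set c0 : C^o := dd e1 f p => c0n; have h0 : 0 < nm c0 / 2 by side.
have [r1 r10 hr1] := dif_cont (ent_dd e1 ef p) h0.
have k0 : 0 < nm e1 + 1 by side.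
pose eps := minr 1 (r1 / (nm e1 + 1)); have eps0 : 0 < eps by rewrite lt_min ltr01 divr_gt0.
have ge (z : C^o) : nm z < eps -> nm (g' z - c0) < nm c0 / 2.
 rewrite lt_min ltr_pdivlMr // => /andP [_ zr]; apply: hr1; rewrite addrC addKr nmZ; apply: le_lt_trans zr.
 by apply: ler_wpM2l; [exact: nm_ge0|rewrite lerDl].
have lo (z : C^o) : nm z < eps -> nm c0 / 2 <= nm (g' z) by move=> /ge; exact: nm_half.
have lip (z1 z2 : C^o) : nm z1 < eps -> nm z2 < eps -> nm c0 / 2 * nm (z2 - z1) <= nm (g z2 - g z1).
 move=> l1 l2; pose v := z2 - z1.
 have dG t : 0 <= t <= 1 -> rder (fun s => g (z1 + s%:C *: v) + - c0 * (s%:C * v)) t (dd v (fun z : C^o => g z) (z1 + t%:C *: v) + - c0 * v).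
  move=> _; apply: rderD; first by apply: rder_dd; eexists; exact: hd_line_g.
  by apply: rderZ; have := rder_lin v 0 t; under eq_fun do rewrite addr0.
 have B t : 0 <= t <= 1 -> nm (dd v (fun z : C^o => g z) (z1 + t%:C *: v) + - c0 * v) <= nm c0 / 2 * nm v.
  move=> t01; rewrite (hd_dd _ (hd_line_g _)) mulNr [c0 * v]mulrC -mulrBr nmM mulrC; apply: ler_wpM2r; first exact: nm_ge0.
  apply/ltW/ge; have -> : z1 + t%:C *: v = (1 - t)%:C *: z1 + t%:C *: z2 by rewrite rmorphB /= scalerBl scale1r /v scalerBr -addrA [- _ + _]addrC.
  apply: le_lt_trans (nmD _ _) _; rewrite !nmZ !nm_real; case/andP: t01 => t0 t1.
  rewrite !ger0_norm ?subr_ge0 // mulrBl mul1r -addrA [- _ + _]addrC -mulrBr.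
  by apply: lin_half; rewrite ?t0.
 have := rder_le ler01 dG B; rewrite subr0 mulr1 scale1r scale0r mul0r mulr0 !addr0 mul1r /v [z1 + _]addrC subrK mulNr.
 rewrite addrAC => H; have := nm_rev (c0 * v) (c0 * v - (g z2 - g z1)); rewrite subKr nmC nmM.
 by apply: half_mul; exact: H.
have [del del0 hdel] := small_root eps0.
have/choice [s hs] : forall y : C^o, exists z : C^o, nm y < del -> nm z < eps /\ g z = y.
 by move=> y; case: (ltP (nm y) del) => yd; [have [z] := hdel _ yd; exists z|exists 0].
have hds y : nm y < del -> hd s y (fun h => h * (g' (s y))^-1 : C^o).
 move=> yd; have [sy gy] := hs y yd; have l := lo _ sy; have gn : g' (s y) != 0 by apply: nm_neq0; exact: lt_le_trans l.
 split; first by move=> a u v; rewrite mulrDl /GRing.scale /= mulrA.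
  by exists (nmc ((g' (s y))^-1)); [exact: nm_ge0|move=> h; rewrite nmM mulrC].
 move=> e e00; have [_ _ H] := hd_line_g (s y).
 have h4 : 0 < e * (nm c0 / 2) ^+ 2 by side.
 have [r r0 hr] := H _ h4; exists (minr (del - nm y) (r * (nm c0 / 2))); first by side.
 move=> h; rewrite lt_min ltrBrDl => /andP [hd hr']; have [sh gh] := hs (y + h) (le_lt_trans (nmD _ _) hd).
 have L := lip _ _ sy sh; rewrite gy gh [y + h]addrC addrK in L.
 have k : s (y + h) = s y + (s (y + h) - s y) by rewrite [RHS]addrC subrK.
 have := hr (s (y + h) - s y); rewrite -k gy gh [y + h]addrC addrK => /(_ _) Q.
 have {}Q : nm (h - (s (h + y) - s y) * g' (s y)) <= e * (nm c0 / 2) ^+ 2 * nm (s (h + y) - s y) by apply: Q; rewrite -(ltr_pM2r h0) mulrC; exact: le_lt_trans L hr'.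
 have E : s (h + y) - s y - h * (g' (s y))^-1 = - (h - (s (h + y) - s y) * g' (s y)) * (g' (s y))^-1 by field.
 rewrite E nmM nmN nmV; rewrite ler_pdivrMr ?(lt_le_trans h0 l) //.
 exact: half_sq Q L l (nm_ge0 h) h0 e00.
exists (fun x : C^o => s (x ^+ d.-1.+1)), (minr 1 del), (nm c0 / 2); split=> //; first by side.
move=> x /lt_minP [x1 xd]; have yd : nmc (x ^+ d.-1.+1) < del by rewrite nmX; apply: le_lt_trans xd; rewrite exprS ler_piMr ?nm_ge0 // exprn_ile1 ?nm_ge0 ?ltW.
have [sy gy] := hs _ yd; split=> //.
- apply: (dif_comp (f := fun x : C^o => x ^+ d.-1.+1 : C^o)); first by apply: difX; exact: dif_id.
 by eexists; exact: hds.
- by move: sy; rewrite lt_min => /andP [/ltW].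
- exact: lo.
- by move=> y ->.
Qed.
End Curve.

(** * Geometric series and transport along segments *)

Section Averaging.
Variables (R : realType).
Local Notation C := R[i].
Implicit Types (a b e : fps R).

Definition geo a := exists K r : R, [/\ 0 < K, 0 < r & forall m, nmc (a m) <= K * r ^+ m].

Lemma geoD a b : geo a -> geo b -> geo (a + b).
move=> [K [r [K0 r0 h]]] [L [s [L0 s0 k]]]; exists (K + L), (r + s); split=> [||m]; rewrite ?addr_gt0 //.
apply: le_trans (nmD _ _) _; rewrite mulrDl; apply: lerD.
 by apply: le_trans (h m) _; rewrite ler_pM2l // lerXn2r ?nnegrE ?addr_ge0 ?(ltW r0) ?(ltW s0) // lerDl ltW.
by apply: le_trans (k m) _; rewrite ler_pM2l // lerXn2r ?nnegrE ?addr_ge0 ?(ltW r0) ?(ltW s0) // lerDr ltW.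
Qed.

Lemma geo_sum (I : Type) (s : seq I) (F : I -> fps R) : (forall i, geo (F i)) -> geo (\sum_(i <- s) F i).
by move=> h; elim/big_rec: _ => [|i a _]; [exists 1, 1; split=> // m; rewrite nm0 expr1n mulr1|exact: geoD].
Qed.

Lemma geoZ (x : C) a : geo a -> geo (fpsc x * a).
move=> [K [r [K0 r0 h]]]; have x0 := nm_ge0 (x : C^o); exists ((nmc x + 1) * K), r; split=> [||m] //.
 by side.
by rewrite fcM nmM -mulrA ler_pM ?nm_ge0 // lerDl.
Qed.

Lemma sol_transport (M c K r : R) : 0 <= M -> 0 < c -> 0 < K -> 0 < r -> exists K' r' : R, [/\ 0 < K', 0 < r' &
 forall (W : normedModType C) (A : W -> fps R) p v, (forall t : R, 0 <= t <= 1 -> difS A (p + t%:C *: v) /\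
  exists2 a, sol A v (p + t%:C *: v) a & forall k, nmc (a k) <= M * c ^+ k) ->
 (forall m, nmc (A p m) <= K * r ^+ m) -> forall m, nmc (A (p + v) m) <= K' * r' ^+ m].
move=> M0 c0 K0 r0; have [K' [r' [K0' r0' h]]] := geo_transport M0 c0 K0 r0; exists K', r'; split=> // W A p v hA A0 m.
have/choice [a ha] : forall t : R, exists a, 0 <= t <= 1 -> sol A v (p + t%:C *: v) a /\ forall k, nmc (a k) <= M * c ^+ k.
 by move=> t; have [/hA [_ [a ? ?]]|/negP H] := boolP (0 <= t <= 1); [exists a|exists 0].
have := h (fun m t => A (p + t%:C *: v) m) (fun k t => a t k); rewrite scale1r scale0r addr0; apply=> [k t t01|k t t01|//].
 have [S _] := ha t t01; have [dA _] := hA t t01; have := congr1 (fun b : fps R => b k) S.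
 rewrite mulrC fME => E; have := rder_dd (dA k); rewrite -[dd _ _ _]/(ddS v A (p + t%:C *: v) k) E.
 by under eq_bigr do rewrite mulrAC.
by have [] := ha t t01.
Qed.

Lemma dd_chain (U W : normedModType C) (phi : U -> W) (g : W -> C^o) x L v : hd phi x L -> dif g (phi x) ->
 dd v (fun z => g (phi z)) x = dd (L v) g (phi x).
by move=> hL [M hM]; rewrite (hd_dd _ (hd_comp hL hM)) (hd_dd _ hM). Qed.

Lemma prim_root_ex k : (0 < k)%N -> exists z : C, k.-primitive_root z.
move=> k0; have [|s E sz] := @poly_split R ('X^k - 1); first by rewrite -polyC1 monicXnsubC.
have us : uniq s by rewrite -separable.separable_prod_XsubC -E cyclotomic.separable_Xn_sub_1 // pnatr_eq0 -lt0n.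
have /hasP [z _ hz] : has k.-primitive_root s; last by exists z.
apply: cyclic.has_prim_root => //; last by move: sz; rewrite -polyC1 size_XnsubC // => -[->].
by apply/allP => z zs; have := root_prod_XsubC s z; rewrite zs -E.
Qed.

(** A chord of the unit circle starting at 1 stays away from 0 unless its other end is -1; the lower
    bound makes this quantitative. *)
Lemma chord (t x y : R) : 0 <= t <= 1 -> x ^+ 2 + y ^+ 2 = 1 -> (1 + x) / 2 <= nmc ((1 - t + t * x) +i* (t * y))%C.
move=> /andP [t0 t1] xy; have x1 : x <= 1 by nra.
rewrite leNgt; apply/negP; have := nm_sq (1 - t + t * x) (t * y); move: (nm _) (nm_ge0 (((1 - t + t * x) +i* (t * y))%C : C^o)) => N N0 E lt.
have x0 : 0 <= 1 + x by nra.
have q : (1 + x) / 2 <= N ^+ 2.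
 have -> : N ^+ 2 = 1 - 2 * (t * (1 - t)) * (1 - x) by by rewrite E; move: xy; clear; nra.
 have tt : t * (1 - t) <= 4^-1 by have := sqr_ge0 (t - 2^-1); rewrite expr2; lra.
 have : t * (1 - t) * (1 - x) <= 4^-1 * (1 - x) by rewrite ler_wpM2r // subr_ge0.
 lra.
have := ltr_pM N0 N0 lt lt; nra.
Qed.
End Averaging.

(** * Transport around the zero set and averaging *)

Section Circle.
Variables (R : realType) (n : nat).
Local Notation C := R[i].
Local Notation V := (Cn R n).
Variables (d : nat) (f : V -> C^o) (e1 : V) (N : nat) (c1 : C^o) (p : V) (E : nat -> V -> C^o).
Hypotheses (d0 : (0 < d)%N) (ef : ent f) (hm : mdir f e1 N.+1 c1) (fp : f p = 0) (gp : dd e1 f p != 0) (eE : forall k, ent (E k)) (E0 : forall x, E 0%N x = 1).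
Local Notation Wf := (Wf E).
Local Notation Fh := (Fh d f E).
Hypothesis CS : forall R0 : R, exists t M : R, [/\ 0 < t, 0 < M & forall x u, nm x <= R0 -> f x != 0 ->
 exists a : fps R, [/\ forall k, nmc (a k) <= M * (nmc (dd u f x / f x) + nm u) * t ^+ k, sol Fh u x a &
  forall xi z : C, xi != 0 -> dd u f x / f x = d%:R * z / xi -> fpsc z * Wf x + fpsc xi * ddS u Wf x = a * fth (fpsc xi * Wf x)]].

Definition Zf (y : C^o -> V) (xi : C^o) : fps R := fpsc xi * Wf (y xi).

(** On the curve [f = xi ^ d] the root [Zf] is single-valued in [xi] and solves the transport
    equation. The coefficients are singular only at [xi = 0]: the constant [M] depends on the
    distance [del] to 0, the rate [t] does not. *)
Lemma Z_sol : exists (y : C^o -> V) (rho t : R), [/\ 0 < rho, rho <= 1, 0 < t,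
 forall xi : C^o, nm xi < rho -> f (y xi) = xi ^+ d /\ forall z : C^o, z ^+ d = xi ^+ d -> y z = y xi &
 forall del : R, 0 < del -> exists2 M : R, 0 <= M & forall xi b : C^o, del <= nm xi -> nm xi < rho -> nm b <= 1 ->
  difS (Zf y) xi /\ exists2 a, sol (Zf y) b xi a & forall k, nmc (a k) <= M * t ^+ k].
have [s [rho [c [rho0 c0 hs]]]] := curve d0 ef hm fp gp; have [t [M [t0 M0 hC]]] := CS (nm p + nm e1).
pose y (z : C^o) : V := p + s z *' e1.
exists y, (minr rho 1), t; split=> //; first by side.
- by rewrite ge_min lexx orbT.
- by move=> xi /lt_minP [/hs [_ _ fx _ h] _]; split=> // z /h E1; rewrite /y E1.
move=> del del0; pose B := d%:R / del + d%:R / c * nm e1.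
have B0 : 0 <= B by rewrite addr_ge0 ?mulr_ge0 ?invr_ge0 ?nm_ge0 ?(ltW del0) ?(ltW c0).
exists (M * B) => [|xi b xd]; first by side.
move=> /lt_minP [xr x1] b1; have [ds s1 gs gc _] := hs _ xr; have [L hL] := ds; have linL : lin L by case: hL.
have xn : xi != 0 by apply: nm_neq0; exact: lt_le_trans xd.
have hy : hd y xi (fun h => L h *' e1).
 have hl : hd (fun z : C^o => p + z *' e1) (s xi) (fun h => 0 + h *' e1).
  apply: hdD; first exact: hd_cst.
  apply: hd_lin => [a z z'|]; first by rewrite scalerDl scalerA.
  by exists (nm e1); [exact: nm_ge0|move=> h; rewrite nmZ mulrC].
 by apply: hd_eq (hd_comp hL hl) => // h; rewrite add0r.
pose u : V := L 1 *' e1.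
have du : dd u f (y xi) = d%:R * xi ^+ d.-1.
 have e0 : 0 < rho - nm xi by side.
 rewrite -(dd_chain (1 : C^o) hy (ef _)) -(dir_ext (f := fun z : C^o => z ^+ d : C^o) _ e0).
 - by rewrite dirX ?(hd_dd _ (hd_id _)) ?mulr1 //; exact: dif_id.
 - by move=> z zx; have /hs [_ _ ->//] : nm z < rho; move: zx; rewrite ltrBrDl; apply: le_lt_trans; rewrite -{1}[z](subrK xi) addrC nmD.
 - by apply: difX; exact: dif_id.
have fy : f (y xi) = xi ^+ d by [].
have E1 : dd u f (y xi) / f (y xi) = d%:R * 1 / xi by rewrite du fy mulr1 -[in xi ^+ d](prednK d0) exprS; field; rewrite xn expf_neq0.
have nu : nm u <= d%:R / c * nm e1.
 rewrite nmZ; apply: ler_wpM2r; first exact: nm_ge0.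
 rewrite ler_pdivlMr //; apply: (@le_trans _ _ (nm (L 1) * nm (dd e1 f (y xi)))); first by rewrite ler_wpM2l ?nm_ge0.
 by rewrite -nmM -dir_dirZ // du nmM nm_nat nmX ler_piMr // exprn_ile1 ?nm_ge0 ?ltW.
have yR : nm (y xi) <= nm p + nm e1 by apply: le_trans (nmD _ _) _; rewrite nmZ lerD2l ler_piMl ?nm_ge0.
have [|a [ba _ /(_ xi 1 xn E1) sa]] := hC (y xi) u yR; first by rewrite fy expf_neq0.
have dy : dif y xi by eexists; exact: hy.
have dW : difS (fun z => Wf (y z)) xi by move=> k; apply: (dif_comp (g := fun x => Wf x k : C^o)) dy _; exact: difS_W.
have dI : difS (fun z : C^o => fpsc (z : C)) xi by apply: difS_c; exact: dif_id.
split; first exact: difS_M.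
exists (fpsc b * a) => [|k]; last first.
 rewrite fcM nmM; apply: (@le_trans _ _ (nmc (a k))); first by rewrite ler_piMl ?nm_ge0.
 apply: le_trans (ba k) _; apply: ler_wpM2r; first by side.
 rewrite ler_pM2l // E1 mulr1 nmM nm_nat nmV lerD // ler_wpM2l // lef_pV2 ?posrE //; exact: lt_le_trans xd.
rewrite /sol; have -> : ddS b (Zf y) xi = fpsc b * ddS (1 : C^o) (Zf y) xi.
 apply/funext => k; rewrite fcM -dir_dirZ; last exact: difS_M.
 by rewrite /ddS; congr (dd _ _ _); rewrite /GRing.scale /= mulr1.
rewrite -mulrA /Zf -sa ddS_M // ddS_c (hd_dd _ (hd_id _)); congr (_ * (_ + _ * _)).
by apply/funext => k; exact: dd_chain hy (difS_W eE _ k).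
Qed.

(** The average of the [k]-th power of a [d]-th root of [Fh] over the choices of the root; it no
    longer involves the root. *)
Definition tau k x : fps R := if (d %| k)%N then Fh x ^+ (k %/ d) else 0.

Lemma Fh_pow j x : Fh x ^+ j = fpsc (f x ^+ j) * Wf x ^+ (d * j).
by rewrite exprMn -fpscX exprM. Qed.

Lemma tau_low k x i : (i < k)%N -> tau k x i = 0.
rewrite /tau; case: ifP => // dk ik; rewrite Fh_pow fcM fX_low ?mulr0 //; last by rewrite mulnC divnK.
by have [] := Wf01 E0 x.
Qed.

Lemma tau_dd x : tau d x d = f x.
by have [W0 W1] := Wf01 E0 x; rewrite /tau dvdnn divnn d0 Fh_pow expr1 muln1 fcM fX_diag // W1 expr1n mulr1. Qed.

Lemma Z0 y z : Zf y z 0%N = 0. by rewrite /Zf fcM; have [-> _] := Wf01 E0 (y z); rewrite mulr0. Qed.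

(** [e] is the [d]-th power of the compositional inverse of [a], found from a triangular system
    whose diagonal entries are the powers of [a 1]. *)
Lemma inverse_series (a : fps R) : a 0%N = 0 -> a 1%N != 0 -> exists e : fps R,
 [/\ forall k, (k < d)%N -> e k = 0, e d != 0 & forall m, fsup e (fun k => a ^+ k) m = (m == d)%:R].
move=> a0 a1; have an k : (a ^+ k) k != 0 by rewrite fX_diag // expf_neq0.
have [e he] : exists e : nat -> C, forall m, e m * (a ^+ m) m + \sum_(k < m) e k * (a ^+ k) m = (m == d)%:R.
 apply: (@strong_rec C 0 (fun e m x => x * (a ^+ m) m + \sum_(k < m) e k * (a ^+ k) m = (m == d)%:R)) => [e e' k x h <-|e k _].
  by congr (_ + _); apply: eq_bigr => i _; rewrite h.
 by exists (((k == d)%:R - \sum_(i < k) e i * (a ^+ i) k) / (a ^+ k) k); rewrite divfK // subrK.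
have z k : (k < d)%N -> e k = 0.
 elim/ltn_ind: k => k IH kd; apply/eqP; have := he k; rewrite (ltn_eqF kd) big1 => [|i _]; last by rewrite IH ?mul0r // (ltn_trans _ kd).
 by rewrite addr0 => /eqP; rewrite mulf_eq0 (negbTE (an k)) orbF.
exists e; split=> // [|m]; last by rewrite /fsup big_ord_recr /= addrC he.
have := he d; rewrite eqxx big1 => [|i _]; last by rewrite z ?mul0r.
by rewrite addr0; apply: contra_eq_neq => ->; rewrite mul0r eq_sym oner_eq0.
Qed.

(** At the base point [xi] the series [e] turns [Zf] into the single monomial of degree [d],
    trivially of geometric growth. Transport along a polygon around 0 keeps the growth geometric. At
    the vertices that differ from [xi] by a [d]-th root of unity the curve is at the same point, and
    averaging over them leaves the powers of [Fh] itself. *)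
Lemma average : exists y0 (e : fps R), [/\ f y0 != 0, forall k, (k < d)%N -> e k = 0, e d != 0 & geo (fsup e (tau^~ y0))].
have [y [rho [t [rho0 rho1 t0 hy hZ]]]] := Z_sol.
pose xi : C^o := (rho / 2)%:C; have nx : nm xi = rho / 2 by rewrite nm_real ger0_norm // divr_ge0 ?(ltW rho0).
have xn : xi != 0 by apply: nm_neq0; rewrite nx divr_gt0.
have xr : nm xi < rho by rewrite nx; lra.
have [|e [elo ed he]] := @inverse_series (Zf y xi) (Z0 _ _); first by rewrite /Zf fcM; have [_ ->] := Wf01 E0 (y xi); rewrite mulr1.
(* The order [4 * d] exceeds 2, so [z] is not -1 and the sides of the polygon miss 0 even for
   [d = 1] or [d = 2]; the power [z ^+ 4] is a primitive [d]-th root of unity. *)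
have [z pz] := @prim_root_ex R (4 * d) ltac:(by rewrite muln_gt0).
have z1 : nmc z = 1 by apply/eqP; rewrite -(@pexpr_eq1 _ _ (4 * d)) ?nm_ge0 ?muln_gt0 // -nmX (prim_expr_order pz) nm1.
have zm m : nmc (z ^+ m) = 1 by rewrite nmX z1 expr1n.
have [kap kap0 kapP] : exists2 kap : R, 0 < kap & forall s : R, 0 <= s <= 1 -> kap <= nmc (1 - s%:C + s%:C * z).
 have zn : z != -1 by apply/eqP => zE; have := prim_order_dvd pz 2; rewrite zE sqrrN expr1n eqxx gtnNdvd //; case: (d) d0 => // k _; rewrite mulnS.
 move: z1 zn; case: z {pz zm} => x y' z1 zn; have sq : x ^+ 2 + y' ^+ 2 = 1 by rewrite -nm_sq z1 expr1n.
 exists ((1 + x) / 2) => [|s s01].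
  rewrite divr_gt0 //; have : x != -1; last by rewrite -subr_eq0 opprK => /eqP; nra.
  by apply: contra_neq zn => xE; move: sq; rewrite xE sqrrN expr1n => /eqP; rewrite -subr_eq0 addrC addKr sqrf_eq0 => /eqP ->; apply/eqP; rewrite eq_complex /= oppr0 !eqxx.
 apply: le_trans (chord s01 sq) _; apply: le_of_eq; congr nm.
 by apply/eqP; rewrite eq_complex /=; apply/andP; split; apply/eqP; ring.
pose U x := fsup e (fun k => Zf y x ^+ k).
have gU m : geo (U (xi * z ^+ m)).
 elim: m => [|m [K [r [K0 r0 h]]]].
  by rewrite expr0 mulr1; exists 1, 1; split=> // m; rewrite /U he expr1n mulr1; case: eqP; rewrite ?nm1 ?nm0.
 pose v : C^o := xi * z ^+ m * (z - 1); have -> : xi * z ^+ m.+1 = xi * z ^+ m + v by rewrite /v exprS; ring.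
 have rk : 0 < rho / 2 * kap by side.
 have [M M0 hM] := hZ _ rk.
 have [K' [r' [K0' r0' H]]] := sol_transport M0 t0 K0 r0; exists K', r'; split=> //.
 apply: H h => s s01; set x := _ + _; have xE : x = xi * z ^+ m * (1 - s%:C + s%:C * z) by rewrite /x /v /GRing.scale /=; ring.
 have nE : nm x = rho / 2 * nmc (1 - s%:C + s%:C * z) by rewrite xE !nmM zm mulr1 nx.
 have [||| dZ [a sa ba]] := hM x v.
 - by rewrite nE ler_pM2l ?divr_gt0 //; exact: kapP.
 - apply: le_lt_trans xr; rewrite nE nx -[leRHS]mulr1 ler_pM2l ?divr_gt0 //.
  case/andP: s01 => s0 s1; apply: le_trans (nmD _ _) _; rewrite nmM z1 mulr1.
  have -> : 1 - s%:C = (1 - s)%:C :> C by rewrite rmorphB rmorph1.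
  by rewrite !nm_real !ger0_norm ?subr_ge0 // subrK.
 - have := nmB (z : C^o) 1; rewrite z1 nm1 !nmM zm mulr1 nx => q; apply: le_trans rho1.
  by apply: (@le_trans _ _ (rho / 2 * 2)); [rewrite ler_pM2l ?divr_gt0|rewrite divfK ?pnatr_eq0].
 split; first by move=> k; apply: dif_sum => i _; apply: difM; [exact: dif_cst|exact: difS_X].
 by exists a => //; apply: sol_sup => [k|k x' i ik|k]; [exact: difS_X|rewrite fX_low ?Z0|exact: sol_X].
exists (y xi), e; split=> //; first by have [-> _] := hy _ xr; rewrite expf_neq0.
have dn : d%:R != 0 :> C by rewrite pnatr_eq0 -lt0n.
(* Orthogonality of roots of unity: passing to the vertex [xi * z ^+ (4 * l)] multiplies the [j]-th
   power of [Zf] by [z ^+ (4 * j * l)], and the sum over [l] is zero unless [d] divides [j]. *)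
have -> : fsup e (tau^~ (y xi)) = fpsc d%:R^-1 * \sum_(l < d) U (xi * z ^+ (4 * l)).
 apply/funext => k; rewrite fcM fsumE /U /fsup exchange_big mulr_sumr; apply: eq_bigr => j _ /=; rewrite -mulr_sumr mulrCA; congr (_ * _).
 have ZE l : (Zf y (xi * z ^+ (4 * l)) ^+ j) k = (z ^+ (4 * j)) ^+ l * (Zf y xi ^+ j) k.
  have [_ yE] := hy _ xr; rewrite /Zf yE; last by rewrite exprMn -exprM mulnAC exprM (prim_expr_order pz) expr1n mulr1.
  by rewrite [xi * _]mulrC fpscMM -mulrA exprMn -fpscX fcM -!exprM; congr (z ^+ _ * _); rewrite mulnAC.
 under eq_bigr do rewrite ZE; rewrite -mulr_suml mulrA /tau; case: ifP => dj.
  have -> : z ^+ (4 * j) = 1 by rewrite -(divnK dj) [(_ * d)%N]mulnC mulnA exprM (prim_expr_order pz) expr1n.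
  under eq_bigr do rewrite expr1n; rewrite sumr_const card_ord mulVf // mul1r Fh_pow /Zf [(fpsc xi * _) ^+ j]exprMn -fpscX.
  by have [-> _] := hy _ xr; rewrite -exprM [(d * _)%N]mulnC divnK.
 suff -> : \sum_(l < d) (z ^+ (4 * j)) ^+ l = 0 by rewrite mulr0 mul0r.
 have q1 : z ^+ (4 * j) - 1 != 0 by rewrite subr_eq0 -(prim_order_dvd pz) dvdn_pmul2l // dj.
 by apply: (mulfI q1); rewrite mulr0 -subrX1 -exprM -mulnA [(j * d)%N]mulnC mulnA exprM (prim_expr_order pz) expr1n subrr.
by apply: geoZ; apply: geo_sum.
Qed.
End Circle.

(** * Convergence of the reparametrized first integral *)

Section Convergence.
Variables (R : realType) (n : nat).
Local Notation C := R[i].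
Local Notation V := (Cn R n).
Local Notation ev := (ev R).
Variables (w : 'I_n -> nat) (d : nat) (f : V -> C^o) (E : nat -> V -> C^o) (y0 : V) (e : fps R).
Hypotheses (w0 : forall i, (0 < w i)%N) (d0 : (0 < d)%N) (ef : ent f) (hf : whom w d f) (eE : forall k, ent (E k)) (wE : forall k, wh w 0 k (E k)) (E0 : forall x, E 0%N x = 1).
Local Notation Fh := (Fh d f E).
Local Notation tau := (tau d f E).
Local Notation act := (act w).
Hypotheses (CS : forall R0 : R, exists t M : R, [/\ 0 < t, 0 < M & forall x u, nm x <= R0 -> f x != 0 ->
 exists2 a : fps R, sol Fh u x a & forall k, nmc (a k) <= M * (nmc (dd u f x / f x) + nm u) * t ^+ k]) (fy0 : f y0 != 0) (geo0 : geo (fsup e (tau^~ y0))).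
Definition Gs x : fps R := fsup e (tau^~ x).

Lemma difS_tau k x : difS (tau k) x.
by rewrite /tau; case: (d %| k)%N => m; [apply: difS_X => {}m; exact: difS_Fh|exact: dif_cst].
Qed.

Lemma ent_G m : ent (fun x => Gs x m : C^o).
by move=> x; apply: dif_sum => k _; apply: difM; [exact: dif_cst|exact: difS_tau]. Qed.

Lemma G_sol x u a : sol Fh u x a -> sol Gs u x a.
move=> h; apply: sol_sup => [k|k y i ik|k]; [exact: difS_tau|exact: tau_low|rewrite /tau; case: (d %| k)%N].
 by apply: sol_X h => m; exact: difS_Fh.
rewrite /sol; apply/funext => m; rewrite mulrC fME big1 /ddS ?dir_cst // => i _; rewrite /fth mulr0 mul0r //.
Qed.

Lemma G_whom m : whom w m (fun x => Gs x m : C^o).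
move=> t x; rewrite /Gs /fsup mulr_sumr; apply: eq_bigr => k _; rewrite mulrCA; congr (_ * _).
by rewrite /tau; case: ifP => _; [rewrite (Fh_act hf wE) -fscX|rewrite mulr0].
Qed.

(** Transport along straight segments from [y0], in a ball where [f] stays at least half as large as
    at [y0], so that the coefficients of the equation are uniformly bounded. *)
Lemma G_near : exists del K r : R, [/\ 0 < del, 0 < K, 0 < r & forall x m, nm (x - y0) < del -> nmc (Gs x m) <= K * r ^+ m].
have h0 : 0 < nm (f y0) / 2 by side.
have [r1 r10 hr1] := dif_cont (ef y0) h0; have [r2 [B [r20 B0 _ hB]]] := hol_bd (hol_ent y0 ef).
have [t [M [t0 M0 hC]]] := CS (nm y0 + 1); have [K [r [K0 r0 hK]]] := geo0.
pose M' := M * (12 * B / (r2 / 2) / (nm (f y0) / 2) + 1).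
have q0 : 0 <= 12 * B / (r2 / 2) by side.
have M0' : 0 <= M' by rewrite mulr_ge0 ?addr_ge0 ?(ltW M0) // divr_ge0 ?(ltW h0).
have [K' [r' [K0' r0' H]]] := sol_transport M0' t0 K0 r0.
exists (minr 1 (minr r1 (r2 / 2))), K', r'; split=> //; first by side.
move=> x m; rewrite !lt_min => /and3P [x1 xr1 xr2]; have := H _ Gs y0 (x - y0); rewrite [y0 + _]addrC subrK; apply=> // s /andP [s0 s1].
split; first by move=> k; exact: ent_G.
set z := y0 + _; have zx : nm (z - y0) <= nm (x - y0) by rewrite addrC addKr nmZ nm_real ger0_norm // ler_piMl ?nm_ge0.
have fz : nm (f y0) / 2 <= nm (f z) by apply: nm_half; apply: hr1; exact: le_lt_trans xr1.
have [||a sa ba] := hC z (x - y0).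
- by rewrite -[z](subrK y0); apply: le_trans (nmD _ _) _; rewrite addrC lerD2l; exact: le_trans (ltW x1).
- by apply: nm_neq0; exact: lt_le_trans fz.
exists a; first exact: G_sol.
move=> k; apply: le_trans (ba k) _; apply: ler_wpM2r; first by side.
rewrite ler_pM2l // lerD //; last exact: ltW.
have [L hL] := ef z; have [|||bL _] := @cauchy_est R V f z (r2 / 2) B L _ _ _ hL; first by side.
- by move=> *; exact: ef.
- by move=> y yz; apply: hB; apply: le_lt_trans (nm_dist z _ _) _; rewrite [r2]splitr ltrD // (le_lt_trans zx).
rewrite (hd_dd _ hL) nmM nmV; apply: ler_pM; rewrite ?nm_ge0 ?invr_ge0 ?nm_ge0 //.
 by apply: le_trans (bL _) _; rewrite ler_piMr // ltW.
by rewrite lef_pV2 ?posrE // (lt_le_trans h0).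
Qed.

(** The coefficient of index [m] is a polynomial of degree at most [m], so a bound on a small ball
    around [y0] extrapolates to the unit ball at a cost geometric in [m]. The zero set is no
    obstacle to this. *)
Lemma G_ball : exists K r : R, [/\ 0 < K, 1 <= r & forall x m, nm x <= 1 -> nmc (Gs x m) <= K * r ^+ m].
have [del [K [r [del0 K0 r0 h]]]] := G_near; pose q := del / (nm y0 + 2).
have q0 : 0 < q by rewrite divr_gt0 // ltr_wpDl ?nm_ge0.
pose Q := 1 + (q / 3)^-1; have Q1 : 1 <= Q by rewrite lerDl invr_ge0 divr_ge0 // ltW.
have Q0 : 0 <= Q by exact: le_trans Q1.
exists (4 * K), (1 + 2 * (r * Q)); split; rewrite ?mulr_gt0 // ?lerDl ?mulr_ge0 ?(ltW r0) // => x m x1.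
have [M M0 hM] := whom_growth w0 (ent_G m) (@G_whom m).
have := @pgN_poly R n m _ (x - y0) y0 1 (conj (ent_G m) (ex_intro2 _ _ M M0 hM)); rewrite scale1r [y0 + _]addrC subrK => ->.
have [||bd _] := @dcoef_tail R n (fun x => Gs x m : C^o) y0 (x - y0) q (K * r ^+ m) q0; first by move=> *; exact: ent_G.
 move=> z zq; apply: h; rewrite addrC addKr nmZ; apply: (@le_lt_trans _ _ (nm z * (nm y0 + 2))); last by rewrite -ltr_pdivlMr // ltr_wpDl ?nm_ge0.
 by rewrite ler_wpM2l ?nm_ge0 //; have := nmB x y0; lra.
apply: le_trans (nm_sum _ _ _) _; apply: (@le_trans _ _ (\sum_(k < m.+1) 4 * K * (r * Q) ^+ m)).
 apply: ler_sum => k _; rewrite expr1n mulr1; apply: le_trans (bd k) _; rewrite [(r * Q) ^+ m]exprMn [leRHS]mulrA -[4 * K * _]mulrA ler_wpM2l //.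
  by side.
 rewrite -exprVn; apply: (@le_trans _ _ (Q ^+ k)); last by rewrite ler_weXn2l // -ltnS.
 by rewrite lerXn2r ?nnegrE ?lerDr // invr_ge0 divr_ge0 // ltW.
rewrite sumr_const card_ord -[_ *+ m.+1]mulr_natr -[4 * K * _ * _]mulrA ler_pM2l ?mulr_gt0 //.
apply: (@le_trans _ _ ((2 * (r * Q)) ^+ m)).
 by rewrite [leRHS]exprMn mulrC ler_wpM2r ?exprn_ge0 ?mulr_ge0 ?(ltW r0) // -natrX ler_nat ltn_expl.
by rewrite lerXn2r ?nnegrE ?addr_ge0 ?mulr_ge0 ?(ltW r0) // lerDr.
Qed.

(** Summing the weighted components gives a holomorphic germ, and homogeneity makes its expansion
    along each orbit the given series, also for [x] far from the origin. *)
Lemma series_sum : exists F : V -> C^o, hol F 0 /\ forall x, asy (fun t : C^o => F (act t x)) (Gs x).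
have [K [r [K0 r1 h]]] := G_ball; have r0 : 0 < r by exact: lt_le_trans r1.
have s0 : 0 < (2 * r)^-1 by side.
(* The action of [2 * r] maps this ball into the unit ball, and weight [k] then turns the bound
   [K * r ^+ k] into [K * 2^-1 ^+ k]. *)
pose rr := (2 * r)^-1 ^+ wmax w; have rr0 : 0 < rr by rewrite exprn_gt0.
have sm x k : nm x < rr -> nmc (Gs x k) <= K * 2^-1 ^+ k.
 move=> xr; pose s : C := ((2 * r)^-1)%:C; have sn : s != 0 by rewrite (inj_eq (@complexI R)) gt_eqF.
 have ns : nmc s = (2 * r)^-1 by rewrite nm_real gtr0_norm.
 have [_ sE] := act_inv w sn; rewrite -[x in Gs x]sE G_whom nmM nmX ns.
 apply: (@le_trans _ _ ((2 * r)^-1 ^+ k * (K * r ^+ k))).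
  apply: ler_wpM2l; [by side|apply: h].
  have T1 : 1 <= 2 * r by lra.
  apply: le_trans (nm_act_big w _ T1 _) _; first by rewrite nmV ns invrK.
  by apply: ltW; rewrite mulrC -ltr_pdivlMr ?exprn_gt0 ?mulr_gt0 // div1r -exprVn.
 by rewrite mulrCA -exprMn invfM mulfVK ?gt_eqF.
have/choice [F hF] : forall x, exists l : C^o, nm x < rr -> forall m, nm (\sum_(k < m) (Gs x k : C^o) - l) <= 4 * K * 2^-1 ^+ m.
 move=> x; case: (ltP (nm x) rr) => xr; last by exists 0.
 by have [l hl] := series_lim (fun k => sm x k xr); exists l.
have K4 : 0 <= 4 * K by side.
exists F; split.
 exists rr => // p; rewrite subr0 => pr; have e0 : 0 < rr - nm p by side.
 have := @unif_lim R V (fun m x => \sum_(k < m) (Gs x k : C^o)) F p _ _ e0 K4; apply=> m x xp.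
  by apply: dif_sum => k _; exact: ent_G.
 by apply: hF; have := nm_rev x p; lra.
move=> x m; pose T := 1 + nm x; have T1 : 1 <= T by rewrite lerDl nm_ge0.
have T0 : 0 < T by exact: lt_le_trans T1.
have gx k : nmc (Gs x k) <= K * (T * r) ^+ k.
 pose s : C := T%:C; have sn : s != 0 by rewrite (inj_eq (@complexI R)) gt_eqF.
 have ns : nmc s = T by rewrite nm_real gtr0_norm.
 have [_ sE] := act_inv w sn; rewrite -[x in Gs x]sE G_whom nmM nmX ns exprMn mulrCA ler_pM2l ?exprn_gt0 //; apply: h.
 have ni : nmc (s^-1) = T^-1 by rewrite nmV ns.
 apply: le_trans (nm_act w0 _ _) _; rewrite ?ni; first by rewrite invf_le1.
 by rewrite mulrC ler_pdivrMr // mul1r lerDr.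
pose B := K * (T * r) ^+ m; have B0 : 0 <= B by rewrite mulr_ge0 ?exprn_ge0 ?mulr_ge0 ?(ltW K0) ?(ltW T0) ?(ltW r0).
pose dl := minr 1 (minr (rr / T) (2 * (T * r))^-1).
exists (2 * B), dl; split; first by side.
 by rewrite !lt_min ltr01 divr_gt0 // invr_gt0 !mulr_gt0.
move=> t; rewrite !lt_min => /and3P [t1 tr tT]; pose y := act t x.
have yr : nm y < rr.
 apply: le_lt_trans (nm_act w0 _ (ltW t1)) _; move: tr; rewrite ltr_pdivlMr //; apply: le_lt_trans.
 by rewrite ler_wpM2l ?nm_ge0 // lerDr.
have yk k : Gs y k = t ^+ k * Gs x k by exact: G_whom.
have S k : nmc (Gs y (m + k)%N) <= B * nm t ^+ m * 2^-1 ^+ k.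
 rewrite yk nmM nmX; apply: le_trans (ler_wpM2l _ (gx _)) _; first by side.
 rewrite !exprD; have -> : nm t ^+ m * nm t ^+ k * (K * ((T * r) ^+ m * (T * r) ^+ k)) = B * nm t ^+ m * (nm t * (T * r)) ^+ k by rewrite /B [(nm t * _) ^+ k]exprMn; ring.
 apply: ler_wpM2l; first by side.
 rewrite lerXn2r ?nnegrE ?mulr_ge0 ?nm_ge0 ?invr_ge0 ?(ltW T0) ?(ltW r0) //.
 by rewrite -ler_pdivlMr ?mulr_gt0 // -invfM ltW.
rewrite -subr_le0; apply: (@pow2_lim0 R _ (4 * K) m) => M /subnKC <-; move: (M - m)%N => {M} q.
have := series_cauchy S (leq0n q); rewrite big_ord0 sub0r nmN expr0 mulr1 => H1.
have H2 := hF y yr (m + q)%N; rewrite lerBlDr; apply: le_trans (nm_dist (\sum_(k < m + q) (Gs y k : C^o)) _ _) _.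
apply: lerD; first by rewrite nmC.
have -> : \sum_(k < m) (Gs x k : C^o) * t ^+ k = \sum_(k < m) (Gs y k : C^o) by apply: eq_bigr => k _; rewrite yk mulrC.
have -> : \sum_(k < m + q) (Gs y k : C^o) - \sum_(k < m) (Gs y k : C^o) = \sum_(k < q) (Gs y (m + k)%N : C^o); last by rewrite -mulrA.
by rewrite big_split_ord /= [LHS]addrC addKr.
Qed.
End Convergence.

(** * The first integral for a weighted homogeneous entire function *)

Section EntireCase.
Variables (R : realType) (n : nat).
Local Notation C := R[i].
Local Notation V := (Cn R n).
Local Notation ev := (ev R).
Variables (w : 'I_n -> nat) (d : nat) (f : V -> C^o).
Hypotheses (w0 : forall i, (0 < w i)%N) (d0 : (0 < d)%N) (ef : ent f) (hf : whom w d f).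

(** The relation is between two derivations applied to [Fh], so it passes to the powers of [Fh] and
    to series in them. *)
Lemma G_sym (E : nat -> V -> C^o) (e A B : fps R) u v x : (forall k, ent (E k)) -> (forall x, E 0%N x = 1) ->
 A * ddS u (Fh d f E) x = B * ddS v (Fh d f E) x -> A * ddS u (Gs d f E e) x = B * ddS v (Gs d f E e) x.
move=> eE E0 h; have dt k : difS (tau d f E k) x by exact: difS_tau.
have S a z m : (a * ddS z (Gs d f E e) x) m = \sum_(k < m.+1) e k * (a * ddS z (tau d f E k) x) m.
 have -> : ddS z (Gs d f E e) x = fsup e (fun k => ddS z (tau d f E k) x).
  apply/funext => i; rewrite /ddS /Gs /fsup dir_sum => [|k _]; last by apply: difM; [exact: dif_cst|exact: dt].
  by apply: eq_bigr => k _; rewrite dirZ //; exact: dt.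
 apply: fsup_mul => k i ik; rewrite /ddS; under [fun y => _]eq_fun do rewrite (tau_low d f E0 _ ik).
 exact: dir_cst.
apply/funext => m; rewrite !S; apply: eq_bigr => k _; congr (_ * _); congr (_ m).
rewrite /tau; case: (d %| k)%N; last first.
 have z0 z : ddS z (fun=> 0 : fps R) x = 0 by apply/funext => i; exact: dir_cst.
 by rewrite !z0 !mulr0.
have dF := difS_Fh d ef eE x; rewrite !ddS_X //.
by rewrite [LHS]mulrCA [RHS]mulrCA h.
Qed.

Hypotheses (red : reduced_germ f) (irr : irreducible_zero_germ f) (fn0 : exists x, f x != 0) (n3 : (3 <= n)%N) (nc : nc_off_codim3 f).
Variable eta : 'I_n -> V -> C^o.
Hypothesis heta : forall i, hol (eta i) 0.
Local Notation om i := (fun x => de i f x + f x * eta i x).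
Hypothesis integ : forall i j k, near0 (fun x => om i x * (de j (om k) x - de k (om j) x)
 + om j x * (de k (om i) x - de i (om k) x) + om k x * (de i (om j) x - de j (om i) x) = 0).

(** The relation between [om] and [dF] is tested on weighted components, where it is the formal
    relation [Fh_om] transferred by [G_sym] to the convergent series. *)
Lemma entire_case : exists F, [/\ hol F 0, ~ near0 (fun x => F x = F 0) &
 forall i j, near0 (fun x => om i x * de j F x - om j x * de i F x = 0)].
have [e1 [N [c1 hm]]] := f_mdir w0 d0 ef hf fn0; have [j1 ej1] := mdir_neq0 hm.
have RC := relative_closed w0 d0 ef hf red irr fn0 hm ej1 n3 nc.
have [H [v [ev_ wv v0 REL]]] := formal_potential w0 d0 ef hf fn0 RC heta integ.
have [E [eE wE E0 thE]] := exp_ex d ev_ wv.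
have CS := coef_sol w0 d0 ef hf heta ev_ wv v0 REL eE E0 thE.
have [p [_ fp gp]] := NDX w0 ef hf red irr hm ej1 (f_0 w0 d0 hf) ltr01.
have [y0 [e [fy elo ed g0]]] := average d0 ef hm fp gp eE E0 CS.
have [|F [hF aF]] := series_sum w0 ef hf eE wE E0 _ fy g0.
 move=> R0; have [t [M [t0 M0 h]]] := CS R0; exists t, M; split=> // x u xR fx.
 by have [a [ba sa _]] := h x u xR fx; exists a.
have wF k x : wcomp w F k x = Gs d f E e x k by rewrite /wcomp (asy_tc (aF x)).
(* The component of weight [d] is a nonzero multiple of [f], since [e] starts at index [d]; hence
   [F] is not constant. *)
have Gd x : Gs d f E e x d = e d * f x by rewrite /Gs /fsup big_ord_recr /= big1 ?add0r ?tau_dd // => k _; rewrite elo ?mul0r.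
exists F; split=> //.
 move=> [r r0 hr]; move: fy; rewrite -(mulrI_eq0 _ (mulfI ed)) -Gd -wF.
 rewrite -(wcomp_ext w0 (g := fun=> F 0) d y0 r0); first last.
 - exact: hol_cst.
 - by move=> x /hr.
 by rewrite /wcomp (asy_tc (asy_cst _)) gtn_eqF // eqxx.
move=> i j; have ho k : hol (om k) 0 by apply: holD; [apply: hol_dir; exact: hol_ent|apply: holM => //; exact: hol_ent].
have hd_ k : hol (de k F) 0 by exact: hol_dir.
have fF k m x : fcomp w (w k) (de k F) m x = ddS (ev k) (Gs d f E e) x m.
 rewrite -[w k in LHS]addn0 -fcomp_pd //; congr (dd _ _ x); apply/funext => y; rewrite /fcomp /= subn0; exact: wF.
have fo k x : (fun m => fcomp w (w k) (om k) m x) = fX R ^+ d * (fpsc (de k f x) + fpsc (f x) * (fun m => fcomp w (w k) (eta k) m x)) :> fps R.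
 apply/funext => m; rewrite fXn (fcomp_om w0 ef hf heta) fDE fcM.
 case: (ltngtP m d) => [//|dm|->]; last by rewrite subnn /= et0 // mulr0 addr0.
 by rewrite /fpsc subn_eq0 leqNgt dm add0r.
apply: (fcomp_inj (w := w) (c := (w i + w j)%N)); first by apply: holB; exact: holM.
move=> m x; rewrite (fcompB w0 _ _ _ (holM (ho i) (hd_ j)) (holM (ho j) (hd_ i))).
rewrite fcompM // addnC fcompM //; apply/eqP; rewrite subr_eq0; apply/eqP.
pose Om k : fps R := fun m => fcomp w (w k) (om k) m x.
have C_ a b : (Om a * ddS (ev b) (Gs d f E e) x) m = \sum_(k < m.+1) fcomp w (w a) (om a) k x * fcomp w (w b) (de b F) (m - k) x by rewrite fME; apply: eq_bigr => k _; rewrite fF.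
rewrite -!C_; congr (_ m); rewrite /Om !fo.
by have Q := G_sym e eE E0 (Fh_om d0 ef ev_ v0 REL eE E0 thE x i j); rewrite -mulrA Q mulrA.
Qed.
End EntireCase.

(** * Passage to the homogeneous representative *)

Section Germ.
Variables (R : realType) (n : nat) (f g : Cn R n -> (R[i])^o).
Local Notation V := (Cn R n).
Hypothesis fg : \forall x \near (0 : V), f x = g x.

Lemma reduced_germ_eq : reduced_germ f -> reduced_germ g.
move=> red h hh hX; have [|k [hk E]] := red h hh; first by apply: filterS2 fg hX => x ->.
by exists k; split=> //; apply: filterS2 fg E => x ->.
Qed.

Lemma irreducible_germ_eq : irreducible_zero_germ f -> irreducible_zero_germ g.
move=> irr A B hA hB h; have [|H|H] := irr A B hA hB; first by apply: filterS2 fg h => x ->.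
 by left; apply: filterS2 fg H => x E [a b]; rewrite /zero_set /= -E; split.
by right; apply: filterS2 fg H => x E [a b]; rewrite /zero_set /= -E; split.
Qed.

Lemma nc_germ_eq : nc_off_codim3 f -> nc_off_codim3 g.
move=> [Y [Ya [YX [Yd h]]]]; exists Y; split=> //; split; first by apply: filterS2 fg YX => x ->.
split=> //; apply: filterS2 (near_join fg) h => p E h gp Yp; have fp := nbhs_singleton E.
have [[m [_ [mn [phi [b [z H]]]]]]|[phi [k [kn [b [z H]]]]]] := h (etrans fp gp) Yp.
 left; exists m; split=> //; split=> //; exists phi; split=> //; split=> //.
 by apply: filterS2 E H => x e; rewrite /zero_set /= e.
by right; exists phi, k; do 3! split=> //; apply: filterS2 E H => x ->.
Qed.
End Germ.

Theorem theorem2 (R : realType) (n : nat) (f : Cn R n -> (R[i])^o) :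
 (3 <= n)%N ->
 holo_at f 0 ->
 strictly_quasi_homogeneous f ->
 reduced_germ f ->
 irreducible_zero_germ f ->
 nc_off_codim3 f ->
 forall eta : 'I_n -> Cn R n -> (R[i])^o,
  (forall i, holo_at (eta i) 0) ->
  integrable_form (one_form_dfeta f eta) ->
  exists F : Cn R n -> (R[i])^o,
   holo_first_integral (one_form_dfeta f eta) F.
Proof.
move=> n3 /hol_holo hf [d [w [d0 [w0 /nearP [r r0 qh]]]]] red irr nc eta heta integ.
(* Quasi-homogeneity makes the component of weight [d] an entire function with the same germ as [f];
   the hypotheses and the form are transferred to it. *)
have [f0 [ef fE hw]] : exists f0, [/\ ent f0, forall x, nm x < r -> f0 x = f x & whom w d f0].
 exists (wcomp w f d); split; [by move=> x; exact: dif_wcomp| |exact: whom_wcomp].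
 apply: (whom_extend r0 hf) => x xr t t1; apply: qh; first by rewrite subr0.
 by rewrite (nmE t : `|t : R[i]| = _); apply: etrans (lecR _ 1) t1.
have F0 : \forall x \near (0 : Cn R n), f x = f0 x by apply/nearP; exists r => // x; rewrite subr0 => /fE.
have hol_eta i : hol (eta i) 0 by apply/hol_holo; exact: heta.
have [r1 r10 he] := near_eta hol_eta.
have near_in (x : Cn R n) : nm x < r -> exists2 s, 0 < s & forall y, nm (y - x) < s -> nm y < r by move=> xr; exists (r - nm x); rewrite ?subr_gt0 // => y; have := nm_rev y x; lra.
pose om i x := de i f0 x + f0 x * eta i x.
have pdE (i : 'I_n) g h x : (forall y, nm y < r -> g y = h y) -> nm x < r -> dif g x -> de i g x = pd i h x.
 move=> gh xr dg; have [s s0 hs] := near_in x xr.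
 by rewrite /pd ddE; apply: (dir_ext _ s0) => // y ys; apply: gh; exact: hs.
have omE i x : nm x < r -> om i x = one_form_dfeta f eta i x by move=> xr; rewrite /one_form_dfeta /om fE // (pdE i f0 f).
(* In the degenerate case of a zero germ the form is zero near 0, and a coordinate function is a
   first integral. *)
have [fn0|fz] := pselect (exists x, f0 x != 0); last first.
 have z : f0 = fun=> 0 by apply/funext => x; apply/eqP; apply: contraT => fx; case: fz; exists x.
 pose i0 : 'I_n := Ordinal (leq_trans (isT : 0 < 3)%N n3).
 exists (fun x => Defs.coord x i0); split; first by apply/hol_holo; apply: hol_ent => x; exact: dif_coord.
 split.
  move=> /nearP [s s0 hs]; have [t t0 ts] := ex_small s0 (nm_ge0 (ev R i0)).
  have := hs (t%:C *: ev R i0); rewrite subr0 nmZ nm_real gtr0_norm // coordZ coord_ev eqxx mulr1 coord0 => /(_ ts) [tE].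
  by move: t0; rewrite tE ltxx.
 apply/nearP; exists r => // x; rewrite subr0 => xr i j.
 have oz k : om k x = 0 by rewrite /om z dir_cst mul0r addr0.
 by rewrite -(omE i x xr) -(omE j x xr) (oz i) (oz j); move: (pd _ _ x) (pd _ _ x) => a b; rewrite !mul0r subrr.
have I i j k : near0 (fun x => om i x * (de j (om k) x - de k (om j) x)
 + om j x * (de k (om i) x - de i (om k) x) + om k x * (de i (om j) x - de j (om i) x) = 0).
 have [r2 r20 hi] := (near0P _).2 integ; exists (minr r (minr r1 r2)); first by side.
 move=> x; rewrite !lt_min => /and3P [xr /he ex /hi /(_ i j k) <-]; rewrite !omE //.
 have do_ l : dif (om l) x by apply: difD; [exact: ent_dd|apply: difM => //; exact: hol_dif].
 by rewrite !(fun a b => pdE a (om b) (one_form_dfeta f eta b) x (omE b) xr (do_ b)).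
have [F [hF Fc Fi]] := entire_case w0 d0 ef hw (reduced_germ_eq F0 red) (irreducible_germ_eq F0 irr) fn0 n3 (nc_germ_eq F0 nc) hol_eta I.
exists F; split; first exact/hol_holo.
split; first by move=> /near0P.
have Q : near0 (fun x => nm x < r) by exists r.
apply/near0P; have [s s0 hs] : near0 (fun x => forall ij : 'I_n * 'I_n, om ij.1 x * de ij.2 F x - om ij.2 x * de ij.1 F x = 0).
 have := fin_small (P := fun (ij : 'I_n * 'I_n) s => forall x, nm x < s -> om ij.1 x * de ij.2 F x - om ij.2 x * de ij.1 F x = 0).
 case=> [[i j]|ij s s' ss h x xs|s s0 h]; [exact: Fi|by apply: h; exact: lt_le_trans ss|by exists s => // x xs ij; exact: h].
exists (minr r s); first by side.
by move=> x /lt_minP [xr xs] i j; have := hs x xs (i, j); rewrite /= !omE // -!ddE.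
Qed.
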